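(* Let $(X,d,\mu)$ be a metric measure space which is either proper or doubling, and which satisfies assumption (HL). Let $p_0,p_1,q_0,q_1\in(1,\infty)$, $\theta\in[0,1]$ and $\alpha>0$. Then, up to equivalence of norms, $$[T^{p_0,q_0,\alpha}(X),T^{p_1,q_1,\alpha}(X)]_\theta = T^{p,q,\alpha}(X),$$ where $1/p=(1-\theta)/p_0+\theta/p_1$ and $1/q=(1-\theta)/q_0+\theta/q_1$.
   Context: A metric measure space $(X,d,\mu)$ is a metric space $(X,d)$ with a Borel measure $\mu$. Write $B(x,r)=\{y\in X: d(x,y)<r\}$ and $V(x,r)=\mu(B(x,r))$; it is assumed throughout that $0<V(x,r)<\infty$ for all $x\in X$, $r>0$. Assumptions: $X$ is *proper* if a subset of $X$ is compact if and only if it is closed and bounded, and $V(x,r)$ is lower semicontinuous as a function of $(x,r)$. $X$ is *doubling* if there is $C>0$ with $V(x,2r)\le C\,V(x,r)$ for all $x\in X$, $r>0$. $X$ satisfies *(HL)* if the uncentred Hardy--Littlewood maximal operator $\mathcal{M}(f)(x):=\sup_{B\ni x}\frac{1}{\mu(B)}\int_B|f|\,d\mu$ (supremum over all balls $B$ containing $x$) is of strong type $(r,r)$ for all $r>1$. Let $X^+:=X\times(0,\infty)$ with the product topology and the measure $d\mu(y)\,dt/t$. For $x\in X$, $\alpha>0$ the cone is $\Gamma^\alpha(x):=\{(y,t)\in X^+: d(x,y)<\alpha t\}$. For $q\in(0,\infty)$ and measurable $f:X^+\to\mathbb{C}$, $$\mathcal{A}_q^\alpha(f)(x):=\left(\iint_{\Gamma^\alpha(x)}|f(y,t)|^q\,\frac{d\mu(y)}{V(y,\alpha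 t)}\,\frac{dt}{t}\right)^{1/q}.$$ For $p,q\in(0,\infty)$, $T^{p,q,\alpha}(X)$ is the space of measurable $f:X^+\to\mathbb{C}$ (modulo a.e. equality) with $\|f\|_{T^{p,q,\alpha}(X)}:=\|\mathcal{A}_q^\alpha(f)\|_{L^p(X)}<\infty$. Complex interpolation: for an interpolation pair $(B_0,B_1)$ of complex Banach spaces (here tent spaces, viewed inside the functions on $X^+$ integrable on all sets $B(x,r)\times(a,b)$ with $0<a<b<\infty$), $B_0+B_1$ has norm $\inf\{\|x_0\|_{B_0}+\|x_1\|_{B_1}: x=x_0+x_1\}$. $\mathcal{F}(B_0,B_1)$ is the space of functions $f:\{0\le\operatorname{Re}z\le1\}\to B_0+B_1$ that are continuous, analytic in the interior, with $f(z)\in B_j$ for $\operatorname{Re}z=j$, and whose traces $f|_{\operatorname{Re}z=j}$ are continuous into $B_j$ and vanish at infinity ($j=0,1$), normed by $\|f\|_{\mathcal{F}}=\max_{j=0,1}\sup_{\operatorname{Re}z=j}\|f(z)\|_{B_j}$. Then $[B_0,B_1]_\theta:=\{f(\theta):f\in\mathcal{F}(B_0,B_1)\}$ with norm $\|x\|=\inf_{f(\theta)=x}\|f\|_{\mathcal{F}(B_0,B_1)}$.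
   Formalization: In the definition of F(B_0,B_1) the functions are also required to be bounded into B_0+B_1 on the closed strip; without this, for 0<θ<1 every element of the intersection of B_0 and B_1 would have interpolation norm 0. *)

(* Defs.v *)
From HB Require Import structures.
From mathcomp Require Import all_boot all_order all_algebra complex.
From mathcomp Require Import generic_quotient ring_quotient.
From mathcomp Require Import all_classical all_reals all_analysis.
From mathcomp Require Import measurable_realfun.
Import Order.TTheory GRing.Theory Num.Theory.
Import numFieldNormedType.Exports.

Set Implicit Arguments.
Unset Strict Implicit.
Unset Printing Implicit Defensive.

Local Open Scope classical_set_scope.
Local Open Scope ring_scope.
Local Open Scope complex_scope.

#[short(type="metricMeasurableType")]
HB.structure Definition MetricMeasurable d (R : numDomainType) :=
  { X of Metric R X & Measurable d X }.

Section metric_measure_space.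
Context d (R : realType) (X : metricMeasurableType d R).
Variable mu : {measure set X -> \bar R}.
Local Open Scope ereal_scope.

Definition borel_space := @measurable d X = <<s @open X >>.

Definition vol (x : X) (r : R) : \bar R := mu (ball x r).

Definition vol_pos_fin := forall x r, (0 < r)%R -> 0 < vol x r < +oo.

Definition metric_bounded (A : set X) :=
  exists M : R, forall x y, A x -> A y -> (mdist x y <= M)%R.

(* Semicontinuity is only meant for r > 0; it is automatic at r <= 0, where the
   ball is empty and vol vanishes. *)
Definition proper_space :=
  (forall A : set X, compact A <-> closed A /\ metric_bounded A) /\
  lower_semicontinuous (fun xr : X * R => vol xr.1 xr.2).

Definition doubling_space :=
  exists2 C : R, (0 < C)%R &
    forall x r, (0 < r)%R -> vol x (2 * r)%R <= C%:E * vol x r.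

Definition maximal_fun (f : X -> R) (x : X) : \bar R :=
  ereal_sup [set a | exists c r, [/\ (0 < r)%R, ball c r x &
    a = (fine (vol c r))^-1%:E * \int[mu]_(y in ball c r) `|f y|%:E]].

(* The maximal function only depends on the modulus, so real-valued f suffice. *)
Definition HL_property :=
  forall r : R, (1 < r)%R -> exists2 C : R, (0 < C)%R &
    forall f : X -> R, measurable_fun setT f ->
      'N[mu]_(r%:E)[maximal_fun f] <= C%:E * 'N[mu]_(r%:E)[EFin \o f].

End metric_measure_space.

(* The upper half-space X^+ is a subset of X * R. Functions on it are total
   functions on X * R whose values outside X^+ are ignored. *)
Section measurable_functions.
Context d (R : realType) (X : metricMeasurableType d R).

Definition upper : set (X * R) := [set z | 0 < z.2].

Definition cmfun : {pred X * R -> R[i]} :=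
  fun f => `[< measurable_fun upper (fun z => complex.Re (f z)) /\
               measurable_fun upper (fun z => complex.Im (f z)) >].

Lemma measurable_upper : measurable upper.
Proof.
rewrite (_ : upper = setT `*` `]0, +oo[%classic); last first.
  by apply/seteqP; split=> z /=; rewrite in_itv/= andbT// => -[].
exact: measurableX.
Qed.

Lemma cmfun_submod_closed : submod_closed cmfun.
Proof.
split=> [|a f g /asboolP[fr fi] /asboolP[gr gi]]; apply/asboolP.
  by split; exact: measurable_cst.
have mZ (b : R) h : measurable_fun upper h ->
    measurable_fun upper (fun z => b * h z).
  by move=> mh; apply: measurable_funM => //; exact: measurable_cst.
split.
- rewrite [X in measurable_fun _ X](_ : _ = fun z =>
      complex.Re a * complex.Re (f z) - complex.Im a * complex.Im (f z)
      + complex.Re (g z)).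
    by apply: measurable_funD gr; apply: measurable_funB; exact: mZ.
  apply/funext => z; rewrite -[(a *: f + g) z]/(a * f z + g z).
  by case: a (f z) (g z) => [? ?] [? ?] [? ?].
- rewrite [X in measurable_fun _ X](_ : _ = fun z =>
      complex.Re a * complex.Im (f z) + complex.Im a * complex.Re (f z)
      + complex.Im (g z)).
    by apply: measurable_funD gi; apply: measurable_funD; exact: mZ.
  apply/funext => z; rewrite -[(a *: f + g) z]/(a * f z + g z).
  by case: a (f z) (g z) => [? ?] [? ?] [? ?].
Qed.
HB.instance Definition _ :=
  GRing.isSubmodClosed.Build R[i] (X * R -> R[i]) cmfun cmfun_submod_closed.

Record cmfunType := CMFun { cmfun_val :> X * R -> R[i]; _ : cmfun_val \in cmfun }.
HB.instance Definition _ := [isSub for cmfun_val].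
HB.instance Definition _ := [Choice of cmfunType by <:].
HB.instance Definition _ := [SubChoice_isSubLmodule of cmfunType by <:].

End measurable_functions.
Arguments upper {d R} X.

(* Classes of measurable functions on X^+ modulo equality almost everywhere.
   The measures dmu(y) dt and dmu(y) dt/t have the same null sets on X^+. *)
Section ae_classes.
Context d (R : realType) (X : metricMeasurableType d R).
Variable mu : {measure set X -> \bar R}.

Definition ae_null : {pred cmfunType X} := fun f =>
  `[< {ae (mu \x lebesgue_measure)%E, forall z, upper X z -> f z = 0} >].

Lemma ae_null_submod_closed : submod_closed ae_null.
Proof.
split=> [|a f g /asboolP f0 /asboolP g0]; apply/asboolP; first exact: aeW.
have FF := ae_filter_ringOfSetsType (mu \x lebesgue_measure)%E.
apply: filterS2 f0 g0 => z f0 g0 z0.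
by rewrite -[LHS]/(a * f z + g z) f0// g0// mulr0 addr0.
Qed.
HB.instance Definition _ :=
  GRing.isSubmodClosed.Build R[i] (cmfunType X) ae_null ae_null_submod_closed.

Definition ae_class := Quotient.quot ae_null.
HB.instance Definition _ := GRing.Zmodule.on ae_class.
HB.instance Definition _ := EqQuotient.on ae_class.

Local Open Scope quotient_scope.

Definition to_class (f : cmfunType X) : ae_class := \pi_ae_class f.

Lemma to_class_repr (F : ae_class) : to_class (repr F) = F.
Proof. exact: reprK. Qed.

Lemma to_classP (f g : cmfunType X) :
  reflect (to_class f = to_class g) ((f - g) \in ae_null).
Proof. by rewrite Quotient.idealrBE; exact: eqP. Qed.

Lemma to_classD f g : to_class (f + g) = to_class f + to_class g.
Proof. exact: (raddfD \pi_ae_class). Qed.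

Definition ae_scale (a : R[i]) (F : ae_class) : ae_class :=
  to_class (a *: (repr F : cmfunType X)).

Lemma ae_scale_to_class a f : ae_scale a (to_class f) = to_class (a *: f).
Proof.
apply/to_classP; rewrite -scalerBr rpredZ//.
by apply/to_classP; rewrite to_class_repr.
Qed.

Fact ae_scaleA a b F : ae_scale a (ae_scale b F) = ae_scale (a * b) F.
Proof. by rewrite -(to_class_repr F) !ae_scale_to_class scalerA. Qed.

Fact ae_scale1 : left_id 1 ae_scale.
Proof.
by move=> F; rewrite -[in LHS](to_class_repr F) ae_scale_to_class scale1r
  to_class_repr.
Qed.

Fact ae_scaleDr : right_distributive ae_scale +%R.
Proof.
move=> a F G; rewrite -(to_class_repr F) -(to_class_repr G) -to_classD.
by rewrite !ae_scale_to_class scalerDr to_classD.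
Qed.

Fact ae_scaleDl F : {morph ae_scale^~ F : a b / a + b}.
Proof.
move=> a b; rewrite -(to_class_repr F).
by rewrite !ae_scale_to_class scalerDl to_classD.
Qed.

HB.instance Definition _ := GRing.Zmodule_isLmodule.Build R[i] ae_class
  ae_scaleA ae_scale1 ae_scaleDr ae_scaleDl.

End ae_classes.

Section tent_spaces.
Context d (R : realType) (X : metricMeasurableType d R).
Variable mu : {measure set X -> \bar R}.
Local Open Scope ereal_scope.

Definition cone (alpha : R) (x : X) : set (X * R) :=
  [set z | upper X z /\ (mdist x z.1 < alpha * z.2)%R].

Definition area (q alpha : R) (f : X * R -> R[i]) (x : X) : \bar R :=
  (\int[mu \x lebesgue_measure]_(z in cone alpha x)
     (Normc.normc (f z) `^ q / fine (vol mu z.1 (alpha * z.2)) / z.2)%:E)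
  `^ q^-1.

(* The area function of a class is computed on an arbitrary representative:
   functions equal a.e. on X^+ have the same one. *)
Definition tent_norm (p q alpha : R) (F : ae_class mu) : \bar R :=
  'N[mu]_(p%:E)[area q alpha (repr F)].

Definition tent_space (p q alpha : R) : set (ae_class mu) :=
  [set F | tent_norm p q alpha F < +oo].

End tent_spaces.
Arguments tent_norm {d R X} mu p q alpha F.
Arguments tent_space {d R X} mu p q alpha _.

(* A Banach space B continuously included in V is given by its norm extended by
   +oo outside B, so that B = [set x | N x < +oo]. *)
Section complex_interpolation.
Context (R : realType) (V : lmodType R[i]).
Variables N0 N1 : V -> \bar R.
Local Open Scope ereal_scope.

Definition sum_norm (x : V) : \bar R :=
  ereal_inf [set a | exists x0 x1, x = (x0 + x1)%R /\ a = N0 x0 + N1 x1].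

Definition strip : set R[i]^o := [set z | (0 <= complex.Re z <= 1)%R].
Definition open_strip : set R[i]^o := [set z | (0 < complex.Re z < 1)%R].

Definition analytic_at (f : R[i] -> V) (z : R[i]) :=
  exists2 l : V, sum_norm l < +oo &
    sum_norm (h^-1 *: (f (z + h) - f z) - l)%R @[h --> (0%R : R[i]^o)^'] --> 0.

Definition trace (f : R[i] -> V) (j y : R) : V := f (j +i* y).

Definition C0_trace (N : V -> \bar R) (g : R -> V) :=
  [/\ forall y, N (g y) < +oo,
      forall y, N (g t - g y)%R @[t --> y] --> 0,
      N (g y) @[y --> +oo%R] --> 0 &
      N (g y) @[y --> -oo%R] --> 0].

(* The values of f outside the closed strip are irrelevant. Boundedness into
   B0 + B1 is part of Calderon's definition: without it multiplying by
   exp (K (sin (pi z) - sin (pi theta)) + z ^ 2 - theta ^ 2), K --> +oo, would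
   give interpolation norm 0 to all elements of the intersection of B0 and B1
   when 0 < theta < 1. *)
Definition calderon : set (R[i] -> V) :=
  [set f | [/\ exists M : R, forall z, strip z -> sum_norm (f z) <= M%:E,
      forall z, strip z -> sum_norm (f w - f z)%R
        @[w --> within strip (nbhs (z : R[i]^o))] --> 0,
      forall z, open_strip z -> analytic_at f z,
      C0_trace N0 (trace f 0) &
      C0_trace N1 (trace f 1)]].

Definition calderon_norm (f : R[i] -> V) : \bar R :=
  maxe (ereal_sup (range (N0 \o trace f 0)))
    (ereal_sup (range (N1 \o trace f 1))).

Definition interp_space (theta : R) : set V :=
  [set f theta%:C | f in calderon].

Definition interp_norm (theta : R) (x : V) : \bar R :=
  ereal_inf [set calderon_norm f | f in calderon `&` [set f | f theta%:C = x]].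

End complex_interpolation.

(* Main.v *)
(* Write A f for the area function of f. Both inclusions rest on a weight. If phi >= 0 has
   norm at most 1 in T^{p,q}, let m(y, t) be the L^{p-1} mean of A phi over the ball
   B(y, alpha t). By Jensen's inequality and the maximal theorem, the function
   phi^(q/Q) m^(p/P - q/Q) is bounded in T^{P,Q} for all exponents P and Q; if moreover phi
   has norm 1, the integral of phi * phi^(q-1) m^(p-q) dmu dt/t is bounded from below.
   Let f = |f| be a multiple of phi (the phase of f plays no role). For a suitable
   combination L of log phi and log m, the family f exp ((z - theta) L + z^2 - theta^2) has
   modulus phi^(q/q_j) m^(p/p_j - q/q_j) on Re z = j, hence lies in Calderon's space, and
   its value at theta is f. Conversely, let F belong to Calderon's space and let phi be the
   normalization of a truncation of |F(theta)|. The same construction with the conjugate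
   exponents gives a holomorphic family of test functions through
   phi^(q-1) m^(p-q). Its pairing with F is bounded and holomorphic on the strip, so its
   value at theta, which dominates the norm of the truncation, is at most a constant times
   the norm of F in Calderon's space. That constant comes from Cauchy's formula for the
   pairing divided by (z + 2)^2. *)
Require Import Defs.
From HB Require Import structures.
From mathcomp Require Import all_boot all_order all_algebra complex.
From mathcomp Require Import all_classical all_reals all_analysis.
From mathcomp Require Import measurable_realfun ring lra.
Import Order.TTheory GRing.Theory Num.Theory.
Import numFieldNormedType.Exports.

Set Implicit Arguments.
Unset Strict Implicit.
Unset Printing Implicit Defensive.

Local Open Scope classical_set_scope.
Local Open Scope ring_scope.

(** * Real powers *)

Section real_powers.
Context (R : realType).
Implicit Types a b s t x y k r : R.

(** The obstacle is that a power of the area function lives on X, while the family must be built on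
    the half-space. Passing to the mean m over a shadow keeps control in one direction only: on the
    cone m lies below the maximal function tau, which settles nonnegative powers of m, but nothing
    bounds m from below there. Negative powers are treated on the shadow side, after transposing the
    integral: Jensen's inequality bounds the negative power of a mean by the mean of the negative
    power, and the resulting power of A phi cancels against the inner integral. The exponent p - 1
    of the mean has two reasons. The power (A phi)^(p-1) lies in L^(p/(p-1)), so the maximal theorem
    yields tau in L^p; and p - q <= p - 1, so m^(p-q) controls the mean of (A phi)^(p-q) in the
    lower bound when p >= q. Only equivalence of norms is claimed, so the inequalities of Young and
    Jensen are used in crude two-term forms. Limits are taken along the sets |L| <= n, on which the
    family and its boundary values are uniformly comparable. *)

Lemma le_powRl x y r : 0 <= r -> 0 <= x -> x <= y -> x `^ r <= y `^ r.
Proof.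
by move=> r0 x0 xy; rewrite ge0_ler_powR ?nnegrE// (le_trans x0).
Qed.

Lemma le_powRl_neg x y r : r <= 0 -> 0 < x -> x <= y -> y `^ r <= x `^ r.
Proof.
move=> r0 x0 xy; have y0 : 0 < y by exact: lt_le_trans xy.
rewrite -(opprK r) (powRN y) (powRN x) lef_pV2 ?posrE ?powR_gt0//.
by apply: le_powRl => //; [rewrite oppr_ge0 | exact: ltW].
Qed.

Lemma powRDp x r s : 0 < x -> x `^ (r + s) = x `^ r * x `^ s.
Proof. by move=> x0; rewrite powRD// (gt_eqF x0) implybT. Qed.

(** Both factors are bounded through max(x, y), and the exponents k and 1 - k add up to 1. *)
Lemma powR_mix_le x y k : 0 < k <= 1 -> 0 <= x -> 0 <= y ->
  x `^ k * y `^ (1 - k) <= x + y.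
Proof.
move=> /andP[k0 k1] x0 y0.
have [k1'|kN1] := eqVneq k 1.
  by rewrite k1' subrr powRr0 powRr1// mulr1 lerDl.
have k1' : 0 < 1 - k by rewrite subr_gt0 lt_neqAle kN1.
set z := Num.max x y.
have z0 : 0 <= z by rewrite le_max x0.
apply: (@le_trans _ _ (z `^ k * z `^ (1 - k))).
  by apply: ler_pM; rewrite ?powR_ge0// le_powRl ?(ltW k0) ?(ltW k1')// le_max lexx ?orbT.
rewrite -powRD ?subrKC ?oner_eq0// powRr1//.
by rewrite ge_max lerDl lerDr x0 y0.
Qed.

(** This is [powR_mix_le] for C x and e y: with C = e^(-(1 - k)/k) the factors C^k and e^(1 - k)
    cancel on the left. *)
Lemma powR_mix_le_eps k e : 0 < k <= 1 -> 0 < e ->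
  exists2 C : R, 0 < C & forall x y, 0 <= x -> 0 <= y ->
    x `^ k * y `^ (1 - k) <= C * x + e * y.
Proof.
move=> k01 e0; have /andP[k0 k1] := k01.
exists (e `^ (- ((1 - k) / k)) ); first exact: powR_gt0.
move=> x y x0 y0.
have ek0 : 0 <= e `^ (- ((1 - k) / k)) by exact: powR_ge0.
have ey0 : 0 <= e * y by rewrite mulr_ge0// ltW.
apply: le_trans (powR_mix_le k01 (mulr_ge0 ek0 x0) ey0).
rewrite !powRM ?(ltW e0)// -powRrM mulNr mulfVK ?gt_eqF//.
rewrite mulrACA -powRDp// addNr powRr0 mul1r//.
Qed.

(** The previous inequality with exponent 1/k, applied to x^k and to y raised to the conjugate
    exponent. *)
Lemma conj_le_eps k e : 1 < k -> 0 < e ->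
  exists2 C : R, 0 < C & forall x y, 0 <= x -> 0 <= y ->
    x * y <= C * x `^ k + e * y `^ (k / (k - 1)).
Proof.
move=> k1 e0; have k0 : 0 < k by apply: lt_trans k1.
have ki : 0 < k^-1 <= 1 by rewrite invr_gt0 k0 invf_le1// ltW.
have [C C0 H] := powR_mix_le_eps ki e0.
exists C => // x y x0 y0.
have := H (x `^ k) (y `^ (k / (k - 1))) (powR_ge0 _ _) (powR_ge0 _ _).
rewrite -!powRrM divff ?gt_eqF// powRr1//.
rewrite (_ : k / (k - 1) * (1 - k^-1) = 1) ?powRr1//.
by field; rewrite gt_eqF//= gt_eqF// subr_gt0.
Qed.

Lemma powRD_le x y r : 0 <= r -> 0 <= x -> 0 <= y ->
  (x + y) `^ r <= 2 `^ r * (x `^ r + y `^ r).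
Proof.
move=> r0 x0 y0; set z := Num.max x y.
have z0 : 0 <= z by rewrite le_max x0.
apply: (@le_trans _ _ ((2 * z) `^ r)).
  apply: le_powRl => //; first exact: addr_ge0.
  by rewrite mulr2n mulrDl mul1r lerD// le_max lexx ?orbT.
rewrite powRM// ler_wpM2l ?powR_ge0// /z.
by case: (leP x y) => _; rewrite ?lerDl ?lerDr powR_ge0.
Qed.

Lemma max_powR_le x y r : 0 <= x -> 0 <= y ->
  Num.max x y `^ r <= x `^ r + y `^ r.
Proof.
by move=> x0 y0; case: (leP x y) => _; rewrite ?lerDl ?lerDr powR_ge0.
Qed.

(** A crude tangent inequality for a concave power, off by a factor 2 at t = a. The right-hand side
    is affine in t, so averaging it replaces Jensen's inequality in [kap_pow_le]. *)
Lemma powR_le_tangent t a r : 0 < t -> 0 < a -> 0 <= r <= 1 ->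
  t `^ r <= a `^ r + a `^ (r - 1) * t.
Proof.
move=> t0 a0 /andP[r0 r1].
have [ta|/ltW ta] := leP t a.
  apply: ler_wpDr; first by rewrite mulr_ge0 ?powR_ge0// ltW.
  by apply: le_powRl => //; exact: ltW.
apply: ler_wpDl; first exact: powR_ge0.
have -> : t `^ r = t `^ (r - 1) * t.
  by rewrite -{3}(powRr1 (ltW t0)) -powRDp// subrK.
apply: ler_wpM2r; first exact: ltW.
by apply: le_powRl_neg => //; rewrite subr_le0.
Qed.

(** The counterpart for the convex power -r. When b is twice the average of t, the linear term
    averages to half of the left-hand side and can be absorbed; this is how [mean_powN_le] uses
    it. *)
Lemma powRN_le_chord t b r : 0 < t -> 0 < b -> 0 <= r ->
  b `^ (- r) <= t `^ (- r) + b `^ (- r) / b * t.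
Proof.
move=> t0 b0 r0; have [tb|/ltW tb] := leP t b.
  apply: ler_wpDr; first by rewrite mulr_ge0 ?divr_ge0 ?powR_ge0// ltW.
  by apply: le_powRl_neg => //; rewrite oppr_le0.
apply: ler_wpDl; first exact: powR_ge0.
by rewrite mulrAC -mulrA ler_peMr ?powR_ge0// ler_pdivlMr// mul1r.
Qed.

Lemma powR_prod_le x y c q k : 0 < x -> 0 < y -> 0 <= c -> 0 <= q -> 0 <= k ->
  (x `^ c * y `^ q) `^ k <= x `^ ((c + q) * k) + y `^ ((c + q) * k).
Proof.
move=> x0 y0 c0 q0 k0.
have z0 : 0 < Num.max x y by rewrite lt_max x0.
apply: le_trans (max_powR_le _ (ltW x0) (ltW y0)).
rewrite powRrM (powRDp _ _ z0); apply: le_powRl; first exact: k0.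
  by rewrite mulr_ge0 ?powR_ge0.
apply: ler_pM; rewrite ?powR_ge0// le_powRl ?(ltW x0) ?(ltW y0)// le_max lexx//.
by rewrite orbT.
Qed.

End real_powers.

Section integral_extra.
Context d (T : measurableType d) (R : realType).
Variable mu : {measure set T -> \bar R}.
Local Open Scope ereal_scope.

(** The integral of a nonnegative function is a supremum over the simple functions below it, so f
    and g may be arbitrary functions. *)
Lemma le_integral_nneg (f g : T -> \bar R) :
  (forall x, 0 <= f x) -> (forall x, f x <= g x) ->
  \int[mu]_x f x <= \int[mu]_x g x.
Proof.
move=> f0 fg; have g0 x : 0 <= g x by exact: le_trans (fg x).
rewrite !ge0_integralE//; apply: ge_ereal_sup => _ [h hf <-].
apply: ereal_sup_ubound; exists h => //= x.
by rewrite patch_setT (le_trans (hf x))// patch_setT.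
Qed.

Lemma measurable_funT_powR (f : T -> R) (r : R) : measurable_fun setT f ->
  measurable_fun setT (fun x => (f x `^ r)%R).
Proof. by move=> mf; exact: (measurableT_comp (measurable_powR r) mf). Qed.

Lemma measurable_funT_poweR (f : T -> \bar R) (r : R) : measurable_fun setT f ->
  measurable_fun setT (fun x => f x `^ r).
Proof. by move=> mf; exact: (measurableT_comp (measurable_poweR r) mf). Qed.

Lemma measurable_funT_inv_ge0 (f : T -> R) : (forall x, 0 <= f x)%R ->
  measurable_fun setT f -> measurable_fun setT (fun x => (f x)^-1%R).
Proof.
move=> f0 mf; under eq_fun do rewrite -powR_inv1//.
exact: measurable_funT_powR.
Qed.

End integral_extra.

(** * Integration over cones and shadows *)

Section kernel_operators.
Context d d' (R : realType) (X : measurableType d) (W : measurableType d').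
Variables (mu : {sigma_finite_measure set X -> \bar R})
  (nu : {sigma_finite_measure set W -> \bar R}).
Variables (K : set (X * W)) (wt : W -> R).
Hypotheses (mK : measurable K) (mwt : measurable_fun setT wt)
  (wt_ge0 : forall w, 0 <= wt w).
Implicit Types (phi psi : W -> R) (h g : X -> R).
Local Open Scope ereal_scope.

(* [lam] integrates over the "cone" [K (x, _)] of [x] and [kap] over the "shadow"
   [K (_, w)] of [w]; they are transposed to each other ([lam_kap]). *)
Definition lam (phi : W -> R) (x : X) : \bar R :=
  \int[nu]_w (\1_K (x, w) * (phi w * wt w))%:E.

Definition kap (h : X -> R) (w : W) : \bar R :=
  \int[mu]_x (\1_K (x, w) * h x)%:E.

Definition kvol (w : W) : \bar R := kap (fun=> 1%R) w.

Lemma lam_ge0 phi x : (forall w, 0 <= phi w)%R -> 0 <= lam phi x.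
Proof.
by move=> p0; apply: integral_ge0 => w _; rewrite lee_fin !mulr_ge0.
Qed.

Lemma kap_ge0 h w : (forall x, 0 <= h x)%R -> 0 <= kap h w.
Proof. by move=> h0; apply: integral_ge0 => x _; rewrite lee_fin mulr_ge0. Qed.

Lemma measurable_fst_comp (h : X -> R) : measurable_fun setT h ->
  measurable_fun setT (fun z : X * W => h z.1).
Proof. by move=> mh; exact: measurableT_comp mh measurable_fst. Qed.

Lemma measurable_snd_comp (h : W -> R) : measurable_fun setT h ->
  measurable_fun setT (fun z : X * W => h z.2).
Proof. by move=> mh; exact: measurableT_comp mh measurable_snd. Qed.

Lemma measurable_indicK : measurable_fun setT (\1_K : X * W -> R).
Proof. exact: measurable_indic. Qed.

Lemma measurable_lam phi : measurable_fun setT phi ->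
  (forall w, 0 <= phi w)%R -> measurable_fun setT (lam phi).
Proof.
move=> mp p0.
pose f (z : X * W) := (\1_K z * (phi z.2 * wt z.2))%:E.
apply: (@measurable_fun_fubini_tonelli_F _ _ _ _ _ nu f).
  apply/measurable_EFinP; apply: measurable_funM; first exact: measurable_indicK.
  by apply: measurable_funM; exact: measurable_snd_comp.
by move=> z; rewrite lee_fin !mulr_ge0.
Qed.

Lemma measurable_kap h : measurable_fun setT h ->
  (forall x, 0 <= h x)%R -> measurable_fun setT (kap h).
Proof.
move=> mh h0.
pose f (z : X * W) := (\1_K z * h z.1)%:E.
apply: (@measurable_fun_fubini_tonelli_G _ _ _ _ _ mu f).
  apply/measurable_EFinP; apply: measurable_funM; first exact: measurable_indicK.
  exact: measurable_fst_comp.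
by move=> z; rewrite lee_fin !mulr_ge0.
Qed.

Lemma kap_sliceM h w : measurable_fun setT h ->
  measurable_fun setT (fun x => (\1_K (x, w) * h x)%:E).
Proof.
move=> mh; apply/measurable_EFinP; apply: measurable_funM => //.
exact: (measurableT_comp measurable_indicK (measurable_pair2 w)).
Qed.

Lemma lam_sliceM phi x : measurable_fun setT phi ->
  measurable_fun setT (fun w => (\1_K (x, w) * (phi w * wt w))%:E).
Proof.
move=> mp; apply/measurable_EFinP; apply: measurable_funM; last exact: measurable_funM.
exact: (measurableT_comp measurable_indicK (measurable_pair1 x)).
Qed.

(** Tonelli's theorem on [X * W]. It moves an estimate from cones, where the area function is
    defined, to shadows, where averages can be compared with powers of m. *)
Lemma lam_kap h phi : measurable_fun setT h -> (forall x, 0 <= h x)%R ->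
  measurable_fun setT phi -> (forall w, 0 <= phi w)%R ->
  \int[mu]_x ((h x)%:E * lam phi x) = \int[nu]_w ((phi w * wt w)%:E * kap h w).
Proof.
move=> mh h0 mp p0.
pose f (z : X * W) := (\1_K z * (h z.1 * (phi z.2 * wt z.2)))%:E.
have f0 z : 0 <= f z by rewrite lee_fin !mulr_ge0.
have mf : measurable_fun setT f.
  apply/measurable_EFinP; apply: measurable_funM; first exact: measurable_indicK.
  apply: measurable_funM; first exact: measurable_fst_comp.
  by apply: measurable_funM; exact: measurable_snd_comp.
rewrite [LHS](_ : _ = \int[mu]_x \int[nu]_w f (x, w)); last first.
  apply: eq_integral => x _; rewrite -ge0_integralZl_EFin//; last 2 first.
  - by move=> w _; rewrite lee_fin !mulr_ge0.
  - exact: lam_sliceM.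
  by apply: eq_integral => w _; rewrite -EFinM /f/=; congr EFin; ring.
rewrite fubini_tonelli//; apply: eq_integral => w _.
rewrite -ge0_integralZl_EFin ?mulr_ge0//; last 2 first.
- by move=> x _; rewrite lee_fin mulr_ge0.
- exact: kap_sliceM.
by apply: eq_integral => x _; rewrite -EFinM /f/=; congr EFin; ring.
Qed.

Lemma lamZ phi x (a : R) : (0 <= a)%R -> measurable_fun setT phi ->
  (forall w, 0 <= phi w)%R ->
  lam (fun w => a * phi w)%R x = a%:E * lam phi x.
Proof.
move=> a0 mp p0; rewrite -ge0_integralZl_EFin//; last 2 first.
- by move=> w _; rewrite lee_fin !mulr_ge0.
- exact: lam_sliceM.
by apply: eq_integral => w _; rewrite -EFinM; congr EFin; ring.
Qed.

Lemma kapZ h w (a : R) : (0 <= a)%R -> measurable_fun setT h ->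
  (forall w, 0 <= h w)%R ->
  kap (fun w => a * h w)%R w = a%:E * kap h w.
Proof.
move=> a0 mh h0; rewrite -ge0_integralZl_EFin//; last 2 first.
- by move=> x _; rewrite lee_fin !mulr_ge0.
- exact: kap_sliceM.
by apply: eq_integral => x _; rewrite -EFinM; congr EFin; ring.
Qed.

Lemma lamD phi psi x : measurable_fun setT phi -> (forall w, 0 <= phi w)%R ->
  measurable_fun setT psi -> (forall w, 0 <= psi w)%R ->
  lam (fun w => phi w + psi w)%R x = lam phi x + lam psi x.
Proof.
move=> mp p0 mq q0; rewrite -ge0_integralD//; last 4 first.
- by move=> w _; rewrite lee_fin !mulr_ge0.
- exact: lam_sliceM.
- by move=> w _; rewrite lee_fin !mulr_ge0.
- exact: lam_sliceM.
by apply: eq_integral => w _; rewrite -EFinD; congr EFin; ring.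
Qed.

Lemma kapD h g w : measurable_fun setT h -> (forall x, 0 <= h x)%R ->
  measurable_fun setT g -> (forall x, 0 <= g x)%R ->
  kap (fun x => h x + g x)%R w = kap h w + kap g w.
Proof.
move=> mp p0 mq q0; rewrite -ge0_integralD//; last 4 first.
- by move=> x _; rewrite lee_fin !mulr_ge0.
- exact: kap_sliceM.
- by move=> x _; rewrite lee_fin !mulr_ge0.
- exact: kap_sliceM.
by apply: eq_integral => x _; rewrite -EFinD; congr EFin; ring.
Qed.

Lemma le_lam phi psi x : (forall w, 0 <= phi w)%R ->
  (forall w, K (x, w) -> phi w <= psi w)%R -> lam phi x <= lam psi x.
Proof.
move=> p0 pq; apply: le_integral_nneg => w; first by rewrite lee_fin !mulr_ge0.
rewrite lee_fin indicE; case: (boolP (_ \in _)) => [|_]; last by rewrite !mul0r.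
by rewrite inE => /pq le_pq; rewrite !mul1r ler_wpM2r.
Qed.

Lemma le_kap h g w : (forall x, 0 <= h x)%R ->
  (forall x, K (x, w) -> h x <= g x)%R -> kap h w <= kap g w.
Proof.
move=> p0 pq; apply: le_integral_nneg => x; first by rewrite lee_fin !mulr_ge0.
rewrite lee_fin indicE; case: (boolP (_ \in _)) => [|_]; last by rewrite !mul0r.
by rewrite inE => /pq le_pq; rewrite !mul1r.
Qed.

Lemma ae_le_kap h g w : measurable_fun setT h -> (forall x, 0 <= h x)%R ->
  measurable_fun setT g -> (forall x, 0 <= g x)%R ->
  {ae mu, forall x, K (x, w) -> (h x <= g x)%R} -> kap h w <= kap g w.
Proof.
move=> mh h0 mg g0 hg; apply: ae_ge0_le_integral => //.
- by move=> x _; rewrite lee_fin !mulr_ge0.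
- exact: kap_sliceM.
- by move=> x _; rewrite lee_fin !mulr_ge0.
- exact: kap_sliceM.
apply: filterS hg => x hg _.
rewrite lee_fin indicE; case: (boolP (_ \in _)) => [|_]; last by rewrite !mul0r.
by rewrite inE => /hg le_pq; rewrite !mul1r.
Qed.

(** By [lam_kap] both sides are integrals over W, where the hypothesis compares the integrands
    pointwise. *)
Lemma lam_kap_le h g phi psi (C : R) : (0 <= C)%R ->
  measurable_fun setT h -> (forall x, 0 <= h x)%R ->
  measurable_fun setT g -> (forall x, 0 <= g x)%R ->
  measurable_fun setT phi -> (forall w, 0 <= phi w)%R ->
  measurable_fun setT psi -> (forall w, 0 <= psi w)%R ->
  (forall w, (phi w)%:E * kap h w <= C%:E * ((psi w)%:E * kap g w)) ->
  \int[mu]_x ((h x)%:E * lam phi x) <= C%:E * \int[mu]_x ((g x)%:E * lam psi x).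
Proof.
move=> C0 mh h0 mg g0 mp p0 mq q0 H; rewrite !lam_kap// -ge0_integralZl_EFin//.
- apply: le_integral_nneg => w.
    by rewrite mule_ge0 ?lee_fin ?mulr_ge0// kap_ge0.
  rewrite mulrC EFinM -muleA.
  rewrite (mulrC (psi w)) EFinM -[_ * _ * kap g w]muleA (muleCA C%:E).
  by apply: lee_wpmul2l; [rewrite lee_fin | exact: H].
- by move=> w _; rewrite mule_ge0 ?lee_fin ?mulr_ge0// kap_ge0.
- apply: emeasurable_funM; last exact: measurable_kap.
  by apply/measurable_EFinP; exact: measurable_funM.
Qed.

End kernel_operators.

(** * Power means over shadows *)

Section averages.
Context d d' (R : realType) (X : measurableType d) (W : measurableType d').
Variables (mu : {sigma_finite_measure set X -> \bar R}) (K : set (X * W)).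
Hypothesis mK : measurable K.
Hypothesis kvol_lty : forall w, (kvol mu K w < +oo)%E.
Implicit Types (h g St : X -> R).
Local Open Scope ereal_scope.

Local Notation kap := (kap mu K).
Local Notation kvol := (kvol mu K).

Lemma kvol_ge0 w : 0 <= kvol w.
Proof. exact: kap_ge0. Qed.

Lemma kvol_fin w : kvol w \is a fin_num.
Proof. by rewrite ge0_fin_numE ?kvol_ge0. Qed.

(** A strictly positive function has zero integral only over a null shadow, and then so has every
    other function. This disposes of the degenerate points with [kvol w = 0]. *)
Lemma kap_eq0 h g w : measurable_fun setT h -> (forall x, 0 < h x)%R ->
  measurable_fun setT g -> (forall x, 0 <= g x)%R ->
  kap h w = 0 -> kap g w = 0.
Proof.
move=> mh h0 mg g0 hw0.
have : \int[mu]_x `|(\1_K (x, w) * h x)%:E| = 0.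
  rewrite -[RHS]hw0; apply: eq_integral => x _.
  by rewrite gee0_abs// lee_fin mulr_ge0// ltW.
move/(ae_eq_integral_abs mu measurableT (kap_sliceM mK w mh)) => hK.
rewrite /kap (ae_eq_integral (cst 0))//; first by rewrite integral0.
- exact: kap_sliceM.
- apply: filterS hK => x /(_ I) [] /eqP; rewrite mulf_eq0 => /orP[/eqP -> _|].
    by rewrite mul0r.
  by rewrite gt_eqF.
Qed.

Section mean.
Variables (s : R) (St : X -> R).
Hypotheses (s_gt0 : (0 < s)%R) (mSt : measurable_fun setT St)
  (St_gt0 : forall x, (0 < St x)%R).
Hypothesis kapSt_lty : forall w, kap (fun x => St x `^ s)%R w < +oo.

Let u x := (St x `^ s)%R.
Let mu_u : measurable_fun setT u. Proof. exact: measurable_funT_powR. Qed.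
Let u_gt0 x : (0 < u x)%R. Proof. exact: powR_gt0. Qed.
Let u_ge0 x : (0 <= u x)%R. Proof. exact: ltW. Qed.

(** The L^s mean of [St] over the shadow of w. Over a null shadow the quotient is 0 by convention,
    which keeps [kap_mean] true there. *)
Definition mean w : R := ((fine (kap u w) / fine (kvol w)) `^ s^-1)%R.

Lemma measurable_mean : measurable_fun setT mean.
Proof.
apply: measurable_funT_powR; apply: measurable_funM.
  by apply: measurableT_comp => //; exact: measurable_kap.
apply: measurable_funT_inv_ge0 => [w|]; first by rewrite fine_ge0// kvol_ge0.
by apply: measurableT_comp => //; exact: measurable_kap.
Qed.

Lemma mean_ge0 w : (0 <= mean w)%R. Proof. exact: powR_ge0. Qed.

Lemma mean_powE w : (mean w `^ s = fine (kap u w) / fine (kvol w))%R.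
Proof.
rewrite -powRrM mulVf ?gt_eqF// powRr1// divr_ge0// fine_ge0//.
- exact: kap_ge0.
- exact: kvol_ge0.
Qed.

Lemma kap_mean w : kap u w = (mean w `^ s)%:E * kvol w.
Proof.
have ku_fin : kap u w \is a fin_num by rewrite ge0_fin_numE ?kap_ge0.
have [v0|v0] := eqVneq (kvol w) 0.
  by rewrite v0 mule0; apply: (@kap_eq0 (fun=> 1%R)).
have fv0 : fine (kvol w) != 0%R by rewrite -eqe fineK// kvol_fin.
by rewrite mean_powE -[X in _ * X](fineK (kvol_fin w)) -EFinM divfK// fineK.
Qed.

Lemma mean_gt0 w : 0 < kvol w -> (0 < mean w)%R.
Proof.
move=> v0; rewrite powR_gt0// divr_gt0// fine_gt0//; last by rewrite v0/=.
rewrite kapSt_lty andbT lt0e kap_ge0// andbT; apply/eqP => ku0.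
suff : kvol w = 0 by apply/eqP; rewrite gt_eqF.
exact: (@kap_eq0 u).
Qed.

(** Jensen's inequality for a negative power, up to a constant. One averages [powRN_le_chord] with b
    = 2a, where a = m^s is the average of [u]; the linear term then contributes half of the
    left-hand side. *)
Lemma mean_powN_le r w : (0 <= r)%R ->
  (mean w `^ (- r))%:E * kvol w <=
  (2 * 2 `^ (r / s))%:E * kap (fun x => St x `^ (- r))%R w.
Proof.
move=> r0; have [v0|v0] := eqVneq (kvol w) 0.
  rewrite v0 mule0 mule_ge0 ?kap_ge0 ?lee_fin ?mulr_ge0 ?powR_ge0// => x.
  exact: powR_ge0.
have {}v0 : 0 < kvol w by rewrite lt0e v0 kvol_ge0.
set m := mean w; have m0 : (0 < m)%R by exact: mean_gt0.
set a := (m `^ s)%R; have a0 : (0 < a)%R by exact: powR_gt0.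
set c := ((2 * a) `^ (- (r / s)))%R.
have c0 : (0 < c)%R by apply: powR_gt0; rewrite mulr_gt0.
have a_ge0 := ltW a0; have c_ge0 := ltW c0.
have a2_ge0 : (0 <= 2 * a)%R by rewrite mulr_ge0.
have ca0 : (0 <= c / (2 * a))%R by exact: divr_ge0.
have rs0 : (0 <= r / s)%R by rewrite divr_ge0// ltW.
have mSr : measurable_fun setT (fun x => St x `^ (- r))%R.
  exact: measurable_funT_powR.
have pw x : (c <= St x `^ (- r) + c / (2 * a) * u x)%R.
  have -> : (St x `^ (- r) = u x `^ (- (r / s)))%R.
    by rewrite -powRrM mulrN mulrCA divff ?mulr1// gt_eqF.
  by apply: powRN_le_chord => //; rewrite mulr_gt0.
have : c%:E * kvol w <= kap (fun x => St x `^ (- r))%R w +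
     (c / (2 * a))%:E * kap u w.
  rewrite -[X in X <= _]kapZ//.
  rewrite -[X in _ <= _ + X]kapZ//.
  rewrite -kapD//.
  - apply: le_kap => x; first by rewrite mulr1.
    by move=> _; rewrite mulr1.
  - by move=> x; exact: powR_ge0.
  - exact: measurable_funM.
  - by move=> x; exact: mulr_ge0.
rewrite kap_mean -/m -/a.
have -> : (m `^ (- r) = 2 `^ (r / s) * c)%R.
  rewrite /c powRM// mulrA -powRDp// subrr powRr0 mul1r.
  by rewrite /a -powRrM mulrN mulrCA divff ?mulr1// gt_eqF.
have : 0 <= kap (fun x => St x `^ (- r))%R w.
  by apply: kap_ge0 => x; exact: powR_ge0.
have C0 : (0 < 2 * 2 `^ (r / s) :> R)%R by rewrite mulr_gt0// powR_gt0.
case: (kap _ w) => [b b0|_ _|//]; last first.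
  by rewrite gt0_muley ?lte_fin// leey.
rewrite -(fineK (kvol_fin w)) -!EFinM -EFinD !lee_fin.
have -> : (c / (2 * a) * (a * fine (kvol w)) = c * fine (kvol w) / 2)%R.
  by field; rewrite gt_eqF.
move=> H; have : (c * fine (kvol w) <= 2 * b)%R by lra.
by move=> /(ler_wpM2l (powR_ge0 2 (r / s))); rewrite !mulrA (mulrC 2%R).
Qed.

(** One averages [powR_le_tangent] at the average a = m^s of [u]: each of its two terms contributes
    a^(r/s) times the volume, whence the factor 2. *)
Lemma kap_pow_le r w : (0 <= r <= s)%R ->
  kap (fun x => St x `^ r)%R w <= (2 * mean w `^ r)%:E * kvol w.
Proof.
move=> /andP[r0 rs]; have [v0|v0] := eqVneq (kvol w) 0.
  rewrite v0 mule0 (@kap_eq0 (fun=> 1%R))//.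
    exact: measurable_funT_powR.
  by move=> x; exact: powR_ge0.
have {}v0 : 0 < kvol w by rewrite lt0e v0 kvol_ge0.
set m := mean w; have m0 : (0 < m)%R by exact: mean_gt0.
set a := (m `^ s)%R; have a0 : (0 < a)%R by exact: powR_gt0.
have a_ge0 := ltW a0; have s_ge0 := ltW s_gt0.
have rs0 : (0 <= r / s)%R by exact: divr_ge0.
have rs1 : (r / s <= 1)%R by rewrite ler_pdivrMr// mul1r.
have pw x : (St x `^ r <= a `^ (r / s) + a `^ (r / s - 1) * u x)%R.
  have -> : (St x `^ r = u x `^ (r / s))%R.
    by rewrite -powRrM mulrCA divff ?mulr1// gt_eqF.
  by apply: powR_le_tangent => //; rewrite rs0.
apply: (@le_trans _ _ ((a `^ (r / s))%:E * kvol w +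
   (a `^ (r / s - 1))%:E * kap u w)).
  rewrite -[X in _ <= X + _]kapZ ?powR_ge0//.
  rewrite -[X in _ <= _ + X]kapZ ?powR_ge0//.
  rewrite -kapD//.
  - apply: le_kap => x; first exact: powR_ge0.
    by move=> _; rewrite mulr1.
  - by move=> x; rewrite mulr1; exact: powR_ge0.
  - exact: measurable_funM.
  - by move=> x; exact: (mulr_ge0 (powR_ge0 _ _) (u_ge0 _)).
have -> : (m `^ r = a `^ (r / s))%R.
  by rewrite /a -powRrM mulrCA divff ?gt_eqF// mulr1.
rewrite kap_mean -/m -/a.
have aE : (a `^ (r / s - 1))%:E * a%:E = (a `^ (r / s))%:E.
  rewrite -(EFinM (a `^ (r / s - 1))%R a); congr EFin.
  by rewrite -[X in (_ * X)%R](powRr1 a_ge0) -powRDp// subrK.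
rewrite (muleA _ a%:E) aE.
move: (powR_ge0 a (r / s)) (kvol_ge0 w); clear.
move: (a `^ _)%R (kvol w) => b v b0 v0.
by rewrite mulr2n mulrDl mul1r EFinD ge0_muleDl.
Qed.

End mean.
End averages.

(** * Weighted estimates *)

Section integral_truncation.
Context d (T : measurableType d) (R : realType).
Variable mu : {measure set T -> \bar R}.
Local Open Scope ereal_scope.

(** Monotone convergence: the truncations increase to F because b is positive. For integrable b
    every truncated integral is finite, which the absorption argument of [weighted_lam_gt1]
    requires. *)
Lemma integral_mine_le (F : T -> \bar R) (b : T -> R) (B : \bar R) :
  measurable_fun setT F -> (forall x, 0 <= F x) ->
  measurable_fun setT b -> (forall x, 0 < b x)%R ->
  (forall n : nat, \int[mu]_x mine (F x) (n%:R * b x)%:E <= B) ->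
  \int[mu]_x F x <= B.
Proof.
move=> mF F0 mb b0 H.
pose g (n : nat) x := mine (F x) (n%:R * b x)%:E.
have mg n : measurable_fun setT (g n).
  apply: measurable_mine => //; apply/measurable_EFinP.
  exact: measurable_funM.
have g0 n x : 0 <= g n x.
  by rewrite /g le_min F0 lee_fin mulr_ge0// ltW.
have ndg x : {homo g^~ x : n m / (n <= m)%N >-> n <= m}.
  move=> n k nk; rewrite /g le_min ge_min lexx/= ge_min.
  by rewrite lee_fin ler_wpM2r ?orbT ?ler_nat// ltW.
have -> : \int[mu]_x F x = \int[mu]_x limn (g^~ x).
  apply: eq_integral => x _; apply/esym/cvg_lim => //.
  have := F0 x; case FE : (F x) => [r| |]// r0.
    apply: (@cvg_near_cst _ _ _ _ (\oo)); near=> n.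
    rewrite /g FE; apply/min_idPl; rewrite lee_fin -ler_pdivrMr//.
    by near: n; exact: nbhs_infty_ger.
  rewrite /g FE; under eq_fun do rewrite minye.
  apply/cvgeryP => /=; apply/cvgryPge => A; near=> n.
  by rewrite -ler_pdivrMr//; near: n; exact: nbhs_infty_ger.
rewrite monotone_convergence//.
apply: lime_le => //.
  apply: ereal_nondecreasing_is_cvgn => n k nk.
  by apply: le_integral_nneg => // x; exact: ndg.
by near=> n; exact: H.
Unshelve. all: by end_near. Qed.

End integral_truncation.

Section weights.
Context d d' (R : realType) (X : measurableType d) (W : measurableType d').
Variables (mu : {sigma_finite_measure set X -> \bar R})
  (nu : {sigma_finite_measure set W -> \bar R}).
Variables (K : set (X * W)) (wt : W -> R).
Hypotheses (mK : measurable K) (mwt : measurable_fun setT wt)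
  (wt_ge0 : forall w, 0 <= wt w).
Hypotheses (kvol_lty : forall w, (kvol mu K w < +oo)%E)
  (kvol_gt0 : forall x w, K (x, w) -> (0 < kvol mu K w)%E).
Local Open Scope ereal_scope.

Local Notation lam := (lam nu K wt).
Local Notation kap := (kap mu K).
Local Notation kvol := (kvol mu K).

(* The maximal theorem in the form used below: [T] dominates all averages of [h] over
   shadows. *)
Definition maximal_bound (r : R) := exists2 C : R, (0 < C)%R &
  forall h : X -> R, measurable_fun setT h -> (forall x, 0 <= h x)%R ->
    \int[mu]_x (h x `^ r)%:E < +oo ->
    exists2 T : X -> R, measurable_fun setT T &
    [/\ (forall x, 0 <= T x)%R,
      {ae mu, forall x w, K (x, w) -> kap h w <= (T x)%:E * kvol w} &
      \int[mu]_x (T x `^ r)%:E <= C%:E * \int[mu]_x (h x `^ r)%:E].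

Hypothesis HL : forall r : R, (1 < r)%R -> maximal_bound r.

(* [St] is the area function of [phi] made positive by adding an L^p function, [m w] is
   the L^s mean of [St] over the shadow of [w], and [tau] is the maximal function of
   [St ^ s] to the power [1 / s]. *)
Record admissible_weight (p q s D : R) (phi m : W -> R) (St tau : X -> R) : Prop :=
  AdmissibleWeight {
    aw_mphi : measurable_fun setT phi;
    aw_phi_ge0 : forall w, (0 <= phi w)%R;
    aw_mm : measurable_fun setT m;
    aw_m_ge0 : forall w, (0 <= m w)%R;
    aw_m_gt0 : forall w, 0 < kvol w -> (0 < m w)%R;
    aw_mSt : measurable_fun setT St;
    aw_St_gt0 : forall x, (0 < St x)%R;
    aw_mtau : measurable_fun setT tau;
    aw_tau_ge0 : forall x, (0 <= tau x)%R;
    aw_lam : {ae mu, forall x, lam (fun w => phi w `^ q)%R x <= (St x `^ q)%:E};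
    aw_tau_gt0 : {ae mu, forall x, (0 < tau x)%R};
    aw_m_tau : {ae mu, forall x w, K (x, w) -> (m w <= tau x)%R};
    aw_mean : forall (r : R) w, (0 <= r)%R -> (m w `^ (- r))%:E * kvol w <=
      (2 * 2 `^ (r / s))%:E * kap (fun x => St x `^ (- r))%R w;
    aw_int_St : \int[mu]_x (St x `^ p)%:E <= D%:E;
    aw_int_tau : \int[mu]_x (tau x `^ p)%:E <= D%:E }.

Section weighted_bounds.
Variables (p q s k : R).
Hypotheses (p_gt1 : (1 < p)%R) (q_gt0 : (0 < q)%R) (s_gt0 : (0 < s)%R) (k_gt0 : (0 < k)%R).

(** With k = P/Q, this is the exponent of m in the Q-th power of phi^(q/Q) m^(p/P - q/Q). Its sign
    decides which of the estimates below applies. *)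
Let c := (p / k - q)%R.

Section fixed_weight.
Variables (D : R) (phi m : W -> R) (St tau : X -> R).
Hypothesis A : admissible_weight p q s D phi m St tau.

Let mphi := aw_mphi A.
Let phi_ge0 := aw_phi_ge0 A.
Let mm := aw_mm A.
Let m_ge0 := aw_m_ge0 A.
Let m_gt0 := aw_m_gt0 A.
Let mSt := aw_mSt A.
Let St_gt0 := aw_St_gt0 A.
Let St_ge0 x : (0 <= St x)%R. Proof. exact/ltW/St_gt0. Qed.
Let mtau := aw_mtau A.
Let tau_ge0 := aw_tau_ge0 A.

Let phiq w := (phi w `^ q)%R.
Let mphiq : measurable_fun setT phiq. Proof. exact: measurable_funT_powR. Qed.
Let phiq_ge0 w : (0 <= phiq w)%R. Proof. exact: powR_ge0. Qed.

Let phic w := (phiq w * m w `^ c)%R.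
Let mphic : measurable_fun setT phic.
Proof. by apply: measurable_funM => //; exact: measurable_funT_powR. Qed.
Let phic_ge0 w : (0 <= phic w)%R. Proof. exact/mulr_ge0/powR_ge0. Qed.

Let mlam : measurable_fun setT (lam phic). Proof. exact: measurable_lam. Qed.

Let mlamk : measurable_fun setT (fun x => lam phic x `^ k).
Proof. exact: measurable_funT_poweR. Qed.

Let int_pow_add : \int[mu]_x ((tau x `^ p)%:E + (St x `^ p)%:E) <= (D + D)%:E.
Proof.
rewrite ge0_integralD//; first by rewrite EFinD leeD ?(aw_int_tau A) ?(aw_int_St A).
- by move=> x _; rewrite lee_fin powR_ge0.
- exact/measurable_EFinP/measurable_funT_powR.
- by move=> x _; rewrite lee_fin powR_ge0.
- exact/measurable_EFinP/measurable_funT_powR.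
Qed.

Let mint_pow_add :
  measurable_fun setT (fun x => (tau x `^ p)%:E + (St x `^ p)%:E).
Proof.
by apply: emeasurable_funD; exact/measurable_EFinP/measurable_funT_powR.
Qed.

Lemma int_mul_lam_le (g : X -> R) : measurable_fun setT g ->
  (forall x, 0 <= g x)%R ->
  \int[mu]_x ((g x)%:E * lam phiq x) <= \int[mu]_x (g x * St x `^ q)%:E.
Proof.
move=> mg g0; apply: ae_ge0_le_integral => //.
- by move=> x _; rewrite mule_ge0 ?lam_ge0 ?lee_fin.
- by apply: emeasurable_funM; [exact/measurable_EFinP|exact: measurable_lam].
- by move=> x _; rewrite lee_fin mulr_ge0 ?powR_ge0.
- by apply/measurable_EFinP; apply: measurable_funM => //; exact: measurable_funT_powR.
- apply: filterS (aw_lam A) => x Hx _.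
  by rewrite EFinM lee_wpmul2l ?lee_fin.
Qed.

(** For c >= 0 the bound m <= tau on the cone takes m^c out of the inner integral, leaving tau^c
    St^q. Its k-th power has total degree (c + q) k = p. *)
Lemma weighted_lam_pos : (0 <= c)%R ->
  \int[mu]_x (lam phic x `^ k) <= (D + D)%:E.
Proof.
move=> c0; apply: le_trans int_pow_add; apply: ae_ge0_le_integral => //.
- by move=> x _; exact: poweR_ge0.
- by move=> x _; rewrite adde_ge0 ?lee_fin ?powR_ge0.
have FF := ae_filter_ringOfSetsType mu.
apply: filterS3 (aw_lam A) (aw_tau_gt0 A) (aw_m_tau A) => x lamx tau0 mtaux _.
have lamle : lam phic x <= ((tau x `^ c) * St x `^ q)%:E.
  apply: (@le_trans _ _ ((tau x `^ c)%:E * lam phiq x)).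
    rewrite -(lamZ nu mK mwt wt_ge0 x (powR_ge0 _ _) mphiq phiq_ge0).
    apply: le_lam; [exact: wt_ge0|exact: phic_ge0|move=> w Kxw].
    rewrite /phic mulrC; apply: ler_wpM2r; first exact: phiq_ge0.
    by apply: le_powRl; [exact: c0|exact: m_ge0|exact: mtaux].
  by rewrite EFinM lee_wpmul2l ?lee_fin ?powR_ge0.
have zle : ((tau x `^ c * St x `^ q) `^ k <= tau x `^ p + St x `^ p)%R.
  have := powR_prod_le tau0 (St_gt0 x) c0 (ltW q_gt0) (ltW k_gt0).
  by rewrite /c subrK divfK// gt_eqF.
apply: le_trans (_ : ((tau x `^ c * St x `^ q) `^ k)%:E <= _).
  rewrite -poweR_EFin; apply: gt0_ler_poweR lamle; first exact: ltW.
    by rewrite in_itv/= leey lam_ge0.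
  by rewrite in_itv/= leey lee_fin mulr_ge0 ?powR_ge0.
by rewrite -EFinD lee_fin.
Qed.

(** Chosen so that lam^k = (lam tau^(-mgam))^k (tau^p)^(1 - k). *)
Let mgam := (p * (1 - k) / k)%R.

(* [lam ^ k] lies between [lam * tau ^ (- mgam)] and [tau ^ p], and Jensen's inequality
   [aw_mean] turns the negative power of [m] into one of [St], which cancels [lam]. *)
Lemma weighted_lam_le1 : (c < 0)%R -> (k <= 1)%R ->
  \int[mu]_x (lam phic x `^ k) <=
  ((2 * 2 `^ ((mgam - c) / s)) * D + D)%:E.
Proof.
move=> c0 k1.
have g0 : (0 <= mgam)%R.
  by rewrite /mgam divr_ge0 ?(ltW k_gt0)// mulr_ge0 ?subr_ge0// ltW// (lt_trans _ p_gt1).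
set C := (2 * 2 `^ ((mgam - c) / s))%R.
have C0 : (0 <= C)%R by rewrite /C mulr_ge0// powR_ge0.
pose taug x := (tau x `^ (- mgam))%R.
have mtaug : measurable_fun setT taug by exact: measurable_funT_powR.
have taug0 x : (0 <= taug x)%R by exact: powR_ge0.
pose Stg x := (St x `^ (- (mgam - c)))%R.
have mStg : measurable_fun setT Stg by exact: measurable_funT_powR.
have Stg0 x : (0 <= Stg x)%R by exact: powR_ge0.
have int1 : \int[mu]_x ((taug x)%:E * lam phic x) <= (C * D)%:E.
  apply: (@le_trans _ _ (C%:E * \int[mu]_x ((Stg x)%:E * lam phiq x))).
    apply: (lam_kap_le nu mK mwt wt_ge0 C0 mtaug taug0 mStg Stg0 mphic phic_ge0
      mphiq phiq_ge0) => w.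
    have [v0|v0] := eqVneq (kvol w) 0.
      rewrite [X in _ * X <= _](_ : _ = 0) ?mule0; last first.
        by apply: (@kap_eq0 _ _ _ _ _ mu K mK (fun=> 1%R) taug).
      by rewrite !mule_ge0 ?lee_fin//; apply: kap_ge0.
    have {}v0 : 0 < kvol w by rewrite lt0e v0 kvol_ge0.
    have mw0 := m_gt0 v0.
    (* On the shadow m <= tau, so the negative power of tau is at most that of m. *)
    have kt : kap taug w <= (m w `^ (- mgam))%:E * kvol w.
      rewrite -(kapZ mu mK w (powR_ge0 _ _))//.
      apply: ae_le_kap => //.
        by move=> x; rewrite mulr1 powR_ge0.
      have FF := ae_filter_ringOfSetsType mu.
      apply: filterS (aw_m_tau A) => x mtaux Kxw.
      rewrite mulr1; apply: le_powRl_neg => //; first by rewrite oppr_le0.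
      exact: mtaux.
    apply: (@le_trans _ _ ((phic w)%:E * ((m w `^ (- mgam))%:E * kvol w))).
      by apply: lee_wpmul2l => //; rewrite lee_fin.
    rewrite muleA -EFinM (_ : _ * _ = phiq w * m w `^ (- (mgam - c)))%R; last first.
      by rewrite /phic -mulrA -powRDp// opprB.
    rewrite EFinM -muleA [leRHS]muleCA; apply: lee_wpmul2l; first by rewrite lee_fin.
    by apply: (aw_mean A); rewrite subr_ge0 (le_trans (ltW c0)).
  rewrite (EFinM C D); apply: lee_wpmul2l; first by rewrite lee_fin.
  apply: le_trans (int_mul_lam_le mStg Stg0) _.
  apply: le_trans (aw_int_St A); apply: le_integral_nneg => x.
    by rewrite lee_fin mulr_ge0 ?powR_ge0.
  (* The exponents of [St] add up: -(mgam - c) + q = p. *)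
  rewrite lee_fin -powRDp// /mgam /c.
  rewrite (_ : _ + q = p)%R//; field.
  by rewrite gt_eqF.
apply: (@le_trans _ _ (\int[mu]_x ((taug x)%:E * lam phic x + (tau x `^ p)%:E))).
  apply: ae_ge0_le_integral => //.
  - by move=> x _; exact: poweR_ge0.
  - move=> x _; apply: adde_ge0; last by rewrite lee_fin powR_ge0.
    by apply: mule_ge0; [rewrite lee_fin|exact: lam_ge0].
  - apply: emeasurable_funD; last exact/measurable_EFinP/measurable_funT_powR.
    by apply: emeasurable_funM => //; exact/measurable_EFinP.
  have FF := ae_filter_ringOfSetsType mu.
  apply: filterS (aw_tau_gt0 A) => x tau0 _.
  have : 0 <= lam phic x by exact: lam_ge0.
  case: (lam phic x) => [f|_|//]; last first.
    by rewrite gt0_muley ?lte_fin ?powR_gt0// addye// leey.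
  rewrite lee_fin => f0; rewrite poweR_EFin -EFinM -EFinD lee_fin.
  have k01 : (0 < k <= 1)%R by rewrite k_gt0.
  have := powR_mix_le k01 (mulr_ge0 (taug0 x) f0) (powR_ge0 (tau x) p).
  apply: le_trans; rewrite powRM// mulrAC /taug -!powRrM -powRDp//.
  rewrite (_ : _ + _ = 0)%R ?powRr0 ?mul1r//.
  by rewrite /mgam; field; rewrite gt_eqF.
rewrite ge0_integralD//.
- by rewrite EFinD leeD// (aw_int_tau A).
- by move=> x _; apply: mule_ge0; [rewrite lee_fin|exact: lam_ge0].
- by apply: emeasurable_funM => //; exact/measurable_EFinP.
- by move=> x _; rewrite lee_fin powR_ge0.
- exact/measurable_EFinP/measurable_funT_powR.
Qed.

(* By duality: if [h ^ (k / (k - 1))] is the (truncated) integrand then the integral is at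
   most that of [h * lam]; [lam_kap] and the maximal theorem bound it by a small multiple
   of the same integral, which is absorbed. *)
Lemma weighted_lam_gt1 (CH Ce e : R) : (c < 0)%R -> (1 < k)%R ->
  (0 < CH)%R -> (0 < Ce)%R -> (0 < e)%R ->
  (forall h : X -> R, measurable_fun setT h -> (forall x, 0 <= h x)%R ->
    \int[mu]_x (h x `^ (k / (k - 1)))%:E < +oo ->
    exists2 T : X -> R, measurable_fun setT T &
    [/\ (forall x, 0 <= T x)%R,
      {ae mu, forall x w, K (x, w) -> kap h w <= (T x)%:E * kvol w} &
      \int[mu]_x (T x `^ (k / (k - 1)))%:E <=
        CH%:E * \int[mu]_x (h x `^ (k / (k - 1)))%:E]) ->
  (forall x y, 0 <= x -> 0 <= y -> x * y <= Ce * x `^ k + e * y `^ (k / (k - 1)))%R ->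
  ((2 * 2 `^ (- c / s)) * (e * CH) = 1 / 2)%R ->
  \int[mu]_x (lam phic x `^ k) <= (2 * (2 * 2 `^ (- c / s) * (Ce * D)))%:E.
Proof.
move=> c0 k1 CH0 Ce0 e0 HLk young Je.
set k' := (k / (k - 1))%R; set J := (2 * 2 `^ (- c / s))%R in Je *.
have k10 : (0 < k - 1)%R by rewrite subr_gt0.
have k'0 : (0 < k')%R by rewrite divr_gt0.
have J0 : (0 <= J)%R by rewrite /J mulr_ge0// powR_ge0.
have lam0 x : 0 <= lam phic x by exact: lam_ge0.
(* Truncating at multiples of the integrable function St^p makes the integral of [P] finite, so that
   part of it can be subtracted at the end. *)
pose b x := (St x `^ p)%R.
have mb : measurable_fun setT b by exact: measurable_funT_powR.
have b0 x : (0 < b x)%R by exact: powR_gt0.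
apply: (integral_mine_le (b := b)) => //; first by move=> x; exact: poweR_ge0.
move=> n; pose P x := fine (mine (lam phic x `^ k) (n%:R * b x)%:E).
have nb0 x : (0 <= n%:R * b x)%R by rewrite mulr_ge0// ltW.
have P0 x : (0 <= P x)%R.
  by rewrite fine_ge0// le_min poweR_ge0 lee_fin nb0.
have PE x : (P x)%:E = mine (lam phic x `^ k) (n%:R * b x)%:E.
  rewrite fineK// ge0_fin_numE ?le_min ?poweR_ge0 ?lee_fin ?nb0//.
  by rewrite gt_min ltry orbT.
have mP : measurable_fun setT P.
  apply/measurable_EFinP; rewrite (_ : _ \o _ = fun x =>
    mine (lam phic x `^ k) (n%:R * b x)%:E); last exact/funext.
  apply: measurable_mine => //; apply/measurable_EFinP.
  exact: measurable_funM.
under eq_integral do rewrite -PE.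
have intP_lty : \int[mu]_x (P x)%:E < +oo.
  apply: (@le_lt_trans _ _ (n%:R * D)%:E); last exact: ltry.
  apply: (@le_trans _ _ (\int[mu]_x (n%:R * b x)%:E)).
    apply: le_integral_nneg => x; first by rewrite lee_fin.
    by rewrite PE ge_min lexx orbT.
  under eq_integral do rewrite EFinM.
  rewrite ge0_integralZl_EFin//.
  - rewrite EFinM; apply: lee_wpmul2l; [by rewrite lee_fin|exact: aw_int_St A].
  - by move=> x _; rewrite lee_fin ltW.
  - exact/measurable_EFinP.
pose h x := (P x `^ (k'^-1))%R.
have h0 x : (0 <= h x)%R by exact: powR_ge0.
have mh : measurable_fun setT h by exact: measurable_funT_powR.
have hk' x : (h x `^ k' = P x)%R.
  by rewrite /h -powRrM mulVf ?gt_eqF// powRr1.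
have inth : \int[mu]_x (h x `^ k')%:E = \int[mu]_x (P x)%:E.
  by apply: eq_integral => x _; rewrite hk'.
have := HLk h mh h0; rewrite -/k' inth => /(_ intP_lty)[T mT [T0 hT intT]].
pose g x := (St x `^ c * T x)%R.
have mg : measurable_fun setT g.
  by apply: measurable_funM => //; exact: measurable_funT_powR.
have g0 x : (0 <= g x)%R by rewrite mulr_ge0// powR_ge0.
(* Since h^k' = P, one has P = h P^(1/k), and P^(1/k) <= lam because P <= lam^k. *)
have PhL x : (P x)%:E <= (h x)%:E * lam phic x.
  have [P00|P00] := eqVneq (P x) 0%R.
    by rewrite P00; apply: mule_ge0; rewrite ?lee_fin.
  have Pgt : (0 < P x)%R by rewrite lt_neqAle eq_sym P00/=.
  have hE : (P x = h x * P x `^ (k^-1))%R.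
    rewrite /h -powRDp// (_ : _ + _ = 1)%R ?powRr1//.
    by rewrite /k'; field; rewrite gt_eqF// gt_eqF.
  rewrite {1}hE EFinM; apply: lee_wpmul2l; first by rewrite lee_fin.
  have : (P x)%:E <= lam phic x `^ k by rewrite PE ge_min lexx.
  have := lam0 x; case: (lam phic x) => [f|_ _|//]; last by rewrite leey.
  rewrite lee_fin poweR_EFin !lee_fin => f0 /(@le_powRl _ _ _ k^-1).
  by rewrite -powRrM divff ?gt_eqF// powRr1// invr_ge0 ltW// => ->.
(* As k' >= 1, h is at most 1 + h^k', and both terms are integrable over the shadow. *)
have kaph_lty w : kap h w < +oo.
  apply: (@le_lt_trans _ _ (kvol w + \int[mu]_x (P x)%:E)); last first.
    by rewrite lte_add_pinfty.
  rewrite /kvol /kap -ge0_integralD//; last 3 first.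
  - by apply: (@kap_sliceM _ _ _ _ _ K mK (fun=> 1%R)).
  - by move=> x _; rewrite lee_fin.
  - exact/measurable_EFinP.
  apply: le_integral_nneg => x; first by rewrite lee_fin mulr_ge0.
  rewrite -EFinD lee_fin indicE; case: (_ \in _); last by rewrite !mul0r add0r.
  rewrite !mul1r; have [h1|h1] := leP (h x) 1%R; first by rewrite ler_wpDr.
  rewrite ler_wpDl// -hk' le1r_powR//; first exact: ltW.
  by rewrite /k' ler_pdivlMr// mul1r gerBl.
(* Write the integral of h over the shadow as its average a times the volume. Jensen's inequality,
   available since c < 0, turns m^c times the volume into the integral of St^c; then a <= T on the
   shadow brings a under that integral. *)
have key w : (phic w)%:E * kap h w <= J%:E * ((phiq w)%:E * kap g w).
  have [v0|v0] := eqVneq (kvol w) 0.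
    rewrite [X in _ * X <= _](_ : _ = 0) ?mule0; last first.
      by apply: (@kap_eq0 _ _ _ _ _ mu K mK (fun=> 1%R) h).
    by rewrite !mule_ge0 ?lee_fin//; apply: kap_ge0.
  have {}v0 : 0 < kvol w by rewrite lt0e v0 kvol_ge0.
  pose a := (fine (kap h w) / fine (kvol w))%R.
  have v0' : (0 < fine (kvol w))%R by rewrite fine_gt0// v0 kvol_lty.
  have kh0 : 0 <= kap h w by exact: kap_ge0.
  have a0 : (0 <= a)%R by rewrite divr_ge0 ?fine_ge0// ltW.
  have khE : kap h w = a%:E * kvol w.
    rewrite -[X in _ * X](fineK (kvol_fin kvol_lty w)) -EFinM divfK ?gt_eqF//.
    by rewrite fineK// ge0_fin_numE.
  rewrite khE [leRHS]muleCA [X in X * _ <= _](EFinM (phiq w) (m w `^ c)).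
  rewrite -muleA; apply: lee_wpmul2l; first by rewrite lee_fin.
  rewrite [leLHS]muleCA.
  apply: (@le_trans _ _ (a%:E * (J%:E * kap (fun x => St x `^ c)%R w))).
    apply: lee_wpmul2l; first by rewrite lee_fin.
    by have := aw_mean A w (_ : 0 <= - c)%R; rewrite !opprK; apply; rewrite oppr_ge0 ltW.
  rewrite muleCA; apply: lee_wpmul2l; first by rewrite lee_fin.
  rewrite -kapZ//.
  - apply: ae_le_kap => //.
    + by apply: measurable_funM => //; exact: measurable_funT_powR.
    + by move=> x; rewrite mulr_ge0// powR_ge0.
    have FF := ae_filter_ringOfSetsType mu.
    apply: filterS hT => x hTx Kxw.
    rewrite /g mulrC; apply: ler_wpM2l; first exact: powR_ge0.
    have := hTx w Kxw; rewrite khE -(fineK (kvol_fin kvol_lty w)) -!EFinM lee_fin.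
    by rewrite ler_pM2r.
  - exact: measurable_funT_powR.
  - by move=> x; exact: powR_ge0.
have step : \int[mu]_x (P x)%:E <=
    J%:E * ((Ce * D)%:E + (e * CH)%:E * \int[mu]_x (P x)%:E).
  apply: (@le_trans _ _ (\int[mu]_x ((h x)%:E * lam phic x))).
    by apply: le_integral_nneg => x; [rewrite lee_fin|exact: PhL].
  apply: (@le_trans _ _ (J%:E * \int[mu]_x ((g x)%:E * lam phiq x))).
    exact: (lam_kap_le nu mK mwt wt_ge0 J0 mh h0 mg g0 mphic phic_ge0 mphiq phiq_ge0).
  apply: lee_wpmul2l; first by rewrite lee_fin.
  apply: le_trans (int_mul_lam_le mg g0) _.
  (* The product of St^c T with St^q is St^(p/k) T, which Young's inequality splits into St^p and a
     small multiple of T^k'. *)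
  apply: (@le_trans _ _
      (\int[mu]_x (Ce%:E * (b x)%:E + e%:E * (T x `^ k')%:E))).
    apply: le_integral_nneg => x.
      by rewrite lee_fin mulr_ge0// powR_ge0.
    rewrite -!EFinM -EFinD lee_fin /g mulrAC -powRDp// /c subrK.
    apply: le_trans (young _ _ (powR_ge0 _ _) (T0 x)) _.
    by rewrite -powRrM divfK// gt_eqF.
  rewrite ge0_integralD//; last 4 first.
  - by move=> x _; rewrite -EFinM lee_fin mulr_ge0 ?ltW.
  - by apply/measurable_EFinP; exact: measurable_funM.
  - by move=> x _; rewrite -EFinM lee_fin mulr_ge0 ?powR_ge0 ?ltW.
  - apply/measurable_EFinP; apply: measurable_funM => //.
    exact: measurable_funT_powR.
  rewrite !ge0_integralZl_EFin ?(ltW e0) ?(ltW Ce0)//; last 4 first.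
  - by move=> x _; rewrite lee_fin powR_ge0.
  - exact/measurable_EFinP/measurable_funT_powR.
  - by move=> x _; rewrite lee_fin ltW.
  - exact/measurable_EFinP.
  apply: leeD.
    rewrite (EFinM Ce D); apply: lee_wpmul2l; first by rewrite lee_fin ltW.
    exact: aw_int_St A.
  rewrite (EFinM e CH) -muleA; apply: lee_wpmul2l; first by rewrite lee_fin ltW.
  exact: intT.
(* The coefficient J e CH of the integral of [P] on the right is 1/2; being finite, this integral is
   absorbed on the left. *)
have : 0 <= \int[mu]_x (P x)%:E by apply: integral_ge0 => x _; rewrite lee_fin.
move: intP_lty step; case: (\int[mu]_x _) => [I|//|//] _.
rewrite -(EFinM (e * CH) I) -(EFinD (Ce * D)) -(EFinM J) !lee_fin => st I0.
move: st; rewrite mulrDr [X in (_ <= _ + X)%R]mulrA Je => st.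
by move: st; move: (J * (Ce * D))%R => Z; lra.
Qed.

End fixed_weight.

Lemma weighted_lam_bound (D : R) : (0 <= D)%R ->
  exists2 C : R, (0 < C)%R & forall phi m St tau,
    admissible_weight p q s D phi m St tau ->
    \int[mu]_x (lam (fun w => phi w `^ q * m w `^ c)%R x `^ k) <= C%:E.
Proof.
move=> D0; have [c0|c0] := leP 0%R c.
  exists (D + D + 1)%R => [|phi m St tau A].
    by rewrite ltr_wpDl// addr_ge0.
  apply: le_trans (weighted_lam_pos A c0) _.
  by rewrite lee_fin lerDl.
have [k1|k1] := leP k 1%R.
  set C := ((2 * 2 `^ ((p * (1 - k) / k - c) / s)) * D + D)%R.
  have C0 : (0 <= C)%R by rewrite /C addr_ge0// mulr_ge0// mulr_ge0// powR_ge0.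
  exists (C + 1)%R => [|phi m St tau A]; first by rewrite ltr_wpDl.
  apply: le_trans (weighted_lam_le1 A c0 k1) _.
  by rewrite lee_fin lerDl.
have k'1 : (1 < k / (k - 1))%R.
  by rewrite ltr_pdivlMr ?subr_gt0// mul1r gtrBl.
have [CH CH0 HLk] := HL k'1.
set J := (2 * 2 `^ (- c / s) : R)%R.
have J0 : (0 < J)%R by rewrite /J mulr_gt0// powR_gt0.
(* This value of e makes J e CH = 1/2. *)
have e0 : (0 < (2 * J * CH)^-1)%R by rewrite invr_gt0 !mulr_gt0.
have [Ce Ce0 young] := conj_le_eps k1 e0.
exists (2 * (J * (Ce * D)) + 1)%R => [|phi m St tau A].
  by rewrite ltr_wpDl// mulr_ge0// mulr_ge0 ?(ltW J0)// mulr_ge0// ltW.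
apply: (le_trans (weighted_lam_gt1 A c0 k1 CH0 Ce0 e0 HLk young _)).
  by rewrite -/J; field; rewrite !gt_eqF.
by rewrite lee_fin lerDl.
Qed.

End weighted_bounds.
End weights.

Section positive_density.
Context d (X : measurableType d) (R : realType).
Variable mu : {sigma_finite_measure set X -> \bar R}.
Local Open Scope ereal_scope.

(** The pieces F n of an exhaustion are given the weights 2^-(n+1) / (1 + mu (F n)). Adding the p-th
    root of the resulting density makes an area function strictly positive without leaving L^p. *)
Lemma sigma_finite_density : exists2 k : X -> R, measurable_fun setT k &
  (forall x, (0 < k x)%R) /\ \int[mu]_x (k x)%:E <= 1.
Proof.
have [F FT Ffin] := sigma_finiteT mu.
have mF n : measurable (F n) by have [] := Ffin n.
have muF n : mu (F n) \is a fin_num.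
  by rewrite ge0_fin_numE//; have [] := Ffin n.
pose c n : R := ((2 ^+ n.+1)^-1 / (1 + fine (mu (F n))))%R.
have den n : (0 < 1 + fine (mu (F n)))%R by rewrite ltr_pwDl// fine_ge0.
have c0 n : (0 < c n)%R by rewrite divr_gt0// invr_gt0 exprn_gt0.
pose f n x : \bar R := (c n * \1_(F n) x)%:E.
have f0 n x : 0 <= f n x by rewrite lee_fin mulr_ge0// ltW.
have mf n : measurable_fun setT (f n).
  by apply/measurable_EFinP; apply: measurable_funM => //; exact: measurable_indic.
pose kE x := \sum_(n <oo) f n x.
have geo : \sum_(n <oo) ((2 ^+ n.+1)^-1 : R)%:E <= 1.
  have := epsilon_trick0 xpredT (ler01 : (0 <= 1 :> R)%R).
  apply: le_trans; apply: lee_nneseries => // n _.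
  by rewrite lee_fin mul1r natrX.
have c1 n : (c n <= (2 ^+ n.+1)^-1)%R.
  by rewrite /c ler_pdivrMr// ler_peMr ?invr_ge0 ?exprn_ge0// lerDl fine_ge0.
have kE1 x : kE x <= 1.
  apply: le_trans geo; apply: lee_nneseries => // n _.
  rewrite lee_fin indicE; case: (_ \in _); first by rewrite mulr1.
  by rewrite mulr0 invr_ge0 exprn_ge0.
have kE_gt0 x : 0 < kE x.
  have [n _ Fx] : (\bigcup_i F i) x by rewrite -FT.
  apply: (@lt_le_trans _ _ (f n x)).
    by rewrite lte_fin mulr_gt0// indicE mem_set.
  rewrite /kE; apply: le_trans (nneseries_lim_ge n.+1 _) => //.
  by rewrite big_nat_recr//= leeDr// sume_ge0.
have kEfin x : kE x \is a fin_num.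
  by rewrite ge0_fin_numE ?ltW// (le_lt_trans (kE1 x))// ltry.
have mkE : measurable_fun setT kE.
  by apply: ge0_emeasurable_sum.
exists (fine \o kE); first exact: measurableT_comp.
split=> [x|]; first by rewrite fine_gt0// kE_gt0 (le_lt_trans (kE1 x))// ltry.
under eq_integral do rewrite /= fineK//.
rewrite integral_nneseries//; apply: le_trans geo.
apply: lee_nneseries => [n _ _|n _]; first by apply: integral_ge0.
rewrite (eq_integral (fun x => (c n)%:E * (\1_(F n) x)%:E))//.
rewrite ge0_integralZl_EFin ?(ltW (c0 n))//; last first.
  by apply/measurable_EFinP; exact: measurable_indic.
have -> : \int[mu]_x (\1_(F n) x)%:E = (fine (mu (F n)))%:E.
  by rewrite integral_indic// setIT fineK.
rewrite -EFinM lee_fin /c.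
by rewrite mulrAC ler_pdivrMr// ler_wpM2l ?invr_ge0 ?exprn_ge0// lerDr.
Qed.

End positive_density.

(** * Construction of the weight and the lower bound *)

Section weight_existence.
Context d d' (R : realType) (X : measurableType d) (W : measurableType d').
Variables (mu : {sigma_finite_measure set X -> \bar R})
  (nu : {sigma_finite_measure set W -> \bar R}).
Variables (K : set (X * W)) (wt : W -> R).
Hypotheses (mK : measurable K) (mwt : measurable_fun setT wt)
  (wt_ge0 : forall w, 0 <= wt w).
Hypotheses (kvol_lty : forall w, (kvol mu K w < +oo)%E)
  (kvol_gt0 : forall x w, K (x, w) -> (0 < kvol mu K w)%E)
  (K_nonempty : forall x, exists w, K (x, w)).
Local Open Scope ereal_scope.

Local Notation lam := (lam nu K wt).
Local Notation kap := (kap mu K).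
Local Notation kvol := (kvol mu K).

Hypothesis HL : forall r : R, (1 < r)%R -> maximal_bound mu K r.

Variables (p q : R).
Hypotheses (p_gt1 : (1 < p)%R) (q_gt1 : (1 < q)%R).
Let p_gt0 : (0 < p)%R. Proof. exact: lt_trans p_gt1. Qed.
Let q_gt0 : (0 < q)%R. Proof. exact: lt_trans q_gt1. Qed.
Let s_gt0 : (0 < p - 1)%R. Proof. by rewrite subr_gt0. Qed.

(** With s = p - 1, the function [u] = St^s lies in L^(p/(p-1)), an exponent above 1 to which the
    maximal theorem applies. If T is the resulting majorant, tau = T^(1/(p-1)) satisfies tau^p =
    T^(p/(p-1)). *)
Lemma exists_weight : exists2 D : R, (0 < D)%R &
  forall phi : W -> R, measurable_fun setT phi -> (forall w, 0 <= phi w)%R ->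
    \int[mu]_x (lam (fun w => phi w `^ q)%R x `^ (p / q)) <= 1 ->
    exists m St tau,
      admissible_weight mu nu K wt p q (p - 1) D phi m St tau /\
      forall r w, (0 <= r <= p - 1)%R ->
        kap (fun x => St x `^ r)%R w <= (2 * m w `^ r)%:E * kvol w.
Proof.
have [k mk [k0 intk]] := sigma_finite_density mu.
have p'1 : (1 < p / (p - 1))%R by rewrite ltr_pdivlMr// mul1r gtrBl.
have [CH CH0 HLp] := HL p'1.
pose D1 := (2 `^ p * 2 : R)%R.
have D10 : (0 < D1)%R by rewrite mulr_gt0// powR_gt0.
exists (D1 * (1 + CH))%R => [|phi mphi phi0 int1]; first by rewrite mulr_gt0// addr_gt0.
have mphiq : measurable_fun setT (fun w => phi w `^ q)%R by exact: measurable_funT_powR.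
have phiq0 w : (0 <= phi w `^ q)%R by exact: powR_ge0.
set L := lam _ in int1 *.
have L0 x : 0 <= L x by exact: lam_ge0.
have mL : measurable_fun setT L by exact: measurable_lam.
have L_lty : {ae mu, forall x, L x < +oo}.
  have : {ae mu, forall x, setT x -> L x `^ (p / q) \is a fin_num}.
    apply: integrable_ae => //; apply/integrableP; split.
      exact: measurable_funT_poweR.
    under eq_integral do rewrite gee0_abs ?poweR_ge0//.
    by apply: le_lt_trans int1 _; rewrite ltry.
  apply: filterS => x /(_ I); rewrite ge0_fin_numE ?poweR_ge0//.
  by apply: lty_poweRy; rewrite gt_eqF// divr_gt0.
pose S x := (fine (L x) `^ q^-1)%R.
have S0 x : (0 <= S x)%R by exact: powR_ge0.
have mS : measurable_fun setT S.
  by apply: measurable_funT_powR; exact: measurableT_comp.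
pose k' x := (k x `^ p^-1)%R.
have k'0 x : (0 < k' x)%R by exact: powR_gt0.
have mk' : measurable_fun setT k' by exact: measurable_funT_powR.
pose St x := (S x + k' x)%R.
have St0 x : (0 < St x)%R by rewrite ltr_wpDl.
have mSt : measurable_fun setT St by exact: measurable_funD.
have intSp : \int[mu]_x (S x `^ p)%:E <= 1.
  apply: le_trans int1; apply: le_integral_nneg => x.
    by rewrite lee_fin powR_ge0.
  rewrite /S -powRrM mulrC; have := L0 x.
  case: (L x) => [l|_|//]; first by rewrite poweR_EFin.
  by rewrite poweRyr ?leey// gt_eqF// divr_gt0.
have intSt : \int[mu]_x (St x `^ p)%:E <= D1%:E.
  apply: (@le_trans _ _ (\int[mu]_x ((2 `^ p)%:E * ((S x `^ p)%:E + (k x)%:E)))).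
    apply: le_integral_nneg => x; first by rewrite lee_fin powR_ge0.
    rewrite -EFinD -EFinM lee_fin /St.
    apply: le_trans (powRD_le (ltW p_gt0) (S0 x) (ltW (k'0 x))) _.
    by rewrite /k' -(powRrM (k x)) mulVf ?gt_eqF// powRr1// ltW.
  have mSp : measurable_fun setT (fun x => (S x `^ p)%:E).
    exact/measurable_EFinP/measurable_funT_powR.
  have mkE : measurable_fun setT (fun x => (k x)%:E) by exact/measurable_EFinP.
  have Sp0 x : 0 <= (S x `^ p)%:E by rewrite lee_fin powR_ge0.
  have kE0 x : 0 <= (k x)%:E by rewrite lee_fin ltW.
  rewrite ge0_integralZl_EFin ?powR_ge0//.
  - rewrite ge0_integralD// /D1 EFinM; apply: lee_wpmul2l.
      by rewrite lee_fin powR_ge0.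
    by rewrite mulr2n EFinD; apply: leeD.
  - by move=> x _; rewrite adde_ge0.
  - exact: emeasurable_funD.
pose u x := (St x `^ (p - 1))%R.
have mu_ : measurable_fun setT u by exact: measurable_funT_powR.
have u0 x : (0 <= u x)%R by exact: powR_ge0.
have uE x : (u x `^ (p / (p - 1)) = St x `^ p)%R.
  by rewrite /u -powRrM mulrCA divff ?mulr1// gt_eqF.
have intu : \int[mu]_x (u x `^ (p / (p - 1)))%:E <= D1%:E.
  by under eq_integral do rewrite uE.
have kapu_lty w : kap u w < +oo.
  apply: (@le_lt_trans _ _ (kvol w + \int[mu]_x (u x `^ (p / (p - 1)))%:E)).
    rewrite /kvol /kap -ge0_integralD//; last 3 first.
    - by apply: (@kap_sliceM _ _ _ _ _ K mK (fun=> 1%R)).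
    - by move=> x _; rewrite lee_fin powR_ge0.
    - exact/measurable_EFinP/measurable_funT_powR.
    apply: le_integral_nneg => x; first by rewrite lee_fin mulr_ge0.
    rewrite -EFinD lee_fin indicE; case: (_ \in _); last first.
      by rewrite !mul0r add0r powR_ge0.
    rewrite !mul1r; have [h1|h1] := leP (u x) 1%R; first by rewrite ler_wpDr ?powR_ge0.
    by rewrite ler_wpDl// le1r_powR// ltW.
  by rewrite lte_add_pinfty// (le_lt_trans intu)// ltry.
have [T mT [T0 uT intT]] := HLp u mu_ u0 (le_lt_trans intu (ltry _)).
pose tau x := (T x `^ (p - 1)^-1)%R.
have mtau : {ae mu, forall x w, K (x, w) -> (mean mu K (p - 1) St w <= tau x)%R}.
  apply: filterS uT => x uT w Kxw.
  have := uT w Kxw; rewrite kap_mean// lee_pmul2r ?(kvol_gt0 Kxw)//; last first.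
    by rewrite ge0_fin_numE ?kvol_ge0.
  rewrite lee_fin => mT'.
  have s'0 : (0 <= (p - 1)^-1)%R by rewrite invr_ge0 ltW.
  have := le_powRl s'0 (powR_ge0 _ _) mT'.
  by rewrite -powRrM divff ?gt_eqF// powRr1// mean_ge0.
exists (mean mu K (p - 1) St), St, tau; split; last first.
  by move=> r w rs; apply: kap_pow_le.
split=> //.
- exact: measurable_mean.
- by move=> w; exact: mean_ge0.
- by move=> w; exact: mean_gt0.
- exact: measurable_funT_powR.
- by move=> x; exact: powR_ge0.
- apply: filterS L_lty => x Lx.
  have Lfin : L x \is a fin_num by rewrite ge0_fin_numE.
  rewrite -/L -(fineK Lfin) lee_fin.
  have -> : fine (L x) = (S x `^ q)%R.
    by rewrite /S -powRrM mulVf ?gt_eqF// powRr1// fine_ge0.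
  by apply: le_powRl => //; [exact: ltW|rewrite lerDl ltW].
(* tau is positive at x because the cone of x is nonempty and m is positive on it. *)
- apply: filterS mtau => x mtaux; have [w Kxw] := K_nonempty x.
  apply: lt_le_trans (mtaux w Kxw); apply: mean_gt0 => //.
  exact: kvol_gt0 Kxw.
- by move=> r w r0; apply: mean_powN_le.
- apply: le_trans intSt _; rewrite lee_fin ler_peMr ?(ltW D10)//.
  by rewrite lerDl ltW.
- rewrite [leLHS](_ : _ = \int[mu]_x (T x `^ (p / (p - 1)))%:E); last first.
    by apply: eq_integral => x _; rewrite /tau -powRrM mulrC.
  apply: le_trans intT _.
  apply: (@le_trans _ _ (CH%:E * D1%:E)).
    by apply: lee_wpmul2l => //; rewrite lee_fin ltW.
  by rewrite -EFinM lee_fin mulrC ler_wpM2l ?(ltW D10)// lerDr.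
Qed.

(* For [p >= q], [m ^ (p - q)] dominates the mean of [St ^ (p - q)]; for [p < q] the
   missing power of [tau] is absorbed by Young's inequality. *)
Lemma weighted_lower_bound (D : R) : (0 < D)%R ->
  exists2 c : R, (0 < c)%R & forall phi m St tau,
    admissible_weight mu nu K wt p q (p - 1) D phi m St tau ->
    (forall r w, (0 <= r <= p - 1)%R ->
      kap (fun x => St x `^ r)%R w <= (2 * m w `^ r)%:E * kvol w) ->
    \int[mu]_x (lam (fun w => phi w `^ q)%R x `^ (p / q)) = 1 ->
    c%:E <= \int[nu]_w ((phi w `^ q * m w `^ (p - q) * wt w)%:E * kvol w).
Proof.
move=> D0.
have pw_le (phi m : W -> R) (g : X -> R) (C : R) : (0 <= C)%R ->
    measurable_fun setT phi -> measurable_fun setT m -> (forall w, 0 <= m w)%R ->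
    measurable_fun setT g -> (forall x, 0 <= g x)%R ->
    (forall w, kap g w <= (C * m w `^ (p - q))%:E * kvol w) ->
    \int[mu]_x ((g x)%:E * lam (fun w => phi w `^ q)%R x) <=
    C%:E * \int[nu]_w ((phi w `^ q * m w `^ (p - q) * wt w)%:E * kvol w).
  move=> C0 mphi mm m0 mg g0 H.
  rewrite lam_kap//; last 2 first.
  - exact: measurable_funT_powR.
  - by move=> w; exact: powR_ge0.
  rewrite -ge0_integralZl_EFin//.
  - apply: le_integral_nneg => w.
      by apply: mule_ge0; [rewrite lee_fin mulr_ge0 ?powR_ge0|exact: kap_ge0].
    apply: (@le_trans _ _ ((phi w `^ q * wt w)%:E * ((C * m w `^ (p - q))%:E * kvol w))).
      by apply: lee_wpmul2l => //; rewrite lee_fin mulr_ge0 ?powR_ge0.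
    rewrite [leLHS]muleA [leRHS]muleA -(EFinM (phi w `^ q * wt w)) -(EFinM C).
    rewrite le_eqVlt; apply/orP; left; apply/eqP; congr (_%:E * _); ring.
  - move=> w _; apply: mule_ge0; last exact: kvol_ge0.
    by rewrite lee_fin !mulr_ge0 ?powR_ge0.
  - apply: emeasurable_funM; last exact: measurable_kap.
    apply/measurable_EFinP; apply: measurable_funM => //.
    by apply: measurable_funM; exact: measurable_funT_powR.
have [qp|pq] := leP q p.
  exists 2^-1%R => [|phi m St tau A J int1]; first by rewrite invr_gt0.
  have [mphi mm mSt] := And3 (aw_mphi A) (aw_mm A) (aw_mSt A).
  have L0 x : 0 <= lam (fun w => phi w `^ q)%R x.
    by apply: lam_ge0 => // w; exact: powR_ge0.
  have mL : measurable_fun setT (lam (fun w => phi w `^ q)%R).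
    apply: measurable_lam => //; first exact: measurable_funT_powR.
    by move=> w; exact: powR_ge0.
  (* One factor lam is kept and the remaining power (p - q)/q >= 0 of it is bounded by St^(p -
     q). *)
  have le1 : 1 <= \int[mu]_x ((St x `^ (p - q))%:E * lam (fun w => phi w `^ q)%R x).
    rewrite -int1; apply: ae_ge0_le_integral => //.
    - by move=> x _; exact: poweR_ge0.
    - exact: measurable_funT_poweR.
    - by move=> x _; rewrite mule_ge0 ?lee_fin ?powR_ge0.
    - apply: emeasurable_funM => //.
      exact/measurable_EFinP/measurable_funT_powR.
    apply: filterS (aw_lam A) => x + _.
    have := L0 x; case: (lam _ x) => [l| |//]; last by rewrite leye_eq.
    rewrite lee_fin => l0; rewrite lee_fin => lSt.
    rewrite poweR_EFin -EFinM lee_fin.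
    have [->|ln0] := eqVneq l 0%R.
      by rewrite powR0 ?mulr0// gt_eqF// divr_gt0.
    have -> : (p / q = (p - q) / q + 1)%R by field; rewrite gt_eqF.
    have {ln0}l0' : (0 < l)%R by rewrite lt_neqAle eq_sym ln0.
    rewrite (powRDp ((p - q) / q) 1 l0') powRr1//; apply: ler_wpM2r => //.
    apply: le_trans (le_powRl _ l0 lSt) _.
      by rewrite divr_ge0 ?subr_ge0// ltW.
    by rewrite -powRrM mulrCA divff ?mulr1// gt_eqF.
  have := pw_le phi m (fun x => St x `^ (p - q))%R 2%R _ mphi mm (aw_m_ge0 A).
  move=> /(_ _ (measurable_funT_powR _ mSt) (fun=> powR_ge0 _ _)) H.
  have {}H := le_trans le1 (H _ _).
  rewrite -(@lee_pmul2l _ 2%:E)// -EFinM divff//; apply: H => //.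
  (* The hypothesis on means covers the exponent p - q, which is at most p - 1 because q > 1. *)
  by move=> w; apply: J; rewrite subr_ge0 qp/= lerD2l lerN2 ltW.
(* With this e the term in tau^p contributes at most 1/2 of the total mass 1. *)
have e0 : (0 < (2 * D)^-1)%R by rewrite invr_gt0 mulr_gt0.
have k01 : (0 < p / q <= 1)%R by rewrite divr_gt0//= ler_pdivrMr// mul1r ltW.
have [C C0 young] := powR_mix_le_eps k01 e0.
exists (2 * C)^-1%R => [|phi m St tau A J int1]; first by rewrite invr_gt0 mulr_gt0.
have [mphi mm mtau] := And3 (aw_mphi A) (aw_mm A) (aw_mtau A).
have L0 x : 0 <= lam (fun w => phi w `^ q)%R x.
  by apply: lam_ge0 => // w; exact: powR_ge0.
have mL : measurable_fun setT (lam (fun w => phi w `^ q)%R).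
  apply: measurable_lam => //; first exact: measurable_funT_powR.
  by move=> w; exact: powR_ge0.
set I := \int[mu]_x ((tau x `^ (p - q))%:E * lam (fun w => phi w `^ q)%R x).
have I0 : 0 <= I.
  by apply: integral_ge0 => x _; rewrite mule_ge0 ?lee_fin ?powR_ge0.
have mg : measurable_fun setT (fun x => (tau x `^ (p - q))%:E * lam (fun w => phi w `^ q)%R x).
  by apply: emeasurable_funM => //; exact/measurable_EFinP/measurable_funT_powR.
have le1 : 1 <= C%:E * I + ((2 * D)^-1)%:E * \int[mu]_x (tau x `^ p)%:E.
  rewrite -ge0_integralZl_EFin ?(ltW C0)//; last first.
    by move=> x _; rewrite mule_ge0 ?lee_fin ?powR_ge0.
  rewrite -ge0_integralZl_EFin ?(ltW e0)//; last 2 first.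
  - by move=> x _; rewrite lee_fin powR_ge0.
  - exact/measurable_EFinP/measurable_funT_powR.
  have mC : measurable_fun setT (fun x => C%:E *
      ((tau x `^ (p - q))%:E * lam (fun w => phi w `^ q)%R x)).
    exact: measurable_funeM.
  have mD : measurable_fun setT (fun x => (2 * D)^-1%:E * (tau x `^ p)%:E).
    by apply: measurable_funeM; exact/measurable_EFinP/measurable_funT_powR.
  have C0' x : 0 <= C%:E * ((tau x `^ (p - q))%:E * lam (fun w => phi w `^ q)%R x).
    by rewrite !mule_ge0 ?lee_fin ?powR_ge0// ltW.
  have D0' x : 0 <= (2 * D)^-1%:E * (tau x `^ p)%:E.
    by rewrite mule_ge0 ?lee_fin ?powR_ge0// ltW.
  rewrite -ge0_integralD//.
  rewrite -int1; apply: ae_ge0_le_integral => //.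
  - by move=> x _; exact: poweR_ge0.
  - exact: measurable_funT_poweR.
  - by move=> x _; rewrite adde_ge0.
  - exact: emeasurable_funD.
  apply: filterS (aw_tau_gt0 A) => x tau0 _.
  have := L0 x; case: (lam _ x) => [l| |//]; last first.
    rewrite gt0_muley ?lte_fin ?powR_gt0// gt0_muley ?lte_fin//.
    by rewrite addye ?leey// -EFinM.
  rewrite lee_fin => l0; rewrite poweR_EFin -!EFinM -EFinD lee_fin.
  (* The powers of tau cancel, since (p - q) p/q + p (1 - p/q) = 0; what is left is l^(p/q). *)
  have := young (tau x `^ (p - q) * l)%R (tau x `^ p)%R.
  rewrite powRM ?powR_ge0// mulrAC -!powRrM -powRDp//.
  have -> : ((p - q) * (p / q) + p * (1 - p / q) = 0)%R by field; rewrite gt_eqF.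
  rewrite powRr0 mul1r.
  by apply; rewrite ?mulr_ge0 ?powR_ge0.
have le2 : 1 <= C%:E * I + 2^-1%:E.
  apply: le_trans le1 _; apply: leeD => //.
  have eD : ((2 * D)^-1 * D = 2^-1)%R by field; rewrite gt_eqF.
  rewrite -eD EFinM; apply: lee_wpmul2l; first by rewrite lee_fin ltW.
  exact: aw_int_tau A.
(* Here p - q < 0, so m <= tau on the shadow bounds the integral of tau^(p - q) by m^(p - q) times
   the volume. *)
have H : I <= 1%:E * \int[nu]_w ((phi w `^ q * m w `^ (p - q) * wt w)%:E * kvol w).
  apply: pw_le => //.
  - exact: aw_m_ge0 A.
  - exact: measurable_funT_powR.
  - by move=> x; exact: powR_ge0.
  move=> w; rewrite mul1r.
  have [v0|v0] := eqVneq (kvol w) 0.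
    rewrite v0 mule0 (_ : kap _ w = 0)//.
    apply: (@kap_eq0 _ _ _ _ _ mu K mK (fun=> 1%R)) => //.
      exact: measurable_funT_powR.
    by move=> x; exact: powR_ge0.
  have {}v0 : 0 < kvol w by rewrite lt0e v0 kvol_ge0.
  rewrite -(kapZ mu mK w (powR_ge0 _ _))//; apply: ae_le_kap => //.
  - exact: measurable_funT_powR.
  - by move=> x; exact: powR_ge0.
  - by move=> x; rewrite mulr1 powR_ge0.
  apply: filterS (aw_m_tau A) => x mtaux Kxw; rewrite mulr1.
  apply: le_powRl_neg; [by rewrite subr_le0 ltW|exact: aw_m_gt0 A w v0|exact: mtaux].
rewrite mul1e in H; apply: le_trans H.
move: I0 le2; move: (I); case=> [i I0'|_ _|//]; last by rewrite leey.
move: I0'.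
rewrite -EFinM -EFinD !lee_fin => i0 le2.
by rewrite -[leLHS]mul1r ler_pdivrMr ?mulr_gt0//; lra.
Qed.

End weight_existence.

(** * Cauchy's formula and an estimate on the strip *)

Section segment_integral.
Context {R : realType}.
Implicit Types (a b c d x y e : R) (f g : R -> R).

Definition sint a b f : R := (\int[lebesgue_measure]_(x in `[a, b]) f x)%R.

Definition sitg a b f := lebesgue_measure.-integrable `[a, b] (EFin \o f).

Lemma sitg_continuous a b f :
  (forall x, a <= x <= b -> {for x, continuous f}) -> sitg a b f.
Proof.
move=> cf; apply: continuous_compact_integrable; first exact: segment_compact.
apply: continuous_in_subspaceT => x; rewrite inE/= in_itv/=; exact: cf.
Qed.

Lemma sintB a b f g : sitg a b f -> sitg a b g ->
  sint a b (fun x => f x - g x) = sint a b f - sint a b g.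
Proof. by move=> mf mg; rewrite /sint RintegralB. Qed.

Lemma sitgB a b f g : sitg a b f -> sitg a b g -> sitg a b (fun x => f x - g x).
Proof.
move=> mf mg; rewrite /sitg (_ : _ \o _ = (EFin \o f) \- (EFin \o g))%E//.
exact: integrableB.
Qed.

Lemma sitgZ a b k f : sitg a b f -> sitg a b (fun x => k * f x).
Proof.
move=> mf; rewrite /sitg (_ : _ \o _ = (fun x => k%:E * (EFin \o f) x)%E)//.
exact: integrableZl.
Qed.

Lemma sitg_cst a b k : sitg a b (fun=> k).
Proof. by apply: sitg_continuous => x _; exact: cst_continuous. Qed.

Lemma sint_cst a b k : a <= b -> sint a b (fun=> k) = k * (b - a).
Proof.
move=> ab; rewrite /sint Rintegral_cst//= lebesgue_measure_itv/= lte_fin.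
by case: ltgtP ab => [ab _|//|-> _] //=; rewrite subrr.
Qed.

Lemma le_sint a b f g : sitg a b f -> sitg a b g ->
  (forall x, a <= x <= b -> f x <= g x) -> sint a b f <= sint a b g.
Proof.
move=> mf mg fg; apply: le_Rintegral => // x /=; rewrite in_itv/=; exact: fg.
Qed.

Lemma sint_bound a b f M : a <= b -> sitg a b f ->
  (forall x, a <= x <= b -> `|f x| <= M) -> `|sint a b f| <= M * (b - a).
Proof.
move=> ab mf fM; rewrite ler_norml; apply/andP; split.
  rewrite -mulNr -sint_cst//; apply: le_sint => //; first exact: sitg_cst.
  by move=> x /fM; rewrite ler_norml => /andP[].
rewrite -sint_cst//; apply: le_sint => //; first exact: sitg_cst.
by move=> x /fM; rewrite ler_norml => /andP[].
Qed.

Lemma sint_abs_le a b f g : sitg a b f -> sitg a b g ->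
  (forall x, a <= x <= b -> `|f x| <= g x) -> `|sint a b f| <= sint a b g.
Proof.
move=> mf mg fM; rewrite ler_norml; apply/andP; split; last first.
  by apply: le_sint => // x /fM; rewrite ler_norml => /andP[].
rewrite lerNl -mulN1r /sint -RintegralZl//; apply: le_sint => //.
  exact: sitgZ.
by move=> x /fM; rewrite ler_norml mulN1r lerNl => /andP[].
Qed.

Lemma sint_split a c b f : sitg a b f -> a <= c <= b ->
  sint a b f = sint a c f + sint c b f.
Proof.
move=> mf /andP[ac cb]; have := @Rintegral_itvB R f (BLeft a) (BRight b) c mf.
rewrite !bnd_simp => /(_ ac cb).
rewrite Rintegral_itv_obnd_cbnd; first by rewrite /sint => <-; rewrite addrC subrK.
apply: integrableS mf => // x /=; rewrite !in_itv/=.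
by move=> /andP[/ltW cx ->]; rewrite (le_trans ac).
Qed.

End segment_integral.

(** * Boundary integrals of 1-forms over rectangles *)

Section green_form.
Context {R : realType}.
Implicit Types (a b c d x y e w h : R) (P Q : R -> R -> R).

Definition dif2 P (A B x0 y0 : R) := forall e, 0 < e -> exists2 r, 0 < r &
  forall x y, `|x - x0| < r -> `|y - y0| < r ->
    `|P x y - P x0 y0 - A * (x - x0) - B * (y - y0)| <=
    e * (`|x - x0| + `|y - y0|).

Definition cont2 P (x0 y0 : R) := forall e, 0 < e -> exists2 r, 0 < r &
  forall x y, `|x - x0| < r -> `|y - y0| < r -> `|P x y - P x0 y0| <= e.

Lemma dif2_cont2 P A B x0 y0 : dif2 P A B x0 y0 -> cont2 P x0 y0.
Proof.
move=> dP e e0; have [r r0 H] := dP 1 ltr01.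
pose N := `|A| + `|B| + 2.
have N0 : 0 < N by rewrite ltr_wpDl// addr_ge0.
exists (Num.min r (e / N)); first by rewrite lt_min r0 divr_gt0.
move=> x y; rewrite !lt_min => /andP[xr xe] /andP[yr ye].
have Hxy := H _ _ xr yr.
set X := x - x0 in xr xe Hxy *; set Y := y - y0 in yr ye Hxy *.
have -> : P x y - P x0 y0 =
    (P x y - P x0 y0 - A * X - B * Y) + (A * X + B * Y) by ring.
apply: (le_trans (ler_normD _ _)).
apply: (@le_trans _ _ (1 * (`|X| + `|Y|) + (`|A| * `|X| + `|B| * `|Y|))).
  apply: lerD; first exact: Hxy.
  by rewrite (le_trans (ler_normD _ _))// !normrM.
have eE : e = (e / N) * N by rewrite divfK ?gt_eqF.
rewrite mul1r [leRHS]eE.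
have : `|X| <= e / N by exact: ltW.
have : `|Y| <= e / N by exact: ltW.
move: (normr_ge0 A) (normr_ge0 B) (normr_ge0 X) (normr_ge0 Y).
move: (e / N); rewrite /N; move: `|A| `|B| `|X| `|Y| => p q u v k p0 q0 u0 v0 vk uk.
have := ler_wpM2l p0 uk; have := ler_wpM2l q0 vk; lra.
Qed.

Lemma cont2_slice1 P x0 y0 : cont2 P x0 y0 -> {for x0, continuous (P^~ y0)}.
Proof.
move=> cP; apply/cvgrPdist_le => /= e e0; have [r r0 H] := cP e e0.
near=> x; rewrite distrC; apply: H; last by rewrite subrr normr0.
by near: x; rewrite near_simpl; exists r => //= x/=; rewrite distrC.
Unshelve. all: by end_near. Qed.

Lemma cont2_slice2 P x0 y0 : cont2 P x0 y0 -> {for y0, continuous (P x0)}.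
Proof.
move=> cP; apply/cvgrPdist_le => /= e e0; have [r r0 H] := cP e e0.
near=> x; rewrite distrC; apply: H; first by rewrite subrr normr0.
by near: x; rewrite near_simpl; exists r => //= x/=; rewrite distrC.
Unshelve. all: by end_near. Qed.

(* The integral of [P dx + Q dy] over the boundary of the rectangle. *)
Definition green P Q a b c d : R :=
  sint a b (fun x => P x c - P x d) + sint c d (fun y => Q b y - Q a y).

Lemma green_splitx P Q a e b c d : a <= e <= b ->
  (forall x, a <= x <= b -> cont2 P x c) -> (forall x, a <= x <= b -> cont2 P x d) ->
  (forall y, c <= y <= d -> [/\ cont2 Q a y, cont2 Q e y & cont2 Q b y]) ->
  green P Q a b c d = green P Q a e c d + green P Q e b c d.
Proof.
move=> ae cc cd cQ.
have mP : sitg a b (fun x => P x c - P x d).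
  by apply: sitgB; apply: sitg_continuous => x xab; apply: cont2_slice1;
    [exact: cc|exact: cd].
have mQ z : (forall y, c <= y <= d -> cont2 Q z y) -> sitg c d (Q z).
  by move=> H; apply: sitg_continuous => y yab; apply: cont2_slice2; exact: H.
have ma : sitg c d (Q a) by apply: mQ => y /cQ[].
have me : sitg c d (Q e) by apply: mQ => y /cQ[].
have mb : sitg c d (Q b) by apply: mQ => y /cQ[].
by rewrite /green (sint_split mP ae) (sintB mb ma) (sintB me ma) (sintB mb me); ring.
Qed.

Lemma green_splity P Q a b c e d : c <= e <= d ->
  (forall y, c <= y <= d -> cont2 Q a y) -> (forall y, c <= y <= d -> cont2 Q b y) ->
  (forall x, a <= x <= b -> [/\ cont2 P x c, cont2 P x e & cont2 P x d]) ->
  green P Q a b c d = green P Q a b c e + green P Q a b e d.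
Proof.
move=> ae cc cd cQ.
have mP : sitg c d (fun y => Q b y - Q a y).
  by apply: sitgB; apply: sitg_continuous => x xab; apply: cont2_slice2;
    [exact: cd|exact: cc].
have mQ z : (forall y, a <= y <= b -> cont2 P y z) -> sitg a b (P^~ z).
  by move=> H; apply: sitg_continuous => y yab; apply: cont2_slice1; exact: H.
have ma : sitg a b (P^~ c) by apply: mQ => y /cQ[].
have me : sitg a b (P^~ e) by apply: mQ => y /cQ[].
have mb : sitg a b (P^~ d) by apply: mQ => y /cQ[].
by rewrite /green (sint_split mP ae) (sintB ma mb) (sintB ma me) (sintB me mb); ring.
Qed.

(** The linear parts of P and Q share the mixed coefficient B, so their contributions -B h w and B w
    h cancel. What remains are linearization errors of at most 2 e (w + h) in each of the two
    integrals, over lengths w and h. *)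
Lemma green_local P Q A B D x0 y0 e r a w c h : 0 < e -> 0 <= w -> 0 <= h ->
  (forall x y, `|x - x0| < r -> `|y - y0| < r ->
    `|P x y - P x0 y0 - A * (x - x0) - B * (y - y0)| <= e * (`|x - x0| + `|y - y0|)) ->
  (forall x y, `|x - x0| < r -> `|y - y0| < r ->
    `|Q x y - Q x0 y0 - B * (x - x0) - D * (y - y0)| <= e * (`|x - x0| + `|y - y0|)) ->
  w < r -> h < r -> a <= x0 <= a + w -> c <= y0 <= c + h ->
  (forall x y, a <= x <= a + w -> c <= y <= c + h -> cont2 P x y /\ cont2 Q x y) ->
  `|green P Q a (a + w) c (c + h)| <= 2 * e * (w + h) ^+ 2.
Proof.
move=> e0 w0 h0 HP HQ wr hr xa yc cPQ.
have near_x x : a <= x <= a + w -> `|x - x0| <= w.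
  by rewrite ler_norml; lra.
have near_y y : c <= y <= c + h -> `|y - y0| <= h.
  by rewrite ler_norml; lra.
have cin : c <= c <= c + h by lra.
have chin : c <= c + h <= c + h by lra.
have ain : a <= a <= a + w by lra.
have awin : a <= a + w <= a + w by lra.
have errP x y : a <= x <= a + w -> c <= y <= c + h ->
    `|P x y - P x0 y0 - A * (x - x0) - B * (y - y0)| <= e * (w + h).
  move=> xi yi; have xw := near_x _ xi; have yh := near_y _ yi.
  apply: le_trans (HP _ _ (le_lt_trans xw wr) (le_lt_trans yh hr)) _.
  by rewrite ler_wpM2l ?lerD// ltW.
have errQ x y : a <= x <= a + w -> c <= y <= c + h ->
    `|Q x y - Q x0 y0 - B * (x - x0) - D * (y - y0)| <= e * (w + h).
  move=> xi yi; have xw := near_x _ xi; have yh := near_y _ yi.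
  apply: le_trans (HQ _ _ (le_lt_trans xw wr) (le_lt_trans yh hr)) _.
  by rewrite ler_wpM2l ?lerD// ltW.
have mP : sitg a (a + w) (fun x => P x c - P x (c + h)).
  by apply: sitgB; apply: sitg_continuous => x xi; apply: cont2_slice1;
    have [] := cPQ _ _ xi cin; have [] := cPQ _ _ xi chin.
have mQ : sitg c (c + h) (fun y => Q (a + w) y - Q a y).
  by apply: sitgB; apply: sitg_continuous => y yi; apply: cont2_slice2;
    have [] := cPQ _ _ ain yi; have [] := cPQ _ _ awin yi.
have -> : green P Q a (a + w) c (c + h) =
    sint a (a + w) (fun x => P x c - P x (c + h) - (- (B * h))) +
    sint c (c + h) (fun y => Q (a + w) y - Q a y - B * w).
  rewrite /green (sintB mP (sitg_cst _ _ _)) (sintB mQ (sitg_cst _ _ _)).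
  by rewrite !sint_cst ?lerDl//; ring.
apply: le_trans (ler_normD _ _) _.
have -> : 2 * e * (w + h) ^+ 2 =
    2 * e * (w + h) * (a + w - a) + 2 * e * (w + h) * (c + h - c) by ring.
apply: lerD; apply: sint_bound; rewrite ?lerDl//.
- exact/sitgB/sitg_cst.
- move=> x xi; have := errP x c xi cin; have := errP x (c + h) xi chin.
  by rewrite !ler_norml; lra.
- exact/sitgB/sitg_cst.
- move=> y yi; have := errQ a y ain yi; have := errQ (a + w) y awin yi.
  by rewrite !ler_norml; lra.
Qed.

End green_form.

(** * Goursat's theorem by repeated quartering *)

Section goursat.
Context {R : realType}.
Implicit Types (a b c d x y e w h r : R) (P Q : R -> R -> R).

Lemma nested_segments (u l : nat -> R) : (forall n, 0 <= l n) ->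
  (forall n, u n <= u n.+1) -> (forall n, u n.+1 + l n.+1 <= u n + l n) ->
  exists x, forall n, u n <= x <= u n + l n.
Proof.
move=> l0 uS ulS.
have u_nd m n : (m <= n)%N -> u m <= u n by move: m n; apply/nondecreasing_seqP.
have ul_ni m n : (m <= n)%N -> u n + l n <= u m + l m.
  by move: m n; apply/(nonincreasing_seqP (fun n => u n + l n)).
have ub m n : u m <= u n + l n.
  have [mn|/ltnW nm] := leqP m n; first by rewrite (le_trans (u_nd _ _ mn))// lerDl.
  by rewrite (le_trans _ (ul_ni _ _ nm))// lerDl.
have hs : has_sup (range u).
  by split; [exists (u 0%N), 0%N | exists (u 0%N + l 0%N) => _ [m _ <-]].
exists (sup (range u)) => n; apply/andP; split.
  by apply: ub_le_sup; [case: hs | exists n].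
by apply: ge_sup; [case: hs | move=> _ [m _ <-]].
Qed.

Lemma expr2_ltn (x : R) : exists n, x < 2 ^+ n.
Proof.
exists (Num.truncn x).+1; apply: (@lt_le_trans _ _ (Num.truncn x).+1%:R).
  exact: truncnS_gt.
by rewrite -natrX ler_nat ltnW// ltn_expl.
Qed.

(** Some quarter of each rectangle carries at least a quarter of the integral. The nested rectangles
    shrink to a point, where differentiability makes the n-th integral O(e' 4^-n), which compensates
    the factor 4^n. *)
Lemma green_eq0 P Q a w c h : 0 <= w -> 0 <= h ->
  (forall x y, a <= x <= a + w -> c <= y <= c + h ->
    exists A B D, dif2 P A B x y /\ dif2 Q B D x y) ->
  green P Q a (a + w) c (c + h) = 0.
Proof.
move=> w0 h0 dPQ.
have cPQ x y : a <= x <= a + w -> c <= y <= c + h -> cont2 P x y /\ cont2 Q x y.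
  move=> xi yi; have [A [B [D [dP dQ]]]] := dPQ _ _ xi yi.
  by split; [exact: dif2_cont2 dP | exact: dif2_cont2 dQ].
pose w_ n := w / 2 ^+ n; pose h_ n := h / 2 ^+ n.
have w_0 n : 0 <= w_ n by rewrite divr_ge0.
have h_0 n : 0 <= h_ n by rewrite divr_ge0.
have w_S n : w_ n = w_ n.+1 + w_ n.+1 by rewrite /w_ exprS; field.
have h_S n : h_ n = h_ n.+1 + h_ n.+1 by rewrite /h_ exprS; field.
pose G n (s : R * R) := green P Q s.1 (s.1 + w_ n) s.2 (s.2 + h_ n).
pose q1 (n : nat) (s : R * R) := s.
pose q2 n (s : R * R) := (s.1 + w_ n.+1, s.2).
pose q3 n (s : R * R) := (s.1, s.2 + h_ n.+1).
pose q4 n (s : R * R) := (s.1 + w_ n.+1, s.2 + h_ n.+1).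
pose big n (s t : R * R) := `|G n s| <= 4 * `|G n.+1 t|.
(* The choice falls back on the fourth quarter; [step_big] shows by the triangle inequality that it
   then has the required property. *)
pose step n s := if big n s (q1 n s) then q1 n s else
  if big n s (q2 n s) then q2 n s else
  if big n s (q3 n s) then q3 n s else q4 n s.
pose inside n (s : R * R) := (a <= s.1 /\ s.1 + w_ n <= a + w) /\
  (c <= s.2 /\ s.2 + h_ n <= c + h).
have stepP n s : [\/ step n s = q1 n s, step n s = q2 n s, step n s = q3 n s |
    step n s = q4 n s].
  rewrite /step; case: ifP => _; first exact: Or41.
  case: ifP => _; first exact: Or42.
  by case: ifP => _; [exact: Or43|exact: Or44].
have step_in n s : inside n s -> inside n.+1 (step n s).
  rewrite /inside w_S h_S; move: (w_0 n.+1) (h_0 n.+1).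
  by case: (stepP n s) => ->; rewrite /q1 /q2 /q3 /q4/=; lra.
have quad n s : inside n s ->
    G n s = (G n.+1 (q1 n s) + G n.+1 (q3 n s)) + (G n.+1 (q2 n s) + G n.+1 (q4 n s)).
  rewrite /inside /G /q1 /q2 /q3 /q4/= w_S h_S; case: s => x y /=.
  move: (w_0 n.+1) (h_0 n.+1); move: (w_ n.+1) (h_ n.+1) => w' h' w'0 h'0 ins.
  clear -w'0 h'0 ins cPQ.
  rewrite (addrA x w') (addrA y h').
  have cP z t : x <= z <= x + w' + w' -> y <= t <= y + h' + h' ->
      cont2 P z t /\ cont2 Q z t by move=> zi ti; apply: cPQ; lra.
  have xi : x <= x <= x + w' + w' by lra.
  have xwi : x <= x + w' <= x + w' + w' by lra.
  have xwwi : x <= x + w' + w' <= x + w' + w' by lra.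
  have yi : y <= y <= y + h' + h' by lra.
  have yhi : y <= y + h' <= y + h' + h' by lra.
  have yhhi : y <= y + h' + h' <= y + h' + h' by lra.
  have zl z : x <= z <= x + w' -> x <= z <= x + w' + w' by lra.
  have zr z : x + w' <= z <= x + w' + w' -> x <= z <= x + w' + w' by lra.
  rewrite (green_splitx xwi); first last.
  - by move=> t ti; split; [have [] := cP _ _ xi ti|have [] := cP _ _ xwi ti|
      have [] := cP _ _ xwwi ti].
  - by move=> z zi; have [] := cP _ _ zi yhhi.
  - by move=> z zi; have [] := cP _ _ zi yi.
  congr (_ + _); rewrite (green_splity yhi)//.
  - by move=> t ti; have [] := cP _ _ xi ti.
  - by move=> t ti; have [] := cP _ _ xwi ti.
  - by move=> z /zl zi; split; [have [] := cP _ _ zi yi|have [] := cP _ _ zi yhi|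
      have [] := cP _ _ zi yhhi].
  - by move=> t ti; have [] := cP _ _ xwi ti.
  - by move=> t ti; have [] := cP _ _ xwwi ti.
  - by move=> z /zr zi; split; [have [] := cP _ _ zi yi|have [] := cP _ _ zi yhi|
      have [] := cP _ _ zi yhhi].
have step_big n s : inside n s -> `|G n s| <= 4 * `|G n.+1 (step n s)|.
  move=> ins; rewrite /step; case: ifP => [//|/negbT]; rewrite /big -ltNge => b1.
  case: ifP => [//|/negbT]; rewrite -ltNge => b2.
  case: ifP => [//|/negbT]; rewrite -ltNge => b3.
  have := ler_normD (G n.+1 (q1 n s) + G n.+1 (q3 n s)) (G n.+1 (q2 n s) + G n.+1 (q4 n s)).
  have := ler_normD (G n.+1 (q1 n s)) (G n.+1 (q3 n s)).
  have := ler_normD (G n.+1 (q2 n s)) (G n.+1 (q4 n s)).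
  by rewrite -(quad n s ins); clear -b1 b2 b3; lra.
pose fix pos n := if n is m.+1 then step m (pos m) else (a, c).
have pos_in n : inside n (pos n).
  elim: n => [|n ih]; last exact: step_in.
  by rewrite /inside /w_ /h_ expr0 !divr1/=.
have pos_big n : `|G 0%N (a, c)| <= 4 ^+ n * `|G n (pos n)|.
  elim: n => [|n ih]; first by rewrite expr0 mul1r.
  apply: le_trans ih _; rewrite exprSr -mulrA ler_wpM2l ?exprn_ge0//.
  exact: step_big.
have [x0 x0P] : exists x, forall n, (pos n).1 <= x <= (pos n).1 + w_ n.
  apply: nested_segments => // n; rewrite /= ?[w_ n]w_S; have := w_0 n.+1;
  by case: (stepP n (pos n)) => ->; rewrite /q1 /q2 /q3 /q4/=; lra.
have [y0 y0P] : exists y, forall n, (pos n).2 <= y <= (pos n).2 + h_ n.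
  apply: nested_segments => // n; rewrite /= ?[h_ n]h_S; have := h_0 n.+1;
  by case: (stepP n (pos n)) => ->; rewrite /q1 /q2 /q3 /q4/=; lra.
have x0i : a <= x0 <= a + w by have := x0P 0%N; rewrite /w_ expr0 divr1.
have y0i : c <= y0 <= c + h by have := y0P 0%N; rewrite /h_ expr0 divr1.
have [A [B [D [dP dQ]]]] := dPQ _ _ x0i y0i.
have GE : green P Q a (a + w) c (c + h) = G 0%N (a, c).
  by rewrite /G /w_ /h_ expr0 !divr1.
apply/eqP; rewrite -normr_le0; apply/ler_addgt0Pl => e e0; rewrite addr0 GE.
(* The summand 1 keeps the denominator positive for a rectangle reduced to a point. *)
pose e' := e / (2 * (w + h) ^+ 2 + 1).
have den : 0 < 2 * (w + h) ^+ 2 + 1 by rewrite ltr_wpDl// mulr_ge0// sqr_ge0.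
have e'0 : 0 < e' by rewrite divr_gt0.
have [rP rP0 HP] := dP _ e'0; have [rQ rQ0 HQ] := dQ _ e'0.
pose r := Num.min rP rQ; have r0 : 0 < r by rewrite lt_min rP0.
have [n nP] := expr2_ltn ((w + h) / r).
have n2 : 0 < 2 ^+ n :> R by rewrite exprn_gt0.
have small z : 0 <= z -> z <= w + h -> z / 2 ^+ n < r.
  move=> z0 zwh; rewrite ltr_pdivrMr// mulrC -ltr_pdivrMr//.
  by apply: le_lt_trans nP; rewrite ler_wpM2r// invr_ge0 ltW.
have [[i1 i2] [i3 i4]] := pos_in n.
have loc : `|G n (pos n)| <= 2 * e' * (w_ n + h_ n) ^+ 2.
  apply: (green_local (r := r) e'0 (w_0 n) (h_0 n) _ _ _ _ (x0P n) (y0P n)).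
  - by move=> x y; rewrite !lt_min => /andP[xP _] /andP[yP _]; exact: HP.
  - by move=> x y; rewrite !lt_min => /andP[_ xP] /andP[_ yP]; exact: HQ.
  - by apply: small => //; clear -w0 h0; lra.
  - by apply: small => //; clear -w0 h0; lra.
  - by move=> x y xi yi; apply: cPQ; clear -xi yi i1 i2 i3 i4; lra.
apply: le_trans (pos_big n) _.
apply: (@le_trans _ _ (4 ^+ n * (2 * e' * (w_ n + h_ n) ^+ 2))).
  by rewrite ler_wpM2l// exprn_ge0.
have -> : 4 ^+ n * (2 * e' * (w_ n + h_ n) ^+ 2) = e' * (2 * (w + h) ^+ 2).
  have -> : (4 : R) ^+ n = 2 ^+ n * 2 ^+ n by rewrite -exprMn; congr (_ ^+ _); ring.
  by rewrite /w_ /h_; field; rewrite gt_eqF.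
by rewrite /e' mulrAC ler_pdivrMr// ler_wpM2l ?lerDl// ltW.
Qed.

End goursat.

Local Open Scope complex_scope.

(** * Bounded isolated singularities *)

Section punctured.
Context {R : realType}.
Implicit Types (a b c d x y e w h r s M : R) (P Q : R -> R -> R).

Lemma exists_small (l : seq R) : all (> 0) l ->
  exists2 s, 0 < s & all (> s) l.
Proof.
elim: l => [_|x l ih /= /andP[x0 /ih[s s0 sl]]]; first by exists 1.
exists (Num.min x s / 2); first by rewrite divr_gt0// lt_min x0.
have lem : Num.min x s / 2 < Num.min x s.
  by rewrite ltr_pdivrMr// mulr_natr mulr2n ltrDl lt_min x0.
rewrite (lt_le_trans lem) ?ge_min ?lexx//=; apply/allP => y /(allP sl)/=.
by apply: lt_trans; rewrite (lt_le_trans lem)// ge_min lexx orbT.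
Qed.

Lemma green_eq0_seg P Q a b c d : a <= b -> c <= d ->
  (forall x y, a <= x <= b -> c <= y <= d ->
    exists A B D, dif2 P A B x y /\ dif2 Q B D x y) ->
  green P Q a b c d = 0.
Proof.
move=> ab cd; rewrite -{1 2}(subrKC a b) -{1 2}(subrKC c d) => H.
by apply: green_eq0 => //; rewrite subr_ge0.
Qed.

Lemma green_punctured P Q a b c d px py r M : a < px < b -> c < py < d ->
  (forall x y, a <= x <= b -> c <= y <= d -> (x != px) || (y != py) ->
    exists A B D, dif2 P A B x y /\ dif2 Q B D x y) ->
  0 < r -> (forall x y, `|x - px| < r -> `|y - py| < r ->
    `|P x y| <= M /\ `|Q x y| <= M) ->
  green P Q a b c d = 0.
Proof.
move=> /andP[apx pxb] /andP[cpy pyd] dPQ r0 HM.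
have cPQ x y : a <= x <= b -> c <= y <= d -> (x != px) || (y != py) ->
    cont2 P x y /\ cont2 Q x y.
  move=> xi yi xy; have [A [B [D [dP dQ]]]] := dPQ _ _ xi yi xy.
  by split; [exact: dif2_cont2 dP | exact: dif2_cont2 dQ].
have M0 : 0 <= M.
  have [] := HM px py; rewrite ?subrr ?normr0//.
  by move=> + _; exact: le_trans.
apply/eqP; rewrite -normr_le0; apply/ler_addgt0Pl => e e0; rewrite addr0.
have den : 0 < 8 * M + 1 by rewrite ltr_wpDl// mulr_ge0.
have [|s s0 /= /and5P[sx1 sx2 sy1 sy2 /and3P[sr se' _]]] := exists_small
    (l := [:: px - a; b - px; py - c; d - py; r; e / (8 * M + 1)]).
  by rewrite /= !subr_gt0 apx pxb cpy pyd r0 divr_gt0.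
have se : s * (8 * M + 1) <= e by rewrite -ler_pdivlMr// ltW.
have nx1 x : x = px - s -> x != px by move=> ->; rewrite lt_eqF// ltrBlDr ltrDl.
have nx2 x : x = px + s -> x != px by move=> ->; rewrite gt_eqF// ltrDl.
have ny1 x : x = py - s -> x != py by move=> ->; rewrite lt_eqF// ltrBlDr ltrDl.
have ny2 x : x = py + s -> x != py by move=> ->; rewrite gt_eqF// ltrDl.
have ca y : y = c -> y != py by move=> ->; rewrite lt_eqF.
have da y : y = d -> y != py by move=> ->; rewrite gt_eqF.
have aa x : x = a -> x != px by move=> ->; rewrite lt_eqF.
have ba x : x = b -> x != px by move=> ->; rewrite gt_eqF.
have ci : c <= c <= d by clear -cpy pyd; lra.
have di : c <= d <= d by clear -cpy pyd; lra.
have ai : a <= a <= b by clear -apx pxb; lra.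
have bi : a <= b <= b by clear -apx pxb; lra.
have xmi : a <= px - s <= b by clear -apx pxb s0 sx1; lra.
have xpi : a <= px + s <= b by clear -apx pxb s0 sx2; lra.
have ymi : c <= py - s <= d by clear -cpy pyd s0 sy1; lra.
have ypi : c <= py + s <= d by clear -cpy pyd s0 sy2; lra.
have xsub x : px - s <= x <= b -> a <= x <= b by clear -xmi; lra.
have xsub2 x : px - s <= x <= px + s -> a <= x <= b by clear -xmi xpi; lra.
have ysub y : py - s <= y <= d -> c <= y <= d by clear -ymi; lra.
have -> : green P Q a b c d = green P Q (px - s) b c d.
  rewrite (@green_splitx _ _ _ _ (px - s))//.
  - rewrite (_ : green P Q a (px - s) c d = 0) ?add0r//.
    clear -apx pxb cpy pyd s0 xmi dPQ.
    apply: green_eq0_seg; [lra|lra|] => x y xi yi; apply: dPQ => //.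
      by clear -xi xmi; lra.
    by clear -xi s0; rewrite lt_eqF//; lra.
  - by move=> x xi; have [] := cPQ x c xi ci _; rewrite ?ca ?orbT.
  - by move=> x xi; have [] := cPQ x d xi di _; rewrite ?da ?orbT.
  - move=> y yi; split.
    + by have [] := cPQ a y ai yi _; rewrite ?aa.
    + by have [] := cPQ (px - s) y xmi yi _; rewrite ?nx1.
    + by have [] := cPQ b y bi yi _; rewrite ?ba.
have -> : green P Q (px - s) b c d = green P Q (px - s) (px + s) c d.
  rewrite (@green_splitx _ _ _ _ (px + s)).
  - rewrite (_ : green P Q (px + s) b c d = 0) ?addr0//.
    clear -apx pxb cpy pyd s0 xpi dPQ.
    apply: green_eq0_seg; [lra|lra|] => x y xi yi; apply: dPQ => //.
      by clear -xi xpi apx s0; lra.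
    by clear -xi s0; rewrite gt_eqF//; lra.
  - by clear -s0 xpi; lra.
  - by move=> x /xsub xi; have [] := cPQ x c xi ci _; rewrite ?ca ?orbT.
  - by move=> x /xsub xi; have [] := cPQ x d xi di _; rewrite ?da ?orbT.
  - move=> y yi; split.
    + by have [] := cPQ (px - s) y xmi yi _; rewrite ?nx1.
    + by have [] := cPQ (px + s) y xpi yi _; rewrite ?nx2.
    + by have [] := cPQ b y bi yi _; rewrite ?ba.
have -> : green P Q (px - s) (px + s) c d = green P Q (px - s) (px + s) (py - s) d.
  rewrite (@green_splity _ _ _ _ _ _ (py - s))//.
  - rewrite (_ : green P Q (px - s) (px + s) c (py - s) = 0) ?add0r//.
    clear -s0 ymi cpy pyd dPQ xsub2.
    apply: green_eq0_seg; [lra|lra|] => x y /xsub2 xi yi; apply: dPQ => //.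
      by clear -yi ymi; lra.
    by clear -yi s0; rewrite orbC lt_eqF//; lra.
  - by move=> y yi; have [] := cPQ (px - s) y xmi yi _; rewrite ?nx1.
  - by move=> y yi; have [] := cPQ (px + s) y xpi yi _; rewrite ?nx2.
  - move=> x /xsub2 xi; split.
    + by have [] := cPQ x c xi ci _; rewrite ?ca ?orbT.
    + by have [] := cPQ x (py - s) xi ymi _; rewrite ?ny1 ?orbT.
    + by have [] := cPQ x d xi di _; rewrite ?da ?orbT.
have -> : green P Q (px - s) (px + s) (py - s) d =
    green P Q (px - s) (px + s) (py - s) (py + s).
  rewrite (@green_splity _ _ _ _ _ _ (py + s)).
  - rewrite (_ : green P Q (px - s) (px + s) (py + s) d = 0) ?addr0//.
    clear -s0 ypi cpy pyd dPQ xsub2.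
    apply: green_eq0_seg; [lra|lra|] => x y /xsub2 xi yi; apply: dPQ => //.
      by clear -yi ypi cpy s0; lra.
    by clear -yi s0; rewrite orbC gt_eqF//; lra.
  - by clear -s0 ypi; lra.
  - by move=> y /ysub yi; have [] := cPQ (px - s) y xmi yi _; rewrite ?nx1.
  - by move=> y /ysub yi; have [] := cPQ (px + s) y xpi yi _; rewrite ?nx2.
  - move=> x /xsub2 xi; split.
    + by have [] := cPQ x (py - s) xi ymi _; rewrite ?ny1 ?orbT.
    + by have [] := cPQ x (py + s) xi ypi _; rewrite ?ny2 ?orbT.
    + by have [] := cPQ x d xi di _; rewrite ?da ?orbT.
have itgP y : (c <= y <= d) -> y != py -> sitg (px - s) (px + s) (P^~ y).
  move=> yi ypy; apply: sitg_continuous => x /xsub2 xi; apply: cont2_slice1.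
  by have [] := cPQ x y xi yi _; rewrite ?ypy ?orbT.
have itgQ x : (a <= x <= b) -> x != px -> sitg (py - s) (py + s) (Q x).
  move=> xi xpx; apply: sitg_continuous => y yi; apply: cont2_slice2.
  by have [] := cPQ x y xi _ _; rewrite ?xpx//; clear -yi ymi ypi; lra.
apply: le_trans (ler_normD _ _) _.
apply: (@le_trans _ _ ((M + M) * (px + s - (px - s)) + (M + M) * (py + s - (py - s)))).
  clear -s0 sr HM itgP itgQ ny1 ny2 nx1 nx2 xmi xpi ymi ypi.
  apply: lerD; apply: sint_bound; [lra| | |lra| |].
  - by apply: sitgB; apply: itgP => //; [exact: ny1|exact: ny2].
  - move=> x xi; apply: le_trans (ler_normB _ _) _.
    have xr : `|x - px| < r by clear -xi sr s0; rewrite ltr_norml; lra.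
    apply: lerD.
      by have [] := HM x (py - s) xr _; rewrite // ltr_norml; clear -s0 sr; lra.
    by have [] := HM x (py + s) xr _; rewrite // ltr_norml; clear -s0 sr; lra.
  - by apply: sitgB; apply: itgQ => //; [exact: nx2|exact: nx1].
  - move=> y yi; apply: le_trans (ler_normB _ _) _.
    have yr : `|y - py| < r by clear -yi sr s0; rewrite ltr_norml; lra.
    apply: lerD.
      by have [] := HM (px + s) y _ yr; rewrite // ltr_norml; clear -s0 sr; lra.
    by have [] := HM (px - s) y _ yr; rewrite // ltr_norml; clear -s0 sr; lra.
by apply: le_trans se; clear -M0 s0; lra.
Qed.

End punctured.

(** * Complex derivatives and the Cauchy-Riemann equations *)

Section complex_derivative.
Context {R : realType}.
Local Notation C := R[i].
Local Notation normc := (@Normc.normc R).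
Local Notation Re := (@complex.Re R).
Local Notation Im := (@complex.Im R).
Implicit Types (z w l m : C) (F G : C -> C) (x y e r : R).

Lemma normc_ge0 z : 0 <= normc z.
Proof. by case: z => x y; rewrite sqrtr_ge0. Qed.

Lemma ler_normcD z w : normc (z + w) <= normc z + normc w.
Proof. exact: (@le_normcD R z w). Qed.

Lemma normcCN z : normc (- z) = normc z.
Proof. exact: (@normcN R z). Qed.

Lemma ler_normcB z w : normc (z - w) <= normc z + normc w.
Proof. by rewrite -[normc w]normcCN ler_normcD. Qed.

Lemma normcB z w : normc (z - w) = normc (w - z).
Proof. by rewrite -normcCN opprB. Qed.

Lemma Re_cB z w : Re (z - w) = Re z - Re w. Proof. by case: z w => ? ? [? ?]. Qed.
Lemma Im_cB z w : Im (z - w) = Im z - Im w. Proof. by case: z w => ? ? [? ?]. Qed.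
Lemma Re_cM z w : Re (z * w) = Re z * Re w - Im z * Im w.
Proof. by case: z w => ? ? [? ?]. Qed.
Lemma Im_cM z w : Im (z * w) = Re z * Im w + Im z * Re w.
Proof. by case: z w => ? ? [? ?]. Qed.

Lemma normc_ge_absRe z : `|Re z| <= normc z.
Proof.
case: z => x y /=; rewrite -sqrtr_sqr ler_sqrt ?addr_ge0 ?sqr_ge0//.
by rewrite lerDl sqr_ge0.
Qed.

Lemma normc_ge_absIm z : `|Im z| <= normc z.
Proof.
case: z => x y /=; rewrite -sqrtr_sqr ler_sqrt ?addr_ge0 ?sqr_ge0//.
by rewrite lerDr sqr_ge0.
Qed.

Lemma normc_real x : normc x%:C = `|x|.
Proof. by rewrite /= expr0n/= addr0 sqrtr_sqr. Qed.

Lemma normc_imag y : normc (0 +i* y) = `|y|.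
Proof. by rewrite /= expr0n/= add0r sqrtr_sqr. Qed.

Lemma normc_le_add z : normc z <= `|Re z| + `|Im z|.
Proof.
case: z => x y; have -> : x +i* y = x%:C + (0 +i* y).
  by apply/eqP; rewrite eq_complex/= addr0 add0r !eqxx.
by apply: le_trans (ler_normcD _ _) _; rewrite normc_real normc_imag/= addr0 add0r.
Qed.

Lemma normc_sqr z : normc z ^+ 2 = Re z ^+ 2 + Im z ^+ 2.
Proof. by case: z => x y; rewrite /= sqr_sqrtr// addr_ge0 ?sqr_ge0. Qed.

Lemma normc_eq0 z : (normc z == 0) = (z == 0).
Proof. by apply/eqP/eqP => [/Normc.eq0_normc//|->]; rewrite Normc.normc0. Qed.

Definition cdif F z l := forall e, 0 < e -> exists2 r, 0 < r &
  forall w, normc (w - z) < r ->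
    normc (F w - F z - l * (w - z)) <= e * normc (w - z).

(** The Cauchy-Riemann equations: the y-derivative of Im F and the x-derivative of Re F are both Re
    l, which is the symmetry that [green_eq0] requires. *)
Lemma cdif_dif2 F x0 y0 l : cdif F (x0 +i* y0) l ->
  dif2 (fun x y => Im (F (x +i* y))) (Im l) (Re l) x0 y0 /\
  dif2 (fun x y => Re (F (x +i* y))) (Re l) (- Im l) x0 y0.
Proof.
move=> dF; split=> e e0; have [r r0 H] := dF e e0; (exists (r / 2);
  first by rewrite divr_gt0) => x y xr yr;
  have nle : normc ((x +i* y) - (x0 +i* y0)) <= `|x - x0| + `|y - y0|
    by exact: normc_le_add.
- have {}H : normc (F (x +i* y) - F (x0 +i* y0) - l * ((x +i* y) - (x0 +i* y0))) <=
    e * normc ((x +i* y) - (x0 +i* y0)) by apply: H; apply: le_lt_trans nle _; lra.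
  have -> : Im (F (x +i* y)) - Im (F (x0 +i* y0)) - Im l * (x - x0) - Re l * (y - y0) =
      Im (F (x +i* y) - F (x0 +i* y0) - l * ((x +i* y) - (x0 +i* y0))).
    by rewrite !Im_cB Im_cM/=; ring.
  apply: le_trans (normc_ge_absIm _) _; apply: le_trans H _.
  by rewrite ler_wpM2l// ltW.
- have {}H : normc (F (x +i* y) - F (x0 +i* y0) - l * ((x +i* y) - (x0 +i* y0))) <=
    e * normc ((x +i* y) - (x0 +i* y0)) by apply: H; apply: le_lt_trans nle _; lra.
  have -> : Re (F (x +i* y)) - Re (F (x0 +i* y0)) - Re l * (x - x0) - - Im l * (y - y0) =
      Re (F (x +i* y) - F (x0 +i* y0) - l * ((x +i* y) - (x0 +i* y0))).
    by rewrite !Re_cB Re_cM/=; ring.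
  apply: le_trans (normc_ge_absRe _) _; apply: le_trans H _.
  by rewrite ler_wpM2l// ltW.
Qed.

Lemma cdif_lipschitz F z l : cdif F z l -> exists2 r, 0 < r &
  forall w, normc (w - z) < r -> normc (F w - F z) <= (normc l + 1) * normc (w - z).
Proof.
move=> dF; have [r r0 H] := dF 1 ltr01; exists r => // w wr.
rewrite -(subrK (l * (w - z)) (F w - F z)).
apply: le_trans (ler_normcD _ _) _; rewrite Normc.normcM addrC mulrDl.
by rewrite lerD2l; exact: H.
Qed.

Lemma cdifM F G z l m : cdif F z l -> cdif G z m ->
  cdif (fun w => F w * G w) z (l * G z + F z * m).
Proof.
move=> dF dG e e0.
have [r1 r10 LF] := cdif_lipschitz dF; have [r2 r20 LG] := cdif_lipschitz dG.
pose N := normc (F z) + normc (G z) + (normc l + 1) * (normc m + 1) + 1.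
have N1 : 1 <= N.
  by rewrite lerDr !addr_ge0 ?mulr_ge0 ?addr_ge0 ?normc_ge0.
have N0 : 0 < N by exact: lt_le_trans N1.
have eN : 0 < e / N by rewrite divr_gt0.
have [r3 r30 HF] := dF _ eN; have [r4 r40 HG] := dG _ eN.
have [|r r0 /= /and5P[rr1 rr2 rr3 rr4 /andP[re _]]] := exists_small
    (l := [:: r1; r2; r3; r4; e / N]).
  by rewrite /= r10 r20 r30 r40 eN.
exists r => // w wr; set D := w - z in wr *.
have -> : F w * G w - F z * G z - (l * G z + F z * m) * D =
  (F w - F z - l * D) * G z + F z * (G w - G z - m * D) + (F w - F z) * (G w - G z).
  by ring.
have D0 := normc_ge0 D.
apply: le_trans (ler_normcD _ _) _.
apply: (@le_trans _ _ (e / N * normc D * normc (G z) + normc (F z) * (e / N * normc D)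
  + ((normc l + 1) * normc D) * ((normc m + 1) * normc D))).
  apply: lerD.
    apply: le_trans (ler_normcD _ _) _; rewrite !Normc.normcM.
    apply: lerD; [apply: ler_wpM2r|apply: ler_wpM2l]; rewrite ?normc_ge0//.
      by apply: HF; exact: lt_trans rr3.
    by apply: HG; exact: lt_trans rr4.
  rewrite Normc.normcM; apply: ler_pM; rewrite ?normc_ge0//.
    by apply: LF; exact: lt_trans rr1.
  by apply: LG; exact: lt_trans rr2.
have nD : normc D <= e / N by rewrite ltW// (lt_trans wr).
have -> : e * normc D = e / N * normc D * N by rewrite mulrAC divfK ?gt_eqF.
have k0 : 0 <= (normc l + 1) * (normc m + 1) * normc D.
  by rewrite !mulr_ge0 ?addr_ge0 ?normc_ge0.
have := ler_wpM2l k0 nD.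
have : 0 <= e / N * normc D by rewrite mulr_ge0// ltW.
move: (e / N) => a; rewrite /N.
move: (normc D) (normc l) (normc m) (normc (F z)) (normc (G z)) => b c d f g.
lra.
Qed.

Lemma cdif_inv_sub z0 z : z != z0 ->
  cdif (fun w => (w - z0)^-1) z (- (z - z0)^-1 ^+ 2).
Proof.
move=> zz0 e e0; set p := normc (z - z0).
have p0 : 0 < p by rewrite lt_neqAle eq_sym normc_eq0 subr_eq0 zz0 normc_ge0.
(* The remainder is D^2 / ((w - z0) (z - z0)^2). For |D| < p/2 it is at most 2 |D|^2 / p^3, whence
   the two bounds on the radius. *)
have [|r r0 /= /and3P[rp re _]] := exists_small (l := [:: p / 2; e * (p ^+ 3 / 2)]).
  by rewrite /= !(divr_gt0, mulr_gt0, exprn_gt0).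
exists r => // w wr; set D := w - z in wr *.
have wE : w - z0 = (z - z0) + D by rewrite /D; ring.
have wp : p / 2 <= normc (w - z0).
  have : p <= normc (w - z0) + normc D.
    rewrite /p (_ : z - z0 = (w - z0) - D); last by rewrite /D; ring.
    exact: ler_normcB.
  lra.
have w0 : w - z0 != 0 by rewrite -normc_eq0 gt_eqF//; lra.
have z0' : z - z0 != 0 by rewrite subr_eq0.
have -> : (w - z0)^-1 - (z - z0)^-1 - - (z - z0)^-1 ^+ 2 * D =
   D * D * ((w - z0)^-1 * (z - z0)^-1 ^+ 2).
  move: w0 z0'; rewrite wE; move: (z - z0) => u w0 u0; field.
  by rewrite w0 u0.
rewrite expr2 !Normc.normcM !Normc.normcV -/p -[leLHS]mulrA [leRHS]mulrC.
apply: ler_wpM2l; first exact: normc_ge0.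
rewrite [leLHS]mulrC.
have nw0 : 0 < normc (w - z0) by lra.
apply: (@le_trans _ _ ((p / 2)^-1 * (p^-1 * p^-1) * (e * (p ^+ 3 / 2)))).
  apply: ler_pM; [|exact: normc_ge0| |].
  - by rewrite !mulr_ge0// invr_ge0 ltW.
  - apply: ler_wpM2r; first by rewrite mulr_ge0// invr_ge0 ltW.
    by rewrite lef_pV2// posrE ?divr_gt0//; lra.
  - by rewrite ltW// (lt_trans wr).
by rewrite le_eqVlt; apply/orP; left; apply/eqP; field; rewrite gt_eqF.
Qed.

Lemma cdifZ F z l k : cdif F z l -> cdif (fun w => k * F w) z (k * l).
Proof.
move=> dF.
have cst0 : cdif (fun=> k) z 0.
  move=> e e0; exists 1 => // w _.
  by rewrite mul0r subr0 subrr Normc.normc0 mulr_ge0 ?normc_ge0// ltW.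
by have := cdifM cst0 dF; rewrite mul0r add0r.
Qed.

End complex_derivative.

Section cauchy_estimate.
Context {R : realType}.
Local Notation C := R[i].
Local Notation normc := (@Normc.normc R).
Local Notation Re := (@complex.Re R).
Local Notation Im := (@complex.Im R).
Implicit Types (z w l m : C) (F G : C -> C) (x y e r : R).

(* The imaginary part of the contour integral of [F]. *)
Definition cgreen F (a b c d : R) : R :=
  green (fun x y => Im (F (x +i* y))) (fun x y => Re (F (x +i* y))) a b c d.

Lemma cgreen_punctured F a b c d z0 r M :
  a < Re z0 < b -> c < Im z0 < d ->
  (forall z, a <= Re z <= b -> c <= Im z <= d -> z != z0 -> exists l, cdif F z l) ->
  0 < r -> (forall z, normc (z - z0) < r -> normc (F z) <= M) ->
  cgreen F a b c d = 0.
Proof.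
case: z0 => px py /= xi yi dF r0 FM.
apply: (@green_punctured _ _ _ a b c d px py (r / 2) M) => //.
- move=> x y xi' yi' xy; have [|l dl] := dF (x +i* y) xi' yi'.
    by rewrite eq_complex/= negb_and.
  have [dP dQ] := cdif_dif2 dl.
  by exists (Im l), (Re l), (- Im l).
- by rewrite divr_gt0.
- move=> x y xr yr.
  have /FM H : normc ((x +i* y) - (px +i* py)) < r.
    by apply: (le_lt_trans (normc_le_add _)) => /=; lra.
  split; first exact: le_trans (normc_ge_absIm _) H.
  exact: le_trans (normc_ge_absRe _) H.
Qed.

Lemma cdif_sitgP F a b y : (forall x, a <= x <= b -> exists l, cdif F (x +i* y) l) ->
  sitg a b (fun x => Im (F (x +i* y))).
Proof.
move=> dF; apply: sitg_continuous => x /dF[l /cdif_dif2[/dif2_cont2 + _]].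
exact: (@cont2_slice1 _ (fun x y => Im (F (x +i* y)))).
Qed.

Lemma cdif_sitgQ F c d x : (forall y, c <= y <= d -> exists l, cdif F (x +i* y) l) ->
  sitg c d (fun y => Re (F (x +i* y))).
Proof.
move=> dF; apply: sitg_continuous => y /dF[l /cdif_dif2[_ /dif2_cont2]].
exact: (@cont2_slice2 _ (fun x y => Re (F (x +i* y)))).
Qed.

Lemma sint_inv1Dsqr_le (Y : R) : 0 < Y ->
  sitg (- Y) Y (fun y => (1 + y ^+ 2)^-1) /\
  sint (- Y) Y (fun y => (1 + y ^+ 2)^-1) <= pi.
Proof.
move=> Y0.
have cf x : {for x, continuous (fun y : R => (1 + y ^+ 2)^-1)}.
  apply: cvgV; first by rewrite gt_eqF// ltr_wpDr// sqr_ge0.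
  by apply: cvgD; [exact: cvg_cst|exact: exprn_continuous].
split; first by apply: sitg_continuous => x _; exact: cf.
rewrite /sint /Rintegral (@continuous_FTC2 _ _ (@atan R)).
- rewrite -EFinB/= atanN opprK; have := atan_ltpi2 Y; lra.
- by rewrite gtrN.
- by apply: continuous_subspaceT => x; exact: cf.
- split.
  + by move=> x _; exact: derivable_atan.
  + by apply: cvg_at_right_filter; exact: continuous_atan.
  + by apply: cvg_at_left_filter; exact: continuous_atan.
- by move=> x _; rewrite derive1_atan.
Qed.

(* The integral of [Im (dz / (z - x0))] over each side of a rectangle around [x0] is
   nonnegative; the right-hand side alone already contributes a fixed amount. *)
Lemma cgreen_inv_ge (a b x0 Y : R) : a < x0 < b -> b - x0 <= 1 -> 1 <= Y ->
  b - x0 <= cgreen (fun z => (z - x0%:C)^-1) a b (- Y) Y.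
Proof.
move=> /andP[ax xb] bx1 Y1.
have ReE x y : Re ((x +i* y - x0%:C)^-1) = (x - x0) / ((x - x0) ^+ 2 + y ^+ 2).
  by rewrite /= subr0.
have ImE x y : Im ((x +i* y - x0%:C)^-1) = - y / ((x - x0) ^+ 2 + y ^+ 2).
  by rewrite /= subr0 mulNr.
have itgP y : y != 0 -> sitg a b (fun x => Im ((x +i* y - x0%:C)^-1)).
  move=> y0; apply: (@cdif_sitgP (fun z => (z - x0%:C)^-1)) => x _; eexists.
  by apply: cdif_inv_sub; rewrite eq_complex/= (negbTE y0) andbF.
have itgQ x (c d : R) : x != x0 -> sitg c d (fun y => Re ((x +i* y - x0%:C)^-1)).
  move=> y0; apply: (@cdif_sitgQ (fun z => (z - x0%:C)^-1)) => y _; eexists.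
  by apply: cdif_inv_sub; rewrite eq_complex/= (negbTE y0).
have Y0 : 0 < Y by lra.
have bx0 : b != x0 by rewrite gt_eqF.
have ax0 : a != x0 by rewrite lt_eqF.
rewrite /cgreen /green -[leLHS]add0r; apply: lerD.
  have ab : a <= b by lra.
  rewrite -(mul0r (b - a)) -sint_cst//.
  apply: le_sint; first exact: sitg_cst.
    by apply: sitgB; apply: itgP; rewrite ?oppr_eq0 gt_eqF.
  move=> x _; rewrite !ImE opprK sqrrN mulNr opprK.
  by rewrite addr_ge0// divr_ge0 ?(ltW Y0)// addr_ge0 ?sqr_ge0.
have itgQQ c d : sitg c d (fun y => Re ((b +i* y - x0%:C)^-1) - Re ((a +i* y - x0%:C)^-1)).
  by apply: sitgB; exact: itgQ.
have pos y : 0 <= Re ((b +i* y - x0%:C)^-1) - Re ((a +i* y - x0%:C)^-1).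
  rewrite !ReE subr_ge0; apply: (@le_trans _ _ 0).
    rewrite -oppr_ge0 -mulNr divr_ge0 ?opprB ?subr_ge0 ?(ltW ax)//.
    by rewrite addr_ge0 ?sqr_ge0.
  by rewrite divr_ge0 ?subr_ge0 ?(ltW xb)// addr_ge0 ?sqr_ge0.
have sint_pos c d : c <= d ->
    0 <= sint c d (fun y => Re ((b +i* y - x0%:C)^-1) - Re ((a +i* y - x0%:C)^-1)).
  move=> cd; rewrite -(mul0r (d - c)) -sint_cst//; apply: le_sint => //.
  exact: sitg_cst.
rewrite (@sint_split _ _ (-1))//; last by lra.
rewrite (@sint_split _ (-1) 1)//; last by lra.
have h1 : 0 <= sint (- Y) (-1) (fun y => Re ((b +i* y - x0%:C)^-1) - Re ((a +i* y - x0%:C)^-1)).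
  by apply: sint_pos; lra.
have h2 : 0 <= sint 1 Y (fun y => Re ((b +i* y - x0%:C)^-1) - Re ((a +i* y - x0%:C)^-1)).
  by apply: sint_pos; lra.
(* On [-1, 1] the integrand is at least (b - x0)/2, because (b - x0)^2 + y^2 <= 2. *)
suff : b - x0 <= sint (-1) 1 (fun y => Re ((b +i* y - x0%:C)^-1) - Re ((a +i* y - x0%:C)^-1)).
  by lra.
have -> : b - x0 = (b - x0) / 2 * (1 - -1) by field.
rewrite -sint_cst; last by lra.
apply: le_sint => //; first exact: sitg_cst.
move=> y yi; rewrite !ReE.
have : (a - x0) / ((a - x0) ^+ 2 + y ^+ 2) <= 0.
  rewrite -oppr_ge0 -mulNr divr_ge0 ?opprB ?subr_ge0 ?(ltW ax)//.
  by rewrite addr_ge0 ?sqr_ge0.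
have : (b - x0) / 2 <= (b - x0) / ((b - x0) ^+ 2 + y ^+ 2).
  have bx2 : (b - x0) ^+ 2 <= 1 by rewrite expr_le1// ?subr_ge0 ltW.
  have bxp : 0 < (b - x0) ^+ 2 by rewrite exprn_gt0// subr_gt0.
  have y2 : y ^+ 2 <= 1 by move: yi; nra.
  have y20 := sqr_ge0 y.
  apply: ler_wpM2l; first by rewrite subr_ge0 ltW.
  by rewrite lef_pV2 ?posrE//; lra.
lra.
Qed.

Lemma cgreenB F G a b c d : a <= b -> c <= d ->
  (forall z, a <= Re z <= b -> c <= Im z <= d ->
    (Re z == a) || (Re z == b) || (Im z == c) || (Im z == d) ->
    (exists l, cdif F z l) /\ (exists l, cdif G z l)) ->
  cgreen (fun z => F z - G z) a b c d = cgreen F a b c d - cgreen G a b c d.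
Proof.
move=> ab cd dFG.
have ci : c <= c <= d by rewrite lexx.
have di : c <= d <= d by rewrite lexx andbT.
have ai : a <= a <= b by rewrite lexx.
have bi : a <= b <= b by rewrite lexx andbT.
have itgP H y : (forall x, a <= x <= b -> exists l, cdif H (x +i* y) l) ->
  sitg a b (fun x => Im (H (x +i* y))) by exact: cdif_sitgP.
have itgQ H x : (forall y, c <= y <= d -> exists l, cdif H (x +i* y) l) ->
  sitg c d (fun y => Re (H (x +i* y))) by exact: cdif_sitgQ.
have Fc : sitg a b (fun x => Im (F (x +i* c))).
  by apply: itgP => x xi; have [] := dFG (x +i* c) xi ci _; rewrite //= eqxx !orbT.
have Fd : sitg a b (fun x => Im (F (x +i* d))).
  by apply: itgP => x xi; have [] := dFG (x +i* d) xi di _; rewrite //= eqxx !orbT.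
have Gc : sitg a b (fun x => Im (G (x +i* c))).
  by apply: itgP => x xi; have [] := dFG (x +i* c) xi ci _; rewrite //= eqxx !orbT.
have Gd : sitg a b (fun x => Im (G (x +i* d))).
  by apply: itgP => x xi; have [] := dFG (x +i* d) xi di _; rewrite //= eqxx !orbT.
have Fa : sitg c d (fun y => Re (F (a +i* y))).
  by apply: itgQ => y yi; have [] := dFG (a +i* y) ai yi _; rewrite //= eqxx.
have Fb : sitg c d (fun y => Re (F (b +i* y))).
  by apply: itgQ => y yi; have [] := dFG (b +i* y) bi yi _; rewrite //= eqxx !orbT.
have Ga : sitg c d (fun y => Re (G (a +i* y))).
  by apply: itgQ => y yi; have [] := dFG (a +i* y) ai yi _; rewrite //= eqxx.
have Gb : sitg c d (fun y => Re (G (b +i* y))).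
  by apply: itgQ => y yi; have [] := dFG (b +i* y) bi yi _; rewrite //= eqxx !orbT.
rewrite /cgreen /green.
have -> : (fun x => Im (F (x +i* c) - G (x +i* c)) - Im (F (x +i* d) - G (x +i* d))) =
    (fun x => (Im (F (x +i* c)) - Im (F (x +i* d))) - (Im (G (x +i* c)) - Im (G (x +i* d)))).
  by apply/funext => x; rewrite !Im_cB; ring.
have -> : (fun y => Re (F (b +i* y) - G (b +i* y)) - Re (F (a +i* y) - G (a +i* y))) =
    (fun y => (Re (F (b +i* y)) - Re (F (a +i* y))) - (Re (G (b +i* y)) - Re (G (a +i* y)))).
  by apply/funext => y; rewrite !Re_cB; ring.
rewrite (sintB (sitgB Fc Fd) (sitgB Gc Gd)) (sintB (sitgB Fb Fa) (sitgB Gb Ga)).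
by ring.
Qed.

Lemma cgreen_real F k a b c d : a <= b -> c <= d ->
  (forall z, a <= Re z <= b -> c <= Im z <= d ->
    (Re z == a) || (Re z == b) || (Im z == c) || (Im z == d) ->
    exists l, cdif F z l) ->
  cgreen (fun z => k%:C * F z) a b c d = k * cgreen F a b c d.
Proof.
move=> ab cd dF.
have ci : c <= c <= d by rewrite lexx.
have di : c <= d <= d by rewrite lexx andbT.
have ai : a <= a <= b by rewrite lexx.
have bi : a <= b <= b by rewrite lexx andbT.
have Fc : sitg a b (fun x => Im (F (x +i* c))).
  by apply: cdif_sitgP => x xi; apply: (dF (x +i* c) xi ci); rewrite /= eqxx !orbT.
have Fd : sitg a b (fun x => Im (F (x +i* d))).
  by apply: cdif_sitgP => x xi; apply: (dF (x +i* d) xi di); rewrite /= eqxx !orbT.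
have Fa : sitg c d (fun y => Re (F (a +i* y))).
  by apply: cdif_sitgQ => y yi; apply: (dF (a +i* y) ai yi); rewrite /= eqxx.
have Fb : sitg c d (fun y => Re (F (b +i* y))).
  by apply: cdif_sitgQ => y yi; apply: (dF (b +i* y) bi yi); rewrite /= eqxx !orbT.
rewrite /cgreen /green mulrDr /sint -!RintegralZl//.
- congr (_ + _); apply: eq_Rintegral => x _; rewrite ?Im_cM ?Re_cM/=; ring.
- exact: (sitgB Fb Fa).
- exact: (sitgB Fc Fd).
Qed.

Lemma cgreen_bound F a b Y B N : a <= b -> 0 < Y ->
  (forall z, a <= Re z <= b -> - Y <= Im z <= Y ->
    (Re z == a) || (Re z == b) || (Im z == - Y) || (Im z == Y) ->
    exists l, cdif F z l) ->
  (forall x, a <= x <= b -> normc (F (x +i* - Y)) <= B /\ normc (F (x +i* Y)) <= B) ->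
  (forall y, - Y <= y <= Y -> normc (F (a +i* y)) <= N / (1 + y ^+ 2) /\
    normc (F (b +i* y)) <= N / (1 + y ^+ 2)) -> 0 <= N ->
  `|cgreen F a b (- Y) Y| <= 2 * B * (b - a) + 2 * N * pi.
Proof.
move=> ab Y0 dF FB FN N0.
have Yi : - Y <= - Y <= Y by lra.
have Yi' : - Y <= Y <= Y by lra.
have ai : a <= a <= b by rewrite lexx.
have bi : a <= b <= b by rewrite lexx andbT.
have Fc : sitg a b (fun x => Im (F (x +i* - Y))).
  by apply: cdif_sitgP => x xi; apply: (dF (x +i* - Y) xi Yi); rewrite /= eqxx !orbT.
have Fd : sitg a b (fun x => Im (F (x +i* Y))).
  by apply: cdif_sitgP => x xi; apply: (dF (x +i* Y) xi Yi'); rewrite /= eqxx !orbT.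
have Fa : sitg (- Y) Y (fun y => Re (F (a +i* y))).
  by apply: cdif_sitgQ => y yi; apply: (dF (a +i* y) ai yi); rewrite /= eqxx.
have Fb : sitg (- Y) Y (fun y => Re (F (b +i* y))).
  by apply: cdif_sitgQ => y yi; apply: (dF (b +i* y) bi yi); rewrite /= eqxx !orbT.
have [mI leI] := sint_inv1Dsqr_le Y0.
apply: le_trans (ler_normD _ _) _; apply: lerD.
  apply: sint_bound => //; first exact: sitgB.
  move=> x /FB[B1 B2]; apply: le_trans (ler_normB _ _) _.
  by have := normc_ge_absIm (F (x +i* - Y)); have := normc_ge_absIm (F (x +i* Y)); lra.
apply: (@le_trans _ _ (sint (- Y) Y (fun y => 2 * N * (1 + y ^+ 2)^-1))).
  apply: sint_abs_le; [exact: sitgB|exact: sitgZ|].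
  move=> y /FN[N1 N2]; apply: le_trans (ler_normB _ _) _.
  rewrite -mulrA.
  by have := normc_ge_absRe (F (a +i* y)); have := normc_ge_absRe (F (b +i* y)); lra.
by rewrite /sint RintegralZl//; apply: ler_wpM2l => //; rewrite mulr_ge0.
Qed.

End cauchy_estimate.

(** * Bounding a holomorphic function inside the strip by its boundary values *)

Section strip_estimate.
Context {R : realType}.
Local Notation C := R[i].
Local Notation normc := (@Normc.normc R).
Local Notation Re := (@complex.Re R).
Local Notation Im := (@complex.Im R).
Implicit Types (z w l m : C) (F G H : C -> C) (x y e r : R).

(** Here 9 bounds (x0 + 2)^2, (1 - x0)/2 is a lower bound for the contour integral of the Cauchy
    kernel, 2/x0 and 2/(1 - x0) bound the kernel on the vertical sides, pi is the integral of 1/(1 +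
    y^2), and the inner factor 2 counts these sides. *)
Definition strip_const (x0 : R) : R :=
  9 * ((1 - x0) / 2)^-1 * (2 * (2 / x0 + 2 / (1 - x0)) * pi).

Lemma normc_gt_strip z : 0 <= Re z -> 1 + Im z ^+ 2 <= normc (z + 2%:C) ^+ 2.
Proof.
move=> z0; rewrite normc_sqr; case: z z0 => x y /= x0; rewrite addr0.
by rewrite lerD2r; nra.
Qed.

(* Cauchy's formula for [H z / (z + 2) ^ 2] on a long rectangle: the denominator makes
   the integrals over the vertical lines converge. *)
Lemma strip_estimate_in H x0 B M : 0 < x0 < 1 -> 0 <= M ->
  (forall z, 0 < Re z < 1 -> exists l, cdif H z l) ->
  (forall z, 0 < Re z < 1 -> normc (H z) <= B) ->
  (forall Y e, 0 < e -> exists2 eta, 0 < eta & forall x y, 0 < x < eta ->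
    `|y| <= Y -> normc (H (x +i* y)) <= M + e /\ normc (H ((1 - x) +i* y)) <= M + e) ->
  normc (H x0%:C) <= strip_const x0 * M.
Proof.
move=> /andP[x00 x01] M0 dH HB Hbd.
set th := x0%:C.
have B0 : 0 <= B by apply: le_trans (normc_ge0 _) (HB th _); rewrite /= x00.
have dinv z : 0 < Re z -> exists l, cdif (fun w => (w + 2%:C)^-1) z l.
  move=> z0; exists (- (z - - 2%:C)^-1 ^+ 2).
  have := @cdif_inv_sub R (- 2%:C) z; rewrite /= => H'.
  have -> : (fun w => (w + 2%:C)^-1) = (fun w => (w - - 2%:C)^-1).
    by apply/funext => w; rewrite opprK.
  apply: H'; apply/eqP => zE; move: z0; rewrite zE/=; lra.
pose G z := H z * ((z + 2%:C)^-1 * (z + 2%:C)^-1).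
have dG z : 0 < Re z < 1 -> exists l, cdif G z l.
  move=> zi; have [l dl] := dH z zi; have /andP[z0 _] := zi.
  have [m dm] := dinv z z0; eexists; apply: cdifM; first exact: dl.
  exact: (cdifM dm dm).
have normG z : 0 <= Re z -> normc (G z) = normc (H z) / normc (z + 2%:C) ^+ 2.
  by move=> _; rewrite /G !Normc.normcM Normc.normcV -invfM expr2.
have leG z N : 0 < Re z -> normc (H z) <= N -> normc (G z) <= N / (1 + Im z ^+ 2).
  move=> z0 HN; rewrite normG ?(ltW z0)//.
  have d0 : 0 < 1 + Im z ^+ 2 by rewrite ltr_wpDr ?sqr_ge0.
  apply: ler_pM; rewrite ?normc_ge0 ?invr_ge0 ?sqr_ge0//.
  by rewrite lef_pV2 ?posrE ?normc_gt_strip ?(ltW z0)// (lt_le_trans d0)// normc_gt_strip// ltW.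
pose g := normc (G th).
have g0 : 0 <= g by exact: normc_ge0.
suff main e Y : 0 < e -> 1 <= Y ->
    (1 - x0) / 2 * g <= 2 * (B / Y) + 2 * ((M + e) * (2 / x0 + 2 / (1 - x0))) * pi.
  have k0 : 0 < (1 - x0) / 2 by rewrite divr_gt0// subr_gt0.
  have key : (1 - x0) / 2 * g <= 2 * (M * (2 / x0 + 2 / (1 - x0))) * pi.
    apply/ler_addgt0Pl => e e0.
    set D := 2 / x0 + 2 / (1 - x0).
    have D0 : 0 < D by rewrite addr_gt0// divr_gt0// subr_gt0.
    have den0 : 2 * D * pi != 0 by rewrite gt_eqF// !mulr_gt0// pi_gt0.
    (* Both errors are made at most e/2: [e1] accounts for the boundary values M + e1, and Y for the
       horizontal sides. *)
    pose e1 : R := e / 2 / (2 * D * pi).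
    have e10 : 0 < e1 by rewrite !divr_gt0// !mulr_gt0// pi_gt0.
    pose Y := Num.max 1 (4 * B / e).
    have Y1 : 1 <= Y by rewrite le_max lexx.
    have Y0 : 0 < Y by exact: lt_le_trans Y1.
    have BY : 2 * (B / Y) <= e / 2.
      rewrite mulrA ler_pdivrMr// -ler_pdivrMl ?divr_gt0//.
      rewrite le_max; apply/orP; right.
      by rewrite le_eqVlt; apply/orP; left; apply/eqP; field; rewrite gt_eqF.
    have := main e1 Y e10 Y1; rewrite -/D.
    have -> : 2 * ((M + e1) * D) * pi = 2 * (M * D) * pi + e / 2.
      rewrite -(divfK den0 (e / 2)) -/e1; ring.
    lra.
  have gE : normc (H th) <= 9 * g.
    have th2 : normc (th + 2%:C) = x0 + 2.
      have -> : th + 2%:C = (x0 + 2)%:C.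
        by apply/eqP; rewrite /th eq_complex/= addr0 !eqxx.
      by rewrite normc_real ger0_norm// addr_ge0// ltW.
    have -> : normc (H th) = g * (x0 + 2) ^+ 2.
      have th0 : 0 <= Re th by rewrite /= ltW.
      by rewrite /g (normG _ th0) th2 divfK// gt_eqF// exprn_gt0// addr_gt0.
    by rewrite mulrC ler_wpM2r//; nra.
  apply: le_trans gE _; rewrite /strip_const -!mulrA ler_wpM2l//.
  rewrite ler_pdivlMl//; apply: le_trans key _.
  by rewrite le_eqVlt; apply/orP; left; apply/eqP; ring.
move=> e0 Y1; have Y0 : 0 < Y by exact: lt_le_trans Y1.
have Me0 : 0 <= M + e by rewrite addr_ge0// ltW.
have rhs0 : 0 <= 2 * (B / Y) + 2 * ((M + e) * (2 / x0 + 2 / (1 - x0))) * pi.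
  have p0 : 0 <= 2 / x0 by rewrite divr_ge0// ltW.
  have p1 : 0 <= 2 / (1 - x0) by rewrite divr_ge0// subr_ge0 ltW.
  have Yi0 : 0 <= Y^-1 by rewrite invr_ge0 ltW.
  apply: addr_ge0; first by rewrite mulr_ge0// mulr_ge0.
  by apply: mulr_ge0; [rewrite mulr_ge0// mulr_ge0// addr_ge0|exact: pi_ge0].
have [G0|G0] := eqVneq (G th) 0.
  by rewrite /g G0 Normc.normc0 mulr0.
have [eta eta0 Heta] := Hbd Y e e0.
(* The vertical sides lie within [eta] of the boundary lines, yet at distance at least x0/2 and (1 -
   x0)/2 from [th]. *)
have [|a a0 /= /and4P[aeta ax ax1 _]] := exists_small
    (l := [:: eta; x0 / 2; (1 - x0) / 2]).
  by rewrite /= eta0 !divr_gt0// subr_gt0.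
pose b := 1 - a.
have ab : a <= b by clear -ax ax1; rewrite /b; lra.
have YY : - Y <= Y by clear -Y0; lra.
have axb : a < x0 < b by clear -ax ax1 x00 a0; rewrite /b; lra.
(* A rotation making the value at [th] the positive real g. The imaginary part of the contour
   integral, which is all that [cgreen] records, then detects the modulus of G th. *)
pose om := g%:C / G th.
have g_gt0 : 0 < g by rewrite lt_neqAle eq_sym normc_eq0 G0 g0.
have nom : normc om = 1.
  by rewrite /om Normc.normcM Normc.normcV normc_real ger0_norm// divff// gt_eqF.
have omG : om * G th = g%:C by rewrite /om divfK.
pose inv z := (z - th)^-1.
pose F1 z := om * G z * inv z.
pose F2 z := g%:C * inv z.
have dG' z : a <= Re z <= b -> exists l, cdif G z l.
  by move=> zi; apply: dG; move: zi; rewrite /b; clear -a0; lra.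
have dF1 z : a <= Re z <= b -> z != th -> exists l, cdif F1 z l.
  move=> zi zth; have [l dl] := dG' z zi; eexists; apply: cdifM.
    exact: cdifZ dl.
  exact: cdif_inv_sub.
have dI z : z != th -> exists l, cdif inv z l.
  by move=> zth; eexists; exact: cdif_inv_sub.
have dF2 z : z != th -> exists l, cdif F2 z l.
  by move=> /dI[l dl]; eexists; exact: cdifZ dl.
have edge z : (Re z == a) || (Re z == b) || (Im z == - Y) || (Im z == Y) -> z != th.
  have /andP[ax0 x0b] := axb.
  apply: contraTneq => ->.
  by rewrite /= (gt_eqF ax0) (lt_eqF x0b) gt_eqF ?oppr_lt0// lt_eqF.
(* The difference is om (G - G th) / (z - th), bounded near [th] by the Lipschitz estimate; hence
   the puncture contributes nothing. *)
have K0 : cgreen (fun z => F1 z - F2 z) a b (- Y) Y = 0.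
  have thi : 0 < Re th < 1 by rewrite /= x00.
  have [l dl] := dG th thi; have [r r0 Hr] := cdif_lipschitz dl.
  apply: (@cgreen_punctured _ _ a b (- Y) Y th r (normc l + 1)) => //.
  - by rewrite /= oppr_lt0 Y0.
  - move=> z zi _ zth; have [l1 dl1] := dF1 z zi zth; have [l2 dl2] := dF2 z zth.
    exists (l1 - l2) => e' e'0.
    have [r1 r10 H1] := dl1 (e' / 2) (divr_gt0 e'0 (ltr0n _ 2)).
    have [r2 r20 H2] := dl2 (e' / 2) (divr_gt0 e'0 (ltr0n _ 2)).
    exists (Num.min r1 r2); first by rewrite lt_min r10.
    move=> w; rewrite lt_min => /andP[/H1 w1 /H2 w2].
    have -> : F1 w - F2 w - (F1 z - F2 z) - (l1 - l2) * (w - z) =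
      (F1 w - F1 z - l1 * (w - z)) - (F2 w - F2 z - l2 * (w - z)) by ring.
    by apply: le_trans (ler_normcB _ _) _; clear -w1 w2; lra.
  - move=> z zr; have -> : F1 z - F2 z = om * (G z - G th) * inv z.
      by rewrite /F1 /F2 -omG; ring.
    have [->|zth] := eqVneq z th.
      by rewrite subrr mulr0 mul0r Normc.normc0 addr_ge0 ?normc_ge0.
    rewrite 2!Normc.normcM nom mul1r Normc.normcV ler_pdivrMr ?Hr//.
    by rewrite lt_neqAle eq_sym normc_eq0 subr_eq0 zth normc_ge0.
have zmem z : a <= Re z <= b -> - Y <= Im z <= Y ->
    (Re z == a) || (Re z == b) || (Im z == - Y) || (Im z == Y) ->
    (exists l, cdif F1 z l) /\ (exists l, cdif F2 z l).
  by move=> zi _ /edge zth; split; [exact: dF1|exact: dF2].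
have E12 : cgreen F1 a b (- Y) Y = g * cgreen inv a b (- Y) Y.
  rewrite -(@cgreen_real R inv g a b (- Y) Y)//; last by move=> z _ _ /edge; exact: dI.
  by apply/eqP; rewrite -subr_eq0 -cgreenB//; apply/eqP.
have low : (1 - x0) / 2 * g <= cgreen F1 a b (- Y) Y.
  rewrite E12 mulrC; apply: ler_wpM2l => //.
  apply: (@le_trans _ _ (b - x0)); first by clear -ax1; rewrite /b; lra.
  by apply: cgreen_inv_ge => //; clear -Y1 ax ax1 a0 x00; rewrite /b; lra.
apply: le_trans low _; apply: le_trans (ler_norm _) _.
pose N := (M + e) * (2 / x0 + 2 / (1 - x0)).
have p0 : 0 <= 2 / x0 by rewrite divr_ge0// ltW.
have p1 : 0 <= 2 / (1 - x0) by rewrite divr_ge0// subr_ge0 ltW.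
have N0 : 0 <= N by rewrite mulr_ge0// addr_ge0.
have nF1 z : normc (F1 z) = normc (G z) / normc (z - th).
  by rewrite /F1 2!Normc.normcM nom mul1r Normc.normcV.
have BY0 : 0 <= B / Y by rewrite divr_ge0// ltW.
apply: (@le_trans _ _ (2 * (B / Y) * (b - a) + 2 * N * pi)); last first.
  rewrite lerD2r; apply: ler_piMr; first by apply: mulr_ge0.
  by clear -a0; rewrite /b; lra.
have horiz x y : a <= x <= b -> `|y| = Y -> normc (F1 (x +i* y)) <= B / Y.
  move=> xi yY; rewrite nF1.
  have y0 : 0 < `|y| by rewrite yY.
  have xi' : 0 < Re (x +i* y) < 1 by clear -a0 xi; move: xi; rewrite /b/=; lra.
  apply: ler_pM; rewrite ?normc_ge0 ?invr_ge0 ?normc_ge0//.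
    apply: le_trans (leG _ _ _ (HB _ xi')) _; first by case/andP : xi'.
    by rewrite ler_pdivrMr ?ltr_wpDr ?sqr_ge0// ler_peMr// lerDl sqr_ge0.
  have nz : Y <= normc (x +i* y - th).
    by rewrite -yY; apply: le_trans (normc_ge_absIm _); rewrite /= subr0.
  by rewrite lef_pV2 ?posrE// (lt_le_trans Y0).
have vert x y k : 0 < x < 1 -> `|y| <= Y -> normc (H (x +i* y)) <= M + e ->
    0 < k -> k <= `|x - x0| -> k^-1 <= 2 / x0 + 2 / (1 - x0) ->
    normc (F1 (x +i* y)) <= N / (1 + y ^+ 2).
  move=> xi yY HM k0 kx kN; rewrite nF1 /N mulrAC.
  have x_gt0 : 0 < Re (x +i* y) by case/andP: xi.
  apply: ler_pM; rewrite ?normc_ge0 ?invr_ge0 ?normc_ge0//.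
    exact: leG.
  have nz : k <= normc (x +i* y - th).
    by apply: le_trans kx _; apply: le_trans (normc_ge_absRe _).
  by apply: le_trans kN; rewrite lef_pV2 ?posrE// (lt_le_trans k0).
have ai : 0 < a < eta by rewrite a0.
apply: cgreen_bound => //.
- by move=> z zi yi /(zmem z zi yi)[].
- by move=> x xi; split; apply: horiz => //; rewrite ?normrN gtr0_norm.
- move=> y yi; have yY : `|y| <= Y by rewrite ler_norml.
  have [H1 H2] := Heta a y ai yY; split.
    apply: (vert a y (x0 / 2)) => //; first by clear -a0 ax x01 x00; lra.
    + by rewrite divr_gt0.
    + by clear -a0 ax x00; rewrite distrC ger0_norm; lra.
    + by rewrite invf_div lerDl.
  apply: (vert b y ((1 - x0) / 2)) => //; first by clear -a0 ax1 x00; rewrite /b; lra.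
  + by rewrite divr_gt0// subr_gt0.
  + by clear -a0 ax1 x00; rewrite /b ger0_norm; lra.
  + by rewrite invf_div lerDr.
Qed.

(** Continuity up to the boundary is uniform along the compact segments |y| <= Y, which provides the
    collar of width [eta] needed by [strip_estimate_in]. The a priori bound B does not enter the
    conclusion. *)
Lemma strip_estimate H x0 B M : 0 < x0 < 1 -> 0 <= M ->
  (forall z, 0 < Re z < 1 -> exists l, cdif H z l) ->
  (forall z e, 0 <= Re z <= 1 -> 0 < e -> exists2 r, 0 < r &
    forall w, 0 <= Re w <= 1 -> normc (w - z) < r -> normc (H w - H z) <= e) ->
  (forall z, 0 <= Re z <= 1 -> normc (H z) <= B) ->
  (forall y, normc (H (0 +i* y)) <= M /\ normc (H (1 +i* y)) <= M) ->
  normc (H x0%:C) <= strip_const x0 * M.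
Proof.
move=> x01 M0 dH cH HB HM; apply: (@strip_estimate_in H x0 B) => //.
  by move=> z /andP[z0 z1]; apply: HB; rewrite !ltW.
move=> Y e e0.
pose P (i y : R) := forall x, 0 < x < i ->
  normc (H (x +i* y)) <= M + e /\ normc (H ((1 - x) +i* y)) <= M + e.
have : \forall i \near (0 : R)^'+, `[- Y, Y] `<=` P i.
  have /compact_near_coveringP cov := @segment_compact R (- Y) Y.
  apply: cov => y _.
  have z0 : 0 <= Re (0 +i* y) <= 1 by rewrite /= lexx ler01.
  have z1 : 0 <= Re (1 +i* y) <= 1 by rewrite /= lexx ler01.
  have [r1 r10 H1] := cH (0 +i* y) e z0 e0.
  have [r2 r20 H2] := cH (1 +i* y) e z1 e0.
  pose r := Num.min (Num.min r1 r2) 1 / 2.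
  have rm : 0 < Num.min (Num.min r1 r2) 1 by rewrite !lt_min r10 r20 ltr01.
  have r0 : 0 < r by rewrite divr_gt0.
  have [rr1 rr2 rr3] : [/\ r + r <= r1, r + r <= r2 & r + r <= 1].
    have -> : r + r = Num.min (Num.min r1 r2) 1 by rewrite /r; field.
    by rewrite !ge_min !lexx !orbT.
  have HM1 y' x : `|y' - y| < r -> 0 < x < r -> normc (H (x +i* y')) <= M + e.
    move=> yr xr; have [HMy _] := HM y.
    rewrite -(subrK (H (0 +i* y)) (H (x +i* y'))).
    apply: le_trans (ler_normcD _ _) _; rewrite addrC; apply: lerD => //.
    apply: H1; first by rewrite /=; lra.
    have /andP[x_gt0 xr'] := xr.
    by apply: (le_lt_trans (normc_le_add _)); rewrite /= subr0 (gtr0_norm x_gt0); lra.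
  have HM2 y' x : `|y' - y| < r -> 0 < x < r -> normc (H ((1 - x) +i* y')) <= M + e.
    move=> yr xr; have [_ HMy] := HM y.
    rewrite -(subrK (H (1 +i* y)) (H ((1 - x) +i* y'))).
    apply: le_trans (ler_normcD _ _) _; rewrite addrC; apply: lerD => //.
    apply: H2; first by rewrite /=; lra.
    apply: (le_lt_trans (normc_le_add _)); rewrite /=.
    have /andP[x_gt0 xr'] := xr.
    have -> : 1 - x - 1 = - x by ring.
    by rewrite normrN (gtr0_norm x_gt0); lra.
  exists ([set y' | `|y' - y| < r], [set i | i < r]) => /=.
    split; first by exists r => //= z /=; rewrite distrC.
    by apply: nbhs_right_lt.
  move=> [y' i] /= [yr ir] x /andP[x0' xi]; split.
    by apply: HM1 => //; rewrite x0' (lt_trans xi).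
  by apply: HM2 => //; rewrite x0' (lt_trans xi).
move=> nearP.
have [eta eta0 Peta] : exists2 eta : R, 0 < eta & `[- Y, Y] `<=` P eta.
  near (0 : R)^'+ => i; exists i; first by near: i; exact: nbhs_right_gt.
  by near: i.
exists eta => // x y xi yY; apply: Peta => //=.
by rewrite in_itv/= -ler_norml.
Unshelve. all: by end_near. Qed.

End strip_estimate.

(** * Cones in a metric measure space *)

Section metric_measure.
Context d (R : realType) (X : metricMeasurableType d R).
Variable mu : {measure set X -> \bar R}.
Hypotheses (borelX : borel_space X) (volX : vol_pos_fin mu).

Lemma open_measurable_borel (A : set X) : open A -> measurable A.
Proof. by move=> oA; rewrite borelX; exact: sub_sigma_algebra. Qed.

Lemma ball_open_metric (x : X) (r : R) : open (ball x r).
Proof.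
rewrite openE => y; rewrite ballEmdist/= => xy.
have e0 : 0 < r - mdist x y by rewrite subr_gt0.
apply/nbhs_ballP; exists (r - mdist x y) => //= z; rewrite !ballEmdist/= => yz.
by rewrite (le_lt_trans (metric_triangle _ y _))// -ltrBrDl.
Qed.

Lemma measurable_ball_metric (x : X) (r : R) : measurable (ball x r).
Proof. exact/open_measurable_borel/ball_open_metric. Qed.

Lemma measurable_mdist (x : X) : measurable_fun setT (mdist x : X -> R).
Proof.
apply: (@measurability _ _ _ _ _ _ (@RGenInftyO.G R)).
  exact: RGenInftyO.measurableE.
move=> _ [_ [r ->] <-]; rewrite setTI (_ : _ @^-1` _ = ball x r).
  exact: measurable_ball_metric.
by rewrite ballEmdist; apply/seteqP; split=> y /=; rewrite in_itv.
Qed.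

Lemma vol_fin x r : vol mu x r \is a fin_num.
Proof.
rewrite ge0_fin_numE ?measure_ge0//; have [r0|r0] := ltP 0 r.
  by case/andP: (volX x r0).
rewrite /vol (_ : ball x r = set0) ?measure0//.
apply/seteqP; split=> y//; rewrite ballEmdist/= => xy.
by have := lt_le_trans xy r0; rewrite ltNge mdist_ge0.
Qed.

Lemma sigma_finite_balls : sigma_finite setT mu.
Proof.
exists (fun n => ball (point : X) n.+1%:R).
  apply/seteqP; split=> // y _; exists (Num.truncn (mdist (point : X) y)) => //.
  by rewrite ballEmdist/= truncnS_gt.
move=> n; split; first exact: measurable_ball_metric.
by have /andP[] := volX point (ltr0Sn R n).
Qed.

(** Balls of radius e/2 around points of A are disjoint. Inside a fixed ball, which has finite
    measure, only finitely many of them have measure above 1/(m+1); since all balls have positive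
    measure, countably many such classes exhaust A. *)
Lemma separated_countable (A : set X) (e : R) : 0 < e ->
  (forall x y, A x -> A y -> x != y -> e <= mdist x y) -> countable A.
Proof.
move=> e0 sepA.
have e20 : 0 < e / 2 by rewrite divr_gt0.
pose D n m := [set x | A x /\ mdist (point : X) x < n.+1%:R /\
  ((m.+1%:R : R)^-1%:E < vol mu x (e / 2))%E].
have -> : A = \bigcup_n \bigcup_m D n m.
  apply/seteqP; split=> [x Ax|x [n _] [m _] []//].
  exists (Num.truncn (mdist (point : X) x)) => //.
  have /andP[v0 _] := volX x e20.
  have := vol_fin x (e / 2); move: v0.
  rewrite /D/=; case vE : (vol mu x (e / 2)) => [v||]// v0 _.
  rewrite lte_fin in v0; have [m] := ltr_add_invr v0; rewrite add0r => mv.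
  by exists m => //; rewrite /D/= vE lte_fin; split=> //; split=> //; exact: truncnS_gt.
apply: bigcup_countable => // n _; apply: bigcup_countable => // m _.
apply: finite_set_countable; apply: contrapT.
move=> /infiniteP/pcard_leP/injfunPex[/= q q_fun q_inj].
pose F k := ball (q k) (e / 2).
have mF k : measurable (F k) by exact: measurable_ball_metric.
have disj : trivIset setT F.
  move=> i j _ _ [z [zi zj]]; apply/eqP/negPn/negP => ij.
  have qij : q i != q j.
    by apply: contra ij => /eqP/q_inj -> //; rewrite inE.
  have [[Ai _] [Aj _]] := (q_fun i I, q_fun j I).
  have := sepA _ _ Ai Aj qij; apply/negP; rewrite -ltNge.
  move: zi zj; rewrite /F !ballEmdist/= => zi zj.
  apply: le_lt_trans (metric_triangle _ z _) _.
  by rewrite (splitr e) ltrD// metric_sym.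
pose Bg := ball (point : X) (n.+1%:R + e).
have FB : \bigcup_k F k `<=` Bg.
  move=> z [k _]; rewrite /F /Bg !ballEmdist/= => qz.
  have [_ [kn _]] := q_fun k I.
  apply: le_lt_trans (metric_triangle _ (q k) _) _.
  by rewrite ltrD// (lt_trans qz)// ltr_pdivrMr// ltr_pMr// ltr1n.
have Bfin : (mu Bg < +oo)%E.
  by have /andP[] := volX (point : X) (addr_gt0 (ltr0Sn R n) e0).
have : (mu (\bigcup_k F k) <= mu Bg)%E.
  by apply: le_measure => //; rewrite inE; [exact: bigcup_measurable|exact: measurable_ball_metric].
rewrite measure_bigcup//.
have Bfin' : mu Bg \is a fin_num by rewrite ge0_fin_numE.
pose N := Num.truncn (fine (mu Bg) * m.+1%:R).
apply/negP; rewrite -ltNge -(fineK Bfin').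
apply: (@lt_le_trans _ _ (\sum_(0 <= k < N.+1) mu (F k))%E); last first.
  rewrite [leRHS](_ : _ = \sum_(0 <= k <oo) mu (F k))%E; last first.
    by apply: eq_eseriesl => i; rewrite in_setT.
  exact: nneseries_lim_ge.
apply: (@lt_le_trans _ _ (\sum_(0 <= k < N.+1) (m.+1%:R^-1 : R)%:E)%E).
  rewrite sumEFin lte_fin sumr_const_nat subn0 -[ltRHS]mulr_natl.
  by rewrite ltr_pdivlMr// truncnS_gt.
apply: lee_sum => k _; have [_ [_ /ltW]] := q_fun k I; exact.
Qed.

(** Zorn's lemma gives maximal 1/(k+1)-separated sets, which are nets, and the measure makes them
    countable. *)
Lemma dense_sequence : exists a : nat -> X,
  forall x (e : R), 0 < e -> exists n, mdist x (a n) < e.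
Proof.
pose sep (e : R) (A : set X) := forall x y, A x -> A y -> x != y -> e <= mdist x y.
have maxA (e : R) : exists A : set X, sep e A /\
    (0 < e -> forall x, exists2 y, A y & mdist x y < e).
  have [|A [sA maxA]] := @Zorn_bigcup X (sep e).
    move=> F FS tF x y [B FB Bx] [C FC Cy].
    have [BC|CB] := tF _ _ FB FC.
      by apply: (FS _ FC) => //; exact: BC.
    by apply: (FS _ FB) => //; exact: CB.
  exists A; split=> // e0 x; apply: contrapT => noy.
  have far y : A y -> e <= mdist x y.
    by move=> Ay; rewrite leNgt; apply/negP => xy; apply: noy; exists y.
  have Ax : ~ A x by move=> /far; rewrite mdistxx leNgt e0.
  apply: (maxA (A `|` [set x])).
    by split=> [|/(_ x)]; [exact: subsetUl|move=> H; apply/Ax/H; right].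
  move=> y z [Ay|->] [Az|->]; first exact: sA.
  - by rewrite metric_sym => _; exact: far.
  - by move=> _; exact: far.
  - by rewrite eqxx.
have [A HA] := choice maxA.
pose D := \bigcup_k A (k.+1%:R^-1).
have cD : countable D.
  apply: bigcup_countable => // k _.
  by have [sA _] := HA (k.+1%:R^-1); apply: (@separated_countable _ k.+1%:R^-1).
have [g gD] : exists g : nat -> X, set_surj setT D g.
  by apply/(@pcard_surjP _ _ D setT).
exists g => x e e0; have [k] := ltr_add_invr e0; rewrite add0r => ke.
have [_ /(_ _ x)] := HA (k.+1%:R^-1); rewrite invr_gt0 ltr0n => /(_ isT)[y Ay xy].
have [n _ gn] : [set g t | t in setT] y by apply: gD; exists k.
by exists n; rewrite gn (lt_trans xy).
Qed.

(** For alpha > 0 the inequality forces a positive height ([cone_rel_gt0]), so the sections at x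
    agree with [cone]. *)
Definition cone_rel (alpha : R) : set (X * (X * R)) :=
  [set z | mdist z.1 z.2.1 < alpha * z.2.2].

(** An open set of a product of metric spaces may fail to belong to the product sigma-algebra.
    Separability writes the relation as a countable union, over dense points and rational radii, of
    products of measurable sets. *)
Lemma measurable_cone_rel alpha : measurable (cone_rel alpha).
Proof.
have [a aP] := dense_sequence.
have -> : cone_rel alpha = \bigcup_n \bigcup_(r : rat)
    (ball (a n) (ratr r) `*` [set w | mdist (a n) w.1 + ratr r < alpha * w.2]).
  apply/seteqP; split=> [[x [y t]]|[x [y t]] [n _] [r _] [/=]]; last first.
    rewrite ballEmdist/= => ar ayr; rewrite /cone_rel/=.
    apply: le_lt_trans (metric_triangle _ (a n) _) _.
    by rewrite metric_sym (lt_trans _ ayr)// addrC ltrD2l.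
  rewrite /cone_rel/= => xyt.
  pose g := alpha * t - mdist x y.
  have g0 : 0 < g by rewrite subr_gt0.
  (* With r < g/3, the triangle inequality gives d(a n, y) + r < d(x, y) + 2 g/3 < alpha t. *)
  have [n xn] := aP x (g / 3) (divr_gt0 g0 (ltr0n _ 3)).
  have [r /andP[r1 r2]] : exists r : rat, mdist x (a n) < ratr r < g / 3.
    by have [r] := rat_in_itvoo xn; rewrite in_itv/= => H; exists r.
  exists n => //; exists r => //; split; first by rewrite ballEmdist/= metric_sym.
  rewrite /=; have := metric_triangle (a n) x y; rewrite (metric_sym (a n) x).
  by move: r1 r2; rewrite /g; lra.
apply: bigcupT_measurable => n; apply: bigcupT_measurable_rat => r.
apply: measurableX; first exact: measurable_ball_metric.
rewrite -[X in measurable X]setTI.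
have m1 : measurable_fun setT (fun w : X * R => mdist (a n) w.1 + ratr r).
  apply: measurable_funD => //.
  exact: (measurableT_comp (measurable_mdist (a n)) measurable_fst).
have m2 : measurable_fun setT (fun w : X * R => alpha * w.2).
  by apply: measurable_funM => //; exact: measurable_snd.
by have /(_ measurableT [set true] I) := measurable_fun_ltr m1 m2.
Qed.

End metric_measure.

(** * The maximal theorem for shadows, and the area function as a kernel integral *)

Section maximal_function.
Context d (R : realType) (X : metricMeasurableType d R).
Variable mu : {sigma_finite_measure set X -> \bar R}.
Hypotheses (borelX : borel_space X) (volX : vol_pos_fin mu) (HLX : HL_property mu).
Variable alpha : R.
Hypothesis alpha_gt0 : 0 < alpha.
Local Open Scope ereal_scope.

Local Notation K := (@cone_rel d R X alpha).

Lemma maximal_fun_ge0 f x : 0 <= maximal_fun mu f x.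
Proof.
apply: (@le_trans _ _ ((fine (vol mu x 1))^-1%:E * \int[mu]_(y in ball x 1%R) `|f y|%:E)).
  by apply: mule_ge0; [rewrite lee_fin invr_ge0 fine_ge0|apply: integral_ge0 => y _; rewrite lee_fin].
apply: ereal_sup_ubound; exists x, 1%R; split=> //.
by rewrite ballEmdist/= mdistxx.
Qed.

(** Superlevel sets are open: an uncentred ball witnessing a large value at x witnesses it at every
    point of a neighbourhood of x. *)
Lemma measurable_maximal_fun f : measurable_fun setT (maximal_fun mu f).
Proof.
apply: (measurability _ (ErealGenOInfty.measurableE R)).
move=> _ [_ [r ->] <-]; rewrite setTI.
apply: (open_measurable_borel borelX).
rewrite openE => x /=; rewrite in_itv/= andbT => /ereal_sup_gt[_ [c [s [s0 xs ->]]]] rlt.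
apply/nbhs_ballP; have := ball_open_metric c s; rewrite openE => /(_ x xs).
move=> /nbhs_ballP[e e0 eB]; exists e => //= y /eB ys.
rewrite /= in_itv/= andbT; apply: (lt_le_trans rlt); apply: ereal_sup_ubound.
by exists c, s; split.
Qed.

Lemma cone_rel_ball x (w : X * R) : K (x, w) <-> ball w.1 (alpha * w.2)%R x.
Proof. by rewrite ballEmdist/= /cone_rel/= metric_sym. Qed.

Lemma cone_rel_gt0 x (w : X * R) : K (x, w) -> (0 < w.2)%R.
Proof.
rewrite /cone_rel/= => H; rewrite -(pmulr_rgt0 _ alpha_gt0).
exact: le_lt_trans (mdist_ge0 _ _) H.
Qed.

Lemma kap_ball (h : X -> R) (w : X * R) :
  kap mu K h w = \int[mu]_(x in ball w.1 (alpha * w.2)%R) (h x)%:E.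
Proof.
rewrite [RHS]integral_mkcond; apply: eq_integral => x _.
rewrite patchE indicE; case: ifPn => [|/negP] xB.
  by rewrite mem_set ?mul1r//; apply/cone_rel_ball; rewrite inE in xB.
by rewrite memNset ?mul0r// => /cone_rel_ball xB'; apply: xB; rewrite inE.
Qed.

Lemma kvol_vol (w : X * R) : kvol mu K w = vol mu w.1 (alpha * w.2)%R.
Proof.
rewrite /kvol kap_ball integral_cst ?mul1e//.
exact: measurable_ball_metric.
Qed.

Lemma kvol_cone_lty w : kvol mu K w < +oo.
Proof. by rewrite kvol_vol ltey_eq vol_fin. Qed.

Lemma kvol_cone_gt0 x w : K (x, w) -> 0 < kvol mu K w.
Proof.
move=> /cone_rel_gt0 w0; rewrite kvol_vol.
by case/andP: (volX w.1 (mulr_gt0 alpha_gt0 w0)).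
Qed.

Lemma cone_rel_nonempty x : exists w, K (x, w).
Proof. by exists (x, 1%R); rewrite /cone_rel/= mdistxx mulr1. Qed.

(** The shadow of w is a ball containing every x whose cone contains w, so the maximal function of
    h, finite almost everywhere, dominates the averages. Its strong type bound raised to the power r
    gives the constant C^r. *)
Lemma maximal_bound_cone (r : R) : (1 < r)%R -> maximal_bound mu K r.
Proof.
move=> r1; have r0 : (0 < r)%R by exact: lt_trans r1.
have rn0 : r != 0%R by rewrite gt_eqF.
have [C C0 HC] := HLX r1; exists (C `^ r)%R; first exact: powR_gt0.
move=> h mh h0 inth.
have := HC h mh; set M := maximal_fun mu h; set N := 'N[mu]_(r%:E)[M] => NM.
have mM : measurable_fun setT M by exact: measurable_maximal_fun.
have M0 x : 0 <= M x by exact: maximal_fun_ge0.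
have NE : N `^ r = \int[mu]_x (M x `^ r).
  rewrite /N (poweR_Lnorm _ _ rn0); apply: eq_integral => x _.
  by rewrite gee0_abs.
have hE : 'N[mu]_(r%:E)[EFin \o h] `^ r = \int[mu]_x (h x `^ r)%:E.
  rewrite (poweR_Lnorm _ _ rn0); apply: eq_integral => x _.
  by rewrite /= ger0_norm.
have le : \int[mu]_x (M x `^ r) <= (C `^ r)%:E * \int[mu]_x (h x `^ r)%:E.
  rewrite -NE -hE -poweR_EFin -poweRM ?lee_fin ?(ltW C0) ?Lnorm_ge0//.
  apply: gt0_ler_poweR NM; first exact: ltW.
    by rewrite in_itv/= leey Lnorm_ge0.
  by rewrite in_itv/= leey mule_ge0 ?Lnorm_ge0// lee_fin ltW.
have M_lty : {ae mu, forall x, M x < +oo}.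
  have : {ae mu, forall x, setT x -> M x `^ r \is a fin_num}.
    apply: integrable_ae => //; apply/integrableP; split.
      exact: measurable_funT_poweR.
    under eq_integral do rewrite gee0_abs ?poweR_ge0//.
    apply: (le_lt_trans le); rewrite lte_mul_pinfty// lee_fin powR_ge0//.
  apply: filterS => x /(_ I); rewrite ge0_fin_numE ?poweR_ge0//.
  by apply: lty_poweRy; rewrite gt_eqF.
exists (fine \o M); first exact: measurableT_comp.
split=> [x||]; first exact: fine_ge0.
- apply: filterS M_lty => x Mx w Kxw.
  have w0 := cone_rel_gt0 Kxw.
  have vpos := kvol_cone_gt0 Kxw; rewrite kvol_vol in vpos *.
  have vE : vol mu w.1 (alpha * w.2)%R = (fine (vol mu w.1 (alpha * w.2)))%:E.
    by rewrite fineK// vol_fin.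
  have v0 : (0 < fine (vol mu w.1 (alpha * w.2)))%R by rewrite -lte_fin -vE.
  rewrite vE -lee_pdivrMr// /= fineK ?ge0_fin_numE// muleC.
  apply: ereal_sup_ubound; exists w.1, (alpha * w.2)%R; split.
  + exact: mulr_gt0.
  + exact/cone_rel_ball.
  + rewrite kap_ball; congr (_ * _); apply: eq_integral => y _.
    by rewrite ger0_norm.
- apply: le_trans le; apply: le_integral_nneg => x.
    by rewrite lee_fin powR_ge0.
  have := M0 x; rewrite /=; case: (M x) => [l||]//=.
  by move=> _; rewrite (negbTE rn0) leey.
Qed.

(** The density of the measure in the area function with respect to mu times Lebesgue measure. At
    heights w.2 <= 0 the ball is empty and the convention for division by zero makes the weight
    vanish. *)
Definition tent_weight (w : X * R) : R :=
  ((fine (vol mu w.1 (alpha * w.2)))^-1 / w.2)%R.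

Lemma tent_weight_le0 w : (w.2 <= 0)%R -> tent_weight w = 0%R.
Proof.
move=> w0; rewrite /tent_weight -kvol_vol (_ : kvol mu K w = 0) ?invr0 ?mul0r//.
rewrite kvol_vol /vol (_ : ball _ _ = set0) ?measure0//.
apply/seteqP; split=> x//; rewrite ballEmdist/= => H.
have := le_lt_trans (mdist_ge0 _ _) H; rewrite pmulr_rgt0// ltNge w0//.
Qed.

Lemma tent_weight_ge0 w : (0 <= tent_weight w)%R.
Proof.
have [w0|w0] := leP w.2 0%R; first by rewrite tent_weight_le0.
by rewrite /tent_weight divr_ge0 ?invr_ge0 ?fine_ge0// ltW.
Qed.

Lemma measurable_tent_weight : measurable_fun setT tent_weight.
Proof.
have mK := measurable_cone_rel borelX volX alpha.
have -> : tent_weight =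
    fun w => ((fine (kvol mu K w))^-1 * (Num.max w.2 0)^-1)%R.
  apply/funext => w; rewrite kvol_vol.
  have [w0|w0] := leP w.2 0%R; last by [].
  by rewrite tent_weight_le0// invr0 mulr0.
apply: measurable_funM; apply: measurable_funT_inv_ge0.
- by move=> w; rewrite fine_ge0// kvol_ge0.
- by apply: measurableT_comp => //; exact: measurable_kap.
- by move=> w; rewrite le_max lexx orbT.
- by apply: measurable_maxr => //; exact: measurable_snd.
Qed.

Lemma product_sigma_finite : sigma_finite setT (mu \x @lebesgue_measure R).
Proof.
have /sigma_finiteP[F [TF ndF Foo]] := sigma_finiteT mu.
have /sigma_finiteP[G [TG ndG Goo]] := sigma_finiteT (@lebesgue_measure R).
exists (fun n => F n `*` G n).
 rewrite -setXTT TF TG predeqE => -[x y]; split.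
    move=> [/= [n _ Fnx] [k _ Gky]]; exists (maxn n k) => //; split.
    - by move: x Fnx; exact/subsetPset/ndF/leq_maxl.
    - by move: y Gky; exact/subsetPset/ndG/leq_maxr.
  by move=> [n _ []/= ? ?]; split; exists n.
move=> k; have [? ?] := Foo k; have [? ?] := Goo k.
split; first exact: measurableX.
by rewrite product_measure1E// lte_mul_pinfty// ge0_fin_numE.
Qed.

(* Canonical structure inference finds no sigma-finite structure on this product. *)
Definition tent_meas : {sigma_finite_measure set (X * measurableTypeR R)%type -> \bar R} :=
  HB.pack (mu \x @lebesgue_measure R)  (Measure_isSigmaFinite.Build _ _ _ (mu \x @lebesgue_measure R) product_sigma_finite).

Lemma area_lam (q : R) (f : X * R -> R[i]) x :
  area mu q alpha f x = (lam tent_meas K tent_weight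
    (fun w => Normc.normc (f w) `^ q)%R x) `^ q^-1.
Proof.
congr (_ `^ _); rewrite integral_mkcond.
change (\int[tent_meas]_w ((fun z : X * R => (Normc.normc (f z) `^ q /
   fine (vol mu z.1 (alpha * z.2)) / z.2)%:E) \_ (cone alpha x)) w =
  \int[tent_meas]_w (\1_K (x, w) * (Normc.normc (f w) `^ q * tent_weight w))%:E).
apply: eq_integral => w _.
rewrite patchE indicE; case: ifPn => [|/negP] xB.
  rewrite mem_set ?mul1r /tent_weight ?mulrA//.
  by move: xB; rewrite inE => -[].
rewrite memNset ?mul0r// => Kxw; apply: xB; rewrite inE; split=> //.
exact: cone_rel_gt0 Kxw.
Qed.

End maximal_function.

Lemma powR_div (R : realType) (x a r : R) : 0 <= x -> 0 < a ->
  (x / a) `^ r = x `^ r / a `^ r.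
Proof.
move=> x0 a0; have {2}-> : x = x / a * a by rewrite divfK ?gt_eqF.
rewrite (powRM _ _ (ltW a0)); last by rewrite divr_ge0// ltW.
by rewrite mulfK// gt_eqF// powR_gt0.
Qed.

(** * Mixed norms *)

Section vanishing_integrals.
Context d (T : measurableType d) (R : realType).
Variable mu : {measure set T -> \bar R}.
Local Open Scope ereal_scope.

(** Dominated convergence with [a 0] as dominating function. *)
Lemma nonincreasing_integral_small (a : nat -> T -> \bar R) :
  (forall n, measurable_fun setT (a n)) -> (forall n x, 0 <= a n x) ->
  (forall x, {homo a^~ x : n m / (n <= m)%N >-> m <= n}) ->
  {ae mu, forall x (e : R), (0 < e)%R -> exists n, a n x <= e%:E} ->
  \int[mu]_x a 0%N x < +oo ->
  forall e : R, (0 < e)%R -> exists n, \int[mu]_x a n x <= e%:E.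
Proof.
move=> ma a0 nia aP inta e e0.
have [_ _ cv] : [/\ mu.-integrable setT (cst 0),
    [sequence \int[mu]_x `|a n x - cst 0 x|]_n @ \oo --> 0 &
    [sequence \int[mu]_x a n x]_n @ \oo --> \int[mu]_x (cst 0 x)].
  apply: (@dominated_convergence _ _ _ _ _ _ _ _ (a 0%N)) => //.
  - apply: filterS aP => x aP _; apply/fine_cvgP; split.
      have [n an] := aP 1%R ltr01; exists n => // k /= nk.
      rewrite ge0_fin_numE//; apply: le_lt_trans (ltry 1%R).
      exact: le_trans (nia x _ _ nk) an.
    apply/cvgrPdist_le => r r0; have [n an] := aP r r0; exists n => // k /= nk.
    rewrite sub0r normrN ger0_norm ?fine_ge0// -lee_fin fineK; last first.
      rewrite ge0_fin_numE//; apply: le_lt_trans (ltry r).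
      exact: le_trans (nia x _ _ nk) an.
    exact: le_trans (nia x _ _ nk) an.
  - apply/integrableP; split => //; under eq_integral do rewrite gee0_abs//.
    by [].
  - by apply: aeW => x n _; rewrite gee0_abs//; exact: nia.
rewrite integral0 in cv; move/fine_cvgP : cv => [[n _ fn] /cvgrPdist_le/(_ e e0)[k _ ke]].
exists (maxn n k); rewrite -[X in X <= _]fineK; last by apply: fn => /=; exact: leq_maxl.
have := ke (maxn n k) (leq_maxr _ _); rewrite /= sub0r normrN lee_fin.
by apply: le_trans; exact: ler_norm.
Qed.

End vanishing_integrals.

Section mixed_norm.
Context d d' (R : realType) (X : measurableType d) (W : measurableType d').
Variables (mu : {sigma_finite_measure set X -> \bar R})
  (nu : {sigma_finite_measure set W -> \bar R}).
Variables (K : set (X * W)) (wt : W -> R).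
Hypotheses (mK : measurable K) (mwt : measurable_fun setT wt)
  (wt_ge0 : forall w, 0 <= wt w).
Local Open Scope ereal_scope.
Local Notation lam := (lam nu K wt).
Local Notation kvol := (kvol mu K).

(* The [P]-th power of the tent norm, see [tent_normE]. *)
Definition rho (P Q : R) (phi : W -> R) : \bar R :=
  \int[mu]_x (lam (fun w => phi w `^ Q)%R x `^ (P / Q)).

Lemma rho_ge0 P Q phi : 0 <= rho P Q phi.
Proof. by apply: integral_ge0 => x _; exact: poweR_ge0. Qed.

Lemma le_poweRl (x y : \bar R) r : (0 <= r)%R -> 0 <= x -> x <= y -> x `^ r <= y `^ r.
Proof.
move=> r0 x0 xy; apply: gt0_ler_poweR => //; rewrite in_itv/= leey andbT//.
exact: le_trans xy.
Qed.

Lemma measurable_lam_powR (Q : R) (phi : W -> R) : measurable_fun setT phi ->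
  measurable_fun setT (lam (fun w => phi w `^ Q)%R).
Proof.
move=> mphi; apply: (measurable_lam nu mK mwt wt_ge0).
  exact: measurable_funT_powR.
by move=> w; exact: powR_ge0.
Qed.

Lemma le_rho (P Q : R) (phi psi : W -> R) : (0 <= P)%R -> (0 < Q)%R -> (forall w, 0 <= phi w)%R ->
  (forall x w, K (x, w) -> phi w <= psi w)%R -> rho P Q phi <= rho P Q psi.
Proof.
move=> P0 Q0 phi0 le; apply: le_integral_nneg => x; first exact: poweR_ge0.
apply: le_poweRl; first by rewrite divr_ge0// ltW.
  by apply: lam_ge0 => // w; exact: powR_ge0.
apply: (le_lam nu wt_ge0) => [w|w Kw]; first exact: powR_ge0.
apply: le_powRl; first exact: ltW.
  exact: phi0.
exact: le Kw.
Qed.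

Lemma ae_eq_lam (phi psi : W -> R) x : measurable_fun setT phi ->
  measurable_fun setT psi -> {ae nu, forall w, phi w * wt w = psi w * wt w}%R ->
  lam phi x = lam psi x.
Proof.
move=> mphi mpsi eqae; apply: ae_eq_integral => //; [exact: lam_sliceM|exact: lam_sliceM|].
by apply: filterS eqae => w E _; rewrite E.
Qed.

Lemma eq_rho (P Q : R) (phi psi : W -> R) :
  (forall x, lam (fun w => phi w `^ Q)%R x = lam (fun w => psi w `^ Q)%R x) ->
  rho P Q phi = rho P Q psi.
Proof. by move=> H; apply: eq_integral => x _; rewrite H. Qed.

(** This puts the weighted function into the form of [weighted_lam_bound], with k = P/Q. *)
Lemma rho_weight (p q P Q : R) (phi m : W -> R) : (0 < P)%R -> (0 < Q)%R ->
  rho P Q (fun w => phi w `^ (q / Q) * m w `^ (p / P - q / Q))%R =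
  \int[mu]_x (lam (fun w => phi w `^ q * m w `^ (p / (P / Q) - q))%R x `^ (P / Q)).
Proof.
move=> P0 Q0; apply: eq_integral => x _; congr (lam _ x `^ _); apply/funext => w.
rewrite powRM ?powR_ge0// -!powRrM divfK ?gt_eqF//.
by congr (_ * _ `^ _)%R; field; rewrite !gt_eqF.
Qed.

Lemma rhoZ (P Q a : R) (phi : W -> R) : (0 < P)%R -> (0 < Q)%R -> (0 <= a)%R -> measurable_fun setT phi ->
  (forall w, 0 <= phi w)%R ->
  rho P Q (fun w => a * phi w)%R = (a `^ P)%:E * rho P Q phi.
Proof.
move=> P0 Q0 a0 mphi phi0; rewrite -ge0_integralZl_EFin ?powR_ge0//.
- apply: eq_integral => x _.
  rewrite (_ : (fun w => _) = fun w => (a `^ Q * phi w `^ Q)%R); last first.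
    by apply/funext => w; rewrite powRM.
  rewrite (lamZ nu mK mwt wt_ge0)//; last 3 first.
  + exact: powR_ge0.
  + exact: measurable_funT_powR.
  + by move=> w; exact: powR_ge0.
  rewrite poweRM; last 2 first.
  + by rewrite lee_fin powR_ge0.
  + by apply: lam_ge0 => // w; exact: powR_ge0.
  by rewrite poweR_EFin -powRrM mulrC divfK ?gt_eqF.
- by move=> x _; exact: poweR_ge0.
- exact/measurable_funT_poweR/measurable_lam_powR.
Qed.

Lemma poweRD_le (x y : \bar R) r : (0 < r)%R -> 0 <= x -> 0 <= y ->
  (x + y) `^ r <= (2 `^ r)%:E * (x `^ r + y `^ r).
Proof.
move=> r0; have rn0 : r != 0%R by rewrite gt_eqF.
have p2 : 0 < (2 `^ r : R)%:E by rewrite lte_fin powR_gt0.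
case: x => [x| |]//; case: y => [y| |]// x0 y0.
- by rewrite -EFinD !poweR_EFin -EFinD -EFinM lee_fin; apply: powRD_le => //; exact: ltW.
- by rewrite poweR_EFin (poweRyr (R := R) rn0) addey// gt0_muley// leey.
- by rewrite poweR_EFin (poweRyr (R := R) rn0) addye// gt0_muley// leey.
- by rewrite (poweRyr (R := R) rn0) addye// gt0_muley// leey.
Qed.

(** A quasi-triangle inequality valid for all positive exponents: (x + y)^r <= 2^r (x^r + y^r) is
    used inside the cone with r = Q and outside with r = P/Q. *)
Lemma rhoD_le (P Q : R) (phi psi : W -> R) : (0 < P)%R -> (0 < Q)%R ->
  measurable_fun setT phi -> (forall w, 0 <= phi w)%R ->
  measurable_fun setT psi -> (forall w, 0 <= psi w)%R ->
  rho P Q (fun w => phi w + psi w)%R <=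
  (2 `^ P * 2 `^ (P / Q))%:E * (rho P Q phi + rho P Q psi).
Proof.
move=> P0 Q0 mphi phi0 mpsi psi0.
have PQ0 : (0 < P / Q)%R by exact: divr_gt0.
have l0 (f : W -> R) x : 0 <= lam (fun w => f w `^ Q)%R x.
  by apply: lam_ge0 => // w; exact: powR_ge0.
have mr (f : W -> R) : measurable_fun setT f ->
    measurable_fun setT (fun x => lam (fun w => f w `^ Q)%R x `^ (P / Q)).
  by move=> mf; exact/measurable_funT_poweR/measurable_lam_powR.
rewrite -ge0_integralD; [|by []|by move=> x _; exact: poweR_ge0|exact: mr|
  by move=> x _; exact: poweR_ge0|exact: mr].
rewrite -ge0_integralZl_EFin; [|by []|
  by move=> x _; apply: adde_ge0; exact: poweR_ge0|
  by apply: emeasurable_funD; exact: mr|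
  by rewrite mulr_ge0// powR_ge0].
apply: le_integral_nneg => x; first exact: poweR_ge0.
apply: (@le_trans _ _ (((2 `^ Q)%:E * (lam (fun w => phi w `^ Q)%R x +
    lam (fun w => psi w `^ Q)%R x)) `^ (P / Q))).
  apply: le_poweRl; [exact: ltW|exact: l0|].
  rewrite -(lamD nu mK mwt wt_ge0); last 4 first.
  - exact: measurable_funT_powR.
  - by move=> w; exact: powR_ge0.
  - exact: measurable_funT_powR.
  - by move=> w; exact: powR_ge0.
  rewrite -(lamZ nu mK mwt wt_ge0); last 3 first.
  - exact: powR_ge0.
  - by apply: measurable_funD; exact: measurable_funT_powR.
  - by move=> w; apply: addr_ge0; exact: powR_ge0.
  apply: (le_lam nu wt_ge0) => [w|w _]; first exact: powR_ge0.
  by apply: powRD_le; [exact: ltW|exact: phi0|exact: psi0].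
rewrite poweRM; last 2 first.
- by rewrite lee_fin powR_ge0.
- by rewrite adde_ge0.
rewrite poweR_EFin -powRrM mulrC divfK ?gt_eqF// EFinM -muleA.
apply: lee_wpmul2l; first by rewrite lee_fin powR_ge0.
exact: poweRD_le.
Qed.

(* Replaces a density argument: multipliers of [U] that are uniformly small on
   [|L| <= n] and bounded elsewhere are small in norm. *)
Lemma rho_small (P Q : R) (U L : W -> R) (B : R) : (0 < P)%R -> (0 < Q)%R ->
  measurable_fun setT U -> (forall w, 0 <= U w)%R -> measurable_fun setT L ->
  (0 <= B)%R -> rho P Q U < +oo -> forall e : R, (0 < e)%R -> exists n : nat,
  forall phi, (forall w, 0 <= phi w)%R ->
    (forall x w, K (x, w) -> phi w <= U w * (n.+1%:R^-1 + B * (n%:R < `|L w|)%R%:R))%R ->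
    rho P Q phi <= e%:E.
Proof.
move=> P0 Q0 mU U0 mL B0 rhoU e e0.
have PQ0 : (0 < P / Q)%R by exact: divr_gt0.
pose b n w := (n.+1%:R^-1 + B * (n%:R < `|L w|)%R%:R : R)%R.
have b0 n w : (0 <= b n w)%R by rewrite addr_ge0 ?invr_ge0// mulr_ge0.
have mb n : measurable_fun setT (b n).
  apply: measurable_funD => //; apply: measurable_funM => //.
  rewrite (_ : (fun w => _) = \1_[set w | (n%:R < `|L w|)%R]); last first.
    by apply/funext => w; rewrite indicE mem_setE.
  apply: measurable_indic; rewrite -[X in measurable X]setTI.
  have /(_ measurableT [set true] I) := measurable_fun_ltr (measurable_cst (n%:R : R))
    (measurableT_comp (@normr_measurable R setT) mL).
  by congr (measurable (_ `&` _)); apply/seteqP; split.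
have nib w : {homo b^~ w : n m / (n <= m)%N >-> (m <= n)%R}.
  move=> n k nk; rewrite /b lerD//.
    by rewrite lef_pV2 ?posrE// ler_nat.
  apply: ler_wpM2l => //; case: (ltP k%:R `|L w|%R) => [kL|_]//.
  by rewrite (le_lt_trans _ kL)// ler_nat.
pose g n w := (U w * b n w)%R.
have g0 n w : (0 <= g n w)%R by rewrite mulr_ge0.
have mg n : measurable_fun setT (g n) by exact: measurable_funM.
have nig w : {homo g^~ w : n m / (n <= m)%N >-> (m <= n)%R}.
  by move=> n k nk; rewrite /g ler_wpM2l// nib.
have rhoB (c : R) : (0 <= c)%R -> rho P Q (fun w => c * U w)%R < +oo.
  by move=> c0; rewrite rhoZ// lte_mul_pinfty// lee_fin powR_ge0.
have g0U w : (g 0%N w <= (1 + B) * U w)%R.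
  rewrite /g /b mulrC ler_wpM2r// invr1 lerD2l ler_piMr//.
  by case: (_ < _)%R.
(* The majorants [g n] decrease to 0 pointwise; dominated convergence is applied to the inner
   integral at almost every x, and then to the outer one. *)
have : exists n, rho P Q (g n) <= e%:E.
  apply: (@nonincreasing_integral_small _ _ _ mu
    (fun n x => lam (fun w => g n w `^ Q)%R x `^ (P / Q))) e0.
  - by move=> n; exact/measurable_funT_poweR/measurable_lam_powR.
  - by move=> n x; exact: poweR_ge0.
  - move=> x n k nk; apply: le_poweRl; first exact: ltW.
      by apply: lam_ge0 => // w; exact: powR_ge0.
    apply: (le_lam nu wt_ge0) => [w|w _]; first exact: powR_ge0.
    by apply: le_powRl; [exact: ltW|exact: g0|exact: nig].
  - have fin : {ae mu, forall x, lam (fun w => g 0%N w `^ Q)%R x < +oo}.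
      have : {ae mu, forall x, setT x ->
          lam (fun w => g 0%N w `^ Q)%R x `^ (P / Q) \is a fin_num}.
        apply: integrable_ae => //; apply/integrableP; split.
          exact/measurable_funT_poweR/measurable_lam_powR.
        under eq_integral do rewrite gee0_abs ?poweR_ge0//.
        apply: (le_lt_trans (le_rho (ltW P0) Q0 (g0 0%N) (fun _ w _ => g0U w))).
        by apply: rhoB; rewrite addr_ge0.
      apply: filterS => x /(_ I); rewrite ge0_fin_numE ?poweR_ge0//.
      by apply: lty_poweRy; rewrite gt_eqF.
    apply: filterS fin => x fx r r0.
    have r'0 : (0 < r `^ (P / Q)^-1)%R by exact: powR_gt0.
    have [] := @nonincreasing_integral_small _ _ _ nu
      (fun n w => (\1_K (x, w) * (g n w `^ Q * wt w))%:E) _ _ _ _ _ _ r'0.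
    + by move=> n; apply: (lam_sliceM mK mwt); exact: measurable_funT_powR.
    + by move=> n w; rewrite lee_fin !mulr_ge0// powR_ge0.
    + move=> w n k nk; rewrite lee_fin ler_wpM2l// ler_wpM2r//.
      by apply: le_powRl; [exact: ltW|exact: g0|exact: nig].
    + apply: aeW => w r1 r10.
      pose c := (U w `^ Q * wt w + 1)%R.
      have c0 : (0 < c)%R by rewrite ltr_wpDl// mulr_ge0// powR_ge0.
      pose h := ((r1 / c) `^ Q^-1)%R.
      have h0 : (0 < h)%R by rewrite powR_gt0// divr_gt0.
      (* Once n exceeds |L w| the indicator vanishes and b n w = 1/(n+1). *)
      have [n hn] : exists n, (b n w <= h)%R.
        have [n1] := ltr_add_invr h0; rewrite add0r => n1h.
        pose n2 := (Num.truncn `|L w|%R).+1.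
        exists (maxn n1 n2); rewrite /b [X in (_ + B * X)%R](_ : _ = 0%R).
          rewrite mulr0 addr0; apply: le_trans (ltW n1h).
          by rewrite lef_pV2 ?posrE// ler_nat ltnS leq_maxl.
        rewrite ltNge (@le_trans _ _ n2%:R)//; first exact/ltW/truncnS_gt.
        by rewrite ler_nat leq_maxr.
      exists n; rewrite lee_fin /g.
      apply: (@le_trans _ _ (1 * (g n w `^ Q * wt w))%R).
        by apply: ler_wpM2r; rewrite ?mulr_ge0 ?powR_ge0// indicE; case: (_ \in _).
      rewrite mul1r /g powRM// mulrAC.
      apply: (@le_trans _ _ (c * (r1 / c))%R); last by rewrite mulrC divfK ?gt_eqF.
      apply: ler_pM; rewrite ?mulr_ge0 ?powR_ge0//; first by rewrite lerDl.
      have -> : (r1 / c = h `^ Q)%R.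
        by rewrite /h -powRrM mulVf ?gt_eqF// powRr1// divr_ge0 ?ltW.
      exact: (le_powRl (ltW Q0) (b0 n w) hn).
    + exact: fx.
    + move=> n Hn; exists n; rewrite -/(lam _ x) in Hn.
      apply: (@le_trans _ _ ((r `^ (P / Q)^-1)%:E `^ (P / Q))).
        apply: le_poweRl Hn; first exact: ltW.
        by apply: lam_ge0 => // w; exact: powR_ge0.
      by rewrite poweR_EFin -powRrM mulVf ?gt_eqF// powRr1// ltW.
  - apply: (le_lt_trans (le_rho (ltW P0) Q0 (g0 0%N) (fun _ w _ => g0U w))).
    by apply: rhoB; rewrite addr_ge0.
case=> n Hn; exists n => phi phi0 phig; apply: le_trans Hn.
exact: (le_rho (ltW P0) Q0 phi0 phig).
Qed.

(** Hoelder's inequality for [nu], the weight being distributed as wt^(1/Q) and wt^(1/Q'). *)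
Lemma lam_hoelder (Q Q' : R) (phi psi : W -> R) x : (0 < Q)%R -> (0 < Q')%R ->
  (Q^-1 + Q'^-1 = 1)%R -> measurable_fun setT phi -> (forall w, 0 <= phi w)%R ->
  measurable_fun setT psi -> (forall w, 0 <= psi w)%R ->
  lam (fun w => phi w * psi w)%R x <=
  lam (fun w => phi w `^ Q)%R x `^ Q^-1 * lam (fun w => psi w `^ Q')%R x `^ Q'^-1.
Proof.
move=> Q0 Q'0 QQ mphi phi0 mpsi psi0.
pose F (r : R) (f : W -> R) w := (\1_K (x, w) * (f w * wt w `^ r^-1))%R.
have mF r f : measurable_fun setT f -> measurable_fun setT (F r f).
  move=> mf; apply: measurable_funM.
    exact: (measurableT_comp (measurable_indicK mK) (measurable_pair1 x)).
  by apply: measurable_funM => //; exact: measurable_funT_powR.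
have NE (r : R) (f : W -> R) : (0 < r)%R -> (forall w, 0 <= f w)%R ->
    'N[nu]_r%:E[EFin \o F r f] = lam (fun w => f w `^ r)%R x `^ r^-1.
  move=> r0 f0; rewrite unlock /Lnorm; congr (_ `^ _); apply: eq_integral => w _.
  rewrite /= ger0_norm; last by rewrite /F !mulr_ge0// powR_ge0.
  rewrite /F indicE; case: (_ \in _); last by rewrite !mul0r powR0// gt_eqF.
  rewrite !mul1r powRM//; last exact: powR_ge0.
  by rewrite -powRrM mulVf ?gt_eqF// powRr1.
have := hoelder nu (mF Q _ mphi) (mF Q' _ mpsi) Q0 Q'0 QQ.
rewrite !NE//; apply: le_trans; rewrite Lnorm1; apply: le_integral_nneg => w.
  by rewrite lee_fin !mulr_ge0.
rewrite lee_fin /= ger0_norm; last by rewrite /F !mulr_ge0// powR_ge0.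
rewrite /F indicE; case: (_ \in _); last by rewrite !mul0r.
rewrite !mul1r mulrACA ler_wpM2l ?mulr_ge0//.
have [->|wn0] := eqVneq (wt w) 0%R; first by rewrite mulr_ge0// powR_ge0.
by rewrite -powRDp ?lt0r ?wn0//= QQ powRr1.
Qed.

(** Young's inequality for x/a and y/b, with the factors 1/P and 1/P' bounded by 1. If the P-th and
    P'-th powers have integrals at most a^P and b^P', each term integrates to at most a b. *)
Lemma ereal_young (x y : \bar R) (P P' a b : R) : (0 < P)%R -> (0 < P')%R ->
  (P^-1 + P'^-1 = 1)%R -> (0 < a)%R -> (0 < b)%R -> 0 <= x -> 0 <= y ->
  x * y <= (a * b / a `^ P)%:E * x `^ P + (a * b / b `^ P')%:E * y `^ P'.
Proof.
move=> P0 P'0 PP a0 b0.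
have ca : (0 < a * b / a `^ P)%R by rewrite divr_gt0 ?mulr_gt0 ?powR_gt0.
have cb : (0 < a * b / b `^ P')%R by rewrite divr_gt0 ?mulr_gt0 ?powR_gt0.
have k0 (k : R) (z : \bar R) (r : R) : (0 < k)%R -> 0 <= k%:E * z `^ r.
  by move=> k0; rewrite mule_ge0 ?poweR_ge0// lee_fin ltW.
case: x => [x| |]// x0; case: y => [y| |]// y0; last 3 first.
- have Py := poweRyr (R := R) (lt0r_neq0 P'0).
  by rewrite Py (gt0_muley (x := (_ / b `^ P')%:E)) ?lte_fin// addey ?leey// -ltNye
    (lt_le_trans (ltNyr 0%R))// k0.
- have Py := poweRyr (R := R) (lt0r_neq0 P0).
  by rewrite Py (gt0_muley (x := (_ / a `^ P)%:E)) ?lte_fin// addye ?leey// -ltNye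
    (lt_le_trans (ltNyr 0%R))// k0.
- have Py := poweRyr (R := R) (lt0r_neq0 P0).
  by rewrite Py (gt0_muley (x := (_ / a `^ P)%:E)) ?lte_fin// addye ?leey// -ltNye
    (lt_le_trans (ltNyr 0%R))// k0.
rewrite lee_fin in x0; rewrite lee_fin in y0.
rewrite !poweR_EFin -!EFinM -EFinD lee_fin.
have xa : (0 <= x / a)%R by rewrite divr_ge0// ltW.
have yb : (0 <= y / b)%R by rewrite divr_ge0// ltW.
have Y := conjugate_powR xa yb P0 P'0 PP.
have P1 : (P^-1 <= 1)%R by rewrite -PP lerDl invr_ge0 ltW.
have P'1 : (P'^-1 <= 1)%R by rewrite -PP lerDr invr_ge0 ltW.
have -> : (x * y = a * b * (x / a * (y / b)))%R by field; rewrite !gt_eqF.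
have xaE : ((x / a) `^ P = x `^ P / a `^ P)%R.
  exact: powR_div.
have ybE : ((y / b) `^ P' = y `^ P' / b `^ P')%R.
  exact: powR_div.
rewrite (_ : (_ + _ = a * b * ((x / a) `^ P + (y / b) `^ P'))%R); last first.
  by rewrite xaE ybE; ring.
apply: ler_wpM2l; first by rewrite mulr_ge0// ltW.
by apply: le_trans Y _; rewrite lerD// ler_piMr// powR_ge0.
Qed.

(** By [lam_kap] with h = 1, the pairing is the integral over X of lam (phi psi). Hoelder's
    inequality is used on each cone and the scaled Young inequality over X. *)
Lemma rho_pairing (P P' Q Q' a b : R) (phi psi : W -> R) :
  (0 < P)%R -> (0 < P')%R -> (P^-1 + P'^-1 = 1)%R ->
  (0 < Q)%R -> (0 < Q')%R -> (Q^-1 + Q'^-1 = 1)%R -> (0 < a)%R -> (0 < b)%R ->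
  measurable_fun setT phi -> (forall w, 0 <= phi w)%R ->
  measurable_fun setT psi -> (forall w, 0 <= psi w)%R ->
  rho P Q phi <= (a `^ P)%:E -> rho P' Q' psi <= (b `^ P')%:E ->
  \int[nu]_w ((phi w * psi w * wt w)%:E * kvol w) <= (2 * (a * b))%:E.
Proof.
move=> P0 P'0 PP Q0 Q'0 QQ a0 b0 mphi phi0 mpsi psi0 rphi rpsi.
have ca : (0 <= a * b / a `^ P)%R by rewrite divr_ge0 ?mulr_ge0 ?powR_ge0// ltW.
have cb : (0 <= a * b / b `^ P')%R by rewrite divr_ge0 ?mulr_ge0 ?powR_ge0// ltW.
have := @lam_kap _ _ R X W mu nu K wt mK mwt wt_ge0 (fun=> 1%R) (fun w => phi w * psi w)%R
  (measurable_cst _) (fun=> ler01) (measurable_funM mphi mpsi)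
  (fun w => mulr_ge0 (phi0 w) (psi0 w)).
rewrite /kvol => <-.
apply: (@le_trans _ _ (\int[mu]_x
   ((a * b / a `^ P)%:E * lam (fun w => phi w `^ Q)%R x `^ (P / Q) +
    (a * b / b `^ P')%:E * lam (fun w => psi w `^ Q')%R x `^ (P' / Q')))).
  have l0 r (f : W -> R) x : 0 <= lam (fun w => f w `^ r)%R x.
    by apply: lam_ge0 => // w; exact: powR_ge0.
  apply: le_integral_nneg => x; rewrite mul1e.
    by apply: lam_ge0 => // w; exact: mulr_ge0.
  apply: (le_trans (lam_hoelder _ Q0 Q'0 QQ mphi phi0 mpsi psi0)).
  have := ereal_young P0 P'0 PP a0 b0 (poweR_ge0 (lam (fun w => phi w `^ Q)%R x) Q^-1)
    (poweR_ge0 (lam (fun w => psi w `^ Q')%R x) Q'^-1).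
  by rewrite -!poweRrM (mulrC _ P) (mulrC _ P').
rewrite ge0_integralD//; last 4 first.
- by move=> x _; rewrite mule_ge0 ?poweR_ge0// lee_fin.
- by apply: measurable_funeM; exact/measurable_funT_poweR/measurable_lam_powR.
- by move=> x _; rewrite mule_ge0 ?poweR_ge0// lee_fin.
- by apply: measurable_funeM; exact/measurable_funT_poweR/measurable_lam_powR.
rewrite !ge0_integralZl_EFin//; last 4 first.
- by move=> x _; exact: poweR_ge0.
- exact/measurable_funT_poweR/measurable_lam_powR.
- by move=> x _; exact: poweR_ge0.
- exact/measurable_funT_poweR/measurable_lam_powR.
rewrite mulr2n mulrDl mul1r EFinD; apply: leeD.
  apply: (@le_trans _ _ ((a * b / a `^ P)%:E * (a `^ P)%:E)).
    by apply: lee_wpmul2l; rewrite ?lee_fin.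
  by rewrite -EFinM divfK// gt_eqF// powR_gt0.
apply: (@le_trans _ _ ((a * b / b `^ P')%:E * (b `^ P')%:E)).
  by apply: lee_wpmul2l; rewrite ?lee_fin.
by rewrite -EFinM divfK// gt_eqF// powR_gt0.
Qed.

End mixed_norm.

(** * Tent norms as mixed norms *)

Section tent_norm_rho.
Context d (R : realType) (X : metricMeasurableType d R).
Variable mu : {sigma_finite_measure set X -> \bar R}.
Hypotheses (borelX : borel_space X) (volX : vol_pos_fin mu).
Variable alpha : R.
Hypothesis alpha_gt0 : 0 < alpha.

Local Notation K := (@cone_rel d R X alpha).
Local Notation nu := (tent_meas mu).
Local Notation wt := (@tent_weight d R X mu alpha).
Local Notation normc := (@Normc.normc R).
Local Notation rho := (rho mu nu K wt).
Let mK := measurable_cone_rel borelX volX alpha.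
Let mwt := measurable_tent_weight borelX volX alpha_gt0.
Let wt_ge0 := tent_weight_ge0 mu borelX alpha_gt0.

(** The values of f at nonpositive heights are meaningless; setting them to 0 makes the modulus
    measurable on all of [X * R]. *)
Definition cmod (f : X * R -> R[i]) (w : X * R) : R :=
  if 0 < w.2 then normc (f w) else 0.

Lemma cmod_ge0 f w : 0 <= cmod f w.
Proof. by rewrite /cmod; case: ifP => // _; exact: normc_ge0. Qed.

Lemma measurable_upper_restrict (g : X * R -> R) : measurable_fun (upper X) g ->
  measurable_fun setT (fun w : X * R => if 0 < w.2 then g w else 0).
Proof.
move=> mg; have := (measurable_restrictT g (@measurable_upper d R X)).1 mg.
by congr measurable_fun; apply/funext => w; rewrite patchE mem_setE.
Qed.

Lemma cmfun_measurable (f : cmfunType X) :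
  measurable_fun (upper X) (fun z => complex.Re (f z)) /\
  measurable_fun (upper X) (fun z => complex.Im (f z)).
Proof. by case: f => f H; have /asboolP := H. Qed.

Lemma measurable_cmod (f : cmfunType X) : measurable_fun setT (cmod f).
Proof.
have [mr mi] := cmfun_measurable f.
rewrite (_ : cmod f = fun w => if 0 < w.2 then
    (complex.Re (f w) ^+ 2 + complex.Im (f w) ^+ 2) `^ 2^-1 else 0); last first.
  apply/funext => w; rewrite /cmod; case: ifP => // _.
  by rewrite -normc_sqr powR12_sqrt ?sqr_ge0// sqrtr_sqr ger0_norm ?normc_ge0.
apply: measurable_upper_restrict.
apply: (measurableT_comp (measurable_powR _)).
by apply: measurable_funD; exact: measurable_funX.
Qed.

Lemma lam_cmod (q : R) (f : X * R -> R[i]) x :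
  lam nu K wt (fun w => normc (f w) `^ q) x = lam nu K wt (fun w => cmod f w `^ q) x.
Proof.
apply: eq_integral => w _; rewrite indicE; case: (boolP (_ \in _)) => [|_].
  by rewrite inE => /(cone_rel_gt0 alpha_gt0); rewrite /cmod => ->.
by rewrite !mul0r.
Qed.

Lemma tent_normE (P Q : R) (F : ae_class mu) : P != 0 ->
  (tent_norm mu P Q alpha F = rho P Q (cmod (repr F)) `^ P^-1)%E.
Proof.
move=> P0; rewrite /tent_norm unlock; congr (_ `^ _)%E; apply: eq_integral => x _.
rewrite gee0_abs ?poweR_ge0// (area_lam mu alpha_gt0) lam_cmod.
by rewrite -poweRrM mulrC.
Qed.

Lemma rho_to_class (P Q : R) (f : cmfunType X) :
  rho P Q (cmod (repr (to_class mu f))) = rho P Q (cmod f).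
Proof.
apply: eq_rho => x.
have /asboolP ae0 : (repr (to_class mu f) - f : cmfunType X) \in ae_null mu.
  by apply/to_classP; rewrite to_class_repr.
refine (@ae_eq_lam _ _ _ _ _ nu K wt mK mwt (fun w => cmod (repr (to_class mu f)) w `^ Q) (fun w => cmod f w `^ Q) x _ _ _).
- exact: (measurable_funT_powR Q (measurable_cmod _)).
- exact: (measurable_funT_powR Q (measurable_cmod _)).
have FF := ae_filter_ringOfSetsType (mu \x @lebesgue_measure R)%E.
apply: filterS ae0 => w H; have [w0|w0] := leP w.2 0.
  by rewrite tent_weight_le0// !mulr0.
rewrite /cmod w0; have /eqP := H w0.
by rewrite -[X in X == _]/(repr (to_class mu f) w - f w) subr_eq0 => /eqP ->.
Qed.

Lemma cone_rel_cmod (f : X * R -> R[i]) (U : X * R -> R) :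
  (forall w : X * R, 0 < w.2 -> normc (f w) <= U w) ->
  forall (x : X) (w : X * R), K (x, w) -> cmod f w <= U w.
Proof.
move=> H x w /(cone_rel_gt0 alpha_gt0) w0; rewrite /cmod w0; exact: H.
Qed.

Lemma le_tent_norm (P Q a : R) (f : cmfunType X) (U : X * R -> R) :
  0 < P -> 0 < Q -> 0 <= a -> (forall w : X * R, 0 < w.2 -> normc (f w) <= U w) ->
  (rho P Q U <= (a `^ P)%:E)%E -> (tent_norm mu P Q alpha (to_class mu f) <= a%:E)%E.
Proof.
move=> P0 Q0 a0 fU rU; rewrite tent_normE ?gt_eqF// rho_to_class.
have -> : (a%:E = (a `^ P)%:E `^ P^-1)%E.
  by rewrite poweR_EFin -powRrM mulfV ?gt_eqF// powRr1.
apply: le_poweRl; [by rewrite invr_ge0 ltW|exact: rho_ge0|].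
apply: le_trans rU; apply: (@le_rho _ _ _ _ _ mu nu K wt wt_ge0) => //; first exact: ltW.
  exact: cmod_ge0.
exact: cone_rel_cmod.
Qed.

Lemma tent_norm_small (P Q : R) (U L : X * R -> R) (B : R) : 0 < P -> 0 < Q ->
  measurable_fun setT U -> (forall w, 0 <= U w) -> measurable_fun setT L ->
  0 <= B -> (rho P Q U < +oo)%E -> forall e : R, 0 < e -> exists n : nat,
  forall (f : cmfunType X) (k : nat), (n <= k)%N ->
    (forall w : X * R, 0 < w.2 -> normc (f w) <= U w * (k.+1%:R^-1 + B * (k%:R < `|L w|)%R%:R)) ->
    (tent_norm mu P Q alpha (to_class mu f) <= e%:E)%E.
Proof.
move=> P0 Q0 mU U0 mL B0 rU e e0.
have eP : 0 < e `^ P by exact: powR_gt0.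
have [n Hn] := @rho_small _ _ _ _ _ mu nu K wt mK mwt wt_ge0 P Q U L B P0 Q0 mU U0 mL B0 rU _ eP.
exists n => f k nk fk.
apply: (le_tent_norm (U := cmod f) P0 Q0 (ltW e0)).
  by move=> w w0; rewrite /cmod w0.
apply: Hn => [w|]; first exact: cmod_ge0.
apply: cone_rel_cmod => w w0; apply: le_trans (fk w w0) _.
apply: ler_wpM2l; first exact: U0.
apply: lerD; first by rewrite lef_pV2 ?posrE// ler_nat.
apply: ler_wpM2l => //; case: (ltP k%:R `|L w|) => [kL|_]//.
by rewrite (le_lt_trans _ kL)// ler_nat.
Qed.

Lemma cmfun_mul (f : cmfunType X) (g : X * R -> R[i]) :
  measurable_fun (upper X) (fun w => complex.Re (g w)) ->
  measurable_fun (upper X) (fun w => complex.Im (g w)) ->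
  (fun w => f w * g w) \in @cmfun d R X.
Proof.
move=> mr mi; have [fr fi] := cmfun_measurable f; apply/asboolP; split.
  under eq_fun do rewrite Re_cM.
  by apply: measurable_funB; exact: measurable_funM.
under eq_fun do rewrite Im_cM.
by apply: measurable_funD; exact: measurable_funM.
Qed.

Lemma to_classB (f g : cmfunType X) :
  to_class mu f - to_class mu g = to_class mu (f - g).
Proof. by have := to_classD mu (f - g) g; rewrite subrK => ->; rewrite addrK. Qed.

Lemma rho_le_tent_norm (P Q a : R) (F : ae_class mu) : 0 < P ->
  (tent_norm mu P Q alpha F <= a%:E)%E -> (rho P Q (cmod (repr F)) <= (a `^ P)%:E)%E.
Proof.
move=> P0; rewrite tent_normE ?gt_eqF// => H.
rewrite -poweR_EFin -[leLHS](poweRe1 (rho_ge0 _ _ _ _ _ _ _)) -(mulVf (lt0r_neq0 P0)).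
by rewrite poweRrM; apply: le_poweRl H; [exact: ltW|exact: poweR_ge0].
Qed.

Lemma tent_norm_ge0 (P Q : R) (F : ae_class mu) : (0 <= tent_norm mu P Q alpha F)%E.
Proof. exact: Lnorm_ge0. Qed.

Lemma tent_normD_le (P Q : R) : 0 < P -> 0 < Q -> exists2 C : R, 0 < C &
  forall (F G : ae_class mu) (a : R), 0 <= a -> (tent_norm mu P Q alpha F <= a%:E)%E ->
    (tent_norm mu P Q alpha G <= a%:E)%E -> (tent_norm mu P Q alpha (F + G)%R <= (C * a)%:E)%E.
Proof.
move=> P0 Q0; pose C0 : R := 2 `^ P * 2 `^ (P / Q) * 2.
have C00 : 0 < C0 by rewrite !mulr_gt0// powR_gt0.
exists (C0 `^ P^-1) => [|F G a a0 Fa Ga]; first exact: powR_gt0.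
have C1 : 0 <= C0 `^ P^-1 by exact: powR_ge0.
rewrite -(to_class_repr F) -(to_class_repr G) -to_classD.
apply: (le_tent_norm (U := fun w => cmod (repr F) w + cmod (repr G) w) P0 Q0).
- exact: mulr_ge0.
- by move=> w w0; rewrite /cmod w0; exact: ler_normcD.
have mF := measurable_cmod (repr F); have mG := measurable_cmod (repr G).
apply: (le_trans (@rhoD_le _ _ _ _ _ mu nu K wt mK mwt wt_ge0 P Q _ _ P0 Q0
  mF (cmod_ge0 _) mG (cmod_ge0 _))).
have rF := rho_le_tent_norm P0 Fa; have rG := rho_le_tent_norm P0 Ga.
rewrite (powRM _ C1 a0) -powRrM mulVf ?gt_eqF// powRr1 ?(ltW C00)//.
have -> : C0 * a `^ P = 2 `^ P * 2 `^ (P / Q) * (2 * a `^ P) by rewrite mulrA.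
rewrite [in leRHS]EFinM; apply: lee_wpmul2l.
  by rewrite lee_fin mulr_ge0// powR_ge0.
have -> : 2 * a `^ P = a `^ P + a `^ P by rewrite mulr_natl mulr2n.
exact: (leeD rF rG).
Qed.

End tent_norm_rho.

(** * The complex exponential *)

Section complex_exponential.
Context {R : realType}.
Local Notation C := R[i].
Local Notation normc := (@Normc.normc R).
Local Notation Re := (@complex.Re R).
Local Notation Im := (@complex.Im R).
Implicit Types (z w : C) (l x y e r : R).

Definition cexp z : C := (expR (Re z) * cos (Im z)) +i* (expR (Re z) * sin (Im z)).

Lemma normc_cexp z : normc (cexp z) = expR (Re z).
Proof.
rewrite /= !exprMn -mulrDr cos2Dsin2 mulr1 sqrtr_sqr ger0_norm//; exact: expR_ge0.
Qed.

Lemma cexpD z w : cexp (z + w) = cexp z * cexp w.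
Proof.
case: z w => [a b] [c d]; rewrite /cexp /=.
by apply/eqP; rewrite eq_complex /= expRD cosD sinD; apply/andP; split; apply/eqP; ring.
Qed.

Lemma normr_sin_le y : `|sin y| <= `|y|.
Proof.
wlog y0 : y / 0 <= y => [H|].
  have [|y0] := leP 0 y; first exact: H.
  by have := H (- y); rewrite sinN !normrN oppr_ge0 => ->//; exact: ltW.
have [c _] := @MVT_segment R (@sin R) (@cos R) 0 y y0
  (fun x _ => is_derive_sin x) (continuous_subspaceT (@continuous_sin R)).
rewrite sin0 !subr0 => ->; rewrite normrM ler_piMl//.
by rewrite ler_norml cos_geN1 cos_le1.
Qed.

Lemma cos_ge1Bsqr y : `|cos y - 1| <= y ^+ 2.
Proof.
rewrite {1}(splitr y) cosD; have := cos2Dsin2 (y / 2).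
set a := cos _; set b := sin _ => ab.
have -> : a * a - b * b - 1 = - (2 * b ^+ 2) by move: ab; rewrite !expr2; lra.
rewrite normrN ger0_norm; last by rewrite mulr_ge0// sqr_ge0.
have := normr_sin_le (y / 2); rewrite -/b => bh.
have : `|b| ^+ 2 <= `|y / 2| ^+ 2 by rewrite lerXn2r ?nnegrE.
rewrite !real_normK ?num_real//.
have := sqr_ge0 y; rewrite expr2; lra.
Qed.

Lemma normr_subr_sin_le y : `|sin y - y| <= 2 * y ^+ 2.
Proof.
wlog y0 : y / 0 <= y => [H|].
  have [|y0] := leP 0 y; first exact: H.
  have := H (- y); rewrite oppr_ge0 sqrrN sinN -opprD normrN => ->//; exact: ltW.
have [c cy] := @MVT_segment R (fun x => sin x - x) (fun x => cos x - 1) 0 y y0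
  (fun x _ => is_deriveB (is_derive_sin x) (is_derive_id x 1)) (continuous_subspaceT
    (fun x => continuousB (@continuous_sin R x) (@cvg_id _ (nbhs x)))).
rewrite sin0 !subr0 => ->; rewrite normrM (ger0_norm y0) expr2 mulrA.
apply: ler_wpM2r => //.
move: cy; rewrite in_itv/= => /andP[c0 cy].
have := cos_ge1Bsqr c; have := cos_geN1 c; have c1 := cos_le1 c.
rewrite ler0_norm ?subr_le0// => cN1 H.
have [c1'|c1'] := leP c 1; last by lra.
have : c ^+ 2 <= c by rewrite expr2 ler_piMl// ltW.
lra.
Qed.

Lemma expR_mul1B_le x : (1 - x) * expR x <= 1.
Proof.
have := expR_ge1Dx (- x); rewrite -(ler_pM2r (expR_gt0 x)).
by rewrite expRN mulVf ?gt_eqF ?expR_gt0.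
Qed.

Lemma normr_expR_sub1 x : `|expR x - 1| <= `|x| * expR `|x|.
Proof.
have [x0|x0] := leP 0 x.
  rewrite ger0_norm; last by rewrite subr_ge0 -expR0 ler_expR.
  by rewrite (ger0_norm x0); have := expR_mul1B_le x; lra.
rewrite ler0_norm; last by rewrite subr_le0 -expR0 ler_expR ltW.
rewrite (ltr0_norm x0); have := expR_ge1Dx x.
have : 1 <= expR (- x) by rewrite -expR0 ler_expR; lra.
have := expR_gt0 x; nra.
Qed.

Lemma normr_expR_sub1x x : `|expR x - 1 - x| <= x ^+ 2 * expR `|x|.
Proof.
have H := expR_ge1Dx x; rewrite ger0_norm; last by lra.
have H1 := normr_expR_sub1 x.
have [x0|x0] := leP 0 x.
  move: H1; rewrite (ger0_norm x0) ger0_norm ?subr_ge0 -?expR0 ?ler_expR// expR0 => H1.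
  have H2 := expR_mul1B_le x.
  have : x * (expR x - 1) <= x * (x * expR x) by rewrite ler_wpM2l.
  by rewrite expr2; lra.
have H2 := expR_mul1B_le x; rewrite (ltr0_norm x0).
have e1 : 1 <= expR (- x) by rewrite -expR0 ler_expR; lra.
have : x ^+ 2 <= x ^+ 2 * expR (- x) by rewrite ler_peMr// sqr_ge0.
have : (- x) * (1 - expR x) <= (- x) * (- x) by rewrite ler_wpM2l//; lra.
rewrite expr2; lra.
Qed.

Lemma normc_cexp_sub1D z : normc (cexp z - 1 - z) <= 5 * normc z ^+ 2 * expR (normc z).
Proof.
set n := normc z; have n0 : 0 <= n by exact: normc_ge0.
have xn : `|Re z| <= n by exact: normc_ge_absRe.
have yn : `|Im z| <= n by exact: normc_ge_absIm.
have eRn : expR `|Re z| <= expR n by rewrite ler_expR.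
have eR : expR (Re z) <= expR n by rewrite ler_expR (le_trans (ler_norm _)).
have e1 : 1 <= expR n by rewrite -expR0 ler_expR.
have x2 : Re z ^+ 2 <= n ^+ 2 by rewrite -(real_normK (num_real (Re z))) lerXn2r ?nnegrE.
have y2 : Im z ^+ 2 <= n ^+ 2 by rewrite -(real_normK (num_real (Im z))) lerXn2r ?nnegrE.
have n2 := sqr_ge0 n.
apply: le_trans (normc_le_add _) _.
(* The real part contributes 1 + 1 and the imaginary part 1 + 2 to the constant 5. *)
rewrite (_ : 5 * _ * _ = (n ^+ 2 * expR n + expR n * n ^+ 2) +
  (n * expR n * n + 2 * n ^+ 2 * expR n)); last by ring.
apply: lerD.
  have -> : Re (cexp z - 1 - z) = (expR (Re z) - 1 - Re z) + expR (Re z) * (cos (Im z) - 1).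
    by rewrite !Re_cB /=; ring.
  apply: le_trans (ler_normD _ _) _; apply: lerD.
    apply: le_trans (normr_expR_sub1x _) _; apply: ler_pM => //; exact: sqr_ge0.
  rewrite normrM ger0_norm ?expR_ge0//; apply: ler_pM => //.
  exact: le_trans (cos_ge1Bsqr _) _.
have -> : Im (cexp z - 1 - z) = (expR (Re z) - 1) * sin (Im z) + (sin (Im z) - Im z).
  by rewrite !Im_cB /=; ring.
apply: le_trans (ler_normD _ _) _; apply: lerD.
  rewrite normrM; apply: ler_pM => //; last exact: le_trans (normr_sin_le _) _.
  apply: le_trans (normr_expR_sub1 _) _; apply: ler_pM => //; exact: expR_ge0.
apply: le_trans (normr_subr_sin_le _) _.
have : n ^+ 2 <= n ^+ 2 * expR n by rewrite ler_peMr.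
lra.
Qed.

Lemma normc_cexp_sub1 z : normc (cexp z - 1) <= 6 * normc z * expR (2 * normc z).
Proof.
set n := normc z; have n0 : 0 <= n by exact: normc_ge0.
have e1 : 1 <= expR n by rewrite -expR0 ler_expR.
have en : n <= expR n by have := expR_ge1Dx n; lra.
have -> : expR (2 * n) = expR n * expR n by rewrite -expRD; congr expR; ring.
rewrite -(subrK z (cexp z - 1)); apply: le_trans (ler_normcD _ _) _.
have := normc_cexp_sub1D z; rewrite -/n => H.
apply: (@le_trans _ _ (5 * n ^+ 2 * expR n + n)); first by rewrite lerD2r.
have e0 := expR_gt0 n.
have : n * n * expR n <= n * expR n * expR n.
  by rewrite ler_wpM2r ?expR_ge0// ler_wpM2l.
have : n <= n * (expR n * expR n) by rewrite ler_peMr//; nra.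
rewrite expr2; lra.
Qed.

Lemma sqr_le_expR e : 0 < e -> exists2 c, 0 < c & forall x, x ^+ 2 <= c * expR (e * `|x|).
Proof.
move=> e0; exists (4 / e ^+ 2); first by rewrite divr_gt0// exprn_gt0.
move=> x; have := expR_ge1Dx (e * `|x| / 2); set t := e * `|x| / 2 => H.
have t0 : 0 <= t by rewrite divr_ge0// mulr_ge0// ltW.
have -> : e * `|x| = t + t by rewrite /t; field.
rewrite expRD -(real_normK (num_real x)).
have -> : `|x| = 2 / e * t by rewrite /t; field; rewrite gt_eqF.
rewrite [leRHS](_ : _ = (2 / e * expR t) ^+ 2); last by field; rewrite gt_eqF.
have ei : 0 <= 2 / e by rewrite divr_ge0// ltW.
rewrite lerXn2r// ?nnegrE; first exact: mulr_ge0.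
  by rewrite mulr_ge0// expR_ge0.
by rewrite ler_wpM2l//; lra.
Qed.

Section gaussian_family.
Variable th : R.

(* The factor [exp (z ^ 2 - th ^ 2)] makes the traces vanish at infinity. *)
Definition gexp z (l : R) : C := cexp ((z - th%:C) * l%:C + z ^+ 2 - th%:C ^+ 2).

Lemma gexp_center l : gexp th%:C l = 1.
Proof.
rewrite /gexp subrr mul0r add0r subrr /cexp /= expR0 cos0 sin0 mulr1 mulr0.
by [].
Qed.

Lemma normc_gexp z l : 0 <= Re z <= 1 ->
  normc (gexp z l) <= expR 1 * expR (- Im z ^+ 2) * expR ((Re z - th) * l).
Proof.
move=> /andP[x0 x1]; rewrite normc_cexp.
rewrite (_ : Re _ = (Re z - th) * l + (Re z ^+ 2 - Im z ^+ 2 - th ^+ 2)); last first.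
  by case: z x0 x1 => x y /= _ _; ring.
rewrite -!expRD ler_expR.
have : Re z ^+ 2 <= 1 by rewrite expr_le1.
have := sqr_ge0 th; lra.
Qed.

(** As x runs over [0, 1] the exponent is monotone, so the exponential is dominated by its larger
    endpoint value. *)
Lemma expR_mix_le (x a l : R) : 0 <= x <= 1 ->
  expR ((x - a) * l) <= expR (- a * l) + expR ((1 - a) * l).
Proof.
move=> /andP[x0 x1]; have [l0|l0] := leP 0 l.
  apply: ler_wpDl; first exact: expR_ge0.
  by rewrite ler_expR ler_wpM2r// lerD2r.
apply: ler_wpDr; first exact: expR_ge0.
by rewrite ler_expR; apply: ler_wnM2r; [exact: ltW|rewrite lerDr].
Qed.

Lemma gexpB z w l : gexp w l - gexp z l =
  gexp z l * (cexp ((w - z) * (l%:C + w + z)) - 1).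
Proof.
rewrite mulrBr mulr1; congr (_ - _); rewrite -cexpD; congr cexp; ring.
Qed.

(** The quotient of the two values depends on l only through (w - z)(l + w + z), so the relative
    error is uniform for |l| <= k. Large |l| is left to the smallness lemmas for cut-off
    multipliers. *)
Lemma gexp_continuous z k e : 0 < e -> exists2 r, 0 < r &
  forall w l, normc (w - z) < r -> `|l| <= k ->
    normc (gexp w l - gexp z l) <= e * normc (gexp z l).
Proof.
move=> e0; pose M := `|k| + 2 * normc z + 1.
have M1 : 1 <= M by rewrite lerDr addr_ge0 ?normr_ge0// mulr_ge0// normc_ge0.
have M0 : 0 < M by exact: lt_le_trans M1.
pose c := 6 * M * expR (2 * M).
have c0 : 0 < c by rewrite !mulr_gt0// expR_gt0.
have [r r0 [r1 re]] : exists2 r, 0 < r & r < 1 /\ r < e / c.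
  have [|r r0 /= /and3P[]] := exists_small (l := [:: 1; e / c]); last by exists r.
  by rewrite /= ltr01 divr_gt0.
exists r => // w l wz lk; rewrite gexpB Normc.normcM mulrC.
apply: ler_wpM2r; first exact: normc_ge0.
set t := normc (w - z) in wz.
have t0 : 0 <= t by exact: normc_ge0.
have t1 : t <= 1 by rewrite ltW// (lt_trans wz).
have nM : normc ((w - z) * (l%:C + w + z)) <= t * M.
  rewrite Normc.normcM; apply: ler_wpM2l => //.
  rewrite (_ : l%:C + w + z = l%:C + (z + z) + (w - z)); last by ring.
  apply: le_trans (ler_normcD _ _) _; rewrite /M; apply: lerD => //.
  apply: le_trans (ler_normcD _ _) _; rewrite normc_real; apply: lerD.
    by apply: le_trans lk _; exact: ler_norm.
  by apply: le_trans (ler_normcD _ _) _; rewrite mulr_natl mulr2n.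
apply: le_trans (normc_cexp_sub1 _) _.
apply: (@le_trans _ _ (t * c)); last first.
  by rewrite -ler_pdivlMr// ltW// (lt_trans wz).
rewrite (_ : t * c = 6 * (t * M) * expR (2 * M)); last by rewrite /c; ring.
apply: ler_pM.
- by rewrite mulr_ge0// normc_ge0.
- exact: expR_ge0.
- by rewrite ler_wpM2l.
- rewrite ler_expR ler_wpM2l//; apply: le_trans nM _.
  by rewrite ler_piMl// ltW.
Qed.

(** The second-order remainder carries a factor l^2, absorbed by a small exponential of |l|. In the
    open strip there is room for it: Re z is at distance at least 2 eta from 0 and 1, so the
    enlarged exponent still lies between the two boundary exponents. *)
Lemma gexp_derivative z : 0 < Re z < 1 -> exists2 K, 0 < K & exists2 r, 0 < r &
  forall h l, h != 0 -> normc h < r ->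
    normc (h^-1 * (gexp (z + h) l - gexp z l) - (l%:C + 2 * z) * gexp z l) <=
    normc h * (K * (expR (- th * l) + expR ((1 - th) * l))).
Proof.
move=> /andP[x0 x1].
pose eta := Num.min (Re z) (1 - Re z) / 2.
have eta0 : 0 < eta by rewrite divr_gt0// lt_min x0 subr_gt0.
have [c c0 sq] := sqr_le_expR eta0.
pose N := 2 * normc z + 1.
have N1 : 1 <= N by rewrite lerDr mulr_ge0// normc_ge0.
have N0 : 0 <= N by exact: le_trans N1.
pose K1 := 10 * (c + N ^+ 2) * expR N + 1.
have K10 : 0 < K1.
  by rewrite ltr_wpDl// mulr_ge0 ?expR_ge0// mulr_ge0// addr_ge0 ?sqr_ge0// ltW.
exists (expR 1 * K1); first by rewrite mulr_gt0// expR_gt0.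
have [r r0 [r1 re]] : exists2 r, 0 < r & r < 1 /\ r < eta.
  have [|r r0 /= /and3P[]] := exists_small (l := [:: 1; eta]); last by exists r.
  by rewrite /= ltr01 eta0.
exists r => // h l hn0 hr; rewrite gexpB addrAC subrr add0r.
set a := l%:C + (z + h) + z.
have aE : a = l%:C + 2 * z + h by rewrite /a; ring.
have -> : h^-1 * (gexp z l * (cexp (h * a) - 1)) - (l%:C + 2 * z) * gexp z l =
    gexp z l * (h^-1 * (cexp (h * a) - 1 - h * a) + h).
  by rewrite aE; field.
have h0 : 0 <= normc h by exact: normc_ge0.
have h1 : normc h <= 1 by rewrite ltW// (lt_trans hr).
have aN : normc a <= `|l| + N.
  rewrite aE /N addrA; apply: le_trans (ler_normcD _ _) _; apply: lerD => //.
  apply: le_trans (ler_normcD _ _) _; rewrite normc_real lerD2l.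
  by rewrite mulr_natl mulr2n; apply: le_trans (ler_normcD _ _) _; rewrite mulr_natl mulr2n.
have a0 := normc_ge0 a; have l0 := normr_ge0 l.
have G : normc (h^-1 * (cexp (h * a) - 1 - h * a) + h) <=
    normc h * (K1 * expR (2 * eta * `|l|)).
  have e1 : 1 <= expR (2 * eta * `|l|).
    by rewrite -[leLHS]expR0 ler_expR mulr_ge0// mulr_ge0// ltW.
  have hn : normc h != 0 by rewrite normc_eq0.
  apply: le_trans (ler_normcD _ _) _.
  rewrite (_ : normc h * (K1 * _) = normc h * (10 * (c + N ^+ 2) * expR N *
    expR (2 * eta * `|l|)) + normc h * expR (2 * eta * `|l|)); last by rewrite /K1; ring.
  apply: lerD; last by rewrite ler_peMr.
  rewrite Normc.normcM Normc.normcV.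
  have := normc_cexp_sub1D (h * a); rewrite Normc.normcM => H.
  apply: (@le_trans _ _ ((normc h)^-1 * (5 * (normc h * normc a) ^+ 2 * expR (normc h * normc a)))).
    by apply: ler_wpM2l => //; rewrite invr_ge0.
  rewrite (_ : _^-1 * _ = normc h * (5 * normc a ^+ 2 * expR (normc h * normc a))); last first.
    by field.
  apply: ler_wpM2l => //.
  have -> : 10 * (c + N ^+ 2) * expR N * expR (2 * eta * `|l|) =
      (10 * (c + N ^+ 2) * expR (eta * `|l|)) * (expR N * expR (eta * `|l|)).
    have -> : expR (2 * eta * `|l|) = expR (eta * `|l|) * expR (eta * `|l|).
      by rewrite -expRD; congr expR; ring.
    by ring.
  have el : 1 <= expR (eta * `|l|) by rewrite -[leLHS]expR0 ler_expR mulr_ge0// ltW.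
  apply: ler_pM; [by rewrite mulr_ge0// sqr_ge0|exact: expR_ge0| |].
    have a2 : normc a ^+ 2 <= (`|l| + N) ^+ 2.
      by rewrite lerXn2r ?nnegrE//; rewrite addr_ge0.
    have N2 : N ^+ 2 <= N ^+ 2 * expR (eta * `|l|) by rewrite ler_peMr// sqr_ge0.
    have := sq l; rewrite -(real_normK (num_real l)) => sql.
    have := sqr_ge0 (`|l| - N); rewrite sqrrB => sN.
    rewrite sqrrD in a2; lra.
  rewrite -expRD ler_expR.
  apply: (@le_trans _ _ (normc h * (`|l| + N))); first by rewrite ler_wpM2l.
  rewrite mulrDr addrC; apply: lerD; first by rewrite ler_piMl.
  by rewrite ler_wpM2r// ltW// (lt_trans hr).
rewrite Normc.normcM mulrC.
apply: le_trans (ler_pM (normc_ge0 _) (normc_ge0 _) G (normc_gexp l _)) _.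
  by rewrite !ltW.
rewrite [leLHS](_ : _ = normc h * (expR 1 * K1) * (expR (- Im z ^+ 2) *
  (expR ((Re z - th) * l) * expR (2 * eta * `|l|)))); last first.
  move: (expR (- _)) (expR ((_ - _) * _)) (expR (2 * _ * _)) (expR 1) => u v t s.
  by ring.
rewrite (_ : normc h * (expR 1 * K1 * _) = normc h * (expR 1 * K1) * (expR (- th * l) + expR ((1 - th) * l))); last by rewrite !mulrA.
apply: ler_wpM2l.
  by rewrite mulr_ge0// mulr_ge0 ?expR_ge0// ltW.
apply: (@le_trans _ _ (expR ((Re z - th) * l) * expR (2 * eta * `|l|))).
  rewrite ler_piMl ?mulr_ge0 ?expR_ge0//.
  by rewrite -[leRHS]expR0 ler_expR oppr_le0 sqr_ge0.
rewrite -expRD.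
have eta1 : 2 * eta <= Re z by rewrite mulrC divfK// ge_min lexx.
have eta2 : 2 * eta <= 1 - Re z by rewrite mulrC divfK// ge_min lexx orbT.
have [l0'|l0'] := leP 0 l.
  rewrite (_ : _ + _ = (Re z + 2 * eta - th) * l); last by rewrite ger0_norm//; ring.
  by apply: expR_mix_le; lra.
rewrite (_ : _ + _ = (Re z - 2 * eta - th) * l); last by rewrite ltr0_norm//; ring.
by apply: expR_mix_le; lra.
Qed.

End gaussian_family.

End complex_exponential.

(** * From the tent space to the interpolation space *)

Section limits.
Context (R : realType).
Local Notation normc := (@Normc.normc R).

Lemma nneg_cvge0 (T : Type) (F : set_system T) (FF : Filter F) (g : T -> \bar R) :
  (forall t, (0 <= g t)%E) -> (forall e : R, 0 < e -> \forall t \near F, (g t <= e%:E)%E) ->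
  (g t @[t --> F] --> 0)%E.
Proof.
move=> g0 H; apply/fine_cvgP; split.
  apply: filterS (H 1 ltr01) => t gt.
  by rewrite ge0_fin_numE// (le_lt_trans gt)// ltry.
apply/cvgrPdist_le => e e0; apply: filterS (H e e0) => t gt.
rewrite sub0r normrN ger0_norm ?fine_ge0//.
by rewrite -lee_fin fineK// ge0_fin_numE// (le_lt_trans gt)// ltry.
Qed.

Lemma cvge0_near (T : Type) (F : set_system T) (FF : Filter F) (g : T -> \bar R) :
  (g t @[t --> F] --> 0)%E -> forall e : R, 0 < e -> \forall t \near F, (g t <= e%:E)%E.
Proof.
move=> /fine_cvgP[gfin /cvgrPdist_le H] e e0.
apply: filterS2 gfin (H e e0) => t gt /=.
rewrite sub0r normrN => le; rewrite -[leLHS]fineK// lee_fin.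
by apply: le_trans le; exact: ler_norm.
Qed.

Lemma normc_sqrtE (z : R[i]) : normc z = Num.sqrt (complex.Re z ^+ 2 + complex.Im z ^+ 2).
Proof. by case: z. Qed.

Lemma nbhs_normc (z : R[i]) (r : R) : 0 < r ->
  nbhs (z : R[i]^o) [set w | normc (w - z) < r].
Proof.
move=> r0; apply/nbhs_ballP; exists r%:C; first by rewrite /= ltcR.
move=> w; rewrite /ball/= normc_def ltcR => H.
by rewrite /= normcB normc_sqrtE.
Qed.

Lemma nbhs_normcP (z : R[i]) (A : set R[i]) : nbhs (z : R[i]^o) A ->
  exists2 r, 0 < r & forall w, normc (w - z) < r -> A w.
Proof.
move=> /nbhs_ballP[e /= e0 eA]; exists (complex.Re e).
  by move: e0; case: (e) => a b; rewrite ltcE/= => /andP[].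
move=> w wz; apply: eA; rewrite /ball/= normc_def.
have -> : e = (complex.Re e)%:C.
  by move: e0; case: (e) => a b; rewrite ltcE/= => /andP[/eqP -> _].
by rewrite ltcR -normc_sqrtE normcB.
Qed.

End limits.

Section sum_of_tent_norms.
Context d (R : realType) (X : metricMeasurableType d R).
Variable mu : {sigma_finite_measure set X -> \bar R}.
Hypotheses (borelX : borel_space X) (volX : vol_pos_fin mu).
Variables (alpha p0 p1 q0 q1 : R).
Hypotheses (alpha_gt0 : 0 < alpha) (p0_gt0 : 0 < p0) (p1_gt0 : 0 < p1)
  (q0_gt0 : 0 < q0) (q1_gt0 : 0 < q1).

Local Notation K := (@cone_rel d R X alpha).
Local Notation nu := (tent_meas mu).
Local Notation wt := (@tent_weight d R X mu alpha).
Local Notation normc := (@Normc.normc R).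
Local Notation rho := (rho mu nu K wt).
Local Notation T0 := (tent_norm mu p0 q0 alpha).
Local Notation T1 := (tent_norm mu p1 q1 alpha).
Local Notation cls := (to_class mu).
Let mK := measurable_cone_rel borelX volX alpha.
Let mwt := measurable_tent_weight borelX volX alpha_gt0.
Let wt_ge0 := tent_weight_ge0 mu borelX alpha_gt0.

Lemma sum_norm_ge0 (F : ae_class mu) : (0 <= sum_norm T0 T1 F)%E.
Proof.
apply: le_ereal_inf_tmp => _ [F0 [F1 [_ ->]]].
by apply: adde_ge0; exact: tent_norm_ge0.
Qed.

(** f is cut along the set V1 <= V0: on it V0 + V1 is at most 2 V0, and off it at most 2 V1. *)
Lemma dominated_split (f : cmfunType X) (V0 V1 : X * R -> R) :
  measurable_fun setT V0 -> measurable_fun setT V1 ->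
  (forall w, 0 <= V0 w) -> (forall w, 0 <= V1 w) ->
  (forall w : X * R, 0 < w.2 -> normc (f w) <= V0 w + V1 w) ->
  exists f0 f1 : cmfunType X, [/\ f = f0 + f1,
    forall w : X * R, 0 < w.2 -> normc (f0 w) <= 2 * V0 w &
    forall w : X * R, 0 < w.2 -> normc (f1 w) <= 2 * V1 w].
Proof.
move=> mV0 mV1 V00 V10 fV.
pose A := [set w | V1 w <= V0 w].
have mA : measurable A.
  rewrite -[X in measurable X]setTI.
  have /(_ measurableT [set true] I) := measurable_fun_ler mV1 mV0.
  by congr (measurable (_ `&` _)); apply/seteqP; split.
pose g w : R[i] := (\1_A w)%:C.
have mgr : measurable_fun (upper X) (fun w => complex.Re (g w)).
  exact: measurable_funTS (measurable_indic mA).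
have mgi : measurable_fun (upper X) (fun w => complex.Im (g w)).
  exact: measurable_cst.
pose f0 := CMFun (cmfun_mul f mgr mgi).
exists f0, (f - f0); split=> [|w w0|w w0]; first by rewrite addrC subrK.
- rewrite -[f0 w]/(f w * g w) /g indicE; case: (boolP (w \in A)) => [|_].
    rewrite inE /A /= mulr1 => VV; apply: le_trans (fV w w0) _.
    by rewrite mulr_natl mulr2n lerD2l.
  by rewrite mulr0 Normc.normc0 mulr_ge0.
- rewrite -[(f - f0) w]/(f w - f w * g w) /g indicE; case: (boolP (w \in A)) => [_|].
    by rewrite mulr1 subrr Normc.normc0 mulr_ge0.
  rewrite notin_setE /A /= mulr0 subr0 => /negP; rewrite -ltNge => VV.
  apply: le_trans (fV w w0) _.
  by rewrite mulr_natl mulr2n lerD2r ltW.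
Qed.

Lemma sum_norm_le (F G : ae_class mu) : (sum_norm T0 T1 (F + G)%R <= T0 F + T1 G)%E.
Proof. by apply: ereal_inf_lbound; exists F, G. Qed.

Lemma sum_norm_bound (f : cmfunType X) (V0 V1 : X * R -> R) :
  measurable_fun setT V0 -> measurable_fun setT V1 ->
  (forall w, 0 <= V0 w) -> (forall w, 0 <= V1 w) ->
  (forall w : X * R, 0 < w.2 -> normc (f w) <= V0 w + V1 w) ->
  forall a : R, 0 <= a -> (rho p0 q0 V0 <= (a `^ p0)%:E)%E ->
  (rho p1 q1 V1 <= (a `^ p1)%:E)%E -> (sum_norm T0 T1 (cls f) <= (4 * a)%:E)%E.
Proof.
move=> mV0 mV1 V00 V10 fV a a0 rV0 rV1.
have [f0 [f1 [-> H0 H1]]] := dominated_split mV0 mV1 V00 V10 fV.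
rewrite to_classD; apply: le_trans (sum_norm_le _ _) _.
have a20 : 0 <= 2 * a by rewrite mulr_ge0.
have rZ (P Q : R) (V : X * R -> R) : 0 < P -> 0 < Q -> measurable_fun setT V ->
    (forall w, 0 <= V w) -> (rho P Q V <= (a `^ P)%:E)%E ->
    (rho P Q (fun w => 2 * V w)%R <= ((2 * a) `^ P)%:E)%E.
  move=> P0 Q0 mV Vge rV.
  rewrite (@rhoZ _ _ _ _ _ mu nu K wt mK mwt wt_ge0 P Q 2 V P0 Q0 _ mV Vge)//.
  rewrite powRM// EFinM; apply: lee_wpmul2l rV.
  by rewrite lee_fin powR_ge0.
have -> : 4 * a = 2 * a + 2 * a by rewrite -mulrDl -natrD.
rewrite EFinD; apply: leeD.
  by apply: (le_tent_norm borelX volX alpha_gt0 p0_gt0 q0_gt0 a20 H0); exact: rZ.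
by apply: (le_tent_norm borelX volX alpha_gt0 p1_gt0 q1_gt0 a20 H1); exact: rZ.
Qed.

Lemma sum_norm_small (U0 U1 L : X * R -> R) (B : R) :
  measurable_fun setT U0 -> measurable_fun setT U1 ->
  (forall w, 0 <= U0 w) -> (forall w, 0 <= U1 w) -> measurable_fun setT L ->
  0 <= B -> (rho p0 q0 U0 < +oo)%E -> (rho p1 q1 U1 < +oo)%E ->
  forall e : R, 0 < e -> exists n : nat, forall f : cmfunType X,
    (forall w : X * R, 0 < w.2 ->
      normc (f w) <= (U0 w + U1 w) * (n.+1%:R^-1 + B * (n%:R < `|L w|)%R%:R)) ->
    (sum_norm T0 T1 (cls f) <= e%:E)%E.
Proof.
move=> mU0 mU1 U00 U10 mL B0 rU0 rU1 e e0.
have e20 : 0 < e / 2 by rewrite divr_gt0.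
have mZ (U : X * R -> R) : measurable_fun setT U -> measurable_fun setT (fun w => 2 * U w).
  by move=> mU; exact: measurable_funM.
have Z0 (U : X * R -> R) : (forall w, 0 <= U w) -> forall w, 0 <= 2 * U w.
  by move=> U_ge0 w; rewrite mulr_ge0.
have rZ (P Q : R) (V : X * R -> R) : 0 < P -> 0 < Q -> measurable_fun setT V ->
    (forall w, 0 <= V w) -> (rho P Q V < +oo)%E ->
    (rho P Q (fun w => 2 * V w)%R < +oo)%E.
  move=> P0 Q0 mV Vge rV.
  rewrite (@rhoZ _ _ _ _ _ mu nu K wt mK mwt wt_ge0 P Q 2 V P0 Q0 _ mV Vge)//.
  by rewrite lte_mul_pinfty// lee_fin powR_ge0.
have [n0 Hn0] := tent_norm_small borelX volX alpha_gt0 p0_gt0 q0_gt0 (mZ _ mU0) (Z0 _ U00)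
  mL B0 (rZ _ _ _ p0_gt0 q0_gt0 mU0 U00 rU0) e20.
have [n1 Hn1] := tent_norm_small borelX volX alpha_gt0 p1_gt0 q1_gt0 (mZ _ mU1) (Z0 _ U10)
  mL B0 (rZ _ _ _ p1_gt0 q1_gt0 mU1 U10 rU1) e20.
pose n := maxn n0 n1; exists n => f fU.
pose b w : R := n.+1%:R^-1 + B * (n%:R < `|L w|)%R%:R.
have b0 w : 0 <= b w by rewrite addr_ge0 ?invr_ge0// mulr_ge0.
have mb : measurable_fun setT b.
  apply: measurable_funD => //; apply: measurable_funM => //.
  rewrite (_ : (fun w => _) = \1_[set w | (n%:R < `|L w|)%R]); last first.
    by apply/funext => w; rewrite indicE mem_setE.
  apply: measurable_indic; rewrite -[X in measurable X]setTI.
  have /(_ measurableT [set true] I) := measurable_fun_ltr (measurable_cst (n%:R : R))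
    (measurableT_comp (@normr_measurable R setT) mL).
  by congr (measurable (_ `&` _)); apply/seteqP; split.
have [||||w w0|f0 [f1 [-> H0 H1]]] := @dominated_split f (fun w => U0 w * b w) (fun w => U1 w * b w).
- exact: measurable_funM.
- exact: measurable_funM.
- by move=> w; exact: mulr_ge0.
- by move=> w; exact: mulr_ge0.
- by rewrite -mulrDl; exact: fU.
rewrite to_classD; apply: le_trans (sum_norm_le _ _) _.
rewrite (splitr e) EFinD; apply: leeD.
  by apply: (Hn0 _ n); [exact: leq_maxl|move=> w w0; rewrite -mulrA; exact: H0].
by apply: (Hn1 _ n); [exact: leq_maxr|move=> w w0; rewrite -mulrA; exact: H1].
Qed.

End sum_of_tent_norms.

Section gaussian_measurability.
Context d (T : measurableType d) (R : realType).
Variables (th : R) (z : R[i]).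

Lemma measurable_gexp (D : set T) (L : T -> R) : measurable_fun D L ->
  measurable_fun D (fun w => complex.Re (gexp th z (L w))) /\
  measurable_fun D (fun w => complex.Im (gexp th z (L w))).
Proof.
move=> mL; pose c : R[i] := (z ^+ 2 - th%:C ^+ 2).
have ReE w : complex.Re ((z - th%:C) * (L w)%:C + z ^+ 2 - th%:C ^+ 2) =
    (complex.Re z - th) * L w + complex.Re c.
  by rewrite /c; case: z => x y; rewrite /=; ring.
have ImE w : complex.Im ((z - th%:C) * (L w)%:C + z ^+ 2 - th%:C ^+ 2) =
    complex.Im z * L w + complex.Im c.
  by rewrite /c; case: z => x y; rewrite /=; ring.
have mA : measurable_fun D (fun w => expR ((complex.Re z - th) * L w + complex.Re c)).
  apply: (measurableT_comp (@measurable_expR R)).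
  by apply: measurable_funD => //; exact: measurable_funM.
have mB : measurable_fun D (fun w => complex.Im z * L w + complex.Im c).
  by apply: measurable_funD => //; exact: measurable_funM.
split; rewrite /gexp /cexp /=; under eq_fun do rewrite ReE ImE;
  apply: measurable_funM => //.
  exact: (measurableT_comp (continuous_measurable_fun (@continuous_cos R)) mB).
exact: (measurableT_comp (continuous_measurable_fun (@continuous_sin R)) mB).
Qed.

End gaussian_measurability.

(** * A Calderon family through a given function *)

Section calderon_family.
Context d (R : realType) (X : metricMeasurableType d R).
Variable mu : {sigma_finite_measure set X -> \bar R}.
Hypotheses (borelX : borel_space X) (volX : vol_pos_fin mu).
Variables (alpha p0 p1 q0 q1 th : R).
Hypotheses (alpha_gt0 : 0 < alpha) (p0_gt0 : 0 < p0) (p1_gt0 : 0 < p1)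
  (q0_gt0 : 0 < q0) (q1_gt0 : 0 < q1).

Local Notation K := (@cone_rel d R X alpha).
Local Notation nu := (tent_meas mu).
Local Notation wt := (@tent_weight d R X mu alpha).
Local Notation normc := (@Normc.normc R).
Local Notation rho := (rho mu nu K wt).
Local Notation T0 := (tent_norm mu p0 q0 alpha).
Local Notation T1 := (tent_norm mu p1 q1 alpha).
Local Notation cls := (to_class mu).
Let mK := measurable_cone_rel borelX volX alpha.
Let mwt := measurable_tent_weight borelX volX alpha_gt0.
Let wt_ge0 := tent_weight_ge0 mu borelX alpha_gt0.

Variables (f : cmfunType X) (L U0 U1 : X * R -> R) (a : R).
Hypotheses (mL : measurable_fun setT L) (mU0 : measurable_fun setT U0)
  (mU1 : measurable_fun setT U1) (U0_ge0 : forall w, 0 <= U0 w)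
  (U1_ge0 : forall w, 0 <= U1 w) (a_ge0 : 0 <= a)
  (rU0 : (rho p0 q0 U0 <= (a `^ p0)%:E)%E) (rU1 : (rho p1 q1 U1 <= (a `^ p1)%:E)%E)
  (fU0 : forall w : X * R, 0 < w.2 -> normc (f w) * expR (- th * L w) <= U0 w)
  (fU1 : forall w : X * R, 0 < w.2 -> normc (f w) * expR ((1 - th) * L w) <= U1 w).

Let mgr z := measurable_funTS (measurable_gexp th z mL).1 : measurable_fun (upper X) _.
Let mgi z := measurable_funTS (measurable_gexp th z mL).2 : measurable_fun (upper X) _.

Definition gauss_fam (z : R[i]) : cmfunType X := CMFun (cmfun_mul f (mgr z) (mgi z)).

Lemma gauss_famE z w : gauss_fam z w = f w * gexp th z (L w). Proof. by []. Qed.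

Let rZ (P Q c : R) (V : X * R -> R) : 0 < P -> 0 < Q -> 0 <= c -> measurable_fun setT V ->
    (forall w, 0 <= V w) -> (rho P Q V <= (a `^ P)%:E)%E ->
    (rho P Q (fun w => c * V w)%R <= ((c * a) `^ P)%:E)%E.
Proof.
move=> P0 Q0 c0 mV Vge rV.
rewrite (@rhoZ _ _ _ _ _ mu nu K wt mK mwt wt_ge0 P Q c V P0 Q0 c0 mV Vge)//.
rewrite powRM// EFinM; apply: lee_wpmul2l rV.
by rewrite lee_fin powR_ge0.
Qed.

Let mZ (c : R) (U : X * R -> R) : measurable_fun setT U ->
  measurable_fun setT (fun w => c * U w).
Proof. by move=> mU; exact: measurable_funM. Qed.

Let Z_ge0 (c : R) (U : X * R -> R) : 0 <= c -> (forall w, 0 <= U w) ->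
  forall w, 0 <= c * U w.
Proof. by move=> c0 U_ge0 w; rewrite mulr_ge0. Qed.

Let e1_ge0 : 0 <= expR 1 :> R. Proof. exact: expR_ge0. Qed.

Lemma fam_center : gauss_fam th%:C = f.
Proof.
apply: val_inj; apply/funext => w.
by rewrite /= gexp_center mulr1.
Qed.

Lemma normc_fam z w : 0 < w.2 -> 0 <= complex.Re z <= 1 ->
  normc (gauss_fam z w) <= expR 1 * U0 w + expR 1 * U1 w.
Proof.
move=> w0 z01; rewrite gauss_famE Normc.normcM -mulrDr.
apply: (@le_trans _ _ (normc (f w) * (expR 1 * 1 * (expR (- th * L w) + expR ((1 - th) * L w))))).
  apply: ler_wpM2l; first exact: normc_ge0.
  apply: le_trans (normc_gexp th _ z01) _; apply: ler_pM.
  - by rewrite mulr_ge0 ?expR_ge0.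
  - exact: expR_ge0.
  - by rewrite ler_wpM2l// -[leRHS]expR0 ler_expR oppr_le0 sqr_ge0.
  - exact: expR_mix_le.
rewrite mulr1 mulrCA ler_wpM2l// mulrDr lerD//; [exact: fU0|exact: fU1].
Qed.

Lemma normc_fam0 y w : 0 < w.2 ->
  normc (gauss_fam (0 +i* y) w) <= expR 1 * U0 w * expR (- y ^+ 2).
Proof.
move=> w0; rewrite gauss_famE Normc.normcM.
apply: (@le_trans _ _ (normc (f w) * (expR 1 * expR (- y ^+ 2) * expR ((0 - th) * L w)))).
  apply: ler_wpM2l; first exact: normc_ge0.
  by apply: (@normc_gexp _ th (0 +i* y)); rewrite /= lexx ler01.
rewrite sub0r (_ : normc (f w) * _ = expR 1 * (normc (f w) * expR (- th * L w)) * expR (- y ^+ 2)).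
  by rewrite ler_wpM2r ?expR_ge0// ler_wpM2l//; exact: fU0.
by move: (expR _) (expR (- _)) (expR _) => ? ? ?; ring.
Qed.

Lemma normc_fam1 y w : 0 < w.2 ->
  normc (gauss_fam (1 +i* y) w) <= expR 1 * U1 w * expR (- y ^+ 2).
Proof.
move=> w0; rewrite gauss_famE Normc.normcM.
apply: (@le_trans _ _ (normc (f w) * (expR 1 * expR (- y ^+ 2) * expR ((1 - th) * L w)))).
  apply: ler_wpM2l; first exact: normc_ge0.
  by apply: (@normc_gexp _ th (1 +i* y)); rewrite /= lexx ler01.
rewrite (_ : normc (f w) * _ = expR 1 * (normc (f w) * expR ((1 - th) * L w)) * expR (- y ^+ 2)).
  by rewrite ler_wpM2r ?expR_ge0// ler_wpM2l//; exact: fU1.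
by move: (expR _) (expR (- _)) (expR _) => ? ? ?; ring.
Qed.

(** Where |L| <= n the exponentials are uniformly close; elsewhere the crude bound 2 V is used. The
    resulting multiplier is the one that [tent_norm_small] and [sum_norm_small] make small in
    norm. *)
Lemma famB_le z (n : nat) : exists2 r, 0 < r & forall v, normc (v - z) < r ->
  forall V w, normc (gauss_fam v w) <= V -> normc (gauss_fam z w) <= V ->
    normc ((gauss_fam v - gauss_fam z) w) <= V * (n.+1%:R^-1 + 2 * (n%:R < `|L w|)%R%:R).
Proof.
have n0 : 0 < n.+1%:R^-1 :> R by [].
have [r r0 H] := gexp_continuous th z n%:R n0.
exists r => // v vz V w Vv Vz; rewrite -[(gauss_fam v - gauss_fam z) w]/(gauss_fam v w - gauss_fam z w).
have V0 : 0 <= V by exact: le_trans (normc_ge0 _) Vz.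
case: (ltP n%:R `|L w|) => [_|Ln].
  apply: le_trans (ler_normcB _ _) _.
  apply: (@le_trans _ _ (V * 2)); first by rewrite mulrC mulr_natl mulr2n lerD.
  by rewrite ler_wpM2l// mulr1 lerDr.
rewrite mulr0 addr0 !gauss_famE -mulrBr Normc.normcM.
apply: (@le_trans _ _ (normc (f w) * (n.+1%:R^-1 * normc (gexp th z (L w))))).
  by rewrite ler_wpM2l ?normc_ge0//; exact: H.
by rewrite mulrCA mulrC ler_wpM2r ?(ltW n0)// -Normc.normcM.
Qed.

Lemma C0_trace_fam (P Q : R) (V : X * R -> R) (j : R) : 0 < P -> 0 < Q ->
  measurable_fun setT V -> (forall w, 0 <= V w) -> (rho P Q V <= (a `^ P)%:E)%E ->
  (forall y (w : X * R), 0 < w.2 -> normc (gauss_fam (j +i* y) w) <= expR 1 * V w * expR (- y ^+ 2)) ->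
  C0_trace (tent_norm mu P Q alpha) (trace (fun z => cls (gauss_fam z)) j) /\
  forall y, (tent_norm mu P Q alpha (cls (gauss_fam (j +i* y))) <= (expR 1 * a)%:E)%E.
Proof.
move=> P0 Q0 mV Vge rV H.
have ea0 : 0 <= expR 1 * a by exact: mulr_ge0.
have rVe := rZ P0 Q0 e1_ge0 mV Vge rV.
have mVe := mZ (expR 1) mV; have Ve0 := Z_ge0 e1_ge0 Vge.
have rVy : (rho P Q (fun w => expR 1 * V w)%R < +oo)%E.
  by apply: (le_lt_trans rVe); exact: ltry.
have H1 y (w : X * R) : 0 < w.2 -> normc (gauss_fam (j +i* y) w) <= expR 1 * V w.
  move=> w0; apply: le_trans (H y w w0) _; rewrite ler_piMr//.
  by rewrite -[leRHS]expR0 ler_expR oppr_le0 sqr_ge0.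
have bnd y : (tent_norm mu P Q alpha (cls (gauss_fam (j +i* y))) <= (expR 1 * a)%:E)%E.
  exact: (le_tent_norm borelX volX alpha_gt0 P0 Q0 ea0 (H1 y) rVe).
(* The Gaussian factor satisfies exp(-y^2) <= 1/(1 + y^2) <= 1/(n+1), a multiplier without the
   cut-off term. *)
have vanish e : 0 < e -> exists n : nat, forall y : R, n.+1%:R <= 1 + y ^+ 2 ->
    (tent_norm mu P Q alpha (cls (gauss_fam (j +i* y))) <= e%:E)%E.
  move=> e0; have [n Hn] := tent_norm_small borelX volX alpha_gt0 P0 Q0 mVe Ve0 mL
    (lexx 0) rVy e0.
  exists n => y ny; apply: (Hn _ n (leqnn n)) => w w0.
  apply: le_trans (H y w w0) _; rewrite mul0r addr0; apply: ler_wpM2l; first exact: Ve0.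
  have Y := expR_ge1Dx (y ^+ 2).
  rewrite expRN lef_pV2 ?posrE ?expR_gt0//; exact: le_trans Y.
have far (n : nat) (y : R) : n.+1%:R <= `|y| -> n.+1%:R <= 1 + y ^+ 2.
  move=> ny; have y1 : 1 <= `|y| by apply: le_trans ny; rewrite ler1n.
  apply: le_trans ny _; rewrite -(real_normK (num_real y)) expr2.
  by apply: ler_wpDl => //; rewrite ler_peMl.
split=> //; split.
- by move=> y; apply: (le_lt_trans (bnd y)); exact: ltry.
- move=> y; apply: nneg_cvge0 => [t|e e0]; first exact: tent_norm_ge0.
  have [n Hn] := tent_norm_small borelX volX alpha_gt0 P0 Q0 mVe Ve0 mL
    (ler0n _ 2) rVy e0.
  have [r r0 Hr] := famB_le (j +i* y) n.
  near=> t.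
  rewrite /trace to_classB; apply: (Hn _ n (leqnn n)) => w w0.
  apply: Hr; [|exact: H1|exact: H1].
  have -> : (j +i* t) - (j +i* y) = 0 +i* (t - y).
    by apply/eqP; rewrite eq_complex /= subrr !eqxx.
  rewrite normc_imag distrC; near: t.
  exact: (@cvgr_dist_lt _ _ _ (nbhs y) _ id y cvg_id).
- apply: nneg_cvge0 => [t|e e0]; first exact: tent_norm_ge0.
  have [n Hn] := vanish e e0; near=> t; apply/Hn/far.
  apply: le_trans (ler_norm _); near: t; exact: nbhs_pinfty_ge.
- apply: nneg_cvge0 => [t|e e0]; first exact: tent_norm_ge0.
  have [n Hn] := vanish e e0; near=> t; apply/Hn/far.
  rewrite -normrN; apply: le_trans (ler_norm _); rewrite lerNr; near: t.
  exact: nbhs_ninfty_le.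
Unshelve. all: by end_near. Qed.

Lemma fam_analytic z : open_strip z -> analytic_at T0 T1 (fun z => cls (gauss_fam z)) z.
Proof.
move=> z01.
have [k k0 [r r0 H]] := gexp_derivative th z01.
have mr : measurable_fun (upper X) (fun w => complex.Re ((L w)%:C + 2 * z)).
  rewrite (_ : (fun w => _) = (fun w => L w + complex.Re (2 * z))).
    by apply: measurable_funD => //; exact: measurable_funTS.
  by apply/funext => w; case: (2 * z).
have mi : measurable_fun (upper X) (fun w => complex.Im ((L w)%:C + 2 * z)).
  rewrite (_ : (fun w => _) = (fun=> complex.Im (2 * z))); first exact: measurable_cst.
  by apply/funext => w; case: (2 * z) => x y; rewrite /= add0r.
(* L + 2z is the derivative in z of the exponent (z - th) L + z^2 - th^2. *)
pose l : cmfunType X := CMFun (cmfun_mul (gauss_fam z) mr mi).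
have rem h w : h != 0 -> normc h < r -> 0 < w.2 ->
    normc ((h^-1 *: (gauss_fam (z + h) - gauss_fam z) - l) w) <= normc h * (k * U0 w + k * U1 w).
  move=> h0 hr w0.
  rewrite -[(_ - l) w]/(h^-1 * (f w * gexp th (z + h) (L w) - f w * gexp th z (L w)) -
    (f w * gexp th z (L w)) * ((L w)%:C + 2 * z)).
  rewrite [X in normc X](_ : _ = f w * (h^-1 * (gexp th (z + h) (L w) - gexp th z (L w)) -
    ((L w)%:C + 2 * z) * gexp th z (L w))); last by ring.
  rewrite Normc.normcM.
  apply: (@le_trans _ _ (normc (f w) * (normc h * (k * (expR (- th * L w) + expR ((1 - th) * L w)))))).
    by rewrite ler_wpM2l ?normc_ge0//; exact: H.
  rewrite mulrCA ler_wpM2l ?normc_ge0// -mulrDr mulrCA ler_wpM2l ?(ltW k0)//.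
  by rewrite mulrDr lerD//; [exact: fU0|exact: fU1].
have rfin (P Q : R) (V : X * R -> R) (c : R) : 0 < P -> 0 < Q -> 0 <= c -> measurable_fun setT V ->
    (forall w, 0 <= V w) -> (rho P Q V <= (a `^ P)%:E)%E ->
    (rho P Q (fun w => c * V w)%R < +oo)%E.
  move=> P0 Q0 c0 mV Vge rV; apply: (le_lt_trans (rZ P0 Q0 c0 mV Vge rV)); exact: ltry.
have clsE h : h^-1 *: (cls (gauss_fam (z + h)) - cls (gauss_fam z)) - cls l =
    cls (h^-1 *: (gauss_fam (z + h) - gauss_fam z) - l).
  by rewrite -to_classB -ae_scale_to_class to_classB.
exists (cls l).
  (* The derivative lies in the sum space because, for one fixed step h, it is a difference quotient
     minus a remainder, both dominated by multiples of U0 + U1. *)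
  have [h [h0 hr hs]] : exists h : R, [/\ h != 0, `|h| < r & 0 <= complex.Re z + h <= 1].
    have [//|h h1 /= /and3P[hr hx _]] := exists_small (l := [:: r; 1 - complex.Re z]).
      by move: z01 => /andP[x0 x1]; rewrite /= r0 subr_gt0 x1.
    exists h; move: z01 => /andP[x0 x1]; rewrite gt_eqF ?gtr0_norm//; split=> //.
    by rewrite addr_ge0 ?(ltW h1) ?(ltW x0)//= -lerBrDl ltW.
  have hC0 : h%:C != 0 by rewrite fmorph_eq0.
  pose c := normc (h%:C)^-1.
  have c0 : 0 <= c by exact: normc_ge0.
  pose b := `|h| * k + 2 * c * expR 1.
  have b0 : 0 <= b by rewrite /b addr_ge0 ?mulr_ge0// ltW.
  have bnd w : 0 < w.2 -> normc (l w) <= b * U0 w + b * U1 w.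
    move=> w0; have := rem h%:C w hC0; rewrite normc_real => /(_ hr w0) remw.
    rewrite (_ : l w = h%:C^-1 * (gauss_fam (z + h%:C) w - gauss_fam z w) -
      (h%:C^-1 *: (gauss_fam (z + h%:C) - gauss_fam z) - l) w); last first.
      by rewrite -[(_ - l) w]/(h%:C^-1 * (gauss_fam (z + h%:C) w - gauss_fam z w) - l w) opprB addrC subrK.
    apply: le_trans (ler_normcB _ _) _; rewrite Normc.normcM -/c.
    have zs : 0 <= complex.Re z <= 1 by move: z01 => /andP[x0 x1]; rewrite !ltW.
    have zhs : 0 <= complex.Re (z + h%:C) <= 1 by move: hs; case: (z).
    have n1 := normc_fam w0 zs; have n2 := normc_fam w0 zhs.
    have n3 : c * normc (gauss_fam (z + h%:C) w - gauss_fam z w) <=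
        c * (2 * (expR 1 * U0 w + expR 1 * U1 w)).
      apply: ler_wpM2l => //; apply: le_trans (ler_normcB _ _) _.
      by rewrite mulr_natl mulr2n lerD.
    apply: le_trans (lerD n3 remw) _; rewrite /b.
    by move: (expR 1) => e; lra.
  have := sum_norm_bound borelX volX alpha_gt0 p0_gt0 p1_gt0 q0_gt0 q1_gt0
    (mZ b mU0) (mZ b mU1) (Z_ge0 b0 U0_ge0) (Z_ge0 b0 U1_ge0) bnd (mulr_ge0 b0 a_ge0)
    (rZ p0_gt0 q0_gt0 b0 mU0 U0_ge0 rU0) (rZ p1_gt0 q1_gt0 b0 mU1 U1_ge0 rU1).
  by move/le_lt_trans; apply; exact: ltry.
apply: nneg_cvge0 => [t|e e0]; first exact: sum_norm_ge0.
have [n Hn] := sum_norm_small borelX volX alpha_gt0 p0_gt0 p1_gt0 q0_gt0 q1_gt0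
    (mZ k mU0) (mZ k mU1) (Z_ge0 (ltW k0) U0_ge0) (Z_ge0 (ltW k0) U1_ge0) mL (lexx 0)
    (rfin _ _ _ _ p0_gt0 q0_gt0 (ltW k0) mU0 U0_ge0 rU0)
    (rfin _ _ _ _ p1_gt0 q1_gt0 (ltW k0) mU1 U1_ge0 rU1) e0.
have n0 : 0 < n.+1%:R^-1 :> R by [].
near=> h; rewrite clsE; apply: Hn => w w0.
have h0 : h != 0 by near: h; exists 1; rewrite /= ?ltr01// => v _.
have hr : normc h < r.
  by rewrite -[h]subr0; near: h; apply: nbhs_dnbhs; exact: nbhs_normc.
have hn : normc h < n.+1%:R^-1.
  by rewrite -[h]subr0; near: h; apply: nbhs_dnbhs; exact: nbhs_normc.
apply: le_trans (rem h w h0 hr w0) _; rewrite mul0r addr0 mulrC.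
by apply: ler_wpM2l; [rewrite addr_ge0// mulr_ge0// ltW|exact: ltW].
Unshelve. all: by end_near. Qed.

Lemma fam_calderon : calderon T0 T1 (fun z => cls (gauss_fam z)) /\
  (calderon_norm T0 T1 (fun z => cls (gauss_fam z)) <= (expR 1 * a)%:E)%E.
Proof.
have [C00 b0] := C0_trace_fam p0_gt0 q0_gt0 mU0 U0_ge0 rU0 normc_fam0.
have [C01 b1] := C0_trace_fam p1_gt0 q1_gt0 mU1 U1_ge0 rU1 normc_fam1.
have rU0e := rZ p0_gt0 q0_gt0 e1_ge0 mU0 U0_ge0 rU0.
have rU1e := rZ p1_gt0 q1_gt0 e1_ge0 mU1 U1_ge0 rU1.
have mV0 := mZ (expR 1) mU0; have mV1 := mZ (expR 1) mU1.
have V00 := Z_ge0 e1_ge0 U0_ge0; have V10 := Z_ge0 e1_ge0 U1_ge0.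
split; last first.
  rewrite ge_max; apply/andP; split; apply: ge_ereal_sup => _ [y _ <-]; [exact: b0|exact: b1].
split=> //.
- exists (4 * (expR 1 * a)) => z zs.
  apply: (sum_norm_bound borelX volX alpha_gt0 p0_gt0 p1_gt0 q0_gt0 q1_gt0
    mV0 mV1 V00 V10 _ (mulr_ge0 e1_ge0 a_ge0) rU0e rU1e) => w w0.
  exact: normc_fam.
- move=> z zs; apply: nneg_cvge0 => [t|e e0]; first exact: sum_norm_ge0.
  have [n Hn] := sum_norm_small borelX volX alpha_gt0 p0_gt0 p1_gt0 q0_gt0 q1_gt0
    mV0 mV1 V00 V10 mL (ler0n _ 2) (le_lt_trans rU0e (ltry _)) (le_lt_trans rU1e (ltry _)) e0.
  have [r r0 Hr] := famB_le z n.
  near=> v; rewrite to_classB; apply: Hn => w w0.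
  apply: Hr; [|apply: normc_fam|exact: normc_fam] => //.
    by near: v; apply: cvg_within; exact: nbhs_normc.
  by near: v; exact: withinT.
- exact: fam_analytic.
Unshelve. all: by end_near. Qed.

End calderon_family.

Section weighted_functions.
Context d (R : realType) (X : metricMeasurableType d R).
Variable mu : {sigma_finite_measure set X -> \bar R}.
Hypotheses (borelX : borel_space X) (volX : vol_pos_fin mu) (HLX : HL_property mu).
Variables (alpha p q : R).
Hypotheses (alpha_gt0 : 0 < alpha) (p_gt1 : 1 < p) (q_gt1 : 1 < q).

Local Notation K := (@cone_rel d R X alpha).
Local Notation nu := (tent_meas mu).
Local Notation wt := (@tent_weight d R X mu alpha).
Local Notation normc := (@Normc.normc R).
Local Notation rho := (rho mu nu K wt).
Let mK := measurable_cone_rel borelX volX alpha.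
Let mwt := measurable_tent_weight borelX volX alpha_gt0.
Let wt_ge0 := tent_weight_ge0 mu borelX alpha_gt0.
Let p_gt0 : 0 < p. Proof. exact: lt_trans p_gt1. Qed.
Let q_gt0 : 0 < q. Proof. exact: lt_trans q_gt1. Qed.

Lemma weighted_rho_bound (D s P Q : R) : 0 <= D -> 0 < P -> 0 < Q ->
  exists2 C : R, 0 < C & forall phi m St tau,
    admissible_weight mu nu K wt p q s D phi m St tau ->
    (rho P Q (fun w => phi w `^ (q / Q) * m w `^ (p / P - q / Q))%R <= (C `^ P)%:E)%E.
Proof.
move=> D0 P0 Q0; have PQ0 : 0 < P / Q by exact: divr_gt0.
have [C C0 H] := @weighted_lam_bound _ _ R X _ mu nu K wt mK mwt wt_ge0
  (kvol_cone_lty borelX volX alpha) (maximal_bound_cone borelX volX HLX alpha_gt0)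
  p q s (P / Q) p_gt1 q_gt0 PQ0 D D0.
exists (C `^ P^-1) => [|phi m St tau A]; first exact: powR_gt0.
rewrite -powRrM mulVf ?gt_eqF// powRr1 ?(ltW C0)//.
rewrite (@rho_weight _ _ R X _ mu nu K wt p q P Q phi m P0 Q0).
exact: H phi m St tau A.
Qed.

Lemma kvol_upper_gt0 (w : X * R) : 0 < w.2 -> (0 < kvol mu K w)%E.
Proof.
move=> w0; apply: (@kvol_cone_gt0 _ _ _ _ borelX volX alpha alpha_gt0 w.1).
by rewrite /cone_rel/= mdistxx mulr_gt0.
Qed.

Lemma exists_tent_weight : exists2 D : R, 0 < D &
  forall (phi : X * R -> R), measurable_fun setT phi -> (forall w, 0 <= phi w) ->
  (rho p q phi <= 1)%E -> exists m St tau,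
    admissible_weight mu nu K wt p q (p - 1) D phi m St tau /\
      forall r w, 0 <= r <= p - 1 ->
        (kap mu K (fun x => St x `^ r)%R w <= (2 * m w `^ r)%:E * kvol mu K w)%E.
Proof.
have [D D0 H] := @exists_weight _ _ R X _ mu nu K wt mK mwt wt_ge0
  (kvol_cone_lty borelX volX alpha) (@kvol_cone_gt0 _ _ _ _ borelX volX _ alpha_gt0)
  (cone_rel_nonempty alpha_gt0) (maximal_bound_cone borelX volX HLX alpha_gt0) p q p_gt1 q_gt1.
by exists D => // phi mphi phi0 rphi; have [m [St [tau [A B]]]] := H phi mphi phi0 rphi;
  exists m, St, tau.
Qed.

End weighted_functions.

Section log_weight.
Context d (T : measurableType d) (R : realType).
Variables (th a0 a1 b0 b1 : R).

(* With this choice [phi ^ a * m ^ b * exp ((z - th) * log_weight)] has modulus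
   [phi ^ a_j * m ^ b_j] on [Re z = j]. *)
Definition log_weight (phi m : T -> R) (w : T) :=
  (a1 - a0) * ln (phi w) + (b1 - b0) * ln (m w).

Lemma measurable_log_weight phi m : measurable_fun setT phi -> measurable_fun setT m ->
  measurable_fun setT (log_weight phi m).
Proof.
move=> mphi mm; apply: measurable_funD; apply: measurable_funM => //.
  exact: (measurableT_comp (@measurable_ln R) mphi).
exact: (measurableT_comp (@measurable_ln R) mm).
Qed.

Variables (a b : R).
Hypotheses (ath : (1 - th) * a0 + th * a1 = a) (bth : (1 - th) * b0 + th * b1 = b).

Lemma log_weight0 phi m w : 0 < phi w -> 0 < m w ->
  phi w `^ a * m w `^ b * expR (- th * log_weight phi m w) = phi w `^ a0 * m w `^ b0.
Proof.
move=> phi0 m0; rewrite /powR !gt_eqF// -!expRD; congr expR.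
by rewrite /log_weight -ath -bth; ring.
Qed.

Lemma log_weight1 phi m w : 0 < phi w -> 0 < m w ->
  phi w `^ a * m w `^ b * expR ((1 - th) * log_weight phi m w) = phi w `^ a1 * m w `^ b1.
Proof.
move=> phi0 m0; rewrite /powR !gt_eqF// -!expRD; congr expR.
by rewrite /log_weight -ath -bth; ring.
Qed.

End log_weight.

Section tent_in_interpolation.
Context d (R : realType) (X : metricMeasurableType d R).
Variable mu : {sigma_finite_measure set X -> \bar R}.
Hypotheses (borelX : borel_space X) (volX : vol_pos_fin mu) (HLX : HL_property mu).
Variables (alpha p0 p1 q0 q1 p q th : R).
Hypotheses (alpha_gt0 : 0 < alpha) (p_gt1 : 1 < p) (q_gt1 : 1 < q)
  (p0_gt0 : 0 < p0) (p1_gt0 : 0 < p1) (q0_gt0 : 0 < q0) (q1_gt0 : 0 < q1)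
  (pE : p^-1 = (1 - th) / p0 + th / p1) (qE : q^-1 = (1 - th) / q0 + th / q1).

Local Notation K := (@cone_rel d R X alpha).
Local Notation nu := (tent_meas mu).
Local Notation wt := (@tent_weight d R X mu alpha).
Local Notation normc := (@Normc.normc R).
Local Notation rho := (rho mu nu K wt).
Let mK := measurable_cone_rel borelX volX alpha.
Let mwt := measurable_tent_weight borelX volX alpha_gt0.
Let wt_ge0 := tent_weight_ge0 mu borelX alpha_gt0.

(** Exponents of m on the boundary lines, where the modulus is phi^(q/q_j) m^(b_j). The
    theta-averages are 1 for phi and 0 for m ([qth], [bth]), so the family passes through phi
    itself. *)
Let b0 := p / p0 - q / q0.
Let b1 := p / p1 - q / q1.

Let qth : (1 - th) * (q / q0) + th * (q / q1) = 1.
Proof.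
have q0' : q != 0 by rewrite gt_eqF// (lt_trans ltr01).
by apply: (@eq_trans _ _ (q * q^-1)); [rewrite qE; ring|exact: mulfV].
Qed.

Let bth : (1 - th) * b0 + th * b1 = 0.
Proof.
have p0' : p != 0 by rewrite gt_eqF// (lt_trans ltr01).
have pth : (1 - th) * (p / p0) + th * (p / p1) = 1.
  by apply: (@eq_trans _ _ (p * p^-1)); [rewrite pE; ring|exact: mulfV].
rewrite (_ : _ + _ = ((1 - th) * (p / p0) + th * (p / p1)) -
  ((1 - th) * (q / q0) + th * (q / q1))); last by rewrite /b0 /b1; ring.
by rewrite pth qth subrr.
Qed.

Lemma tent_calderon : exists2 C : R, 0 < C &
  forall (F : ae_class mu) (l : R), 0 < l -> (tent_norm mu p q alpha F <= l%:E)%E ->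
  exists2 g, calderon (tent_norm mu p0 q0 alpha) (tent_norm mu p1 q1 alpha) g &
    g th%:C = F /\
    (calderon_norm (tent_norm mu p0 q0 alpha) (tent_norm mu p1 q1 alpha) g <= (C * l)%:E)%E.
Proof.
have p_gt0 : 0 < p by exact: lt_trans p_gt1.
have q_gt0 : 0 < q by exact: lt_trans q_gt1.
have [D D0 HD] := exists_tent_weight borelX volX HLX alpha_gt0 p_gt1 q_gt1.
have [C0 C00 H0] := weighted_rho_bound borelX volX HLX alpha_gt0 p_gt1 q_gt1 (p - 1)
  (ltW D0) p0_gt0 q0_gt0.
have [C1 C10 H1] := weighted_rho_bound borelX volX HLX alpha_gt0 p_gt1 q_gt1 (p - 1)
  (ltW D0) p1_gt0 q1_gt0.
exists (expR 1 * (C0 + C1)) => [|F l l0 Fl]; first by rewrite mulr_gt0 ?expR_gt0// addr_gt0.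
pose f := repr F.
pose phi w := l^-1 * cmod f w.
have li0 : 0 <= l^-1 by rewrite invr_ge0 ltW.
have phi0 w : 0 <= phi w by rewrite mulr_ge0// cmod_ge0.
have mphi : measurable_fun setT phi by apply: measurable_funM => //; exact: measurable_cmod.
have rphi : (rho p q phi <= 1)%E.
  rewrite (@rhoZ _ _ _ _ _ mu nu K wt mK mwt wt_ge0 p q l^-1 (cmod f) p_gt0 q_gt0 li0
    (measurable_cmod f) (cmod_ge0 f)).
  apply: (@le_trans _ _ ((l^-1 `^ p)%:E * (l `^ p)%:E)%E).
    apply: lee_wpmul2l; first by rewrite lee_fin powR_ge0.
    exact: rho_le_tent_norm Fl.
  by rewrite -EFinM -powRM ?(ltW l0)// mulVf ?gt_eqF// powR1.
have [m [St [tau [A _]]]] := HD phi mphi phi0 rphi.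
have mm := aw_mm A; have m0 := aw_m_ge0 A.
have {}H0 := H0 _ _ _ _ A; have {}H1 := H1 _ _ _ _ A.
pose V (Q P : R) w := phi w `^ (q / Q) * m w `^ (p / P - q / Q).
have V0 Q P w : 0 <= V Q P w by rewrite mulr_ge0 ?powR_ge0.
have mV Q P : measurable_fun setT (V Q P).
  by apply: measurable_funM; exact: measurable_funT_powR.
pose U Q P w := l * V Q P w.
have U0 Q P w : 0 <= U Q P w by rewrite mulr_ge0// ltW.
have mU Q P : measurable_fun setT (U Q P) by exact: measurable_funM.
have rU P Q C : 0 < P -> 0 < Q -> 0 < C -> C <= C0 + C1 ->
    (rho P Q (V Q P) <= (C `^ P)%:E)%E -> (rho P Q (U Q P) <= ((l * (C0 + C1)) `^ P)%:E)%E.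
  move=> P0 Q0 Cp CC rV.
  rewrite (@rhoZ _ _ _ _ _ mu nu K wt mK mwt wt_ge0 P Q l _ P0 Q0 (ltW l0)
    (mV Q P) (V0 Q P)).
  have CC0 : 0 <= C0 + C1 by rewrite addr_ge0 // ltW.
  rewrite (powRM _ (ltW l0) CC0) (EFinM (l `^ P)); apply: lee_wpmul2l.
    by rewrite lee_fin powR_ge0.
  apply: le_trans rV _; rewrite lee_fin; apply: le_powRl CC; exact: ltW.
have a0 : 0 <= l * (C0 + C1) by rewrite mulr_ge0 ?addr_ge0// ltW.
pose L := log_weight (q / q0) (q / q1) b0 b1 phi m.
have mL : measurable_fun setT L by exact: measurable_log_weight.
have phiE (w : X * R) : 0 < w.2 -> normc (f w) = l * phi w.
  by move=> w0; rewrite /phi /cmod w0 mulrA mulfV ?gt_eqF// mul1r.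
have mgt0 (w : X * R) : 0 < w.2 -> 0 < m w.
  by move=> w0; apply: (aw_m_gt0 A); exact: kvol_upper_gt0 w0.
have fU0 (w : X * R) : 0 < w.2 -> normc (f w) * expR (- th * L w) <= U q0 p0 w.
  move=> w0; rewrite phiE// -mulrA ler_wpM2l ?(ltW l0)//.
  have [ph|ph] := eqVneq (phi w) 0; first by rewrite ph mul0r.
  have ph0 : 0 < phi w by rewrite lt0r ph phi0.
  have := log_weight0 qth bth ph0 (mgt0 w w0).
  by rewrite powRr1 ?(ltW ph0)// powRr0 mulr1 => ->.
have fU1 (w : X * R) : 0 < w.2 -> normc (f w) * expR ((1 - th) * L w) <= U q1 p1 w.
  move=> w0; rewrite phiE// -mulrA ler_wpM2l ?(ltW l0)//.
  have [ph|ph] := eqVneq (phi w) 0; first by rewrite ph mul0r.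
  have ph0 : 0 < phi w by rewrite lt0r ph phi0.
  have := log_weight1 qth bth ph0 (mgt0 w w0).
  by rewrite powRr1 ?(ltW ph0)// powRr0 mulr1 => ->.
have [cal bnd] := fam_calderon borelX volX alpha_gt0 p0_gt0 p1_gt0 q0_gt0 q1_gt0 mL
  (mU q0 p0) (mU q1 p1) (U0 q0 p0) (U0 q1 p1) a0
  (rU _ _ _ p0_gt0 q0_gt0 C00 (ler_wpDr (ltW C10) (lexx _)) H0)
  (rU _ _ _ p1_gt0 q1_gt0 C10 (ler_wpDl (ltW C00) (lexx _)) H1) fU0 fU1.
eexists; first exact: cal.
split; first by rewrite fam_center to_class_repr.
by apply: le_trans bnd _; rewrite lee_fin mulrCA [leRHS]mulrC mulrA.
Qed.

End tent_in_interpolation.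

(** * From the interpolation space to the tent space *)

Section monotone_limits.
Context d (T : measurableType d) (R : realType).
Variable mu : {measure set T -> \bar R}.
Local Open Scope ereal_scope.

Lemma integral_le_sup (a : nat -> T -> \bar R) (g : T -> \bar R) (B : \bar R) :
  (forall n, measurable_fun setT (a n)) -> (forall n x, 0 <= a n x) ->
  (forall x, {homo a^~ x : n m / (n <= m)%N >-> n <= m}) ->
  (forall x, 0 <= g x) -> (forall x, g x <= ereal_sup (range (a^~ x))) ->
  (forall n, \int[mu]_x a n x <= B) -> \int[mu]_x g x <= B.
Proof.
move=> ma a0 nda g0 ga aB.
apply: (@le_trans _ _ (\int[mu]_x limn (a^~ x))).
  apply: le_integral_nneg => // x; apply: le_trans (ga x) _.
  by rewrite (cvg_lim _ (ereal_nondecreasing_cvgn (nda x))).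
rewrite monotone_convergence//; apply: lime_le.
  apply: ereal_nondecreasing_is_cvgn => n m nm.
  by apply: le_integral_nneg => // x; exact: nda.
by apply: nearW.
Qed.

End monotone_limits.

Section mixed_norm_limits.
Context d d' (R : realType) (X : measurableType d) (W : measurableType d').
Variables (mu : {sigma_finite_measure set X -> \bar R})
  (nu : {sigma_finite_measure set W -> \bar R}).
Variables (K : set (X * W)) (wt : W -> R).
Hypotheses (mK : measurable K) (mwt : measurable_fun setT wt)
  (wt_ge0 : forall w, 0 <= wt w).
Local Open Scope ereal_scope.
Local Notation lam := (lam nu K wt).
Local Notation rho := (rho mu nu K wt).

(** Monotone convergence, used on each cone and then over X. It reduces the bound for a function of
    unknown norm to its truncations, whose norms are known to be finite. *)
Lemma rho_le_sup (P Q : R) (psi : nat -> W -> R) (phi : W -> R) (B : \bar R) :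
  (0 < P)%R -> (0 < Q)%R -> (forall n, measurable_fun setT (psi n)) ->
  (forall n w, 0 <= psi n w)%R ->
  (forall w, {homo psi^~ w : n m / (n <= m)%N >-> (n <= m)%R}) ->
  (forall w, 0 <= phi w)%R ->
  (forall x w, K (x, w) -> exists n, phi w <= psi n w)%R ->
  (forall n, rho P Q (psi n) <= B) -> rho P Q phi <= B.
Proof.
move=> P0 Q0 mpsi psi0 ndpsi phi0 sup H.
have PQ0 : (0 < P / Q)%R by exact: divr_gt0.
have l0 (f : W -> R) x : 0 <= lam (fun w => f w `^ Q)%R x.
  by apply: lam_ge0 => // w; exact: powR_ge0.
have ndl x : {homo (fun n => lam (fun w => psi n w `^ Q)%R x) : n m / (n <= m)%N >-> n <= m}.
  move=> n k nk; apply: (le_lam nu wt_ge0) => [w|w _]; first exact: powR_ge0.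
  by apply: le_powRl; [exact: ltW|exact: psi0|exact: ndpsi].
apply: (@integral_le_sup _ _ _ mu (fun n x => lam (fun w => psi n w `^ Q)%R x `^ (P / Q)) _ B).
- by move=> n; exact/measurable_funT_poweR/measurable_lam_powR.
- by move=> n x; exact: poweR_ge0.
- by move=> x n k nk; apply: le_poweRl; [exact: ltW|exact: l0|exact: ndl].
- by move=> x; exact: poweR_ge0.
- move=> x; set s := ereal_sup _.
  have sn n : lam (fun w => psi n w `^ Q)%R x `^ (P / Q) <= s.
    by apply: ereal_sup_ubound; exists n.
  have s0 : 0 <= s by apply: le_trans (sn 0%N); exact: poweR_ge0.
  have -> : s = (s `^ (P / Q)^-1) `^ (P / Q).
    by rewrite -poweRrM mulVf ?gt_eqF// poweRe1.
  apply: le_poweRl; [exact: ltW|exact: l0|].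
  apply: (@integral_le_sup _ _ _ nu (fun n w => (\1_K (x, w) * (psi n w `^ Q * wt w))%:E)).
  + by move=> n; apply: (lam_sliceM mK mwt); exact: measurable_funT_powR.
  + by move=> n w; rewrite lee_fin !mulr_ge0// powR_ge0.
  + move=> w n k nk; rewrite lee_fin ler_wpM2l// ler_wpM2r//.
    by apply: le_powRl; [exact: ltW|exact: psi0|exact: ndpsi].
  + by move=> w; rewrite lee_fin !mulr_ge0// powR_ge0.
  + move=> w; case: (pselect (K (x, w))) => [Kw|nK].
      have [n le] := sup x w Kw; apply: ereal_sup_ge.
      exists (\1_K (x, w) * (psi n w `^ Q * wt w))%:E; first by exists n.
      rewrite lee_fin ler_wpM2l// ler_wpM2r//.
      by apply: le_powRl; [exact: ltW|exact: phi0|exact: le].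
    rewrite indicE memNset// mul0r; apply: ereal_sup_ge; exists 0 => //.
    by exists 0%N => //; rewrite mul0r.
  + move=> n; rewrite -/(lam _ x).
    rewrite -[leLHS](poweRe1 (l0 _ _)) -(mulfV (lt0r_neq0 PQ0)) poweRrM.
    by apply: le_poweRl (sn n); [rewrite invr_ge0 ltW|exact: poweR_ge0].
- exact: H.
Qed.

End mixed_norm_limits.

(** * Truncations of finite norm *)

Section truncation.
Context d (R : realType) (X : metricMeasurableType d R).
Variable mu : {sigma_finite_measure set X -> \bar R}.
Hypotheses (borelX : borel_space X) (volX : vol_pos_fin mu).
Variables (alpha : R).
Hypotheses (alpha_gt0 : 0 < alpha).

Local Notation K := (@cone_rel d R X alpha).
Local Notation nu := (tent_meas mu).
Local Notation wt := (@tent_weight d R X mu alpha).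
Local Notation rho := (rho mu nu K wt).
Let mK := measurable_cone_rel borelX volX alpha.
Let mwt := measurable_tent_weight borelX volX alpha_gt0.
Let wt_ge0 := tent_weight_ge0 mu borelX alpha_gt0.

(** The bound on [wt] keeps the density of the area measure bounded, so that bounded functions
    supported in a box have finite norm for all positive exponents. The boxes exhaust the
    half-space. *)
Definition box (n : nat) : set (X * R) :=
  [set w | [/\ mdist (point : X) w.1 < n%:R, 0 < w.2 < n%:R & wt w <= n%:R]].

Definition trunc (f : cmfunType X) (n : nat) (w : X * R) : R :=
  \1_(box n) w * Num.min (cmod f w) n%:R.

Lemma measurable_box n : measurable (box n).
Proof.
have -> : box n = (ball (point : X) n%:R `*` `]0, n%:R[%classic) `&`
    [set w | wt w <= n%:R].
  apply/seteqP; split=> [w [w1 w2 w3]|w [[w1 w2] w3]].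
    by do !split => //; rewrite ?ballEmdist//= in_itv.
  by move: w1 w2; rewrite ballEmdist/= in_itv/= => w1 w2; split.
apply: measurableI.
  by apply: measurableX => //; exact: measurable_ball_metric.
rewrite -[X in measurable X]setTI.
have /(_ measurableT [set true] I) := measurable_fun_ler mwt (measurable_cst (n%:R : R)).
by congr (measurable (_ `&` _)); apply/seteqP; split.
Qed.

Lemma trunc_ge0 f n w : 0 <= trunc f n w.
Proof. by rewrite mulr_ge0// le_min cmod_ge0 ler0n. Qed.

Lemma trunc_le f n w : trunc f n w <= cmod f w.
Proof.
rewrite /trunc indicE; case: (_ \in _); last by rewrite mul0r cmod_ge0.
by rewrite mul1r ge_min lexx.
Qed.

Lemma measurable_trunc f n : measurable_fun setT (trunc f n).
Proof.
apply: measurable_funM; first by apply: measurable_indic; exact: measurable_box.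
by apply: measurable_minr => //; exact: measurable_cmod.
Qed.

Lemma box_subset n k : (n <= k)%N -> box n `<=` box k.
Proof.
move=> nk w [w1 /andP[w0 w2] w3]; have nkR : n%:R <= k%:R :> R by rewrite ler_nat.
split; [exact: lt_le_trans nkR|by rewrite w0 (lt_le_trans w2)|exact: le_trans nkR].
Qed.

Lemma trunc_nondecreasing f w : {homo (trunc f)^~ w : n k / (n <= k)%N >-> n <= k}.
Proof.
move=> n k nk; rewrite /trunc.
have nkR : n%:R <= k%:R :> R by rewrite ler_nat.
apply: ler_pM => //; first by rewrite le_min cmod_ge0 ler0n.
  rewrite !indicE; case: (boolP (w \in box n)) => //; rewrite inE => /(box_subset nk) H.
  by rewrite mem_set.
by rewrite le_min !ge_min lexx /= nkR orbT.
Qed.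

Lemma trunc_eventually (f : cmfunType X) (w : X * R) : 0 < w.2 -> exists n, cmod f w <= trunc f n w.
Proof.
move=> w0; pose n := maxn (maxn (Num.truncn (mdist (point : X) w.1)).+1
  (Num.truncn w.2).+1) (maxn (Num.truncn (wt w)).+1 (Num.truncn (cmod f w)).+1).
have big (x : R) : ((Num.truncn x).+1 <= n)%N -> x < n%:R.
  by move=> xn; apply: (lt_le_trans (truncnS_gt x)); rewrite ler_nat.
exists n; rewrite /trunc indicE mem_set; last first.
  split; first by apply: big; rewrite /n !leq_max leqnn.
    by rewrite w0 big// /n !leq_max leqnn ?orbT.
  by apply/ltW/big; rewrite /n !leq_max leqnn ?orbT.
by rewrite mul1r le_min lexx /= ltW// big// /n !leq_max leqnn ?orbT.
Qed.

(** The cone of x meets the box only if x is within n + alpha n of the base point, and the inner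
    integral is at most n^q n times the finite measure of [E]. *)
Lemma rho_trunc_lty (p q : R) (f : cmfunType X) n : 0 < p -> 0 < q -> (rho p q (trunc f n) < +oo)%E.
Proof.
move=> p0 q0; pose E : set (X * R) := ball (point : X) n%:R `*` `]0, n%:R[%classic.
have mE : measurable E by apply: measurableX => //; exact: measurable_ball_metric.
have nuE : (nu E < +oo)%E.
  rewrite -[nu E]/((mu \x @lebesgue_measure R) E)%E product_measure1E//; last first.
    exact: measurable_ball_metric.
  have vn := vol_fin volX point n%:R.
  have li : (@lebesgue_measure R `]0%R, (n%:R)%R[%classic < +oo)%E.
    by rewrite lebesgue_measure_itv; case: ifP => _; rewrite ?ltry// -EFinB ltry.
  by apply: lte_mul_pinfty => //; exact: vn.
pose B : set X := ball (point : X) (n%:R + alpha * n%:R).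
have mB : measurable B by exact: measurable_ball_metric.
pose c : R := n%:R `^ q * n%:R.
have c0 : 0 <= c by rewrite mulr_ge0// powR_ge0.
pose A := (c%:E * nu E)%E.
have A0 : (0 <= A)%E by rewrite mule_ge0.
have Aoo : (A < +oo)%E by rewrite lte_mul_pinfty.
have lamA x : (lam nu K wt (fun w => trunc f n w `^ q)%R x <= (\1_B x)%:E * A)%E.
  have [xB|xB] := pselect (B x); last first.
    rewrite indicE memNset// mul0e; apply: (@le_trans _ _ (lam nu K wt (fun=> 0) x)).
      apply: (le_lam nu wt_ge0) => [w|w Kw]; first exact: powR_ge0.
      rewrite /trunc indicE memNset ?mul0r ?powR0 ?gt_eqF// => -[w1 /andP[w0 w2] _].
      apply: xB; rewrite /B ballEmdist /=.
      apply: le_lt_trans (metric_triangle _ w.1 _) _; apply: ltrD => //.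
      rewrite metric_sym; apply: (lt_trans Kw); by rewrite /= ltr_pM2l.
    rewrite /lam (eq_integral (cst 0%E)) ?integral0// => w _.
    by rewrite mul0r mulr0.
  rewrite indicE mem_set// mul1e.
  apply: (@le_trans _ _ (\int[nu]_w (c%:E * (\1_E w)%:E))%E); last first.
    rewrite ge0_integralZl_EFin//.
      by rewrite integral_indic// setIT.
    exact/measurable_EFinP/measurable_indic.
  apply: le_integral_nneg => w; first by rewrite lee_fin; apply: mulr_ge0 => //; apply: mulr_ge0; [exact: powR_ge0|exact: wt_ge0].
  rewrite -EFinM lee_fin /trunc [\1_(box n) w]indicE; case: (boolP (w \in box n)) => [|_]; last first.
    by rewrite mul0r powR0 ?gt_eqF// mul0r mulr0 mulr_ge0.
  rewrite inE => -[w1 w2 w3]; rewrite mul1r.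
  have -> : \1_E w = 1 :> R.
    by rewrite indicE mem_set//; split; rewrite ?ballEmdist//= in_itv.
  rewrite mulr1; apply: (@le_trans _ _ (1 * (Num.min (cmod f w) n%:R `^ q * wt w))).
    apply: ler_wpM2r; first by apply: mulr_ge0; [exact: powR_ge0|exact: wt_ge0].
    by rewrite indicE; case: (_ \in _).
  rewrite mul1r; apply: ler_pM => //; first exact: powR_ge0.
  apply: le_powRl; [exact: ltW|by rewrite le_min cmod_ge0 ler0n|].
  by rewrite ge_min lexx orbT.
apply: (@le_lt_trans _ _ (\int[mu]_x ((A `^ (p / q)) * (\1_B x)%:E))%E).
  apply: le_integral_nneg => x; first exact: poweR_ge0.
  apply: (@le_trans _ _ (((\1_B x)%:E * A) `^ (p / q))%E).
    apply: le_poweRl; [by rewrite divr_ge0// ltW| |exact: lamA].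
    by apply: lam_ge0 => // w; exact: powR_ge0.
  rewrite indicE; case: (_ \in _); first by rewrite mul1e mule1.
  by rewrite mul0e mule0 poweR0r// gt_eqF// divr_gt0.
have Apoo : (A `^ (p / q) < +oo)%E by exact: poweR_lty.
have Ap0 : (0 <= A `^ (p / q))%E by exact: poweR_ge0.
rewrite -(@fineK _ (A `^ (p / q))%E) ?ge0_fin_numE//.
rewrite ge0_integralZl_EFin ?fine_ge0//; last first.
  exact/measurable_EFinP/measurable_indic.
rewrite integral_indic// setIT.
have vB := vol_fin volX point (n%:R + alpha * n%:R).
rewrite lte_mul_pinfty// ?lee_fin ?fine_ge0// -ge0_fin_numE//; exact: vB.
Qed.

End truncation.

(* [M G c] reads "[G] is bounded by [c]"; [J] is bilinear only on elements satisfying [P]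
   and on bounded [G], as is the case for an integral. *)
Section bilinear_strip.
Context (R : realType) (V U : lmodType R[i]).
Local Notation normc := (@Normc.normc R).
Local Notation Re := (@complex.Re R).
Variables (P : V -> Prop) (N : V -> \bar R) (M : U -> R -> Prop) (J : V -> U -> R[i]) (A : R).
Hypotheses (A_gt0 : 0 < A) (N_ge0 : forall F, (0 <= N F)%E) (NP : forall F, (N F < +oo)%E -> P F)
  (PD : forall F F', P F -> P F' -> P (F + F'))
  (PZ : forall (a : R[i]) F, P F -> P (a *: F))
  (JB : forall F G s c, (N F < s%:E)%E -> M G c -> normc (J F G) <= A * (s * c))
  (JDl : forall F F' G c, P F -> P F' -> M G c -> J (F + F') G = J F G + J F' G)
  (JZl : forall (a : R[i]) F G c, P F -> M G c -> J (a *: F) G = a * J F G)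
  (JDr : forall F G G' c c', P F -> M G c -> M G' c' -> J F (G + G') = J F G + J F G')
  (JZr : forall (a : R[i]) F G c, P F -> M G c -> J F (a *: G) = a * J F G)
  (MZ : forall (a : R[i]) G c, M G c -> M (a *: G) (normc a * c))
  (MD : forall G G' c c', M G c -> M G' c' -> M (G + G') (c + c')).
Variables (F : R[i] -> V) (G : R[i] -> U) (MF MG : R).
Hypotheses (F_bound : forall z, 0 <= Re z <= 1 -> (N (F z) < MF%:E)%E)
  (G_bound : forall z, 0 <= Re z <= 1 -> M (G z) MG)
  (F_cont : forall z e, 0 <= Re z <= 1 -> 0 < e -> exists2 r, 0 < r &
    forall w, 0 <= Re w <= 1 -> normc (w - z) < r -> (N (F w - F z)%R < e%:E)%E)
  (G_cont : forall z e, 0 <= Re z <= 1 -> 0 < e -> exists2 r, 0 < r &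
    forall w, normc (w - z) < r -> M (G w - G z) e)
  (F_analytic : forall z, 0 < Re z < 1 -> exists2 l, (N l < +oo)%E &
    forall e, 0 < e -> exists2 r, 0 < r & forall h, h != 0 -> normc h < r ->
      (N (h^-1 *: (F (z + h) - F z) - l)%R < e%:E)%E)
  (G_analytic : forall z, 0 < Re z < 1 -> exists l c, M l c /\
    forall e, 0 < e -> exists2 r, 0 < r & forall h, h != 0 -> normc h < r ->
      M (h^-1 *: (G (z + h) - G z) - l) e).

Let H z := J (F z) (G z).

Let MF_gt0 : 0 < MF.
Proof.
have z01 : 0 <= Re (0 : R[i]) <= 1 by rewrite /= lexx ler01.
by have := le_lt_trans (N_ge0 (F 0)) (F_bound z01).
Qed.

Let P_F z : 0 <= Re z <= 1 -> P (F z).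
Proof. by move=> z01; apply: NP; apply: lt_trans (F_bound z01) (ltry _). Qed.

Lemma pairing_bound z : 0 <= Re z <= 1 -> normc (H z) <= A * (MF * MG).
Proof. by move=> z01; apply: JB; [exact: F_bound|exact: G_bound]. Qed.

Let MG_ge0 : 0 <= MG.
Proof.
have z01 : 0 <= Re (0 : R[i]) <= 1 by rewrite /= lexx ler01.
have := le_trans (normc_ge0 _) (pairing_bound z01).
by rewrite pmulr_rge0// pmulr_rge0.
Qed.

Lemma pairing_continuous z e : 0 <= Re z <= 1 -> 0 < e -> exists2 r, 0 < r &
  forall w, 0 <= Re w <= 1 -> normc (w - z) < r -> normc (H w - H z) <= e.
Proof.
move=> z01 e0; pose c := A * (MG + MF).
have c0 : 0 < c by rewrite mulr_gt0// ltr_wpDl.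
have ec : 0 < e / c by rewrite divr_gt0.
have [r1 r10 H1] := F_cont z01 ec; have [r2 r20 H2] := G_cont z01 ec.
have r0 : 0 < Num.min r1 r2 by rewrite lt_min r10 r20.
exists (Num.min r1 r2) => // w w01; rewrite lt_min => /andP[wr1 wr2].
have {}H1 := H1 w w01 wr1; have {}H2 := H2 w wr2.
have PB : P (F w - F z) by apply: NP; apply: lt_trans H1 (ltry _).
rewrite (_ : H w - H z = J (F w - F z) (G w) + J (F z) (G w - G z)); last first.
  have e1 := JDl PB (P_F z01) (G_bound w01); rewrite subrK in e1.
  have e2 := JDr (P_F z01) H2 (G_bound z01); rewrite subrK in e2.
  by rewrite /H e1 e2; ring.
apply: le_trans (ler_normcD _ _) _.
apply: le_trans (lerD (JB H1 (G_bound w01)) (JB (F_bound z01) H2)) _.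
rewrite -mulrDr (mulrC (e / c)) -mulrDl mulrA -/c mulrC divfK//.
by rewrite gt_eqF.
Qed.

Lemma pairing_cdif z : 0 < Re z < 1 -> exists l, cdif H z l.
Proof.
move=> z01; have z01' : 0 <= Re z <= 1 by move: z01 => /andP[z0 z1]; rewrite !ltW.
have [lF NlF HF] := F_analytic z01; have [lG [cG [MlG HG]]] := G_analytic z01.
exists (J lF (G z) + J (F z) lG) => e e0.
have [s sl] : exists s : R, (N lF < s%:E)%E.
  exists (fine (N lF) + 1).
  by rewrite -[ltLHS]fineK ?ge0_fin_numE// lte_fin ltrDl.
have s0 : 0 < s by have := le_lt_trans (N_ge0 lF) sl.
pose c := A * (s + MG + MF).
have c0 : 0 < c by rewrite mulr_gt0// addr_gt0// ltr_wpDr.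
have ec : 0 < e / c by rewrite divr_gt0.
have [r1 r10 H1] := HF _ ec; have [r2 r20 H2] := HG _ ec.
have [r3 r30 H3] := G_cont z01' ec.
have [x0 x1] := andP z01.
pose r := Num.min (Num.min r1 r2) (Num.min r3 (Num.min (Re z) (1 - Re z))).
have r0 : 0 < r by rewrite !lt_min r10 r20 r30 x0 subr_gt0 x1.
exists r => // w; rewrite !lt_min -!andbA => /and5P[wr1 wr2 wr3 wx0 wx1].
have [->|wz] := eqVneq w z; first by rewrite !subrr mulr0 subr0 Normc.normc0 mulr0.
set h := w - z in wr1 wr2 wr3 wx0 wx1 *.
have hn0 : h != 0 by rewrite subr_eq0.
have wE : w = z + h by rewrite /h addrC subrK.
have hx := normc_ge_absRe h.
have w01 : 0 <= Re w <= 1.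
  rewrite wE raddfD /=; move: (le_lt_trans hx wx0) (le_lt_trans hx wx1).
  by rewrite !ltr_norml; lra.
have {}H1 := H1 h hn0 wr1; have {}H2 := H2 h hn0 wr2; have {}H3 := H3 w wr3.
rewrite -wE in H1 H2.
set Rm := h^-1 *: (F w - F z) - lF in H1; set S := h^-1 *: (G w - G z) - lG in H2.
have PR : P Rm by apply: NP; apply: lt_trans H1 (ltry _).
have PlF : P lF by exact: NP.
have PFz := P_F z01'.
have FwE : F w = F z + h *: (lF + Rm).
  have -> : lF + Rm = h^-1 *: (F w - F z) by rewrite /Rm addrC subrK.
  by rewrite scalerA mulfV// scale1r addrC subrK.
have GwE : G w = G z + h *: (lG + S).
  have -> : lG + S = h^-1 *: (G w - G z) by rewrite /S addrC subrK.
  by rewrite scalerA mulfV// scale1r addrC subrK.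
(* The product rule with remainder: each of the three terms on the right contains one small
   factor. *)
rewrite (_ : _ - _ = h * (J lF (G w - G z) + J Rm (G w) + J (F z) S)); last first.
  have Gw := G_bound w01; have Gz := G_bound z01'.
  have e1 : J (F w) (G w) = J (F z) (G w) + h * (J lF (G w) + J Rm (G w)).
    by rewrite {1}FwE (JDl PFz (PZ h (PD PlF PR)) Gw) (JZl h (PD PlF PR) Gw) (JDl PlF PR Gw).
  have e2 : J (F z) (G w) = J (F z) (G z) + h * (J (F z) lG + J (F z) S).
    by rewrite {1}GwE (JDr PFz Gz (MZ h (MD MlG H2))) (JZr h PFz (MD MlG H2)) (JDr PFz MlG H2).
  have e3 := JDr PlF H3 Gz; rewrite subrK in e3.
  by rewrite /H e1 e2 e3; ring.
rewrite Normc.normcM mulrC; apply: ler_wpM2r; first exact: normc_ge0.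
apply: (@le_trans _ _ (A * (s * (e / c)) + A * (e / c * MG) + A * (MF * (e / c)))).
  apply: le_trans (ler_normcD _ _) _; apply: lerD; last exact: JB (F_bound z01') H2.
  apply: le_trans (ler_normcD _ _) _; apply: lerD; first exact: JB sl H3.
  exact: JB H1 (G_bound w01).
rewrite (_ : _ + _ = c * (e / c)); first by rewrite mulrC divfK// gt_eqF.
by rewrite /c; ring.
Qed.

End bilinear_strip.

Section complex_integral.
Context d (W : measurableType d) (R : realType).
Variable nu : {measure set W -> \bar R}.
Variable om : W -> R.
Hypotheses (mom : measurable_fun setT om) (om_ge0 : forall w, 0 <= om w).
Local Notation normc := (@Normc.normc R).
Implicit Types (h k : W -> R[i]).

Definition cmeasurable h := measurable_fun setT (fun w => complex.Re (h w)) /\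
  measurable_fun setT (fun w => complex.Im (h w)).

Definition cnorm1 h : \bar R := (\int[nu]_w (normc (h w) * om w)%:E)%E.

Definition cintegral h : R[i] :=
  (\int[nu]_w (complex.Re (h w) * om w)) +i* (\int[nu]_w (complex.Im (h w) * om w)).

Lemma cintegrable h : cmeasurable h -> (cnorm1 h < +oo)%E ->
  nu.-integrable setT (EFin \o (fun w => complex.Re (h w) * om w)) /\
  nu.-integrable setT (EFin \o (fun w => complex.Im (h w) * om w)).
Proof.
move=> [mr mi] hoo; split; apply/integrableP; split.
- by apply/measurable_EFinP; exact: measurable_funM.
- apply: le_lt_trans hoo; apply: le_integral_nneg => w; first exact: abse_ge0.
  by rewrite /= lee_fin normrM (ger0_norm (om_ge0 w)) ler_wpM2r// normc_ge_absRe.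
- by apply/measurable_EFinP; exact: measurable_funM.
- apply: le_lt_trans hoo; apply: le_integral_nneg => w; first exact: abse_ge0.
  by rewrite /= lee_fin normrM (ger0_norm (om_ge0 w)) ler_wpM2r// normc_ge_absIm.
Qed.

Lemma normc_cintegral_le h (s : R) : cmeasurable h -> (cnorm1 h <= s%:E)%E ->
  normc (cintegral h) <= 2 * s.
Proof.
move=> mh hs; have hoo : (cnorm1 h < +oo)%E by apply: le_lt_trans hs (ltry _).
have [ir ii] := cintegrable mh hoo.
apply: le_trans (normc_le_add _) _; rewrite mulr_natl mulr2n /=.
have bnd (g : W -> R) : nu.-integrable setT (EFin \o (fun w => g w * om w)) ->
    (forall w, `|g w| <= normc (h w)) -> `|\int[nu]_w (g w * om w)| <= s.
  move=> ig gh; apply: le_trans (le_normr_Rintegral _ ig) _ => //.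
  rewrite -lee_fin; apply: le_trans hs.
  rewrite /Rintegral fineK; last first.
    have [mg goo] := integrableP _ _ _ ig; rewrite ge0_fin_numE//.
    by apply: integral_ge0 => w _; rewrite lee_fin.
  apply: le_integral_nneg => w; rewrite lee_fin// normrM (ger0_norm (om_ge0 w)).
  by rewrite ler_wpM2r.
apply: lerD; apply: bnd => // w; [exact: normc_ge_absRe|exact: normc_ge_absIm].
Qed.

Lemma cintegralD h k : cmeasurable h -> (cnorm1 h < +oo)%E ->
  cmeasurable k -> (cnorm1 k < +oo)%E ->
  cintegral (fun w => h w + k w) = cintegral h + cintegral k.
Proof.
move=> mh hoo mk koo; have [hr hi] := cintegrable mh hoo; have [kr ki] := cintegrable mk koo.
rewrite /cintegral; apply/eqP; rewrite eq_complex /=; apply/andP; split; apply/eqP.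
  rewrite -RintegralD//; apply: eq_Rintegral => w _.
  by rewrite raddfD mulrDl.
rewrite -RintegralD//; apply: eq_Rintegral => w _.
by rewrite raddfD mulrDl.
Qed.

Lemma cintegralZ (a : R[i]) h : cmeasurable h -> (cnorm1 h < +oo)%E ->
  cintegral (fun w => a * h w) = a * cintegral h.
Proof.
move=> mh hoo; have [hr hi] := cintegrable mh hoo.
have Z (c : R) (g : W -> R) : nu.-integrable setT (EFin \o (fun w => g w * om w)) ->
    nu.-integrable setT (EFin \o (fun w => c * (g w * om w))).
  by move=> ig; exact: (integrableZl measurableT c ig).
apply/eqP; rewrite eq_complex Re_cM Im_cM /=; apply/andP; split; apply/eqP.
  rewrite -!RintegralZl// -RintegralB; [|by []|exact: Z|exact: Z].
  by apply: eq_Rintegral => w _; rewrite Re_cM; ring.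
rewrite -!RintegralZl// -RintegralD; [|by []|exact: Z|exact: Z].
by apply: eq_Rintegral => w _; rewrite Im_cM; ring.
Qed.

Lemma ae_eq_cintegral h k : cmeasurable h -> cmeasurable k ->
  {ae nu, forall w, h w = k w} -> cintegral h = cintegral k.
Proof.
move=> [hr hi] [kr ki] hk; apply/eqP; rewrite eq_complex /=; apply/andP; split; apply/eqP;
  congr fine; apply: ae_eq_integral => //; do ?[by apply/measurable_EFinP; exact: measurable_funM];
  by apply: filterS hk => w -> _.
Qed.

Lemma cmeasurableM h k : cmeasurable h -> cmeasurable k -> cmeasurable (fun w => h w * k w).
Proof.
move=> [hr hi] [kr ki]; split; [under eq_fun do rewrite Re_cM|under eq_fun do rewrite Im_cM].
  by apply: measurable_funB; exact: measurable_funM.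
by apply: measurable_funD; exact: measurable_funM.
Qed.

Lemma cmeasurableD h k : cmeasurable h -> cmeasurable k -> cmeasurable (fun w => h w + k w).
Proof.
move=> [hr hi] [kr ki]; split.
  by under eq_fun do rewrite raddfD; exact: measurable_funD.
by under eq_fun do rewrite raddfD; exact: measurable_funD.
Qed.

Lemma cmeasurableB h k : cmeasurable h -> cmeasurable k -> cmeasurable (fun w => h w - k w).
Proof.
move=> [hr hi] [kr ki]; split.
  by under eq_fun do rewrite raddfB; exact: measurable_funB.
by under eq_fun do rewrite raddfB; exact: measurable_funB.
Qed.

Lemma cmeasurable_cst (a : R[i]) : cmeasurable (fun=> a).
Proof. by split; exact: measurable_cst. Qed.

End complex_integral.
Arguments cmeasurable_cst {d W R} a.

(** * The bilinear pairing of tent spaces *)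

Section tent_pairing.
Context d (R : realType) (X : metricMeasurableType d R).
Variable mu : {sigma_finite_measure set X -> \bar R}.
Hypotheses (borelX : borel_space X) (volX : vol_pos_fin mu).
Variables (alpha : R).
Hypotheses (alpha_gt0 : 0 < alpha).

Local Notation K := (@cone_rel d R X alpha).
Local Notation nu := (tent_meas mu).
Local Notation wt := (@tent_weight d R X mu alpha).
Local Notation normc := (@Normc.normc R).
Local Notation rho := (rho mu nu K wt).
Let mK := measurable_cone_rel borelX volX alpha.
Let mwt := measurable_tent_weight borelX volX alpha_gt0.
Let wt_ge0 := tent_weight_ge0 mu borelX alpha_gt0.

(* Equal to [1 / w.2] on the upper half-space. *)
Definition pair_weight (w : X * R) : R := wt w * fine (kvol mu K w).
Local Notation om := pair_weight.

Lemma pair_weight_ge0 w : 0 <= om w.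
Proof. by apply: mulr_ge0; [exact: wt_ge0|rewrite fine_ge0// kvol_ge0]. Qed.

Lemma measurable_pair_weight : measurable_fun setT om.
Proof.
apply: measurable_funM; first exact: mwt.
by apply: measurableT_comp => //; exact: measurable_kap.
Qed.

Definition cutC (h : X * R -> R[i]) (w : X * R) : R[i] := if 0 < w.2 then h w else 0.

Lemma normc_cutC h w : normc (cutC h w) = cmod h w.
Proof. by rewrite /cutC /cmod; case: ifP => // _; rewrite Normc.normc0. Qed.

Lemma cmeasurable_cutC (f : cmfunType X) : cmeasurable (cutC f).
Proof.
have [fr fi] := cmfun_measurable f; split.
  rewrite (_ : (fun w => _) = fun w : X * R => if 0 < w.2 then complex.Re (f w) else 0).
    exact: measurable_upper_restrict.
  by apply/funext => w; rewrite /cutC; case: ifP.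
rewrite (_ : (fun w => _) = fun w : X * R => if 0 < w.2 then complex.Im (f w) else 0).
  exact: measurable_upper_restrict.
by apply/funext => w; rewrite /cutC; case: ifP.
Qed.

Lemma ae_eq_cutC (f g : cmfunType X) : to_class mu f = to_class mu g ->
  {ae nu, forall w, cutC f w = cutC g w}.
Proof.
move=> /to_classP/asboolP fg.
have FF := ae_filter_ringOfSetsType (mu \x @lebesgue_measure R)%E.
apply: filterS fg => w H; rewrite /cutC; case: ifP => // w0.
have /eqP := H w0.
by rewrite -[X in X == _]/(f w - g w) subr_eq0 => /eqP.
Qed.

Lemma ae_reprD (F F' : ae_class mu) : {ae nu, forall w,
  cutC (repr (F + F')) w = cutC (repr F) w + cutC (repr F') w}.
Proof.
have E : to_class mu (repr (F + F')) = to_class mu (repr F + repr F').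
  by rewrite to_classD !to_class_repr.
have FF := ae_filter_ringOfSetsType nu.
apply: filterS (ae_eq_cutC E) => w ->; rewrite /cutC; case: ifP => // _.
by rewrite addr0.
Qed.

Lemma ae_reprZ (a : R[i]) (F : ae_class mu) : {ae nu, forall w,
  cutC (repr (a *: F)) w = a * cutC (repr F) w}.
Proof.
have E : to_class mu (repr (a *: F)) = to_class mu (a *: repr F).
  by rewrite to_class_repr -ae_scale_to_class to_class_repr.
have FF := ae_filter_ringOfSetsType nu.
apply: filterS (ae_eq_cutC E) => w ->; rewrite /cutC; case: ifP => // _.
by rewrite mulr0.
Qed.

Definition pair_abs (f : X * R -> R[i]) (V : X * R -> R) : \bar R :=
  (\int[nu]_w (cmod f w * V w * om w)%:E)%E.

Lemma tent_pairing (P Q P' Q' s b : R) (F : ae_class mu) (V : X * R -> R) :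
  0 < P -> 0 < P' -> P^-1 + P'^-1 = 1 -> 0 < Q -> 0 < Q' -> Q^-1 + Q'^-1 = 1 ->
  0 < s -> 0 < b -> measurable_fun setT V -> (forall w, 0 <= V w) ->
  (tent_norm mu P Q alpha F <= s%:E)%E -> (rho P' Q' V <= (b `^ P')%:E)%E ->
  (pair_abs (repr F) V <= (2 * (s * b))%:E)%E.
Proof.
move=> P0 P'0 PP Q0 Q'0 QQ s0 b0 mV V0 Fs rV.
have := @rho_pairing _ _ R X _ mu nu K wt mK mwt wt_ge0 P P' Q Q' s b _ V P0 P'0 PP Q0 Q'0
  QQ s0 b0 (measurable_cmod (repr F)) (cmod_ge0 (repr F)) mV V0
  (rho_le_tent_norm alpha_gt0 P0 Fs) rV.
apply: le_trans; apply: le_integral_nneg => w.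
  rewrite lee_fin; apply: mulr_ge0; last exact: pair_weight_ge0.
  by apply: mulr_ge0; [exact: cmod_ge0|exact: V0].
rewrite /pair_weight mulrA EFinM fineK// ge0_fin_numE ?kvol_cone_lty//.
exact: kvol_ge0.
Qed.

Lemma measurable_pair_abs (f : cmfunType X) (V : X * R -> R) : measurable_fun setT V ->
  measurable_fun setT (fun w => (cmod f w * V w * om w)%:E).
Proof.
move=> mV; apply/measurable_EFinP; apply: measurable_funM; last exact: measurable_pair_weight.
by apply: measurable_funM => //; exact: measurable_cmod.
Qed.

Lemma pair_abs_ge0 f V : (forall w, 0 <= V w) -> (0 <= pair_abs f V)%E.
Proof.
move=> V0; apply: integral_ge0 => w _; rewrite lee_fin.
apply: mulr_ge0; last exact: pair_weight_ge0.
by apply: mulr_ge0; [exact: cmod_ge0|exact: V0].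
Qed.

Lemma pair_absD (F F' : ae_class mu) (V : X * R -> R) : measurable_fun setT V -> (forall w, 0 <= V w) ->
  (pair_abs (repr (F + F')%R) V <= pair_abs (repr F) V + pair_abs (repr F') V)%E.
Proof.
move=> mV V0; have p0 f w : (0 <= (cmod f w * V w * om w)%:E)%E.
  rewrite lee_fin; apply: mulr_ge0; last exact: pair_weight_ge0.
  by apply: mulr_ge0; [exact: cmod_ge0|exact: V0].
rewrite -ge0_integralD; [|by []|by move=> w _; exact: p0|exact: measurable_pair_abs|
  by move=> w _; exact: p0|exact: measurable_pair_abs].
apply: ae_ge0_le_integral; [by []|by move=> w _; exact: p0|exact: measurable_pair_abs|
  by move=> w _; apply: adde_ge0; exact: p0|
  by apply: emeasurable_funD; exact: measurable_pair_abs|].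
have FF := ae_filter_ringOfSetsType nu.
apply: filterS (ae_reprD F F') => w E _.
rewrite -EFinD lee_fin -(mulrDl _ _ (om w)) -(mulrDl _ _ (V w)); apply: ler_wpM2r; first exact: pair_weight_ge0.
apply: ler_wpM2r; first exact: V0.
by rewrite -!normc_cutC E ler_normcD.
Qed.

Lemma pair_absZ (a : R[i]) (F : ae_class mu) (V : X * R -> R) : measurable_fun setT V -> (forall w, 0 <= V w) ->
  (pair_abs (repr (a *: F)%R) V <= (normc a)%:E * pair_abs (repr F) V)%E.
Proof.
move=> mV V0; have p0 f w : (0 <= (cmod f w * V w * om w)%:E)%E.
  rewrite lee_fin; apply: mulr_ge0; last exact: pair_weight_ge0.
  by apply: mulr_ge0; [exact: cmod_ge0|exact: V0].
rewrite -ge0_integralZl_EFin; [|by []|by move=> w _; exact: p0|exact: measurable_pair_abs|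
  exact: normc_ge0].
apply: ae_ge0_le_integral; [by []|by move=> w _; exact: p0|exact: measurable_pair_abs|
  by move=> w _; apply: mule_ge0; [rewrite lee_fin normc_ge0|exact: p0]|
  by apply: measurable_funeM; exact: measurable_pair_abs|].
have FF := ae_filter_ringOfSetsType nu.
apply: filterS (ae_reprZ a F) => w E _.
rewrite -EFinM lee_fin (mulrA (normc a) (_ * _) (om w)) (mulrA (normc a) (cmod _ w)).
apply: ler_wpM2r; first exact: pair_weight_ge0.
apply: ler_wpM2r; first exact: V0.
by rewrite -!normc_cutC E Normc.normcM.
Qed.

Lemma le_pair_abs f (V V' : X * R -> R) : (forall w, 0 <= V w) ->
  (forall w : X * R, 0 < w.2 -> V w <= V' w) -> (pair_abs f V <= pair_abs f V')%E.
Proof.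
move=> V0 VV; apply: le_integral_nneg => w; rewrite lee_fin.
  apply: mulr_ge0; last exact: pair_weight_ge0.
  by apply: mulr_ge0; [exact: cmod_ge0|exact: V0].
apply: ler_wpM2r; first exact: pair_weight_ge0.
rewrite /cmod; case: ifP => [w0|]; last by rewrite !mul0r.
by apply: ler_wpM2l; [exact: normc_ge0|exact: VV].
Qed.

Section envelope.
Variable E : X * R -> R.
Hypotheses (mE : measurable_fun setT E) (E_ge0 : forall w, 0 <= E w).

Implicit Types (F : ae_class mu) (G : X * R -> R[i]) (c : R).

(** This is the bound [M G c] of the abstract bilinear argument. Measuring all G against one
    envelope E makes every pairing integrable as soon as [pair_abs] against E is finite. *)
Definition enveloped (G : X * R -> R[i]) (c : R) :=
  [/\ 0 <= c, cmeasurable G & forall w, normc (G w) <= c * E w].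

(** Bilinear rather than sesquilinear, so that pairing two holomorphic families gives a holomorphic
    function; the conjugation is put into [test_fun] instead. *)
Definition tpair (F : ae_class mu) (G : X * R -> R[i]) : R[i] :=
  cintegral nu om (fun w => cutC (repr F) w * G w).

Lemma cnorm1_tpair F G c : enveloped G c ->
  (cnorm1 nu om (fun w => cutC (repr F) w * G w)%R <= c%:E * pair_abs (repr F) E)%E.
Proof.
move=> [c0 mG GE].
rewrite -ge0_integralZl_EFin; [|by []|
  by move=> w _; rewrite lee_fin; apply: mulr_ge0; [
    apply: mulr_ge0; [exact: cmod_ge0|exact: E_ge0]|exact: pair_weight_ge0]|
  exact: measurable_pair_abs|exact: c0].
apply: le_integral_nneg => w; rewrite lee_fin.
  by apply: mulr_ge0; [exact: normc_ge0|exact: pair_weight_ge0].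
rewrite (mulrA c (_ * _) (om w)); apply: ler_wpM2r; first exact: pair_weight_ge0.
rewrite Normc.normcM normc_cutC (mulrCA c (cmod _ w)); apply: ler_wpM2l; first exact: cmod_ge0.
exact: GE.
Qed.

Lemma cnorm1_tpair_lty F G c : enveloped G c -> (pair_abs (repr F) E < +oo)%E ->
  (cnorm1 nu om (fun w => cutC (repr F) w * G w)%R < +oo)%E.
Proof.
move=> GE FE; apply: (le_lt_trans (cnorm1_tpair F GE)).
by case: GE => c0 _ _; apply: lte_mul_pinfty.
Qed.

Lemma normc_tpair_le F G c (s : R) : enveloped G c -> (pair_abs (repr F) E <= s%:E)%E ->
  normc (tpair F G) <= 2 * (c * s).
Proof.
move=> GE FE; have [c0 mG _] := GE.
apply: normc_cintegral_le.
- exact: measurable_pair_weight.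
- exact: pair_weight_ge0.
- exact: cmeasurableM (cmeasurable_cutC _) mG.
- apply: le_trans (cnorm1_tpair F GE) _; rewrite EFinM.
  by apply: lee_wpmul2l; rewrite ?lee_fin.
Qed.

Let mom := measurable_pair_weight.
Let om0 := pair_weight_ge0.
Let mcut (F : ae_class mu) G : cmeasurable G -> cmeasurable (fun w => cutC (repr F) w * G w).
Proof. by move=> mG; apply: cmeasurableM => //; exact: cmeasurable_cutC. Qed.

Lemma tpairDl F F' G c : (pair_abs (repr F) E < +oo)%E -> (pair_abs (repr F') E < +oo)%E ->
  enveloped G c -> tpair (F + F') G = tpair F G + tpair F' G.
Proof.
move=> FE F'E GE; have [_ mG _] := GE.
rewrite /tpair -(@cintegralD _ _ R nu om mom om0); [|exact: mcut|exact: cnorm1_tpair_lty GE FE|exact: mcut|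
  exact: cnorm1_tpair_lty GE F'E].
apply: (@ae_eq_cintegral _ _ R nu om mom); [exact: mcut|by apply: cmeasurableD; exact: mcut|].
have FF := ae_filter_ringOfSetsType nu.
by apply: filterS (ae_reprD F F') => w ->; rewrite mulrDl.
Qed.

Lemma tpairZl (a : R[i]) F G c : (pair_abs (repr F) E < +oo)%E ->
  enveloped G c -> tpair (a *: F) G = a * tpair F G.
Proof.
move=> FE GE; have [_ mG _] := GE.
rewrite /tpair -(@cintegralZ _ _ R nu om mom om0); [|exact: mcut|exact: cnorm1_tpair_lty GE FE].
apply: (@ae_eq_cintegral _ _ R nu om mom); [exact: mcut|
  by apply: cmeasurableM; [exact: cmeasurable_cst|exact: mcut]|].
have FF := ae_filter_ringOfSetsType nu.
by apply: filterS (ae_reprZ a F) => w ->; rewrite mulrA.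
Qed.

Lemma tpairDr F G G' c c' : (pair_abs (repr F) E < +oo)%E ->
  enveloped G c -> enveloped G' c' -> tpair F (G + G') = tpair F G + tpair F G'.
Proof.
move=> FE GE GE'; have [_ mG _] := GE; have [_ mG' _] := GE'.
rewrite /tpair -(@cintegralD _ _ R nu om mom om0); [|exact: mcut|exact: cnorm1_tpair_lty GE FE|exact: mcut|
  exact: cnorm1_tpair_lty GE' FE].
by congr cintegral; apply/funext => w; rewrite -mulrDr.
Qed.

Lemma tpairZr (a : R[i]) F G c : (pair_abs (repr F) E < +oo)%E ->
  enveloped G c -> tpair F (a *: G) = a * tpair F G.
Proof.
move=> FE GE; have [_ mG _] := GE.
rewrite /tpair -(@cintegralZ _ _ R nu om mom om0); [|exact: mcut|exact: cnorm1_tpair_lty GE FE].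
by congr cintegral; apply/funext => w; rewrite mulrCA.
Qed.

Lemma envelopedD G G' c c' : enveloped G c -> enveloped G' c' -> enveloped (G + G') (c + c').
Proof.
move=> [c0 mG GE] [c'0 mG' GE']; split; first exact: addr_ge0.
  exact: cmeasurableD.
move=> w; rewrite mulrDl; apply: le_trans (ler_normcD _ _) _; exact: lerD.
Qed.

Lemma envelopedZ (a : R[i]) G c : enveloped G c -> enveloped (a *: G) (normc a * c).
Proof.
move=> [c0 mG GE]; split; first by rewrite mulr_ge0// normc_ge0.
  by apply: cmeasurableM => //; exact: cmeasurable_cst.
move=> w; rewrite -[(a *: G) w]/(a * G w) Normc.normcM -mulrA.
by apply: ler_wpM2l; [exact: normc_ge0|exact: GE].
Qed.

End envelope.

End tent_pairing.

(** * Pairing a Calderon family with a holomorphic test family *)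

Section calderon_pairing.
Context d (R : realType) (X : metricMeasurableType d R).
Variable mu : {sigma_finite_measure set X -> \bar R}.
Hypotheses (borelX : borel_space X) (volX : vol_pos_fin mu).
Variables (alpha p0 p1 q0 q1 p0' p1' q0' q1' th : R).
Hypotheses (alpha_gt0 : 0 < alpha) (th01 : 0 < th < 1)
  (p0_gt0 : 0 < p0) (p1_gt0 : 0 < p1) (q0_gt0 : 0 < q0) (q1_gt0 : 0 < q1)
  (p0'_gt0 : 0 < p0') (p1'_gt0 : 0 < p1') (q0'_gt0 : 0 < q0') (q1'_gt0 : 0 < q1')
  (pp0 : p0^-1 + p0'^-1 = 1) (pp1 : p1^-1 + p1'^-1 = 1)
  (qq0 : q0^-1 + q0'^-1 = 1) (qq1 : q1^-1 + q1'^-1 = 1).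

Local Notation K := (@cone_rel d R X alpha).
Local Notation nu := (tent_meas mu).
Local Notation wt := (@tent_weight d R X mu alpha).
Local Notation normc := (@Normc.normc R).
Local Notation rho := (rho mu nu K wt).
Local Notation T0 := (tent_norm mu p0 q0 alpha).
Local Notation T1 := (tent_norm mu p1 q1 alpha).
Let mK := measurable_cone_rel borelX volX alpha.
Let mwt := measurable_tent_weight borelX volX alpha_gt0.
Let wt_ge0 := tent_weight_ge0 mu borelX alpha_gt0.

Variables (g : R[i] -> ae_class mu) (M : R).
Hypotheses (g_calderon : calderon T0 T1 g) (M_gt0 : 0 < M)
  (gM : (calderon_norm T0 T1 g <= M%:E)%E).

Variables (G : X * R -> R[i]) (L V0 V1 : X * R -> R) (b : R) (n : R).
Hypotheses (mG : cmeasurable G) (mL : measurable_fun setT L)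
  (mV0 : measurable_fun setT V0) (mV1 : measurable_fun setT V1)
  (V0_ge0 : forall w, 0 <= V0 w) (V1_ge0 : forall w, 0 <= V1 w) (b_gt0 : 0 < b)
  (rV0 : (rho p0' q0' V0 <= (b `^ p0')%:E)%E) (rV1 : (rho p1' q1' V1 <= (b `^ p1')%:E)%E)
  (GV0 : forall w, normc (G w) * expR (- th * L w) <= V0 w)
  (GV1 : forall w, normc (G w) * expR ((1 - th) * L w) <= V1 w)
  (L_le : forall w, G w != 0 -> `|L w| <= n).

Let E w := normc (G w).
Let E_ge0 w : 0 <= E w. Proof. exact: normc_ge0. Qed.
Let mE : measurable_fun setT E.
Proof.
have [mr mi] := mG; rewrite /E; under eq_fun do
  rewrite normc_sqrtE -powR12_sqrt ?addr_ge0 ?sqr_ge0//.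
by apply: measurable_funT_powR; apply: measurable_funD; exact: measurable_funX.
Qed.

Let n_exp (r : R) w : G w != 0 -> `|r| <= 1 -> expR (r * L w) <= expR n.
Proof.
move=> Gw r1; rewrite ler_expR; apply: le_trans (ler_norm _) _; rewrite normrM.
by apply: le_trans (L_le Gw); rewrite ler_piMl.
Qed.

Let th_norm : `|th| <= 1 /\ `|1 - th| <= 1.
Proof. by case/andP: th01 => t0 t1; split; rewrite ger0_norm; lra. Qed.

Let E_le0 w : E w <= expR n * V0 w.
Proof.
have [Gw|Gw] := eqVneq (G w) 0.
  by rewrite /E Gw Normc.normc0 mulr_ge0 ?expR_ge0.
have -> : E w = expR (th * L w) * (E w * expR (- th * L w)).
  by rewrite mulrCA -expRD mulNr subrr expR0 mulr1.
apply: ler_pM; [exact: expR_ge0|by rewrite mulr_ge0 ?expR_ge0| |exact: GV0].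
by apply: n_exp => //; case: th_norm.
Qed.

Let E_le1 w : E w <= expR n * V1 w.
Proof.
have [Gw|Gw] := eqVneq (G w) 0.
  by rewrite /E Gw Normc.normc0 mulr_ge0 ?expR_ge0.
have -> : E w = expR ((th - 1) * L w) * (E w * expR ((1 - th) * L w)).
  by rewrite mulrCA -expRD -mulrDl addrA subrK subrr mul0r expR0 mulr1.
apply: ler_pM; [exact: expR_ge0|by rewrite mulr_ge0 ?expR_ge0| |exact: GV1].
by apply: n_exp => //; rewrite distrC; case: th_norm.
Qed.

Let en_gt0 : 0 < expR n. Proof. exact: expR_gt0. Qed.

(** On the support of G the bound |L| <= n makes E comparable to both boundary majorants, so E pairs
    with either summand of F. The factor expR n serves only for boundedness, continuity and
    differentiability of the pairing. *)
Let pair_le (s : R) F : (sum_norm T0 T1 F < s%:E)%E ->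
  (pair_abs mu alpha (repr F) E <= (4 * (expR n * b) * s)%:E)%E.
Proof.
move=> /ereal_inf_lt[_ [F0 [F1 [-> ->]]] Fs].
have F0s : (T0 F0 <= s%:E)%E.
  by apply: ltW; apply: le_lt_trans Fs; rewrite leeDl// tent_norm_ge0.
have F1s : (T1 F1 <= s%:E)%E.
  by apply: ltW; apply: le_lt_trans Fs; rewrite leeDr// tent_norm_ge0.
have s0 : 0 < s.
  rewrite -lte_fin; apply: le_lt_trans Fs.
  by rewrite adde_ge0// tent_norm_ge0.
have eb : 0 < expR n * b by rewrite mulr_gt0.
have rZ (P Q : R) (V : X * R -> R) : 0 < P -> 0 < Q -> measurable_fun setT V ->
    (forall w, 0 <= V w) -> (rho P Q V <= (b `^ P)%:E)%E ->
    (rho P Q (fun w => expR n * V w)%R <= ((expR n * b) `^ P)%:E)%E.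
  move=> P0 Q0 mV Vge rV.
  rewrite (@rhoZ _ _ _ _ _ mu nu K wt mK mwt wt_ge0 P Q (expR n) V P0 Q0 (ltW en_gt0) mV Vge).
  rewrite (powRM _ (ltW en_gt0) (ltW b_gt0)) (EFinM (expR n `^ P)); apply: lee_wpmul2l rV.
  by rewrite lee_fin powR_ge0.
have mZ (V : X * R -> R) : measurable_fun setT V -> measurable_fun setT (fun w => expR n * V w).
  by move=> mV; exact: measurable_funM.
have Z0 (V : X * R -> R) : (forall w, 0 <= V w) -> forall w, 0 <= expR n * V w.
  by move=> V_ge0 w; rewrite mulr_ge0 ?expR_ge0.
apply: (le_trans (pair_absD borelX volX alpha_gt0 F0 F1 mE E_ge0)).
have -> : 4 * (expR n * b) * s = 2 * (s * (expR n * b)) + 2 * (s * (expR n * b)) by ring.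
rewrite EFinD; apply: leeD.
  apply: le_trans (le_pair_abs mu borelX alpha_gt0 _ E_ge0 (fun w _ => E_le0 w)) _.
  exact: (tent_pairing borelX volX alpha_gt0 p0_gt0 p0'_gt0 pp0 q0_gt0 q0'_gt0 qq0 s0 eb
    (mZ _ mV0) (Z0 _ V0_ge0) F0s (rZ _ _ _ p0'_gt0 q0'_gt0 mV0 V0_ge0 rV0)).
apply: le_trans (le_pair_abs mu borelX alpha_gt0 _ E_ge0 (fun w _ => E_le1 w)) _.
exact: (tent_pairing borelX volX alpha_gt0 p1_gt0 p1'_gt0 pp1 q1_gt0 q1'_gt0 qq1 s0 eb
    (mZ _ mV1) (Z0 _ V1_ge0) F1s (rZ _ _ _ p1'_gt0 q1'_gt0 mV1 V1_ge0 rV1)).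
Qed.

Definition gauss_mul (z : R[i]) (w : X * R) : R[i] := G w * gexp th z (L w).

Let mgauss z : cmeasurable (gauss_mul z).
Proof. apply: cmeasurableM => //; exact: measurable_gexp. Qed.

Let MG : R := expR 1 * expR n.
Let MG_gt0 : 0 < MG. Proof. by rewrite mulr_gt0 ?expR_gt0. Qed.

Let gexp_le (z : R[i]) w : 0 <= complex.Re z <= 1 -> G w != 0 -> normc (gexp th z (L w)) <= MG.
Proof.
move=> z01 Gw; apply: le_trans (normc_gexp th _ z01) _.
rewrite -mulrA; apply: ler_wpM2l; first exact: expR_ge0.
rewrite -[leRHS]mul1r; apply: ler_pM; [exact: expR_ge0|exact: expR_ge0| |].
  by rewrite -[leRHS]expR0 ler_expR oppr_le0 sqr_ge0.
apply: n_exp => //; case/andP: z01 => x0 x1; case/andP: th01 => t0 t1.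
by rewrite ler_norml; lra.
Qed.

Let gauss_le (c : R) (h : R -> R[i]) : 0 <= c ->
  (forall w, G w != 0 -> normc (h (L w)) <= c) ->
  forall w, normc (G w * h (L w)) <= c * E w.
Proof.
move=> c0 H w; rewrite Normc.normcM mulrC.
have [Gw|Gw] := eqVneq (G w) 0; first by rewrite /E Gw Normc.normc0 !mulr0.
by apply: ler_wpM2r; [exact: normc_ge0|exact: H].
Qed.

Let gauss_bound (z : R[i]) : 0 <= complex.Re z <= 1 -> enveloped E (gauss_mul z) MG.
Proof.
move=> z01; split; [exact: ltW|exact: mgauss|].
by apply: (gauss_le (h := gexp th z)) => [|w Gw]; [exact: ltW|exact: gexp_le].
Qed.

Let gauss_cont (z : R[i]) (e : R) : 0 <= complex.Re z <= 1 -> 0 < e -> exists2 r, 0 < r &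
  forall w, normc (w - z) < r -> enveloped E (gauss_mul w - gauss_mul z) e.
Proof.
move=> z01 e0; have eM : 0 < e / MG by rewrite divr_gt0.
have [r r0 H] := gexp_continuous th z n eM; exists r; first exact: r0.
move=> w wz; split; first exact: ltW.
  exact: cmeasurableB.
have -> : gauss_mul w - gauss_mul z = fun u => G u * (gexp th w (L u) - gexp th z (L u)).
  by apply/funext => u; rewrite mulrBr.
apply: (gauss_le (h := fun l => gexp th w l - gexp th z l)) => [|u Gu]; first exact: ltW.
apply: le_trans (H w (L u) wz (L_le Gu)) _.
by rewrite -[leRHS](divfK (lt0r_neq0 MG_gt0)) ler_wpM2l ?(ltW eM)//; exact: gexp_le.
Qed.

Let gauss_analytic (z : R[i]) : 0 < complex.Re z < 1 -> exists (l : X * R -> R[i]) c, enveloped E l c /\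
    forall e, 0 < e -> exists2 r, 0 < r & forall h, h != 0 -> normc h < r ->
      enveloped E (h^-1 *: (gauss_mul (z + h) - gauss_mul z) - l) e.
Proof.
move=> z01; have z01' : 0 <= complex.Re z <= 1 by case/andP: z01 => x0 x1; rewrite !ltW.
have [k k0 [r r0 H]] := gexp_derivative th z01.
pose l u := G u * (((L u)%:C + 2 * z) * gexp th z (L u)).
have ml : cmeasurable l.
  apply: cmeasurableM; first exact: mG.
  apply: cmeasurableM; last exact: measurable_gexp.
  apply: cmeasurableD; last exact: cmeasurable_cst.
  by split => //=; exact: measurable_cst.
exists l, ((`|n| + 2 * normc z) * MG); split.
  have c0 : 0 <= `|n| + 2 * normc z by rewrite addr_ge0// mulr_ge0// normc_ge0.
  split => //; first by rewrite mulr_ge0// ltW.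
  apply: (gauss_le (h := fun x => (x%:C + 2 * z) * gexp th z x)) => [|u Gu].
    by rewrite mulr_ge0// ltW.
  rewrite Normc.normcM; apply: ler_pM; [exact: normc_ge0|exact: normc_ge0| |exact: gexp_le].
  apply: le_trans (ler_normcD _ _) _; rewrite normc_real; apply: lerD.
    by apply: le_trans (L_le Gu) _; exact: ler_norm.
  by rewrite mulr_natl mulr2n mulr_natl mulr2n; exact: ler_normcD.
move=> e e0; pose c := k * (expR n + expR n).
have c0 : 0 < c by rewrite mulr_gt0// addr_gt0.
have r'0 : 0 < Num.min r (e / c) by rewrite lt_min r0 divr_gt0.
exists (Num.min r (e / c)); first exact: r'0.
move=> h hn0; rewrite lt_min => /andP[hr he].
split; first exact: ltW.
  apply: cmeasurableB; last exact: ml.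
  apply: cmeasurableM; first exact: cmeasurable_cst.
  exact: cmeasurableB.
have -> : h^-1 *: (gauss_mul (z + h) - gauss_mul z) - l = fun u =>
    G u * (h^-1 * (gexp th (z + h) (L u) - gexp th z (L u)) - ((L u)%:C + 2 * z) * gexp th z (L u)).
  apply/funext => u.
  rewrite -[LHS]/(h^-1 * (gauss_mul (z + h) u - gauss_mul z u) - l u) /gauss_mul /l.
  by ring.
apply: (gauss_le (h := fun x => h^-1 * (gexp th (z + h) x - gexp th z x) -
  (x%:C + 2 * z) * gexp th z x)) => [|u Gu]; first exact: ltW.
apply: le_trans (H h (L u) hn0 hr) _.
apply: (@le_trans _ _ (normc h * c)).
  apply: ler_wpM2l; first exact: normc_ge0.
  apply: ler_wpM2l; first exact: ltW.
  apply: lerD; apply: n_exp => //; first by rewrite normrN; case: th_norm.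
  by case: th_norm.
by rewrite -ler_pdivlMr// ltW.
Qed.

Let NP (F : ae_class mu) : (sum_norm T0 T1 F < +oo)%E -> (pair_abs mu alpha (repr F) E < +oo)%E.
Proof.
move=> Foo; have Fs : (sum_norm T0 T1 F < (fine (sum_norm T0 T1 F) + 1)%:E)%E.
  by rewrite -[ltLHS]fineK ?ge0_fin_numE ?sum_norm_ge0// lte_fin ltrDl.
by apply: (le_lt_trans (pair_le Fs)); exact: ltry.
Qed.

Lemma calderon_pairing_lty : (pair_abs mu alpha (repr (g th%:C)) E < +oo)%E.
Proof.
have [[B0 gB] _ _ _ _] := g_calderon; case/andP: th01 => t0 t1.
apply: NP; apply: le_lt_trans (gB th%:C _) (ltry _).
by rewrite /strip /= !ltW.
Qed.

(** On the line Re z = j the test family is dominated by expR 1 times V_j, which gives boundary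
    values independent of n. The n-dependent bound inside the strip enters [strip_estimate] only as
    its a priori bound. *)
Lemma calderon_pairing_le :
  normc (tpair alpha (g th%:C) G) <= strip_const th * (2 * (expR 1 * (2 * (M * b)))).
Proof.
have [[B0 gB] gC gA [_ _ _ _] [_ _ _ _]] := g_calderon.
pose A : R := 2 * (4 * (expR n * b)).
have A0 : 0 < A by rewrite !mulr_gt0.
have PD (F F' : ae_class mu) : (pair_abs mu alpha (repr F) E < +oo)%E -> (pair_abs mu alpha (repr F') E < +oo)%E ->
    (pair_abs mu alpha (repr (F + F')%R) E < +oo)%E.
  move=> Fo F'o; apply: (le_lt_trans (pair_absD borelX volX alpha_gt0 F F' mE E_ge0)).
  exact: lte_add_pinfty.
have PZ (a : R[i]) (F : ae_class mu) : (pair_abs mu alpha (repr F) E < +oo)%E ->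
    (pair_abs mu alpha (repr (a *: F)%R) E < +oo)%E.
  move=> Fo; apply: (le_lt_trans (pair_absZ borelX volX alpha_gt0 a F mE E_ge0)).
  by apply: lte_mul_pinfty => //; rewrite lee_fin normc_ge0.
have JB (F : ae_class mu) (H : X * R -> R[i]) (s c : R) : (sum_norm T0 T1 F < s%:E)%E -> enveloped E H c ->
    normc (tpair alpha F H) <= A * (s * c).
  move=> Fs HE; have := normc_tpair_le borelX volX alpha_gt0 mE E_ge0 HE (pair_le Fs).
  by rewrite (_ : 2 * _ = A * (s * c)) // /A; ring.
have F_bound (z : R[i]) : 0 <= complex.Re z <= 1 -> (sum_norm T0 T1 (g z) < (B0 + 1)%:E)%E.
  by move=> z01; apply: (le_lt_trans (gB z z01)); rewrite lte_fin ltrDl.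
have F_cont (z : R[i]) (e : R) : 0 <= complex.Re z <= 1 -> 0 < e -> exists2 r, 0 < r &
    forall w, 0 <= complex.Re w <= 1 -> normc (w - z) < r ->
      (sum_norm T0 T1 (g w - g z)%R < e%:E)%E.
  move=> z01 e0; have e20 : 0 < e / 2 by rewrite divr_gt0.
  have : nbhs (z : R[i]^o) (fun w => strip w -> (sum_norm T0 T1 (g w - g z)%R <= (e / 2)%:E)%E).
    exact: (cvge0_near _ (gC z z01) e20).
  move=> /nbhs_normcP[r r0 H]; exists r => // w w01 wz.
  by apply: (le_lt_trans (H w wz w01)); rewrite lte_fin ltr_pdivrMr// ltr_pMr// ltr1n.
have F_analytic (z : R[i]) : 0 < complex.Re z < 1 -> exists2 l, (sum_norm T0 T1 l < +oo)%E &
    forall e, 0 < e -> exists2 r, 0 < r & forall h, h != 0 -> normc h < r ->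
      (sum_norm T0 T1 (h^-1 *: (g (z + h) - g z) - l)%R < e%:E)%E.
  move=> z01; have [l lo Hl] := gA z z01; exists l => // e e0.
  have e20 : 0 < e / 2 by rewrite divr_gt0.
  have : nbhs (0 : R[i]^o) (fun h => h != 0 ->
      (sum_norm T0 T1 (h^-1 *: (g (z + h) - g z) - l)%R <= (e / 2)%:E)%E).
    exact: (cvge0_near _ Hl e20).
  move=> /nbhs_normcP[r r0 H]; exists r => // h h0 hr.
  have hr' : normc (h - 0) < r by rewrite subr0.
  by apply: (le_lt_trans (H h hr' h0)); rewrite lte_fin ltr_pdivrMr// ltr_pMr// ltr1n.
have DL F F' H c := @tpairDl _ _ _ _ borelX volX _ alpha_gt0 E mE E_ge0 F F' H c.
have ZL (a : R[i]) F H c := @tpairZl _ _ _ _ borelX volX _ alpha_gt0 E mE E_ge0 a F H c.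
have DR F H H' c c' := @tpairDr _ _ _ _ borelX volX _ alpha_gt0 E mE E_ge0 F H H' c c'.
have ZR (a : R[i]) F H c := @tpairZr _ _ _ _ borelX volX _ alpha_gt0 E mE E_ge0 a F H c.
have MZ (a : R[i]) H c := @envelopedZ _ _ _ E a H c.
have MD H H' c c' := @envelopedD _ _ _ E H H' c c'.
have main := @strip_estimate R (fun z => tpair alpha (g z) (gauss_mul z)) th (A * ((B0 + 1) * MG))
  (2 * (expR 1 * (2 * (M * b)))) th01.
have -> : G = gauss_mul th%:C.
  by apply/funext => w; rewrite /gauss_mul gexp_center mulr1.
apply: main.
- by rewrite !mulr_ge0 ?expR_ge0// ltW.
- move=> z z01.
  exact: (@pairing_cdif R _ _ _ _ _ _ A A0 (@sum_norm_ge0 _ _ _ mu alpha p0 p1 q0 q1) NP PD PZ JB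
    DL ZL DR ZR MZ MD g gauss_mul (B0 + 1) MG F_bound gauss_bound gauss_cont F_analytic gauss_analytic).
- move=> z e z01 e0.
  exact: (@pairing_continuous R _ _ _ _ _ _ A A0 (@sum_norm_ge0 _ _ _ mu alpha p0 p1 q0 q1) NP JB
    DL DR g gauss_mul (B0 + 1) MG F_bound gauss_bound F_cont gauss_cont).
- move=> z z01; exact: (@pairing_bound R _ _ _ _ _ A JB g gauss_mul (B0 + 1) MG F_bound gauss_bound).
- move=> y.
  have bnd0 : (T0 (trace g 0%R y) <= M%:E)%E.
    apply: le_trans gM; rewrite le_max; apply/orP; left.
    by apply: ereal_sup_ubound; exists y.
  have bnd1 : (T1 (trace g 1%R y) <= M%:E)%E.
    apply: le_trans gM; rewrite le_max; apply/orP; right.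
    by apply: ereal_sup_ubound; exists y.
  have env0 : enveloped V0 (gauss_mul (0 +i* y)) (expR 1).
    split; [exact: expR_ge0|exact: mgauss|move=> w].
    rewrite Normc.normcM; apply: (@le_trans _ _ (normc (G w) * (expR 1 * 1 * expR ((0 - th) * L w)))).
      apply: ler_wpM2l; first exact: normc_ge0.
      apply: (le_trans (@normc_gexp R th (0 +i* y) (L w) _)); first by rewrite /= lexx ler01.
      apply: ler_wpM2r; first exact: expR_ge0.
      apply: ler_wpM2l; first exact: expR_ge0.
      by rewrite -[leRHS]expR0 ler_expR oppr_le0 sqr_ge0.
    rewrite sub0r mulr1 mulrCA; apply: ler_wpM2l; first exact: expR_ge0.
    exact: GV0.
  have env1 : enveloped V1 (gauss_mul (1 +i* y)) (expR 1).
    split; [exact: expR_ge0|exact: mgauss|move=> w].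
    rewrite Normc.normcM; apply: (@le_trans _ _ (normc (G w) * (expR 1 * 1 * expR ((1 - th) * L w)))).
      apply: ler_wpM2l; first exact: normc_ge0.
      apply: (le_trans (@normc_gexp R th (1 +i* y) (L w) _)); first by rewrite /= lexx ler01.
      apply: ler_wpM2r; first exact: expR_ge0.
      apply: ler_wpM2l; first exact: expR_ge0.
      by rewrite -[leRHS]expR0 ler_expR oppr_le0 sqr_ge0.
    rewrite mulr1 mulrCA; apply: ler_wpM2l; first exact: expR_ge0.
    exact: GV1.
  split.
    apply: (normc_tpair_le borelX volX alpha_gt0 mV0 V0_ge0 env0).
    exact: (tent_pairing borelX volX alpha_gt0 p0_gt0 p0'_gt0 pp0 q0_gt0 q0'_gt0 qq0 M_gt0 b_gt0
      mV0 V0_ge0 bnd0 rV0).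
  apply: (normc_tpair_le borelX volX alpha_gt0 mV1 V1_ge0 env1).
  exact: (tent_pairing borelX volX alpha_gt0 p1_gt0 p1'_gt0 pp1 q1_gt0 q1'_gt0 qq1 M_gt0 b_gt0
    mV1 V1_ge0 bnd1 rV1).
Qed.

End calderon_pairing.

Section interpolation_in_tent.
Context d (R : realType) (X : metricMeasurableType d R).
Variable mu : {sigma_finite_measure set X -> \bar R}.
Hypotheses (borelX : borel_space X) (volX : vol_pos_fin mu) (HLX : HL_property mu).
Variables (alpha p0 p1 q0 q1 p q th : R).
Hypotheses (alpha_gt0 : 0 < alpha) (p_gt1 : 1 < p) (q_gt1 : 1 < q)
  (p0_gt1 : 1 < p0) (p1_gt1 : 1 < p1) (q0_gt1 : 1 < q0) (q1_gt1 : 1 < q1)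
  (th01 : 0 < th < 1)
  (pE : p^-1 = (1 - th) / p0 + th / p1) (qE : q^-1 = (1 - th) / q0 + th / q1).

Local Notation K := (@cone_rel d R X alpha).
Local Notation nu := (tent_meas mu).
Local Notation wt := (@tent_weight d R X mu alpha).
Local Notation normc := (@Normc.normc R).
Local Notation rho := (rho mu nu K wt).
Local Notation T0 := (tent_norm mu p0 q0 alpha).
Local Notation T1 := (tent_norm mu p1 q1 alpha).
Local Notation om := (pair_weight mu alpha).
Let mK := measurable_cone_rel borelX volX alpha.
Let mwt := measurable_tent_weight borelX volX alpha_gt0.
Let wt_ge0 := tent_weight_ge0 mu borelX alpha_gt0.

Let conj (r : R) := (1 - r^-1)^-1.

Let conj_gt0 r : 1 < r -> 0 < conj r.
Proof. by move=> r1; rewrite invr_gt0 subr_gt0 invf_lt1// (lt_trans ltr01). Qed.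

Let conjE r : r^-1 + (conj r)^-1 = 1.
Proof. by rewrite invrK addrC subrK. Qed.

Let p_gt0 : 0 < p. Proof. exact: lt_trans p_gt1. Qed.
Let q_gt0 : 0 < q. Proof. exact: lt_trans q_gt1. Qed.

(** The exponents of phi and m in the test family on the boundary lines, as prescribed by the
    conjugate exponents. Their theta-averages are q - 1 and p - q ([ath], [bth]). *)
Let a0 := q / conj q0.
Let a1 := q / conj q1.
Let b0 := p / conj p0 - q / conj q0.
Let b1 := p / conj p1 - q / conj q1.

Let conj_mix (r r0 r1 : R) : 0 < r -> r^-1 = (1 - th) / r0 + th / r1 ->
  (1 - th) * (r / conj r0) + th * (r / conj r1) = r - 1.
Proof.
move=> r_gt0 rE; rewrite /conj !invrK.
rewrite [LHS](_ : _ = r - r * ((1 - th) / r0 + th / r1)); last by ring.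
by rewrite -rE mulfV// gt_eqF.
Qed.

Let ath : (1 - th) * a0 + th * a1 = q - 1.
Proof. exact: conj_mix. Qed.

Let bth : (1 - th) * b0 + th * b1 = p - q.
Proof.
rewrite [LHS](_ : _ = ((1 - th) * (p / conj p0) + th * (p / conj p1)) -
  ((1 - th) * a0 + th * a1)); last by rewrite /b0 /b1 /a0 /a1; ring.
by rewrite ath conj_mix//; ring.
Qed.

Section test_function.
Variables (f : cmfunType X) (phi m : X * R -> R).
Hypotheses (mphi : measurable_fun setT phi) (mm : measurable_fun setT m).
Hypotheses (phi_ge0 : forall w, 0 <= phi w) (m_ge0 : forall w, 0 <= m w)
  (m_gt0 : forall w : X * R, 0 < w.2 -> 0 < m w)
  (phi_supp : forall w : X * R, phi w != 0 -> 0 < w.2).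

Definition dual_modulus w := phi w `^ (q - 1) * m w `^ (p - q).
Definition dual_log := log_weight a0 a1 b0 b1 phi m.
Definition dual_cut (n : nat) w : R := (`|dual_log w| <= n%:R)%R%:R.

(* The conjugate phase of [f] times [dual_modulus], cut off where it is not comparable to
   both of its boundary values. *)
Definition test_fun (n : nat) (w : X * R) : R[i] :=
  (cutC f w)^*%C * (dual_modulus w * (cmod f w)^-1 * dual_cut n w)%:C.

Let mD : measurable_fun setT dual_modulus.
Proof. by apply: measurable_funM; exact: measurable_funT_powR. Qed.

Lemma dual_modulus_ge0 w : 0 <= dual_modulus w.
Proof. by rewrite mulr_ge0 ?powR_ge0. Qed.

Lemma dual_modulus_eq0 w : phi w = 0 -> dual_modulus w = 0.
Proof. by move=> ph; rewrite /dual_modulus ph powR0 ?mul0r// gt_eqF// subr_gt0. Qed.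

Lemma measurable_dual_log : measurable_fun setT dual_log.
Proof. exact: measurable_log_weight. Qed.

Lemma measurable_dual_cut n : measurable_fun setT (dual_cut n).
Proof.
rewrite (_ : dual_cut n = \1_[set w | `|dual_log w| <= n%:R]); last first.
  by apply/funext => w; rewrite indicE mem_setE.
apply: measurable_indic; rewrite -[X in measurable X]setTI.
have /(_ measurableT [set true] I) := measurable_fun_ler
  (measurableT_comp (@normr_measurable R setT) measurable_dual_log) (measurable_cst (n%:R : R)).
by congr (measurable (_ `&` _)); apply/seteqP; split.
Qed.

Lemma cmeasurable_test_fun n : cmeasurable (test_fun n).
Proof.
apply: cmeasurableM.
  have [mr mi] := cmeasurable_cutC f; split.
    by rewrite (_ : (fun w => _) = fun w => complex.Re (cutC f w)) //; apply/funext => w; case: (cutC f w).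
  rewrite (_ : (fun w => _) = fun w => - complex.Im (cutC f w)); last first.
    by apply/funext => w; case: (cutC f w).
  exact: measurable_funN.
split; last exact: measurable_cst.
apply: measurable_funM; last exact: measurable_dual_cut.
apply: measurable_funM; first exact: mD.
by apply: measurable_funT_inv_ge0; [exact: cmod_ge0|exact: measurable_cmod].
Qed.

Lemma normc_conjc (z : R[i]) : normc z^*%C = normc z.
Proof. by case: z => x y; rewrite /= sqrrN. Qed.

Lemma dual_cut_ge0 n w : 0 <= dual_cut n w. Proof. exact: ler0n. Qed.

Lemma normc_test_fun n w :
  normc (test_fun n w) = cmod f w * (dual_modulus w * (cmod f w)^-1 * dual_cut n w).
Proof.
rewrite Normc.normcM normc_conjc normc_cutC normc_real ger0_norm//.
apply: mulr_ge0; last exact: dual_cut_ge0.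
by apply: mulr_ge0; [exact: dual_modulus_ge0|rewrite invr_ge0 cmod_ge0].
Qed.

Lemma normc_test_fun_le n w : normc (test_fun n w) <= dual_modulus w.
Proof.
rewrite normc_test_fun; have D0 := dual_modulus_ge0 w.
have [->|fw] := eqVneq (cmod f w) 0; first by rewrite mul0r.
rewrite mulrA mulrCA mulfV// mulr1 ler_piMr//.
by rewrite /dual_cut lern1 leq_b1.
Qed.

Lemma test_fun_dual_log n w : test_fun n w != 0 -> `|dual_log w| <= n%:R.
Proof.
rewrite /test_fun /dual_cut; case: (boolP (`|_| <= _)) => // _.
by rewrite mulr0 mulr0 eqxx.
Qed.

Lemma test_fun_le0 n w :
  normc (test_fun n w) * expR (- th * dual_log w) <= phi w `^ a0 * m w `^ b0.
Proof.
apply: le_trans (ler_wpM2r (expR_ge0 _) (normc_test_fun_le n w)) _.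
have [ph|ph] := eqVneq (phi w) 0.
  by rewrite (dual_modulus_eq0 ph) mul0r mulr_ge0 ?powR_ge0.
have ph0 : 0 < phi w by rewrite lt0r ph phi_ge0.
by rewrite (log_weight0 ath bth ph0 (m_gt0 (phi_supp ph))).
Qed.

Lemma test_fun_le1 n w :
  normc (test_fun n w) * expR ((1 - th) * dual_log w) <= phi w `^ a1 * m w `^ b1.
Proof.
apply: le_trans (ler_wpM2r (expR_ge0 _) (normc_test_fun_le n w)) _.
have [ph|ph] := eqVneq (phi w) 0.
  by rewrite (dual_modulus_eq0 ph) mul0r mulr_ge0 ?powR_ge0.
have ph0 : 0 < phi w by rewrite lt0r ph phi_ge0.
by rewrite (log_weight1 ath bth ph0 (m_gt0 (phi_supp ph))).
Qed.

Lemma cmod_test_fun n w :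
  cmod f w * normc (test_fun n w) = cmod f w * (dual_modulus w * dual_cut n w).
Proof.
rewrite normc_test_fun.
have [->|fw] := eqVneq (cmod f w) 0; first by rewrite !mul0r.
by field.
Qed.

(** The conjugate phase makes the product real and nonnegative, so the pairing equals the integral
    of the moduli. *)
Lemma cutC_test_fun n w :
  cutC f w * test_fun n w = (cmod f w * normc (test_fun n w))%:C.
Proof.
rewrite cmod_test_fun /test_fun mulrA.
have -> : cutC f w * (cutC f w)^*%C = (cmod f w ^+ 2)%:C.
  rewrite -normc_cutC normc_sqr; case: (cutC f w) => x y.
  by apply/eqP; rewrite eq_complex /=; apply/andP; split; apply/eqP; ring.
rewrite -rmorphM /=; congr (_%:C).
have [->|fw] := eqVneq (cmod f w) 0; first by rewrite expr0n !mul0r.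
by field.
Qed.

End test_function.

Lemma interpolation_tent : exists2 C : R, 0 < C & forall (g : R[i] -> ae_class mu) (M : R),
  calderon T0 T1 g -> 0 < M -> (calderon_norm T0 T1 g <= M%:E)%E ->
  (tent_norm mu p q alpha (g th%:C) <= (C * M)%:E)%E.
Proof.
have [p0_gt0 p1_gt0] := (lt_trans ltr01 p0_gt1, lt_trans ltr01 p1_gt1).
have [q0_gt0 q1_gt0] := (lt_trans ltr01 q0_gt1, lt_trans ltr01 q1_gt1).
have [p0'_gt0 p1'_gt0] := (conj_gt0 p0_gt1, conj_gt0 p1_gt1).
have [q0'_gt0 q1'_gt0] := (conj_gt0 q0_gt1, conj_gt0 q1_gt1).
have [D D0 HD] := exists_tent_weight borelX volX HLX alpha_gt0 p_gt1 q_gt1.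
have [C0 C00 H0] := weighted_rho_bound borelX volX HLX alpha_gt0 p_gt1 q_gt1 (p - 1)
  (ltW D0) p0'_gt0 q0'_gt0.
have [C1 C10 H1] := weighted_rho_bound borelX volX HLX alpha_gt0 p_gt1 q_gt1 (p - 1)
  (ltW D0) p1'_gt0 q1'_gt0.
have [c c0 Hc] := @weighted_lower_bound _ _ R X _ mu nu K wt mK mwt wt_ge0 p q p_gt1 q_gt1 D D0.
pose b := C0 + C1; have b_gt0 : 0 < b by exact: addr_gt0.
(* The absolute value and the summand 1 make S positive without examining the sign of
   [strip_const]. *)
pose S := `|strip_const th * (2 * (expR 1 * (2 * b)))| + 1.
have S0 : 0 < S by rewrite ltr_wpDl.
exists (S / c) => [|g M gcal M0 gM]; first exact: divr_gt0.
pose f := repr (g th%:C).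
have CM0 : 0 < S / c * M by rewrite mulr_gt0// divr_gt0.
rewrite -(to_class_repr (g th%:C)).
apply: (le_tent_norm borelX volX alpha_gt0 (U := cmod f) p_gt0 q_gt0 (ltW CM0)).
  by move=> w w0; rewrite /cmod w0.
have mt n : measurable_fun setT (trunc mu alpha f n) by exact: measurable_trunc.
have t0 n w : 0 <= trunc mu alpha f n w by exact: trunc_ge0.
(* The norm of g at theta is not yet known to be finite; it suffices to bound its truncations
   uniformly. *)
apply: (@rho_le_sup _ _ R X _ mu nu K wt mK mwt wt_ge0 p q (trunc mu alpha f) (cmod f) _
  p_gt0 q_gt0 mt t0).
- by move=> w; exact: trunc_nondecreasing.
- exact: cmod_ge0.
- by move=> x w /(cone_rel_gt0 alpha_gt0); exact: trunc_eventually.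
move=> N; set psi := trunc mu alpha f N.
have psi0 w : 0 <= psi w by exact: t0.
have mpsi : measurable_fun setT psi by exact: mt.
have roo := rho_trunc_lty borelX volX alpha_gt0 f N p_gt0 q_gt0.
have rfin : rho p q psi \is a fin_num by rewrite ge0_fin_numE// rho_ge0.
pose r := fine (rho p q psi).
have rE : rho p q psi = r%:E by rewrite fineK.
have r0 : 0 <= r by rewrite fine_ge0// rho_ge0.
have [r_eq0|rn0] := eqVneq r 0; first by rewrite rE r_eq0 lee_fin powR_ge0.
have rgt0 : 0 < r by rewrite lt0r rn0 r0.
(* The norm of the truncation, finite and nonzero, by which it is normalized. *)
pose sg := r `^ p^-1; have sg0 : 0 < sg by exact: powR_gt0.
have sgp : sg `^ p = r by rewrite -powRrM mulVf ?gt_eqF// powRr1.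
rewrite rE -sgp lee_fin; apply: le_powRl; [exact: ltW|exact: ltW|].
have si0 : 0 <= sg^-1 by rewrite invr_ge0 ltW.
pose phi w := sg^-1 * psi w.
have phi0 w : 0 <= phi w by rewrite mulr_ge0.
have mphi : measurable_fun setT phi by exact: measurable_funM.
have rphi : rho p q phi = 1%E.
  rewrite (@rhoZ _ _ _ _ _ mu nu K wt mK mwt wt_ge0 p q sg^-1 psi p_gt0 q_gt0 si0 mpsi psi0).
  by rewrite rE -sgp -EFinM -powRM ?(ltW sg0)// mulVf ?gt_eqF// powR1.
have rphi1 : (rho p q phi <= 1)%E by rewrite rphi.
have [m [St [tau [A B]]]] := HD phi mphi phi0 rphi1.
have mm := aw_mm A; have m_ge0 := aw_m_ge0 A.
have m_gt0 (w : X * R) : 0 < w.2 -> 0 < m w.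
  by move=> w0; apply: (aw_m_gt0 A); exact: kvol_upper_gt0 w0.
have supp (w : X * R) : phi w != 0 -> 0 < w.2.
  rewrite /phi /psi /trunc indicE; case: (boolP (w \in box mu alpha N)).
    by rewrite inE => -[_ /andP[]].
  by rewrite mul0r mulr0 eqxx.
have V_ge0 (x y : R) w : 0 <= phi w `^ x * m w `^ y by rewrite mulr_ge0 ?powR_ge0.
have mV (x y : R) : measurable_fun setT (fun w => phi w `^ x * m w `^ y).
  by apply: measurable_funM; exact: measurable_funT_powR.
have rV (P Q C : R) : 0 < P -> 0 < C -> C <= b ->
    (rho P Q (fun w => phi w `^ (q / Q) * m w `^ (p / P - q / Q))%R <= (C `^ P)%:E)%E ->
    (rho P Q (fun w => phi w `^ (q / Q) * m w `^ (p / P - q / Q))%R <= (b `^ P)%:E)%E.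
  move=> P0 Cp Cb H; apply: le_trans H _; rewrite lee_fin.
  by apply: le_powRl => //; exact: ltW.
have rV0 := rV _ _ _ p0'_gt0 C00 (ler_wpDr (ltW C10) (lexx _)) (H0 _ _ _ _ A).
have rV1 := rV _ _ _ p1'_gt0 C10 (ler_wpDl (ltW C00) (lexx _)) (H1 _ _ _ _ A).
pose G n := test_fun f phi m n.
pose Dm := dual_modulus phi m.
have pair_n n : (pair_abs mu alpha f (fun w => normc (G n w)) <= (S * M)%:E)%E.
  have mG := cmeasurable_test_fun f mphi mm n.
  have mL := measurable_dual_log mphi mm.
  have le0 := @test_fun_le0 f phi m phi0 m_gt0 supp n.
  have le1 := @test_fun_le1 f phi m phi0 m_gt0 supp n.
  have lty := @calderon_pairing_lty _ _ _ mu borelX volX _ _ _ _ _ _ _ _ _ _ alpha_gt0 th01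
    p0_gt0 p1_gt0 q0_gt0 q1_gt0 p0'_gt0 p1'_gt0 q0'_gt0 q1'_gt0 (conjE p0) (conjE p1)
    (conjE q0) (conjE q1) g gcal (G n) (dual_log phi m) _ _ b n%:R mG (mV a0 b0) (mV a1 b1)
    (V_ge0 a0 b0) (V_ge0 a1 b1) b_gt0 rV0 rV1 le0 le1 (@test_fun_dual_log f phi m n).
  have := @calderon_pairing_le _ _ _ mu borelX volX _ _ _ _ _ _ _ _ _ _ alpha_gt0 th01
    p0_gt0 p1_gt0 q0_gt0 q1_gt0 p0'_gt0 p1'_gt0 q0'_gt0 q1'_gt0 (conjE p0) (conjE p1)
    (conjE q0) (conjE q1) g M gcal M0 gM (G n) (dual_log phi m) _ _ b n%:R mG mL (mV a0 b0) (mV a1 b1)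
    (V_ge0 a0 b0) (V_ge0 a1 b1) b_gt0 rV0 rV1 le0 le1 (@test_fun_dual_log f phi m n).
  set bound := _ * _ => tle.
  have boundS : bound <= S * M.
    rewrite /bound (_ : _ * _ = strip_const th * (2 * (expR 1 * (2 * b))) * M); last by ring.
    rewrite ler_wpM2r ?(ltW M0)//; apply: (le_trans (ler_norm _)).
    by rewrite lerDl.
  have := le_trans (le_trans (normc_ge_absRe _) tle) boundS.
  have -> : complex.Re (tpair alpha (g th%:C) (G n)) =
      fine (pair_abs mu alpha f (fun w => normc (G n w))).
    by congr fine; apply: eq_integral => w _; rewrite (cutC_test_fun f phi m n w).
  have pair0 := @pair_abs_ge0 _ _ _ mu borelX alpha alpha_gt0 f (fun w => normc (G n w))
    (fun w => normc_ge0 _).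
  rewrite ger0_norm ?fine_ge0// => H.
  (* [fine] would hide an infinite integral; finiteness comes from [lty]. *)
  by rewrite -[leLHS]fineK ?ge0_fin_numE// lee_fin.
have mDm : measurable_fun setT Dm by exact: mV.
have Dm0 w : 0 <= Dm w by exact: V_ge0.
have om0 := pair_weight_ge0 mu borelX alpha_gt0.
(* The cut increases to 1 with n, so monotone convergence removes it; afterwards |f| is replaced by
   its smaller truncation psi. *)
have pair_lim : (\int[nu]_w (psi w * Dm w * om w)%:E <= (S * M)%:E)%E.
  pose a n (w : X * R) := (cmod f w * (Dm w * dual_cut phi m n w) * om w)%:E.
  have t_ge0 (x y z : R) w : 0 <= x -> 0 <= y -> 0 <= z -> (0 <= (x * (y * z) * om w)%:E)%E.
    by move=> x0 y0 z0; rewrite lee_fin; apply: mulr_ge0; [rewrite mulr_ge0// mulr_ge0|exact: om0].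
  have cut_le n k w : (n <= k)%N -> dual_cut phi m n w <= dual_cut phi m k w.
    rewrite /dual_cut => nk; case: (leP `|_| n%:R) => [L_le|_]; last exact: ler0n.
    by rewrite (le_trans L_le)// ler_nat.
  apply: (@integral_le_sup _ _ _ nu a).
  - move=> n; apply/measurable_EFinP; apply: measurable_funM; last exact: measurable_pair_weight.
    apply: measurable_funM; first exact: measurable_cmod.
    by apply: measurable_funM => //; exact: measurable_dual_cut.
  - by move=> n w; apply: t_ge0; [exact: cmod_ge0|exact: Dm0|exact: dual_cut_ge0].
  - move=> w n k nk; rewrite lee_fin; apply: ler_wpM2r; first exact: om0.
    apply: ler_wpM2l; first exact: cmod_ge0.
    by apply: ler_wpM2l; [exact: Dm0|exact: cut_le].
  - move=> w; have := t_ge0 (psi w) (Dm w) 1 w (psi0 w) (Dm0 w) ler01.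
    by rewrite mulr1.
  - move=> w; apply: ereal_sup_ge.
    pose n := (Num.truncn `|dual_log phi m w|).+1.
    exists (a n w); first by exists n.
    rewrite lee_fin; apply: ler_wpM2r; first exact: om0.
    have -> : dual_cut phi m n w = 1 by rewrite /dual_cut ltW// truncnS_gt.
    by rewrite mulr1; apply: ler_wpM2r; [exact: Dm0|exact: trunc_le].
  - move=> n; apply: le_trans (pair_n n).
    rewrite le_eqVlt; apply/orP; left; apply/eqP; apply: eq_integral => w _.
    by rewrite /a /G cmod_test_fun.
have Hlow : (c%:E <= \int[nu]_w (phi w * Dm w * om w)%:E)%E.
  apply: le_trans (Hc phi m St tau A B rphi) _.
  rewrite le_eqVlt; apply/orP; left; apply/eqP; apply: eq_integral => w _.
  have -> : phi w * Dm w = phi w `^ q * m w `^ (p - q).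
    rewrite /Dm /dual_modulus mulrA; congr (_ * _).
    have [->|ph] := eqVneq (phi w) 0; first by rewrite mul0r powR0// gt_eqF.
    have ph0 : 0 < phi w by rewrite lt0r ph phi0.
    by rewrite -{1}(powRr1 (ltW ph0)) -powRDp// addrC subrK.
  have vf : kvol mu K w \is a fin_num by rewrite ge0_fin_numE ?kvol_cone_lty// kvol_ge0.
  have kE (x : R) : (x%:E * kvol mu K w = (x * fine (kvol mu K w))%:E)%E.
    by rewrite EFinM fineK.
  by apply: (eq_trans (kE _)); congr EFin; rewrite /pair_weight -!mulrA.
have eqint : (\int[nu]_w (psi w * Dm w * om w)%:E = sg%:E * \int[nu]_w (phi w * Dm w * om w)%:E)%E.
  rewrite -ge0_integralZl_EFin; [|by []| | |exact: ltW].
  - apply: eq_integral => w _; rewrite -EFinM; congr EFin.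
    by rewrite /phi !mulrA mulfV ?gt_eqF// mul1r.
  - move=> w _; rewrite lee_fin; apply: mulr_ge0; last exact: om0.
    by apply: mulr_ge0; [exact: phi0|exact: Dm0].
  - apply/measurable_EFinP; apply: measurable_funM; last exact: measurable_pair_weight.
    exact: measurable_funM.
(* The chain is: sg c <= sg times the integral of phi Dm om, which is the integral of psi Dm om, and
   this is at most S M. *)
rewrite mulrAC ler_pdivlMr// -lee_fin EFinM; apply: le_trans pair_lim.
by rewrite eqint; apply: lee_wpmul2l => //; rewrite lee_fin ltW.
Qed.

End interpolation_in_tent.

Section sigma_finite_copy.
Context d (T : measurableType d) (R : realType).
Variable mu : {measure set T -> \bar R}.
Hypothesis sf : sigma_finite setT mu.

(* A measure that is finite on balls is sigma-finite only by a theorem; the copy carries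
   the structure required by Fubini's theorem. *)
Definition sigma_finite_copy of sigma_finite setT mu : set T -> \bar R := mu.

HB.instance Definition _ := Measure.copy (sigma_finite_copy sf) mu.
HB.instance Definition _ := Measure_isSigmaFinite.Build _ _ _ (sigma_finite_copy sf) sf.

End sigma_finite_copy.

Lemma sigma_finite_repack d (T : measurableType d) (R : realType)
  (mu : {measure set T -> \bar R}) : sigma_finite setT mu ->
  exists nu : {sigma_finite_measure set T -> \bar R}, (nu : {measure set T -> \bar R}) = mu.
Proof. by case: mu => m c sf; exists (sigma_finite_copy sf). Qed.

(** The inverse of r is a convex combination of numbers strictly between 0 and 1. *)
Lemma harmonic_mean_gt1 (R : realType) (r r0 r1 th : R) : 1 < r0 -> 1 < r1 -> 0 <= th <= 1 ->
  r^-1 = (1 - th) / r0 + th / r1 -> 1 < r.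
Proof.
move=> r01 r11 /andP[t0 t1] rE.
have i0 : 0 < r0^-1 by rewrite invr_gt0 (lt_trans ltr01).
have i1 : 0 < r1^-1 by rewrite invr_gt0 (lt_trans ltr01).
have j0 : r0^-1 < 1 by rewrite invf_lt1// (lt_trans ltr01).
have j1 : r1^-1 < 1 by rewrite invf_lt1// (lt_trans ltr01).
have ri : 0 < r^-1 by rewrite rE; nra.
have r_gt0 : 0 < r by rewrite -invr_gt0.
rewrite -(invf_lt1 r_gt0) rE.
have k1 : Num.max r0^-1 r1^-1 < 1 by rewrite gt_max j0.
have k0 : r0^-1 <= Num.max r0^-1 r1^-1 by rewrite le_max lexx.
have k2 : r1^-1 <= Num.max r0^-1 r1^-1 by rewrite le_max lexx orbT.
by apply: le_lt_trans k1; nra.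
Qed.

Section trace_bounds.
Context d (R : realType) (X : metricMeasurableType d R).
Variable mu : {sigma_finite_measure set X -> \bar R}.
Hypotheses (borelX : borel_space X) (volX : vol_pos_fin mu).
Variables (alpha : R).
Hypotheses (alpha_gt0 : 0 < alpha).

(** Vanishing at infinity bounds the trace outside a segment, and continuity with compactness bounds
    it on the segment. The quasi-triangle inequality suffices to pass from a point to its
    neighbourhood. *)
Lemma C0_trace_bounded (P Q : R) (h : R -> ae_class mu) : 0 < P -> 0 < Q ->
  C0_trace (tent_norm mu P Q alpha) h ->
  exists M : R, forall y, (tent_norm mu P Q alpha (h y) <= M%:E)%E.
Proof.
move=> P0 Q0 [hoo hc hp hm]; set N := tent_norm mu P Q alpha in hoo hc hp hm *.
have N0 F : (0 <= N F)%E by exact: tent_norm_ge0.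
have [C C0 HC] := tent_normD_le borelX volX alpha_gt0 P0 Q0.
have [A1 [_ HA1]] := cvge0_near _ hp ltr01; have [A2 [_ HA2]] := cvge0_near _ hm ltr01.
have : near_covering `[A2 - 1, A1 + 1]%classic by exact/compact_near_coveringP/segment_compact.
move=> /(_ _ (+oo : set_system R) (fun M y => (N (h y) <= M%:E)%E) _) [|M0 [_ HM]].
  move=> y _; pose a := fine (N (h y)) + 1.
  have a1 : 1 <= a by rewrite lerDr fine_ge0.
  have Na : (N (h y) <= a%:E)%E.
    by rewrite -[leLHS]fineK ?ge0_fin_numE// lee_fin lerDl.
  exists ([set y' | (N (h y' - h y)%R <= 1%:E)%E], [set M | C * a <= M]).
    split; first exact: (cvge0_near _ (hc y) ltr01).
    by exists (C * a); split; [exact: num_real|move=> M /ltW].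
  move=> [y' M] [/= N1 CM]; rewrite -(subrK (h y) (h y')).
  apply: (@le_trans _ _ (C * a)%:E); last by rewrite lee_fin.
  have a0 : 0 <= a by exact: le_trans a1.
  have N1a : (N (h y' - h y)%R <= a%:E)%E by apply: (le_trans N1); rewrite lee_fin.
  exact: (HC (h y' - h y) (h y) a a0 N1a Na).
exists (Num.max (M0 + 1) 1) => y.
have [yA1|yA1] := ltP A1 y.
  by apply: (le_trans (HA1 y yA1)); rewrite lee_fin le_max lexx orbT.
have [yA2|yA2] := ltP y A2.
  by apply: (le_trans (HA2 y yA2)); rewrite lee_fin le_max lexx orbT.
apply: (@le_trans _ _ (M0 + 1)%:E); last by rewrite lee_fin le_max lexx.
apply: HM; first by rewrite ltrDl.
by rewrite /= in_itv /=; apply/andP; split; lra.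
Qed.

End trace_bounds.

(** * Equality of the spaces and equivalence of the norms *)

Section equivalence.
Context d (R : realType) (X : metricMeasurableType d R).
Variable mu : {sigma_finite_measure set X -> \bar R}.
Hypotheses (borelX : borel_space X) (volX : vol_pos_fin mu) (HLX : HL_property mu).
Variables (p0 p1 q0 q1 p q th alpha : R).
Hypotheses (p0_gt1 : 1 < p0) (p1_gt1 : 1 < p1) (q0_gt1 : 1 < q0) (q1_gt1 : 1 < q1)
  (th01 : 0 <= th <= 1) (alpha_gt0 : 0 < alpha)
  (pE : p^-1 = (1 - th) / p0 + th / p1) (qE : q^-1 = (1 - th) / q0 + th / q1).
Local Notation T0 := (tent_norm mu p0 q0 alpha).
Local Notation T1 := (tent_norm mu p1 q1 alpha).
Local Notation T := (tent_norm mu p q alpha).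

Let p_gt1 : 1 < p. Proof. exact: harmonic_mean_gt1 pE. Qed.
Let q_gt1 : 1 < q. Proof. exact: harmonic_mean_gt1 qE. Qed.

Lemma calderon_norm_ge0 (g : R[i] -> ae_class mu) : (0 <= calderon_norm T0 T1 g)%E.
Proof.
rewrite le_max; apply/orP; left; apply: (@le_trans _ _ (T0 (trace g 0%R 0%R))).
  exact: tent_norm_ge0.
by apply: ereal_sup_ubound; exists 0.
Qed.

Lemma calderon_norm_lty (g : R[i] -> ae_class mu) : calderon T0 T1 g ->
  (calderon_norm T0 T1 g < +oo)%E.
Proof.
move=> [_ _ _ g0 g1].
have [M0 H0] := C0_trace_bounded borelX volX alpha_gt0 (lt_trans ltr01 p0_gt1)
  (lt_trans ltr01 q0_gt1) g0.
have [M1 H1] := C0_trace_bounded borelX volX alpha_gt0 (lt_trans ltr01 p1_gt1)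
  (lt_trans ltr01 q1_gt1) g1.
rewrite gt_max; apply/andP; split.
  by apply: (@le_lt_trans _ _ M0%:E); [apply: ge_ereal_sup => _ [y _ <-]; exact: H0|exact: ltry].
by apply: (@le_lt_trans _ _ M1%:E); [apply: ge_ereal_sup => _ [y _ <-]; exact: H1|exact: ltry].
Qed.

(** For theta equal to 0 or 1 the evaluation point lies on a boundary line and (p, q) are the
    exponents of that endpoint, so the norm is among the boundary values. The strip estimate covers
    the interior. *)
Lemma interpolation_tent_closed : exists2 C : R, 0 < C & forall (g : R[i] -> ae_class mu) (M : R),
  calderon T0 T1 g -> 0 < M -> (calderon_norm T0 T1 g <= M%:E)%E ->
  (T (g th%:C) <= (C * M)%:E)%E.
Proof.
have [th0|th0] := eqVneq th 0.
  exists 1 => // g M gcal M0 gM; rewrite mul1r.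
  have -> : p = p0 by apply: invr_inj; rewrite pE th0 subr0 mul1r mul0r addr0.
  have -> : q = q0 by apply: invr_inj; rewrite qE th0 subr0 mul1r mul0r addr0.
  apply: le_trans gM; rewrite le_max; apply/orP; left.
  by rewrite th0; apply: ereal_sup_ubound; exists 0; [exact: I|reflexivity].
have [th1|th1] := eqVneq th 1.
  exists 1 => // g M gcal M0 gM; rewrite mul1r.
  have -> : p = p1 by apply: invr_inj; rewrite pE th1 subrr mul1r mul0r add0r.
  have -> : q = q1 by apply: invr_inj; rewrite qE th1 subrr mul1r mul0r add0r.
  apply: le_trans gM; rewrite le_max; apply/orP; right.
  by rewrite th1; apply: ereal_sup_ubound; exists 0; [exact: I|reflexivity].
have th01' : 0 < th < 1.
  by case/andP: th01 => t0 t1; rewrite !lt_neqAle t0 t1 th1 eq_sym th0.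
exact: (interpolation_tent borelX volX HLX alpha_gt0 p_gt1 q_gt1 p0_gt1 p1_gt1 q0_gt1 q1_gt1
  th01' pE qE).
Qed.

Lemma interpolation_equivalence : interp_space T0 T1 th = tent_space mu p q alpha /\
  exists2 c : R, 0 < c & exists2 C : R, 0 < C &
    forall F, tent_space mu p q alpha F ->
      (c%:E * T F <= interp_norm T0 T1 th F)%E /\ (interp_norm T0 T1 th F <= C%:E * T F)%E.
Proof.
have [C1 C10 H1] := tent_calderon borelX volX HLX alpha_gt0 p_gt1 q_gt1
  (lt_trans ltr01 p0_gt1) (lt_trans ltr01 p1_gt1) (lt_trans ltr01 q0_gt1)
  (lt_trans ltr01 q1_gt1) pE qE.
have [C2 C20 H2] := interpolation_tent_closed.
have T_fin F : tent_space mu p q alpha F -> T F = (fine (T F))%:E.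
  by move=> Foo; rewrite fineK// ge0_fin_numE// tent_norm_ge0.
split.
  apply/seteqP; split=> [_ [g gcal <-]|F Foo].
    have N0 := calderon_norm_ge0 g; have Noo := calderon_norm_lty gcal.
    (* The summand 1 gives a strictly positive bound even when the norm of g is 0. *)
    have M0 : 0 < fine (calderon_norm T0 T1 g) + 1 by rewrite ltr_wpDl// fine_ge0.
    apply: (le_lt_trans (H2 g _ gcal M0 _)); last exact: ltry.
    by rewrite -[leLHS]fineK ?ge0_fin_numE// lee_fin lerDl.
  have l0 : 0 < fine (T F) + 1 by rewrite ltr_wpDl// fine_ge0// tent_norm_ge0.
  have [|g gcal [gF _]] := H1 F _ l0; first by rewrite [leLHS]T_fin// lee_fin lerDl.
  by exists g.
exists C2^-1; first by rewrite invr_gt0.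
exists C1 => // F Foo; split.
  apply: le_ereal_inf_tmp => _ [g [gcal gF] <-].
  have N0 := calderon_norm_ge0 g; have Noo := calderon_norm_lty gcal.
  (* The bounds are stated for strictly positive M, so the norm of g, possibly 0, is approached from
     above. *)
  apply/lee_addgt0Pr => e e0.
  have Nfin : calderon_norm T0 T1 g \is a fin_num by rewrite ge0_fin_numE.
  have M0 : 0 < fine (calderon_norm T0 T1 g) + e by rewrite ltr_wpDl// fine_ge0.
  have := H2 g _ gcal M0 _; rewrite gF [T F]T_fin// lee_fin => H.
  rewrite -(fineK Nfin) -EFinD -EFinM lee_fin mulrC ler_pdivrMr// mulrC; apply: H.
  by rewrite -[leLHS]fineK// lee_fin lerDl ltW.
rewrite [T F]T_fin//; apply/lee_addgt0Pr => e e0.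
have l0 : 0 < fine (T F) + e / C1 by rewrite ltr_wpDl ?divr_gt0// fine_ge0// tent_norm_ge0.
have [|g gcal [gF gN]] := H1 F _ l0.
  by rewrite [leLHS]T_fin// lee_fin lerDl divr_ge0// ltW.
apply: (@le_trans _ _ (calderon_norm T0 T1 g)); first by apply: ereal_inf_lbound; exists g.
apply: (le_trans gN); rewrite -EFinM -EFinD lee_fin mulrDr lerD2l mulrC divfK//.
by rewrite gt_eqF.
Qed.

End equivalence.

Theorem proposition3p12 (d : measure_display) (R : realType)
    (X : metricMeasurableType d R) (mu : {measure set X -> \bar R})
    (borelX : borel_space X) (volX : vol_pos_fin mu)
    (geomX : proper_space mu \/ doubling_space mu) (HLX : HL_property mu)
    (p0 p1 q0 q1 p q theta alpha : R)
    (p0_gt1 : 1 < p0) (p1_gt1 : 1 < p1) (q0_gt1 : 1 < q0) (q1_gt1 : 1 < q1)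
    (theta01 : 0 <= theta <= 1) (alpha_gt0 : 0 < alpha)
    (pE : p^-1 = (1 - theta) / p0 + theta / p1)
    (qE : q^-1 = (1 - theta) / q0 + theta / q1) :
  let T0 := tent_norm mu p0 q0 alpha in
  let T1 := tent_norm mu p1 q1 alpha in
  interp_space T0 T1 theta = tent_space mu p q alpha /\
  exists2 c : R, 0 < c & exists2 C : R, 0 < C &
    forall F, tent_space mu p q alpha F ->
      (c%:E * tent_norm mu p q alpha F <= interp_norm T0 T1 theta F)%E /\
      (interp_norm T0 T1 theta F <= C%:E * tent_norm mu p q alpha F)%E.
Proof.
(* Balls of integer radius around a base point exhaust X with finite measure, so mu is sigma-finite
   and is identified with a measure carrying that structure. *)
move=> /=; have [nu nuE] := sigma_finite_repack (sigma_finite_balls borelX volX).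
subst mu; exact: interpolation_equivalence.
Qed.
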